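(* Let $n$ be a positive integer, $\mathbf{g}=(g_0,\dots,g_{n-1})$ with $g_k\in H(\mathbb{D})$ for $0\leq k\leq n-1$, and $0<q<p<\infty$. The following are equivalent: (a) $I_{\mathbf{g}}^{(n)}:A^p\to A^q$ is bounded; (b) $I_{\mathbf{g}}^{(n)}:A^p\to A^q$ is compact; (c) for each $0\leq k\leq n-1$, $\int_{\mathbb{D}}\big|g_k(z)(1-|z|^2)^{n-k}\big|^{\frac{pq}{p-q}}\,dA(z)<\infty$.
   Context: $\mathbb{D}$ is the open unit disc, $H(\mathbb{D})$ the analytic functions on $\mathbb{D}$, $dA=\frac{dx\,dy}{\pi}$, and $A^p=\{f\in H(\mathbb{D}):\int_{\mathbb{D}}|f|^p\,dA<\infty\}$ is the Bergman space. $I$ is the integration operator $(If)(z)=\int_0^zf(w)\,dw$ and $I^n$ its $n$-th iterate; $I_{\mathbf{g}}^{(n)}f=I^n\big(fg_0+f'g_1+\cdots+f^{(n-1)}g_{n-1}\big)$. *)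

(* Defs.v *)
From Stdlib Require Import Reals ClassicalEpsilon.
From Coquelicot Require Import Coquelicot.
From mathcomp Require Import all_boot all_algebra.
From mathcomp Require Import all_classical all_reals all_analysis.
From mathcomp Require Import Rstruct Rstruct_topology.

Set Implicit Arguments.
Unset Strict Implicit.
Unset Printing Implicit Defensive.
Local Open Scope classical_set_scope.

Definition Disc : set (R * R)%type := [set z | (Cmod z < 1)%R].

Definition Cdiff (f : C -> C) (z : C) : Prop :=
  @Coquelicot.Derive.ex_derive C_AbsRing C_NormedModule f z.

Definition holo (f : C -> C) : Prop := forall z : C, Disc z -> Cdiff f z.

(* The complex derivative f' (junk value 0 where it does not exist). *)
Definition Cderiv (f : C -> C) (z : C) : C :=
  match excluded_middle_informative
          (exists l : C, @Coquelicot.Derive.is_derive C_AbsRing C_NormedModule f z l) with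
  | left H => proj1_sig (ClassicalEpsilon.constructive_indefinite_description _ H)
  | right _ => RtoC 0%R
  end.

Definition Cderiv_n (k : nat) (f : C -> C) : C -> C := Nat.iter k Cderiv f.

(* Integration operator (I f)(z) = \int_0^z f(w) dw, along the segment [0,z]:
   \int_0^1 f(t z) z dt. *)
Definition Iop (f : C -> C) : C -> C :=
  fun z => @RInt C_R_CompleteNormedModule
             (fun t : R => Cmult (f (Cmult (RtoC t) z)) z) 0%R 1%R.

Definition Iop_n (n : nat) (f : C -> C) : C -> C := Nat.iter n Iop f.

Definition Ig (n : nat) (g : nat -> C -> C) (f : C -> C) : C -> C :=
  Iop_n n (fun z => \big[Cplus/RtoC 0%R]_(k < n) Cmult (Cderiv_n k f z) (g k z)).

Definition intdA (h : R * R -> R) : \bar R :=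
  ((pi : R)^-1)%:E *
  \int[(@lebesgue_measure R \x @lebesgue_measure R)%E]_(z in Disc) (h z)%:E.

Definition Lpint (p : R) (f : C -> C) : \bar R :=
  intdA (fun z => powR (Cmod (f z)) p).

Definition Bergman (p : R) (f : C -> C) : Prop :=
  holo f /\ (Lpint p f < +oo)%E.

Definition Bnorm (p : R) (f : C -> C) : R :=
  powR (fine (Lpint p f)) (p^-1)%R.

Definition bounded_op (p q : R) (T : (C -> C) -> (C -> C)) : Prop :=
  (forall f, Bergman p f -> Bergman q (T f)) /\
  exists c : R, forall f, Bergman p f -> (Bnorm q (T f) <= c * Bnorm p f)%R.

Definition compact_op (p q : R) (T : (C -> C) -> (C -> C)) : Prop :=
  (forall f, Bergman p f -> Bergman q (T f)) /\
  forall fs : nat -> C -> C,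
    (forall j, Bergman p (fs j)) ->
    (exists M : R, forall j, (Bnorm p (fs j) <= M)%R) ->
    exists (phi : nat -> nat) (h : C -> C),
      (forall j, (phi j < phi j.+1)%N) /\ Bergman q h /\
      (fun j => Bnorm q (fun z => Cminus (T (fs (phi j)) z) (h z))) @ \oo --> (0%R : R).

(* Main.v *)
(** Write d(z) = 1 - |z| and L f = sum_k f^(k) g_k, so that I_g^(n) f is the n-fold primitive of L f.
    Two Littlewood-Paley inequalities, valid for all positive exponents, turn the problem into one about
    weights: int |F'|^p d^(a+p) <= C int |F|^p d^a, and conversely int |F|^q d^a <= C int |F'|^q d^(a+q) when
    F(0) = 0. The first follows from a local mean value inequality for |F|^p and Tonelli's theorem; for the second,
    the dyadic annulus j is carried by two dilations into disjoint halves of the annulus j - 1, which gives a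
    contraction of the masses that absorbs all but the derivative terms.

    (c) => (a), (b): with X = |f^(k)| d^k, Y = |g_k| d^(n-k) and s = pq/(p-q), Young's inequality
    X^q Y^q <= e X^p + e^(-q/(p-q)) Y^s bounds the operator; Montel's theorem and the small tails of int Y^s
    make it compact.

    (a) or (b) => (c): test functions sum_i +-c_i (z - a_i)^m / (1 - conj(a_i) z)^(b+m) over separated points a_i,
    averaged over the signs, give sum_i Y(a_i)^s d(a_i)^2 <= C for the top symbol g_m, the bump of order m being
    invisible at a_i to the lower derivatives; a greedy choice of the a_i (near-maximal Y on what remains of
    a disc) bounds int Y^s, and the term f^(m) g_m can then be dropped, by downward induction on m. *)

Require Import Defs.
From Stdlib Require Import Reals Lra Psatz Classical ClassicalEpsilon.
From Coquelicot Require Import Coquelicot.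

(** In the second Littlewood-Paley inequality a comparison of F(z) with a single dilate F(rho z)
    would move the mass of each annulus to the preceding one with a constant above 1; for the weight
    exponent 0 this cannot be absorbed. With two dilates whose images are disjoint, the average
    costs only about half of the preceding mass. The masses are first truncated to finitely many
    annuli, so that they are finite and may be subtracted. In the converse direction no square
    function is needed: on the disc around a_i only the i-th summand is kept, and separation makes
    these discs disjoint. Taking c_i proportional to Y(a_i)^(s/p) d(a_i)^b turns the inequality into
    a bound for the finite sum of Y(a_i)^s d(a_i)^2, which does not depend on the number of points.
    While the top terms of L are dropped one by one, the weight d^(nq) is kept unchanged. *)

Section ComplexAnalysis.
Local Open Scope R_scope.
Local Open Scope C_scope.

(** * Complex derivatives and curves in epsilon-delta form *)

Definition dlim (f : C -> C) (z l : C) : Prop :=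
  forall eps : R, (0 < eps)%R -> exists d : R, (0 < d)%R /\
    forall w, (Cmod (w - z) < d)%R -> (Cmod (f w - f z - l * (w - z)) <= eps * Cmod (w - z))%R.

Definition ccont (f : C -> C) (z : C) : Prop :=
  forall eps : R, (0 < eps)%R -> exists d : R, (0 < d)%R /\
    forall w, (Cmod (w - z) < d)%R -> (Cmod (f w - f z) < eps)%R.

Definition ccurve (g : R -> C) (t : R) : Prop :=
  forall eps : R, (0 < eps)%R -> exists d : R, (0 < d)%R /\
    forall s, (Rabs (s - t) < d)%R -> (Cmod (g s - g t) < eps)%R.

Definition dcurve (g : R -> C) (t : R) (v : C) : Prop :=
  forall eps : R, (0 < eps)%R -> exists d : R, (0 < d)%R /\
    forall s, (Rabs (s - t) < d)%R ->
      (Cmod (g s - g t - v * RtoC (s - t)) <= eps * Rabs (s - t))%R.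

Lemma Cmod_normR (x : C) : norm (V := C_R_NormedModule) x = Cmod x.
Proof. symmetry. exact (Cmod_norm x). Qed.

Lemma dlim_is_derive f z l :
  dlim f z l <-> is_derive (K := C_AbsRing) (V := C_NormedModule) f z l.
Proof.
split.
- intros H. split; [apply is_linear_scal_l|].
  intros x Hx.
  (* The neighbourhood filter of [z] converges to [z] only, so the filter clause of the derivative
     concerns [z] itself. *)
  assert (Ex : z = x) by exact (is_filter_lim_locally_unique (K := C_AbsRing) (V := AbsRing_NormedModule C_AbsRing) z x Hx).
  subst x. intros eps. destruct (H eps (cond_pos eps)) as [d [dp Hd]].
  exists (mkposreal d dp). intros y Hy.
  specialize (Hd y Hy). unfold norm, scal, minus, plus, opp; simpl.
  unfold Cminus in Hd. unfold mult; simpl.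
  replace ((y + - z) * l) with (l * (y + - z)) by ring. exact Hd.
- intros [_ H] eps He.
  destruct (H z (fun P HP => HP) (mkposreal eps He)) as [d Hd].
  exists d. split; [apply cond_pos|]. intros w Hw.
  assert (Hw' : ball (M := AbsRing_UniformSpace C_AbsRing) z d w) by exact Hw.
  specialize (Hd w Hw'). unfold norm, scal, minus, plus, opp in Hd; simpl in Hd.
  unfold mult in Hd; simpl in Hd. unfold Cminus.
  replace (l * (w + - z)) with ((w + - z) * l) by ring. exact Hd.
Qed.

Lemma Cmod_sub_sym (a b : C) : Cmod (a - b) = Cmod (b - a).
Proof. rewrite <- Cmod_opp. f_equal. ring. Qed.

Lemma Cmod_tri3 (a b c : C) : (Cmod (a - c) <= Cmod (a - b) + Cmod (b - c))%R.
Proof. replace (a - c) with ((a - b) + (b - c)) by ring. apply Cmod_triangle. Qed.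

Lemma Cmod_sub_le (a b : C) : (Cmod (a - b) <= Cmod a + Cmod b)%R.
Proof. unfold Cminus. rewrite <- (Cmod_opp b). apply Cmod_triangle. Qed.

Lemma Cmod_sub_ge (a b : C) : (Cmod a - Cmod b <= Cmod (a - b))%R.
Proof. generalize (Cmod_triangle (a - b) b). replace (a - b + b) with a by ring. lra. Qed.

Lemma Cmod_small_eq0 (z : C) : (forall e, 0 < e -> Cmod z <= e)%R -> z = 0.
Proof.
intros H. apply Cmod_eq_0.
destruct (Rle_lt_or_eq_dec 0 (Cmod z) (Cmod_ge_0 z)) as [h|h]; [|auto].
specialize (H (Cmod z / 2)%R). lra.
Qed.

Lemma dlim_ccont f z l : dlim f z l -> ccont f z.
Proof.
intros H eps He. destruct (H 1%R Rlt_0_1) as [d [dp Hd]].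
assert (K : (0 < 2 + Cmod l)%R) by (generalize (Cmod_ge_0 l); lra).
exists (Rmin d (eps / (2 + Cmod l))). split.
  apply Rmin_case; [lra| apply Rdiv_lt_0_compat; lra].
intros w Hw.
assert (Hw1 := Rlt_le_trans _ _ _ Hw (Rmin_l _ _)).
assert (Hw2 := Rlt_le_trans _ _ _ Hw (Rmin_r _ _)).
specialize (Hd w Hw1).
replace (f w - f z) with ((f w - f z - l * (w - z)) + l * (w - z)) by ring.
eapply Rle_lt_trans; [apply Cmod_triangle|]. rewrite Cmod_mult.
apply (Rmult_lt_compat_r (2 + Cmod l)) in Hw2; [|lra].
unfold Rdiv in Hw2; rewrite Rmult_assoc, Rinv_l in Hw2 by lra.
generalize (Cmod_ge_0 (w - z)) (Cmod_ge_0 l); nra.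
Qed.

Lemma dlim_unique f z l m : dlim f z l -> dlim f z m -> l = m.
Proof.
intros H1 H2. cut (l - m = 0). intros E; replace l with ((l - m) + m) by ring; rewrite E; ring.
apply Cmod_small_eq0. intros e He.
destruct (H1 (e/2)%R) as [d1 [p1 h1]]; [lra|].
destruct (H2 (e/2)%R) as [d2 [p2 h2]]; [lra|].
set (d := Rmin d1 d2). assert (dp : (0 < d)%R) by (apply Rmin_case; lra).
assert (E : Cmod (z + RtoC (d/2) - z) = (d/2)%R).
  replace (z + RtoC (d/2) - z) with (RtoC (d/2)) by ring.
  rewrite Cmod_R, Rabs_right; lra.
assert (dd1 : (d <= d1)%R) by apply Rmin_l. assert (dd2 : (d <= d2)%R) by apply Rmin_r.
assert (g1 := h1 (z + RtoC (d/2))). rewrite E in g1. assert (g1' := g1 ltac:(lra)).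
assert (g2 := h2 (z + RtoC (d/2))). rewrite E in g2. assert (g2' := g2 ltac:(lra)).
clear g1 g2.
assert (T := Cmod_sub_le (f (z + RtoC (d / 2)) - f z - m * (z + RtoC (d / 2) - z)) (f (z + RtoC (d / 2)) - f z - l * (z + RtoC (d / 2) - z))).
replace (f (z + RtoC (d / 2)) - f z - m * (z + RtoC (d / 2) - z) -
      (f (z + RtoC (d / 2)) - f z - l * (z + RtoC (d / 2) - z))) with ((l - m) * (z + RtoC (d/2) - z)) in T by ring.
rewrite Cmod_mult, E in T. apply Rmult_le_reg_r with (d/2)%R; lra.
Qed.

Lemma dlim_ext_loc f g z l r : (0 < r)%R ->
  (forall w, (Cmod (w - z) < r)%R -> f w = g w) -> dlim f z l -> dlim g z l.
Proof.
intros rp E H eps He. destruct (H eps He) as [d [dp h]].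
exists (Rmin d r). split; [apply Rmin_case; lra|].
intros w Hw. assert (w1 := Rlt_le_trans _ _ _ Hw (Rmin_l _ _)).
assert (w2 := Rlt_le_trans _ _ _ Hw (Rmin_r _ _)).
rewrite <- (E w w2), <- (E z). now apply h.
replace (z - z) with (RtoC 0) by ring. rewrite Cmod_0. lra.
Qed.

Lemma dlim_const c z : dlim (fun _ => c) z 0.
Proof.
intros e He. exists 1%R. split; [lra|]. intros w _.
replace (c - c - 0 * (w - z)) with (RtoC 0) by ring. rewrite Cmod_0.
generalize (Cmod_ge_0 (w - z)); nra.
Qed.

Lemma dlim_id z : dlim (fun w => w) z 1.
Proof.
intros e He. exists 1%R. split; [lra|]. intros w _.
replace (w - z - 1 * (w - z)) with (RtoC 0) by ring. rewrite Cmod_0.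
generalize (Cmod_ge_0 (w - z)); nra.
Qed.

Lemma dlim_plus f g z l m : dlim f z l -> dlim g z m -> dlim (fun w => f w + g w) z (l + m).
Proof.
intros H1 H2 e He.
destruct (H1 (e/2)%R) as [d1 [p1 h1]]; [lra|].
destruct (H2 (e/2)%R) as [d2 [p2 h2]]; [lra|].
exists (Rmin d1 d2). split; [apply Rmin_case; lra|]. intros w Hw.
assert (w1 := Rlt_le_trans _ _ _ Hw (Rmin_l _ _)).
assert (w2 := Rlt_le_trans _ _ _ Hw (Rmin_r _ _)).
replace (f w + g w - (f z + g z) - (l + m) * (w - z)) with
  ((f w - f z - l * (w - z)) + (g w - g z - m * (w - z))) by ring.
eapply Rle_trans; [apply Cmod_triangle|]. specialize (h1 w w1). specialize (h2 w w2). lra.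
Qed.

Lemma dlim_mult f g z l m : dlim f z l -> dlim g z m ->
  dlim (fun w => f w * g w) z (l * g z + f z * m).
Proof.
intros H1 H2 e He.
assert (C2 := dlim_ccont _ _ _ H2).
set (K := (1 + Cmod (f z) + Cmod (g z) + Cmod l)%R).
assert (Kp : (1 <= K)%R) by (unfold K; generalize (Cmod_ge_0 (f z)) (Cmod_ge_0 (g z)) (Cmod_ge_0 l); lra).
assert (e3 : (0 < e / (4 * K))%R) by (apply Rdiv_lt_0_compat; lra).
assert (e4 : (0 < Rmin 1 (e / (4 * K)))%R) by (apply Rmin_case; lra).
destruct (H1 _ e3) as [d1 [p1 h1]]. destruct (H2 _ e3) as [d2 [p2 h2]].
destruct (C2 _ e4) as [d3 [p3 h3]].
exists (Rmin d1 (Rmin d2 d3)). split; [repeat apply Rmin_case; lra|]. intros w Hw.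
assert (w1 := Rlt_le_trans _ _ _ Hw (Rmin_l _ _)).
assert (w' := Rlt_le_trans _ _ _ Hw (Rmin_r _ _)).
assert (w2 := Rlt_le_trans _ _ _ w' (Rmin_l _ _)).
assert (w3 := Rlt_le_trans _ _ _ w' (Rmin_r _ _)).
specialize (h1 w w1). specialize (h2 w w2). specialize (h3 w w3).
assert (h3a := Rlt_le_trans _ _ _ h3 (Rmin_l _ _)).
assert (h3b := Rlt_le_trans _ _ _ h3 (Rmin_r _ _)).
replace (f w * g w - f z * g z - (l * g z + f z * m) * (w - z)) with
 ((f w - f z - l * (w - z)) * g w + (l * (w - z) * (g w - g z) + f z * (g w - g z - m * (w - z)))) by ring.
eapply Rle_trans; [apply Cmod_triangle|].
eapply Rle_trans; [apply Rplus_le_compat_l; apply Cmod_triangle|].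
rewrite !Cmod_mult.
assert (gw : (Cmod (g w) <= K)%R).
  replace (g w) with ((g w - g z) + g z) by ring.
  eapply Rle_trans; [apply Cmod_triangle|]. unfold K. generalize (Cmod_ge_0 (f z)) (Cmod_ge_0 l); lra.
assert (lK : (Cmod l <= K)%R) by (unfold K; generalize (Cmod_ge_0 (f z)) (Cmod_ge_0 (g z)); lra).
assert (fK : (Cmod (f z) <= K)%R) by (unfold K; generalize (Cmod_ge_0 l) (Cmod_ge_0 (g z)); lra).
set (q := (e / (4 * K))%R) in *.
assert (Eq : (q * K = e / 4)%R) by (unfold q; field; lra).
assert (W := Cmod_ge_0 (w - z)).
generalize dependent (Cmod (w - z)). intros W0. intros.
assert (A1 : (Cmod (f w - f z - l * (w - z)) * Cmod (g w) <= (q * W0) * K)%R)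
  by (apply Rmult_le_compat; auto using Cmod_ge_0).
assert (A2 : (Cmod l * W0 * Cmod (g w - g z) <= (K * W0) * q)%R).
  apply Rmult_le_compat; auto using Cmod_ge_0.
  apply Rmult_le_pos; auto using Cmod_ge_0. apply Rmult_le_compat_r; auto. lra.
assert (A3 : (Cmod (f z) * Cmod (g w - g z - m * (w - z)) <= K * (q * W0))%R)
  by (apply Rmult_le_compat; auto using Cmod_ge_0).
nra.
Qed.

Lemma dlim_opp f z l : dlim f z l -> dlim (fun w => - f w) z (- l).
Proof.
intros H e He. destruct (H e He) as [d [dp h]]. exists d; split; auto.
intros w Hw. replace (- f w - - f z - - l * (w - z)) with (- (f w - f z - l * (w - z))) by ring.
rewrite Cmod_opp. auto.
Qed.

Lemma dlim_minus f g z l m : dlim f z l -> dlim g z m -> dlim (fun w => f w - g w) z (l - m).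
Proof. intros H1 H2. apply dlim_plus; auto. now apply dlim_opp. Qed.

Lemma dlim_scal c f z l : dlim f z l -> dlim (fun w => c * f w) z (c * l).
Proof.
intros H. replace (c * l) with (0 * f z + c * l) by ring.
apply (dlim_mult (fun _ => c)); auto. apply dlim_const.
Qed.

Lemma dlim_inv f z l : dlim f z l -> f z <> 0 -> dlim (fun w => / f w) z (- l / (f z * f z)).
Proof.
intros H Hz e He.
assert (Cf := dlim_ccont _ _ _ H).
assert (fp : (0 < Cmod (f z))%R) by now apply Cmod_gt_0.
set (F := Cmod (f z)) in *.
set (K := (1 + Cmod l)%R). assert (Kp : (1 <= K)%R) by (unfold K; generalize (Cmod_ge_0 l); lra).
assert (e1 : (0 < e * (F * F) / 4)%R) by (apply Rdiv_lt_0_compat; [|lra]; repeat apply Rmult_lt_0_compat; lra).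
assert (e2 : (0 < Rmin (F / 2) (e * (F * F * F) / (4 * K)))%R).
  apply Rmin_case; [lra|]. apply Rdiv_lt_0_compat; [|lra]; repeat apply Rmult_lt_0_compat; lra.
destruct (H _ e1) as [d1 [p1 h1]]. destruct (Cf _ e2) as [d2 [p2 h2]].
exists (Rmin d1 d2). split; [apply Rmin_case; lra|]. intros w Hw.
assert (w1 := Rlt_le_trans _ _ _ Hw (Rmin_l _ _)).
assert (w2 := Rlt_le_trans _ _ _ Hw (Rmin_r _ _)).
specialize (h1 w w1). specialize (h2 w w2).
assert (h2a := Rlt_le_trans _ _ _ h2 (Rmin_l _ _)).
assert (h2b := Rlt_le_trans _ _ _ h2 (Rmin_r _ _)).
assert (fw : (F / 2 <= Cmod (f w))%R).
  assert (T := Cmod_sub_ge (f z) (f w)). rewrite Cmod_sub_sym in T. unfold F in *; lra.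
assert (fw0 : f w <> 0) by (apply Cmod_gt_0; lra).
replace (/ f w - / f z - - l / (f z * f z) * (w - z)) with
  ((- (f w - f z - l * (w - z)) * f z + l * (w - z) * (f w - f z)) / (f w * (f z * f z))) by (field; auto).
rewrite Cmod_div by (repeat apply Cmult_neq_0; auto). rewrite !Cmod_mult.
fold F.
assert (fwp : (0 < Cmod (f w) * (F * F))%R) by (apply Rmult_lt_0_compat; [lra|nra]).
apply Rmult_le_reg_r with (Cmod (f w) * (F * F))%R; [auto|].
unfold Rdiv. rewrite Rmult_assoc, Rinv_l, Rmult_1_r by lra.
eapply Rle_trans; [apply Cmod_triangle|]. rewrite !Cmod_mult, Cmod_opp. fold F.
set (W := Cmod (w - z)) in *. assert (Wp : (0 <= W)%R) by apply Cmod_ge_0.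
assert (A1 : (Cmod (f w - f z - l * (w - z)) * F <= (e * (F * F) / 4 * W) * F)%R) by (apply Rmult_le_compat_r; lra).
assert (A2 : (Cmod l * W * Cmod (f w - f z) <= (K * W) * (e * (F * F * F) / (4 * K)))%R).
  apply Rmult_le_compat; auto using Cmod_ge_0; try lra.
  apply Rmult_le_pos; auto using Cmod_ge_0. apply Rmult_le_compat_r; auto; unfold K; lra.
replace ((K * W) * (e * (F * F * F) / (4 * K)))%R with (W * e * (F * F * F) / 4)%R in A2 by (field; lra).
assert (A3 : (e * W * (F / 2 * (F * F)) <= e * W * (Cmod (f w) * (F * F)))%R).
  apply Rmult_le_compat_l; [nra|]. apply Rmult_le_compat_r; nra.
lra.
Qed.

Lemma dlim_pow f z l n : dlim f z l ->
  dlim (fun w => (f w) ^ n) z (RtoC (INR n) * (f z) ^ (n - 1) * l).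
Proof.
intros H. induction n as [|n IH].
(* For [n = 0] the truncated exponent [n - 1] is harmless, being multiplied by [INR 0]. *)
- simpl. replace (RtoC 0 * 1 * l) with (RtoC 0) by ring. apply dlim_const.
- assert (G := dlim_mult _ _ _ _ _ H IH).
  replace (RtoC (INR (S n)) * f z ^ (S n - 1) * l) with
    (l * f z ^ n + f z * (RtoC (INR n) * f z ^ (n - 1) * l)).
  exact G.
  rewrite S_INR, RtoC_plus. replace (S n - 1)%nat with n by lia.
  destruct n as [|n]. simpl. ring.
  replace (S n - 1)%nat with n by lia.
  change (f z ^ (S n)) with (f z * f z ^ n). ring.
Qed.

Lemma ccont_ccurve f g t : ccont f (g t) -> ccurve g t -> ccurve (fun s => f (g s)) t.
Proof.
intros H1 H2 e He. destruct (H1 e He) as [d [dp h]]. destruct (H2 d dp) as [d' [dp' h']].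
exists d'; split; auto.
Qed.

Lemma ccurve_const c t : ccurve (fun _ => c) t.
Proof.
intros e He. exists 1%R; split; [lra|]. intros s _. replace (c - c) with (RtoC 0) by ring.
rewrite Cmod_0; auto.
Qed.

Lemma ccurve_plus f g t : ccurve f t -> ccurve g t -> ccurve (fun s => f s + g s) t.
Proof.
intros H1 H2 e He.
destruct (H1 (e/2)%R) as [d1 [p1 h1]]; [lra|].
destruct (H2 (e/2)%R) as [d2 [p2 h2]]; [lra|].
exists (Rmin d1 d2). split; [apply Rmin_case; lra|]. intros w Hw.
assert (w1 := Rlt_le_trans _ _ _ Hw (Rmin_l _ _)).
assert (w2 := Rlt_le_trans _ _ _ Hw (Rmin_r _ _)).
replace (f w + g w - (f t + g t)) with ((f w - f t) + (g w - g t)) by ring.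
eapply Rle_lt_trans; [apply Cmod_triangle|]. specialize (h1 w w1). specialize (h2 w w2). lra.
Qed.

Lemma ccurve_opp f t : ccurve f t -> ccurve (fun s => - f s) t.
Proof.
intros H e He. destruct (H e He) as [d [dp h]]. exists d; split; auto.
intros w Hw. replace (- f w - - f t) with (- (f w - f t)) by ring. rewrite Cmod_opp; auto.
Qed.

Lemma ccurve_minus f g t : ccurve f t -> ccurve g t -> ccurve (fun s => f s - g s) t.
Proof. intros H1 H2. apply ccurve_plus; auto. now apply ccurve_opp. Qed.

Lemma ccurve_mult f g t : ccurve f t -> ccurve g t -> ccurve (fun s => f s * g s) t.
Proof.
intros H1 H2 e He.
set (K := (1 + Cmod (f t) + Cmod (g t))%R).
assert (Kp : (1 <= K)%R) by (unfold K; generalize (Cmod_ge_0 (f t)) (Cmod_ge_0 (g t)); lra).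
assert (e3 : (0 < e / (4 * K))%R) by (apply Rdiv_lt_0_compat; lra).
assert (e4 : (0 < Rmin 1 (e / (4 * K)))%R) by (apply Rmin_case; lra).
destruct (H1 _ e3) as [d1 [p1 h1]]. destruct (H2 _ e4) as [d2 [p2 h2]].
exists (Rmin d1 d2). split; [apply Rmin_case; lra|]. intros w Hw.
assert (w1 := Rlt_le_trans _ _ _ Hw (Rmin_l _ _)).
assert (w2 := Rlt_le_trans _ _ _ Hw (Rmin_r _ _)).
specialize (h1 w w1). specialize (h2 w w2).
assert (h3a := Rlt_le_trans _ _ _ h2 (Rmin_l _ _)).
assert (h3b := Rlt_le_trans _ _ _ h2 (Rmin_r _ _)).
replace (f w * g w - f t * g t) with ((f w - f t) * g w + f t * (g w - g t)) by ring.
eapply Rle_lt_trans; [apply Cmod_triangle|]. rewrite !Cmod_mult.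
assert (gw : (Cmod (g w) <= K)%R).
  replace (g w) with ((g w - g t) + g t) by ring.
  eapply Rle_trans; [apply Cmod_triangle|]. unfold K. generalize (Cmod_ge_0 (f t)); lra.
assert (fK : (Cmod (f t) <= K)%R) by (unfold K; generalize (Cmod_ge_0 (g t)); lra).
set (q := (e / (4 * K))%R) in *.
assert (Eq : (q * K = e / 4)%R) by (unfold q; field; lra).
assert (A1 : (Cmod (f w - f t) * Cmod (g w) <= q * K)%R)
  by (apply Rmult_le_compat; auto using Cmod_ge_0; lra).
assert (A3 : (Cmod (f t) * Cmod (g w - g t) <= K * q)%R)
  by (apply Rmult_le_compat; auto using Cmod_ge_0; lra).
lra.
Qed.

Lemma ccurve_continuous g t : ccurve g t -> continuous (U := C_R_NormedModule) g t.
Proof.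
intros H. apply filterlim_locally. intros eps.
destruct (H eps (cond_pos eps)) as [d [dp h]].
exists (mkposreal d dp). intros s Hs. specialize (h s Hs).
assert (M := Rmax_Cmod (g s - g t)).
split.
- eapply Rle_lt_trans; [|exact h]. eapply Rle_trans; [|exact M]. apply Rmax_l.
- eapply Rle_lt_trans; [|exact h]. eapply Rle_trans; [|exact M]. apply Rmax_r.
Qed.

Lemma dcurve_is_derive g t v : dcurve g t v -> is_derive (V := C_R_NormedModule) g t v.
Proof.
intros H. split; [apply is_linear_scal_l|]. intros x Hx.
assert (Ex : t = x) by exact (is_filter_lim_locally_unique (K := R_AbsRing) (V := R_NormedModule) t x Hx).
subst x. intros eps. destruct (H eps (cond_pos eps)) as [d [dp Hd]].
exists (mkposreal d dp). intros y Hy.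
specialize (Hd y Hy).
rewrite Cmod_normR.
eapply Rle_trans; [right; apply f_equal | exact Hd].
apply injective_projections; unfold minus, plus, opp, scal, prod_plus; simpl;
unfold mult, scal, plus, opp; simpl; unfold mult; simpl; ring.
Qed.

Lemma dcurve_ccurve g t v : dcurve g t v -> ccurve g t.
Proof.
intros H eps He. destruct (H 1%R Rlt_0_1) as [d [dp Hd]].
assert (K : (0 < 2 + Cmod v)%R) by (generalize (Cmod_ge_0 v); lra).
exists (Rmin d (eps / (2 + Cmod v))). split.
  apply Rmin_case; [lra| apply Rdiv_lt_0_compat; lra].
intros w Hw.
assert (Hw1 := Rlt_le_trans _ _ _ Hw (Rmin_l _ _)).
assert (Hw2 := Rlt_le_trans _ _ _ Hw (Rmin_r _ _)).
specialize (Hd w Hw1).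
replace (g w - g t) with ((g w - g t - v * RtoC (w - t)) + v * RtoC (w - t)) by ring.
eapply Rle_lt_trans; [apply Cmod_triangle|]. rewrite Cmod_mult, Cmod_R.
apply (Rmult_lt_compat_r (2 + Cmod v)) in Hw2; [|lra].
unfold Rdiv in Hw2; rewrite Rmult_assoc, Rinv_l in Hw2 by lra.
generalize (Rabs_pos (w - t)) (Cmod_ge_0 v); nra.
Qed.

Lemma dlim_dcurve F g t l v : dlim F (g t) l -> dcurve g t v ->
  dcurve (fun s => F (g s)) t (l * v).
Proof.
intros H1 H2 e He. assert (Cg := dcurve_ccurve _ _ _ H2).
set (K := (1 + Cmod v + Cmod l)%R).
assert (Kp : (1 <= K)%R) by (unfold K; generalize (Cmod_ge_0 v) (Cmod_ge_0 l); lra).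
assert (e1 : (0 < e / (2 * K))%R) by (apply Rdiv_lt_0_compat; lra).
destruct (H1 _ e1) as [d1 [p1 h1]].
assert (e2 : (0 < Rmin 1 (e / (2 * K)))%R) by (apply Rmin_case; lra).
destruct (H2 _ e2) as [d2 [p2 h2]]. destruct (Cg _ p1) as [d3 [p3 h3]].
exists (Rmin d2 d3). split; [apply Rmin_case; lra|]. intros s Hs.
assert (s2 := Rlt_le_trans _ _ _ Hs (Rmin_l _ _)).
assert (s3 := Rlt_le_trans _ _ _ Hs (Rmin_r _ _)).
specialize (h3 s s3). specialize (h1 _ h3). specialize (h2 s s2).
replace (F (g s) - F (g t) - l * v * RtoC (s - t)) with
 ((F (g s) - F (g t) - l * (g s - g t)) + l * (g s - g t - v * RtoC (s - t))) by ring.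
eapply Rle_trans; [apply Cmod_triangle|]. rewrite Cmod_mult.
assert (S0 := Rabs_pos (s - t)).
assert (m1 : (Cmod (g s - g t - v * RtoC (s - t)) <= 1 * Rabs (s - t))%R).
  eapply Rle_trans; [exact h2|]. apply Rmult_le_compat_r; auto. apply Rmin_l.
assert (m2 : (Cmod (g s - g t - v * RtoC (s - t)) <= e / (2 * K) * Rabs (s - t))%R).
  eapply Rle_trans; [exact h2|]. apply Rmult_le_compat_r; auto. apply Rmin_r.
assert (m3 : (Cmod (g s - g t) <= K * Rabs (s - t))%R).
  replace (g s - g t) with ((g s - g t - v * RtoC (s - t)) + v * RtoC (s - t)) by ring.
  eapply Rle_trans; [apply Cmod_triangle|]. rewrite Cmod_mult, Cmod_R. unfold K.
  generalize (Cmod_ge_0 l); nra.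
set (q := (e / (2 * K))%R) in *.
assert (Eq : (q * K = e / 2)%R) by (unfold q; field; lra).
assert (A1 : (q * Cmod (g s - g t) <= q * (K * Rabs (s - t)))%R) by (apply Rmult_le_compat_l; lra).
assert (A2 : (Cmod l * Cmod (g s - g t - v * RtoC (s - t)) <= K * (q * Rabs (s - t)))%R).
  apply Rmult_le_compat; auto using Cmod_ge_0. unfold K; generalize (Cmod_ge_0 v); lra.
nra.
Qed.

Lemma dcurve_mult f g t l m : dcurve f t l -> dcurve g t m ->
  dcurve (fun s => f s * g s) t (l * g t + f t * m).
Proof.
intros H1 H2 e He.
assert (C2 := dcurve_ccurve _ _ _ H2).
set (K := (1 + Cmod (f t) + Cmod (g t) + Cmod l)%R).
assert (Kp : (1 <= K)%R) by (unfold K; generalize (Cmod_ge_0 (f t)) (Cmod_ge_0 (g t)) (Cmod_ge_0 l); lra).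
assert (e3 : (0 < e / (4 * K))%R) by (apply Rdiv_lt_0_compat; lra).
assert (e4 : (0 < Rmin 1 (e / (4 * K)))%R) by (apply Rmin_case; lra).
destruct (H1 _ e3) as [d1 [p1 h1]]. destruct (H2 _ e3) as [d2 [p2 h2]].
destruct (C2 _ e4) as [d3 [p3 h3]].
exists (Rmin d1 (Rmin d2 d3)). split; [repeat apply Rmin_case; lra|]. intros w Hw.
assert (w1 := Rlt_le_trans _ _ _ Hw (Rmin_l _ _)).
assert (w' := Rlt_le_trans _ _ _ Hw (Rmin_r _ _)).
assert (w2 := Rlt_le_trans _ _ _ w' (Rmin_l _ _)).
assert (w3 := Rlt_le_trans _ _ _ w' (Rmin_r _ _)).
specialize (h1 w w1). specialize (h2 w w2). specialize (h3 w w3).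
assert (h3a := Rlt_le_trans _ _ _ h3 (Rmin_l _ _)).
assert (h3b := Rlt_le_trans _ _ _ h3 (Rmin_r _ _)).
replace (f w * g w - f t * g t - (l * g t + f t * m) * RtoC (w - t)) with
 ((f w - f t - l * RtoC (w - t)) * g w + (l * RtoC (w - t) * (g w - g t) + f t * (g w - g t - m * RtoC (w - t)))) by ring.
eapply Rle_trans; [apply Cmod_triangle|].
eapply Rle_trans; [apply Rplus_le_compat_l; apply Cmod_triangle|].
rewrite !Cmod_mult, Cmod_R.
assert (gw : (Cmod (g w) <= K)%R).
  replace (g w) with ((g w - g t) + g t) by ring.
  eapply Rle_trans; [apply Cmod_triangle|]. unfold K. generalize (Cmod_ge_0 (f t)) (Cmod_ge_0 l); lra.
assert (lK : (Cmod l <= K)%R) by (unfold K; generalize (Cmod_ge_0 (f t)) (Cmod_ge_0 (g t)); lra).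
assert (fK : (Cmod (f t) <= K)%R) by (unfold K; generalize (Cmod_ge_0 l) (Cmod_ge_0 (g t)); lra).
set (q := (e / (4 * K))%R) in *.
assert (Eq : (q * K = e / 4)%R) by (unfold q; field; lra).
set (W0 := Rabs (w - t)) in *. assert (W : (0 <= W0)%R) by apply Rabs_pos.
assert (A1 : (Cmod (f w - f t - l * RtoC (w - t)) * Cmod (g w) <= (q * W0) * K)%R)
  by (apply Rmult_le_compat; auto using Cmod_ge_0).
assert (A2 : (Cmod l * W0 * Cmod (g w - g t) <= (K * W0) * q)%R).
  apply Rmult_le_compat; auto using Cmod_ge_0.
  apply Rmult_le_pos; auto using Cmod_ge_0. apply Rmult_le_compat_r; auto. lra.
assert (A3 : (Cmod (f t) * Cmod (g w - g t - m * RtoC (w - t)) <= K * (q * W0))%R)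
  by (apply Rmult_le_compat; auto using Cmod_ge_0).
nra.
Qed.

Lemma dcurve_line (a v : C) t : dcurve (fun s => a + RtoC s * v) t v.
Proof.
intros e He. exists 1%R; split; [lra|]. intros s _.
replace (a + RtoC s * v - (a + RtoC t * v) - v * RtoC (s - t)) with (RtoC 0)
  by (rewrite RtoC_minus; ring).
rewrite Cmod_0. generalize (Rabs_pos (s - t)); nra.
Qed.

(** * Integrals of complex curves over [0,1] *)

Definition isCI (g : R -> C) (l : C) : Prop := is_RInt (V := C_R_NormedModule) g 0%R 1%R l.
Definition CI (g : R -> C) : C := RInt (V := C_R_CompleteNormedModule) g 0%R 1%R.

Definition cpath (g : R -> C) : Prop := forall t, (0 <= t <= 1)%R -> ccurve g t.

Lemma CI_correct g : cpath g -> isCI g (CI g).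
Proof.
intros H. apply (RInt_correct (V := C_R_CompleteNormedModule)).
apply (ex_RInt_continuous (V := C_R_CompleteNormedModule)).
intros t Ht. apply ccurve_continuous. apply H.
rewrite Rmin_left, Rmax_right in Ht; lra.
Qed.

Lemma isCI_unique g l : isCI g l -> CI g = l.
Proof. apply (is_RInt_unique (V := C_R_CompleteNormedModule)). Qed.

Lemma CI_ext f g : (forall t, (0 <= t <= 1)%R -> f t = g t) -> CI f = CI g.
Proof.
intros H. apply (RInt_ext (V := C_R_CompleteNormedModule)).
intros t Ht. rewrite Rmin_left, Rmax_right in Ht by lra. apply H. lra.
Qed.

Lemma CI_plus f g : cpath f -> cpath g -> CI (fun t => f t + g t) = CI f + CI g.
Proof.
intros Hf Hg. apply isCI_unique.
exact (is_RInt_plus (V := C_R_NormedModule) _ _ _ _ _ _ (CI_correct _ Hf) (CI_correct _ Hg)).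
Qed.

Lemma scal_C_R (k : R) (x : C) : scal (V := C_R_NormedModule) k x = RtoC k * x.
Proof.
apply injective_projections; unfold scal; simpl; unfold scal; simpl; unfold mult; simpl; ring.
Qed.

Lemma CI_scalR (k : R) g : cpath g -> CI (fun t => RtoC k * g t) = RtoC k * CI g.
Proof.
intros Hg. apply isCI_unique.
assert (H := is_RInt_scal (V := C_R_NormedModule) g 0 1 k _ (CI_correct _ Hg)).
rewrite <- scal_C_R. eapply is_RInt_ext; [|exact H]. intros t _. apply scal_C_R.
Qed.

(** The integral is taken in C as a real vector space, so multiplication by i is not covered by its
    linearity. It swaps the two real component integrals, with one sign. *)
Lemma CI_Ci g : cpath g -> CI (fun t => Ci * g t) = Ci * CI g.
Proof.
intros Hg. apply isCI_unique. assert (H := CI_correct _ Hg).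
assert (H1 := is_RInt_fct_extend_fst _ _ _ _ H).
assert (H2 := is_RInt_fct_extend_snd _ _ _ _ H).
assert (H2' := is_RInt_opp (V := R_NormedModule) _ _ _ _ H2).
assert (H3 := is_RInt_fct_extend_pair (U := R_NormedModule) (V := R_NormedModule)
  (fun t => (Ropp (snd (g t)), fst (g t))) 0 1 _ _ H2' H1).
replace (Ci * CI g) with (Ropp (snd (CI g)), fst (CI g)).
eapply is_RInt_ext; [|exact H3]. intros t _. apply injective_projections; simpl; ring.
apply injective_projections; simpl; ring.
Qed.

Lemma CI_scal (c : C) g : cpath g -> CI (fun t => c * g t) = c * CI g.
Proof.
intros Hg.
assert (P : cpath (fun t => Ci * g t)) by (intros t Ht; apply ccurve_mult; [apply ccurve_const| auto]).
rewrite (CI_ext _ (fun t => RtoC (fst c) * g t + RtoC (snd c) * (Ci * g t))).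
2:{ intros t _. apply injective_projections; simpl; ring. }
rewrite CI_plus, !CI_scalR, CI_Ci; auto.
apply injective_projections; simpl; ring.
- intros t Ht; apply ccurve_mult; [apply ccurve_const| auto].
- intros t Ht; apply ccurve_mult; [apply ccurve_const| auto].
Qed.

Lemma CI_opp g : cpath g -> CI (fun t => - g t) = - CI g.
Proof.
intros Hg. rewrite (CI_ext _ (fun t => (-1) * g t)). rewrite CI_scal; auto. ring. intros; ring.
Qed.

Lemma CI_minus f g : cpath f -> cpath g -> CI (fun t => f t - g t) = CI f - CI g.
Proof.
intros Hf Hg. unfold Cminus. rewrite CI_plus, CI_opp; auto. intros t Ht. apply ccurve_opp; auto.
Qed.

Lemma CI_const c : CI (fun _ => c) = c.
Proof.
apply isCI_unique.
assert (H := is_RInt_const (V := C_R_NormedModule) 0 1 c).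
rewrite scal_C_R in H. unfold isCI.
assert (E : RtoC (1 - 0) * c = c) by (rewrite RtoC_minus; ring).
exact (eq_ind _ (fun v => is_RInt (V := C_R_NormedModule) (fun _ => c) 0 1 v) H _ E).
Qed.

Lemma CI_le g M : cpath g -> (forall t, (0 <= t <= 1)%R -> (Cmod (g t) <= M)%R) -> (Cmod (CI g) <= M)%R.
Proof.
intros Hg H. rewrite <- Cmod_normR.
replace M with ((1 - 0) * M)%R by ring.
apply (norm_RInt_le_const (V := C_R_NormedModule) g 0 1 (CI g) M). lra.
intros t Ht. rewrite Cmod_normR. auto. now apply CI_correct.
Qed.

Lemma CI_deriv (F f : R -> C) : (forall t, (0 <= t <= 1)%R -> dcurve F t (f t)) -> cpath f ->
  CI f = F 1%R - F 0%R.
Proof.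
intros H Hf. apply isCI_unique.
apply (is_RInt_derive (V := C_R_CompleteNormedModule) F f);
intros t Ht; rewrite Rmin_left, Rmax_right in Ht by lra.
- apply dcurve_is_derive; auto.
- apply ccurve_continuous; auto.
Qed.

(** * Integrals along segments, and compactness of closed discs *)

Definition seg (a b : C) (t : R) : C := a + RtoC t * (b - a).

Lemma seg_norm a b t M : (0 <= t <= 1)%R -> (Cmod a <= M)%R -> (Cmod b <= M)%R -> (Cmod (seg a b t) <= M)%R.
Proof.
intros Ht Ha Hb. unfold seg.
replace (a + RtoC t * (b - a)) with (RtoC (1 - t) * a + RtoC t * b) by (rewrite RtoC_minus; ring).
eapply Rle_trans; [apply Cmod_triangle|]. rewrite !Cmod_mult, !Cmod_R, !Rabs_right by lra. nra.
Qed.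

Lemma seg_near a b t z r : (0 <= t <= 1)%R -> (Cmod (a - z) <= r)%R -> (Cmod (b - z) <= r)%R ->
  (Cmod (seg a b t - z) <= r)%R.
Proof.
intros Ht Ha Hb. replace (seg a b t - z) with (seg (a - z) (b - z) t) by (unfold seg; ring).
now apply seg_norm.
Qed.

Lemma seg_norm_lt a b t M : (0 <= t <= 1)%R -> (Cmod a < M)%R -> (Cmod b < M)%R -> (Cmod (seg a b t) < M)%R.
Proof.
intros Ht Ha Hb. apply Rle_lt_trans with (Rmax (Cmod a) (Cmod b)).
apply seg_norm; auto using Rmax_l, Rmax_r. now apply Rmax_case.
Qed.

Lemma ccurve_seg a b t : ccurve (seg a b) t.
Proof. apply (dcurve_ccurve _ _ (b - a)). apply dcurve_line. Qed.

Definition sI (f : C -> C) (a b : C) : C := CI (fun t => f (seg a b t) * (b - a)).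

Definition cont_on_seg (f : C -> C) a b := forall t, (0 <= t <= 1)%R -> ccont f (seg a b t).

Lemma cpath_sI f a b : cont_on_seg f a b -> cpath (fun t => f (seg a b t) * (b - a)).
Proof.
intros H t Ht. apply ccurve_mult; [|apply ccurve_const].
apply ccont_ccurve; [auto|apply ccurve_seg].
Qed.

Lemma seg_rev a b t : seg a b t = seg b a (1 - t).
Proof. unfold seg. rewrite RtoC_minus. ring. Qed.

Lemma sI_rev f a b : cont_on_seg f a b -> sI f b a = - sI f a b.
Proof.
intros H. assert (P := CI_correct _ (cpath_sI _ _ _ H)).
apply isCI_unique. unfold isCI in *.
apply (is_RInt_swap (V := C_R_NormedModule)) in P.
assert (Q := is_RInt_comp_lin (V := C_R_NormedModule) (fun t => f (seg a b t) * (b - a)) (-1) 1 0 1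
  (- sI f a b)).
replace (-1 * 0 + 1)%R with 1%R in Q by ring. replace (-1 * 1 + 1)%R with 0%R in Q by ring.
specialize (Q P). eapply is_RInt_ext; [|exact Q].
intros t _. simpl. replace (-1 * t + 1)%R with (1 - t)%R by ring. rewrite <- seg_rev.
rewrite scal_C_R. replace (RtoC (-1)) with (-(1)) by (rewrite <- RtoC_opp; reflexivity). ring.
Qed.

Lemma RtoC_half : RtoC (/ 2) = / 2.
Proof. rewrite RtoC_inv; auto; lra. Qed.

Lemma sI_split f a b : cont_on_seg f a b ->
  sI f a b = sI f a ((a + b) / 2) + sI f ((a + b) / 2) b.
Proof.
intros H. set (m := (a + b) / 2).
assert (S1 : forall t, seg a m t = seg a b (/2 * t + 0)).
  intros t. unfold seg, m. rewrite RtoC_plus, RtoC_mult, RtoC_half; field.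
assert (S2 : forall t, seg m b t = seg a b (/2 * t + /2)).
  intros t. unfold seg, m. rewrite RtoC_plus, RtoC_mult, RtoC_half; field.
assert (H1 : cont_on_seg f a m) by (intros t Ht; rewrite S1; apply H; lra).
assert (H2 : cont_on_seg f m b) by (intros t Ht; rewrite S2; apply H; lra).
assert (P := CI_correct _ (cpath_sI _ _ _ H)). unfold isCI in P.
assert (ex : forall u v, (0 <= u <= v)%R -> (v <= 1)%R ->
   ex_RInt (V := C_R_CompleteNormedModule) (fun t => f (seg a b t) * (b - a)) u v).
  intros u v Hu Hv. apply (ex_RInt_continuous (V := C_R_CompleteNormedModule)).
  intros z Hz. rewrite Rmin_left, Rmax_right in Hz by lra.
  apply ccurve_continuous, cpath_sI; auto. lra.
assert (E1 := RInt_correct (V := C_R_CompleteNormedModule) _ _ _ (ex 0%R (/2)%R ltac:(lra) ltac:(lra))).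
assert (E2 := RInt_correct (V := C_R_CompleteNormedModule) _ _ _ (ex (/2)%R 1%R ltac:(lra) ltac:(lra))).
assert (E := RInt_Chasles (V := C_R_CompleteNormedModule) _ _ _ _ (ex 0%R (/2)%R ltac:(lra) ltac:(lra)) (ex (/2)%R 1%R ltac:(lra) ltac:(lra))).
set (I1 := RInt (V := C_R_CompleteNormedModule) (fun t => f (seg a b t) * (b - a)) 0%R (/2)%R) in *.
set (I2 := RInt (V := C_R_CompleteNormedModule) (fun t => f (seg a b t) * (b - a)) (/2)%R 1%R) in *.
transitivity (I1 + I2). symmetry. exact E.
f_equal; symmetry; apply isCI_unique; unfold isCI.
- assert (Q := is_RInt_comp_lin (V := C_R_NormedModule) (fun t => f (seg a b t) * (b - a)) (/2) 0 0 1 I1).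
  replace (/2 * 0 + 0)%R with 0%R in Q by ring. replace (/2 * 1 + 0)%R with (/2)%R in Q by ring.
  specialize (Q E1). eapply is_RInt_ext; [|exact Q]. intros t _. simpl. rewrite <- S1.
  assert (m - a = RtoC (/2) * (b - a)) by (unfold m; rewrite RtoC_half; field). rewrite H0.
  rewrite scal_C_R. ring.
- assert (Q := is_RInt_comp_lin (V := C_R_NormedModule) (fun t => f (seg a b t) * (b - a)) (/2) (/2) 0 1 I2).
  replace (/2 * 0 + /2)%R with (/2)%R in Q by ring. replace (/2 * 1 + /2)%R with 1%R in Q by field.
  specialize (Q E2). eapply is_RInt_ext; [|exact Q]. intros t _. simpl. rewrite <- S2.
  assert (b - m = RtoC (/2) * (b - a)) by (unfold m; rewrite RtoC_half; field). rewrite H0.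
  rewrite scal_C_R. ring.
Qed.

Lemma sI_le f a b M : cont_on_seg f a b ->
  (forall t, (0 <= t <= 1)%R -> (Cmod (f (seg a b t)) <= M)%R) -> (Cmod (sI f a b) <= M * Cmod (b - a))%R.
Proof.
intros H HM. apply CI_le. now apply cpath_sI. intros t Ht. rewrite Cmod_mult.
apply Rmult_le_compat_r; auto using Cmod_ge_0.
Qed.

Lemma sI_plus f g a b : cont_on_seg f a b -> cont_on_seg g a b ->
  sI (fun z => f z + g z) a b = sI f a b + sI g a b.
Proof.
intros Hf Hg. unfold sI. rewrite <- CI_plus by now apply cpath_sI.
apply CI_ext. intros; ring.
Qed.

Lemma sI_deriv F f a b : (forall t, (0 <= t <= 1)%R -> dlim F (seg a b t) (f (seg a b t))) ->
  cont_on_seg f a b -> sI f a b = F b - F a.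
Proof.
intros HF Hf. unfold sI. rewrite (CI_deriv (fun t => F (seg a b t))).
- f_equal; [f_equal|do 2 f_equal]; unfold seg; ring.
- intros t Ht. apply dlim_dcurve; auto. apply dcurve_line.
- now apply cpath_sI.
Qed.

Lemma lebesgue_number (R0 : R) (P : C -> R -> Prop) :
  (forall z, (Cmod z <= R0)%R -> exists d, (0 < d)%R /\ P z d) ->
  exists d, (0 < d)%R /\ forall w, (Cmod w <= R0)%R ->
    exists z d', (Cmod z <= R0)%R /\ P z d' /\ (Cmod (w - z) < d' / 2)%R /\ (d <= d' / 2)%R.
Proof.
intros H.
assert (D : forall z : C, exists d : posreal, ((Cmod z <= R0)%R -> P z (4 * d)%R) /\
   (* Compactness is available for squares, so points outside the disc need a gauge too. It is
      chosen so small that such a point never serves a [w] of the disc. The factor 2 pays for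
      passing from the sup norm to the modulus, and the 4 leaves the required half. *)
   ((R0 < Cmod z)%R -> (2 * d < Cmod z - R0)%R)).
  intros z. destruct (Rle_lt_dec (Cmod z) R0) as [h|h].
  - destruct (H z h) as [d [dp hd]].
    assert (dp4 : (0 < d / 4)%R) by lra. exists (mkposreal _ dp4). simpl. split; [|lra].
    intros _. replace (4 * (d / 4))%R with d by field. auto.
  - assert (dp4 : (0 < (Cmod z - R0) / 3)%R) by lra. exists (mkposreal _ dp4). simpl. split; lra.
set (delta := fun z => proj1_sig (constructive_indefinite_description _ (D z))).
assert (Hd : forall z, ((Cmod z <= R0)%R -> P z (4 * delta z)%R) /\ ((R0 < Cmod z)%R -> (2 * delta z < Cmod z - R0)%R))
  by (intros z; exact (proj2_sig (constructive_indefinite_description _ (D z)))).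
destruct (compactness_value_2d (-R0) R0 (-R0) R0 (fun x y => delta (x, y))) as [d hd].
exists d. split; [apply cond_pos|]. intros w Hw.
assert (M := Rmax_Cmod w).
assert (M1 : (-R0 <= fst w <= R0)%R) by (apply Rabs_le_between; eapply Rle_trans; [|exact Hw]; eapply Rle_trans; [|exact M]; apply Rmax_l).
assert (M2 : (-R0 <= snd w <= R0)%R) by (apply Rabs_le_between; eapply Rle_trans; [|exact Hw]; eapply Rle_trans; [|exact M]; apply Rmax_r).
specialize (hd (fst w) (snd w) M1 M2). apply NNPP in hd.
destruct hd as [u [v [_ [_ [hu [hv hdd]]]]]].
set (z := (u, v) : C) in *. destruct (Hd z) as [h1 h2].
assert (N : (Cmod (w - z) <= sqrt 2 * Rmax (Rabs (fst (w - z)%C)) (Rabs (snd (w - z)%C)))%R) by apply Cmod_2Rmax.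
assert (N2 : (Rmax (Rabs (fst (w - z)%C)) (Rabs (snd (w - z)%C)) < delta z)%R) by (apply Rmax_case; assumption).
assert (s2 : (1 < sqrt 2 < 2)%R).
  assert (sp := sqrt_pos 2). assert (ss := sqrt_sqrt 2 ltac:(lra)). nra.
assert (N3 : (Cmod (w - z) < 2 * delta z)%R) by (generalize (cond_pos (delta z)); nra).
assert (hz : (Cmod z <= R0)%R).
  destruct (Rle_lt_dec (Cmod z) R0) as [|h]; auto. specialize (h2 h).
  assert (T := Cmod_sub_ge z w). rewrite Cmod_sub_sym in T. lra.
exists z, (4 * delta z)%R. split; [auto|split; [auto|split; [lra|]]].
assert (dz := cond_pos (delta z)). change (pos d <= delta z)%R in hdd. lra.
Qed.

(** Only [w] is confined to the closed disc; [w'] may leave it, which spares a case distinction when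
    discs are perturbed. *)
Lemma unif_cont (f : C -> C) (R0 : R) : (forall z, (Cmod z <= R0)%R -> ccont f z) ->
  forall e, (0 < e)%R -> exists d, (0 < d)%R /\ forall w w', (Cmod w <= R0)%R ->
   (Cmod (w' - w) < d)%R -> (Cmod (f w' - f w) < e)%R.
Proof.
intros H e He.
destruct (lebesgue_number R0 (fun z d => forall w, (Cmod (w - z) < d)%R -> (Cmod (f w - f z) < e / 2)%R)) as [d [dp hd]].
  intros z hz. apply H; auto. lra.
exists d; split; auto. intros w w' Hw Hw'.
destruct (hd w Hw) as [z [d' [hz [h [h1 h2]]]]].
assert (k1 := h w ltac:(lra)).
assert (k2 := h w' ltac:(generalize (Cmod_tri3 w' w z); lra)).
assert (T := Cmod_tri3 (f w') (f z) (f w)). rewrite (Cmod_sub_sym (f z)) in T. lra.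
Qed.

(** Walking from the centre along a ray in steps shorter than the modulus of continuity for 1 raises
    [Cmod (f w)] by at most 1 per step, and finitely many steps reach the boundary. *)
Lemma bounded_on_disc (f : C -> C) (R0 : R) : (forall z, (Cmod z <= R0)%R -> ccont f z) ->
  exists M, (0 < M)%R /\ forall w, (Cmod w <= R0)%R -> (Cmod (f w) <= M)%R.
Proof.
intros H. destruct (Rlt_le_dec R0 0) as [neg|pos].
  exists 1%R; split; [lra|]. intros w Hw. generalize (Cmod_ge_0 w); lra.
destruct (unif_cont f R0 H 1 Rlt_0_1) as [d [dp hd]].
destruct (nfloor_ex (R0 / (d / 2))) as [N [_ hN]]; [apply Rdiv_le_0_compat; lra|].
assert (NR : (R0 < INR (S N) * (d / 2))%R).
  rewrite S_INR. apply (Rmult_lt_compat_r (d / 2)) in hN; [|lra].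
  unfold Rdiv at 1 in hN. rewrite Rmult_assoc, Rinv_l in hN by lra. lra.
exists (1 + Cmod (f 0) + INR (S N))%R. split. generalize (Cmod_ge_0 (f 0)) (pos_INR (S N)); lra.
assert (K : forall k w, (Cmod w <= R0)%R -> (Cmod w <= INR k * (d / 2))%R ->
   (Cmod (f w) <= Cmod (f 0) + INR k)%R).
  induction k as [|k IH]; intros w Hw Hk.
  - simpl in Hk. assert (w = 0) by (apply Cmod_eq_0; generalize (Cmod_ge_0 w); lra). subst. simpl; lra.
  - destruct (Rle_lt_dec (Cmod w) (INR k * (d / 2))) as [h|h].
    rewrite S_INR. specialize (IH w Hw h). lra.
    assert (wp : (0 < Cmod w)%R) by (generalize (pos_INR k); nra).
    rewrite S_INR in *.
    (* The preceding point on the ray is the radial projection of [w] to radius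
       [INR k * (d / 2)]. *)
    set (lam := (INR k * (d / 2) / Cmod w)%R).
    assert (L : (0 <= lam < 1)%R).
      unfold lam. split. apply Rdiv_le_0_compat; [generalize (pos_INR k); nra|auto].
      apply (Rmult_lt_reg_r (Cmod w)); auto. unfold Rdiv. rewrite Rmult_assoc, Rinv_l; lra.
    assert (Lw : (lam * Cmod w = INR k * (d / 2))%R) by (unfold lam; field; lra).
    assert (C1 : Cmod (RtoC lam * w) = (lam * Cmod w)%R) by (rewrite Cmod_mult, Cmod_R, Rabs_right; lra).
    assert (I1 := IH (RtoC lam * w) ltac:(rewrite C1; nra) ltac:(rewrite C1; lra)).
    assert (D1 : Cmod (RtoC lam * w - w) = ((1 - lam) * Cmod w)%R).
      replace (RtoC lam * w - w) with (- (RtoC (1 - lam) * w)) by (rewrite RtoC_minus; ring).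
      rewrite Cmod_opp, Cmod_mult, Cmod_R, Rabs_right; lra.
    assert (D2 := hd w (RtoC lam * w) Hw ltac:(rewrite D1; nra)).
    assert (T := Cmod_sub_ge (f w) (f (RtoC lam * w))). rewrite Cmod_sub_sym in T. lra.
intros w Hw. specialize (K (S N) w Hw ltac:(lra)). lra.
Qed.

(** * Goursat's theorem on triangles and the existence of primitives *)

Definition tri (f : C -> C) a b c := sI f a b + sI f b c + sI f c a.

Section Goursat.
Variables (f : C -> C) (R0 : R).
Hypothesis Hf : forall z, (Cmod z <= R0)%R -> exists l, dlim f z l.

Let Cf z : (Cmod z <= R0)%R -> ccont f z.
Proof. intros h. destruct (Hf z h) as [l hl]. exact (dlim_ccont _ _ _ hl). Qed.

Let cs a b : (Cmod a <= R0)%R -> (Cmod b <= R0)%R -> cont_on_seg f a b.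
Proof. intros Ha Hb t Ht. apply Cf. now apply seg_norm. Qed.

Let mid_norm (a b : C) : (Cmod a <= R0)%R -> (Cmod b <= R0)%R -> (Cmod ((a + b) / 2) <= R0)%R.
Proof.
intros Ha Hb. replace ((a + b) / 2) with (seg a b (/2)). apply seg_norm; auto. lra.
unfold seg. rewrite RtoC_half; field.
Qed.

Let tri_split (a b c : C) : (Cmod a <= R0)%R -> (Cmod b <= R0)%R -> (Cmod c <= R0)%R ->
  tri f a b c = tri f a ((a + b) / 2) ((c + a) / 2) + tri f ((a + b) / 2) b ((b + c) / 2)
     + tri f ((c + a) / 2) ((b + c) / 2) c + tri f ((a + b) / 2) ((b + c) / 2) ((c + a) / 2).
Proof.
intros Ha Hb Hc. unfold tri.
rewrite (sI_split f a b), (sI_split f b c), (sI_split f c a) by auto.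
rewrite (sI_rev f ((a + b) / 2) ((c + a) / 2)) by auto.
rewrite (sI_rev f ((a + b) / 2) ((b + c) / 2)) by auto.
rewrite (sI_rev f ((b + c) / 2) ((c + a) / 2)) by auto. ring.
Qed.


(** One of the four midpoint triangles carries at least a quarter of the integral. Testing three of
    them and falling back on the middle one makes the selection a function, which can be
    iterated. *)
Definition subtri (T : C * C * C) : C * C * C :=
  let '(a, b, c) := T in
  let p := (a + b) / 2 in let q := (b + c) / 2 in let r := (c + a) / 2 in
  let good u v w := Rle_dec (Cmod (tri f a b c)) (4 * Cmod (tri f u v w)) in
  if good a p r then (a, p, r) else
  if good p b q then (p, b, q) else
  if good r q c then (r, q, c) else (p, q, r).

Let inside (T : C * C * C) := let '(a, b, c) := T in (Cmod a <= R0 /\ Cmod b <= R0 /\ Cmod c <= R0)%R.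
Let small (T : C * C * C) s :=
  let '(a, b, c) := T in (Cmod (b - a) <= s /\ Cmod (c - b) <= s /\ Cmod (a - c) <= s)%R.
Let tri' (T : C * C * C) := let '(a, b, c) := T in tri f a b c.

Let subtri_inside T : inside T -> inside (subtri T).
Proof.
destruct T as [[a b] c]. intros [Ha [Hb Hc]]. unfold subtri.
repeat destruct Rle_dec; simpl; auto.
Qed.

Let half_norm (x y : C) s : (Cmod y <= s)%R -> x = y / 2 -> (Cmod x <= s / 2)%R.
Proof.
intros H ->. rewrite Cmod_div. rewrite Cmod_R, Rabs_right by lra. lra.
intros h. apply RtoC_inj in h. lra.
Qed.

Let subtri_small T s : small T s -> small (subtri T) (s / 2).
Proof.
destruct T as [[a b] c]. intros [Ha [Hb Hc]]. unfold subtri.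
assert (Ha' : (Cmod (a - b) <= s)%R) by now rewrite Cmod_sub_sym.
assert (Hb' : (Cmod (b - c) <= s)%R) by now rewrite Cmod_sub_sym.
assert (Hc' : (Cmod (c - a) <= s)%R) by now rewrite Cmod_sub_sym.
repeat destruct Rle_dec; simpl; repeat split;
first [ refine (half_norm _ _ s Ha _); now field | refine (half_norm _ _ s Hb _); now field
 | refine (half_norm _ _ s Hc _); now field | refine (half_norm _ _ s Ha' _); now field | refine (half_norm _ _ s Hb' _); now field
 | refine (half_norm _ _ s Hc' _); now field ].
Qed.

Let subtri_fst T s : small T s -> (Cmod (fst (fst (subtri T)) - fst (fst T)) <= s)%R.
Proof.
destruct T as [[a b] c]. intros [Ha [Hb Hc]]. unfold subtri.
assert (Hc' : (Cmod (c - a) <= s)%R) by now rewrite Cmod_sub_sym.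
assert (s0 : (0 <= s)%R) by (generalize (Cmod_ge_0 (b - a)); lra).
repeat destruct Rle_dec; simpl.
- replace (a - a) with (RtoC 0) by ring. rewrite Cmod_0; auto.
- apply Rle_trans with (s / 2)%R; [|lra]. apply (half_norm _ _ s Ha). field.
- apply Rle_trans with (s / 2)%R; [|lra]. apply (half_norm _ _ s Hc'). field.
- apply Rle_trans with (s / 2)%R; [|lra]. apply (half_norm _ _ s Ha). field.
Qed.

Let subtri_big T : inside T -> (Cmod (tri' T) <= 4 * Cmod (tri' (subtri T)))%R.
Proof.
destruct T as [[a b] c]. intros [Ha [Hb Hc]]. unfold subtri.
destruct Rle_dec; [simpl; auto|]. destruct Rle_dec; [simpl; auto|]. destruct Rle_dec; [simpl; auto|].
simpl. rewrite (tri_split a b c) in * by auto.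
match goal with |- (Cmod (?x + ?y + ?z + ?w) <= _)%R =>
  assert (K1 := Cmod_triangle (x + y + z) w); assert (K2 := Cmod_triangle (x + y) z); assert (K3 := Cmod_triangle x y) end.
lra.
Qed.

(** The affine part of [f] at [x] has the explicit primitive [- G] and drops out of the closed
    contour. The remainder is at most e times 3s on each of three sides of length at most s. *)
Let tri_local x e d a b c s : (0 < e)%R -> (exists l, forall w, (Cmod (w - x) < d)%R ->
     (Cmod (f w - f x - l * (w - x)) <= e * Cmod (w - x))%R) ->
   inside (a, b, c) -> small (a, b, c) s -> (Cmod (a - x) <= 2 * s)%R -> (3 * s < d)%R ->
   (Cmod (tri f a b c) <= 9 * e * (s * s))%R.
Proof.
intros He [l Hl] [Ha [Hb Hc]] [S1 [S2 S3]] Hax Hd.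
assert (s0 : (0 <= s)%R) by (generalize (Cmod_ge_0 (b - a)); lra).
assert (Hax' : (Cmod (a - x) <= 3 * s)%R) by lra.
assert (Hbx : (Cmod (b - x) <= 3 * s)%R) by (generalize (Cmod_tri3 b a x); lra).
assert (Hcx : (Cmod (c - x) <= 3 * s)%R) by (generalize (Cmod_tri3 c a x); rewrite (Cmod_sub_sym c a); lra).
set (g := fun w => f w + - (f x + l * (w - x))).
set (G := fun w => - (f x * (w - x) + l * ((w - x) * (w - x)) / 2)).
assert (DG : forall w, dlim G w (- (f x + l * (w - x)))).
  intros w. unfold G. apply dlim_opp.
  replace (f x + l * (w - x)) with (f x * (1 - 0) + l / 2 * ((1 - 0) * (w - x) + (w - x) * (1 - 0))) by (field).
  apply (dlim_ext_loc (fun w => f x * (w - x) + l / 2 * ((w - x) * (w - x))) _ _ _ 1); [lra| intros; field |].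
  assert (D1 : dlim (fun w => w - x) w (1 - 0)) by (apply dlim_minus; [apply dlim_id | apply dlim_const]).
  apply dlim_plus; apply dlim_scal; auto. apply (dlim_mult (fun w => w - x) (fun w => w - x)); auto.
assert (CG : forall a b, cont_on_seg (fun w => - (f x + l * (w - x))) a b).
  intros u v t _. apply (dlim_ccont _ _ (- (0 + l * (1 - 0)))). apply dlim_opp. apply dlim_plus. apply dlim_const.
  apply dlim_scal. apply dlim_minus; [apply dlim_id | apply dlim_const].
assert (E : forall u v, (Cmod u <= R0)%R -> (Cmod v <= R0)%R -> sI g u v = sI f u v + (G v - G u)).
  intros u v Hu Hv. unfold g. rewrite sI_plus; auto. f_equal. apply sI_deriv; auto.
assert (Cg : forall u v, (Cmod u <= R0)%R -> (Cmod v <= R0)%R -> cont_on_seg g u v).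
  intros u v Hu Hv t Ht. destruct (Hf (seg u v t)) as [m hm]. now apply seg_norm.
  apply (dlim_ccont _ _ (m + - (0 + l * (1 - 0)))). apply dlim_plus; auto. apply dlim_opp. apply dlim_plus. apply dlim_const.
  apply dlim_scal. apply dlim_minus; [apply dlim_id | apply dlim_const].
assert (B : forall u v, (Cmod u <= R0)%R -> (Cmod v <= R0)%R -> (Cmod (u - x) <= 3 * s)%R -> (Cmod (v - x) <= 3 * s)%R ->
   (Cmod (v - u) <= s)%R -> (Cmod (sI g u v) <= 3 * e * (s * s))%R).
  intros u v Hu Hv Hux Hvx Huv.
  apply Rle_trans with (e * (3 * s) * Cmod (v - u))%R.
  - apply sI_le; auto. intros t Ht.
    assert (N := seg_near u v t x (3 * s) Ht Hux Hvx).
    unfold g. replace (f (seg u v t) + - (f x + l * (seg u v t - x))) with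
     (f (seg u v t) - f x - l * (seg u v t - x)) by ring.
    eapply Rle_trans; [apply Hl; lra|]. apply Rmult_le_compat_l; lra.
  - replace (3 * e * (s * s))%R with (e * (3 * s) * s)%R by ring. apply Rmult_le_compat_l; [nra|auto].
assert (TE : tri f a b c = sI g a b + sI g b c + sI g c a) by (unfold tri; rewrite !E; auto; ring).
rewrite TE. assert (B1 := B a b). assert (B2 := B b c). assert (B3 := B c a).
assert (K1 := Cmod_triangle (sI g a b + sI g b c) (sI g c a)).
assert (K2 := Cmod_triangle (sI g a b) (sI g b c)).
specialize (B1 Ha Hb Hax' Hbx S1). specialize (B2 Hb Hc Hbx Hcx S2). specialize (B3 Hc Ha Hcx Hax' S3). lra.
Qed.

(** With [r n = 2 * K / 2 ^ n] the intervals from [u n - r n] to [u n + r n] are nested, and the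
    supremum of the left ends lies in all of them. *)
Let geom_limit (u : nat -> R) K : (forall n, (Rabs (u (S n) - u n) <= K / 2 ^ n)%R) ->
  exists l, forall n, (Rabs (u n - l) <= 2 * K / 2 ^ n)%R.
Proof.
intros H.
assert (p2 : forall n, (0 < 2 ^ n)%R) by (intros; apply pow_lt; lra).
set (r := fun n => (2 * K / 2 ^ n)%R).
assert (rS : forall n, (K / 2 ^ n = r n - r (S n))%R).
  intros n. unfold r. simpl. field. generalize (p2 n); lra.
assert (step : forall n, (u n - r n <= u (S n) - r (S n) /\ u (S n) + r (S n) <= u n + r n)%R).
  intros n. specialize (H n). rewrite rS in H. apply Rabs_le_between in H. lra.
assert (mon : forall n k, (u n - r n <= u (n + k)%nat - r (n + k)%nat /\ u (n + k)%nat + r (n + k)%nat <= u n + r n)%R).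
  induction k as [|k IH]. rewrite Nat.add_0_r; lra.
  rewrite Nat.add_succ_r. generalize (step (n + k)%nat); lra.
assert (rp : forall n, (0 <= r n)%R).
  intros n. unfold r. assert (0 <= K)%R. specialize (H 0%nat). simpl in H. generalize (Rabs_pos (u 1%nat - u 0%nat)); lra.
  apply Rdiv_le_0_compat; auto; lra.
assert (lu : forall n m, (u n - r n <= u m + r m)%R).
  intros n m. destruct (mon n m) as [m1 _]. destruct (mon m n) as [_ m2].
  rewrite (Nat.add_comm m n) in m2. generalize (rp (n + m)%nat); lra.
destruct (completeness (fun x => exists n, x = (u n - r n)%R)) as [l [l1 l2]].
  exists (u 0%nat + r 0%nat)%R. intros x [n ->]. apply lu. exists (u 0%nat - r 0%nat)%R. now exists 0%nat.
exists l. intros n. apply Rabs_le_between. fold (r n).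
assert (A := l1 _ (ex_intro _ n eq_refl)).
assert (B : (l <= u n + r n)%R) by (apply l2; intros x [m ->]; apply lu). lra.
Qed.

(** The integral loses at most a factor 4 per bisection, while the local bound gains the square of
    the halved size; the two cancel and the arbitrary e remains. *)
Lemma goursat_triangle a b c : (Cmod a <= R0)%R -> (Cmod b <= R0)%R -> (Cmod c <= R0)%R -> tri f a b c = 0.
Proof.
intros Ha Hb Hc.
set (s := (Cmod (b - a) + Cmod (c - b) + Cmod (a - c))%R).
assert (s0 : (0 <= s)%R) by (unfold s; generalize (Cmod_ge_0 (b - a)) (Cmod_ge_0 (c - b)) (Cmod_ge_0 (a - c)); lra).
set (T := fun n => Nat.iter n subtri (a, b, c)).
assert (p2 : forall n, (0 < 2 ^ n)%R) by (intros; apply pow_lt; lra).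
assert (Tin : forall n, inside (T n)).
  induction n as [|n IH]. simpl; auto. unfold T; simpl. now apply subtri_inside.
assert (Tsm : forall n, small (T n) (s / 2 ^ n)).
  induction n as [|n IH]. simpl. unfold s.
  generalize (Cmod_ge_0 (b - a)) (Cmod_ge_0 (c - b)) (Cmod_ge_0 (a - c)); intros; lra.
  replace (s / 2 ^ S n)%R with (s / 2 ^ n / 2)%R. unfold T; simpl. now apply subtri_small.
  simpl. field. generalize (p2 n); lra.
assert (Tbig : forall n, (Cmod (tri f a b c) <= 4 ^ n * Cmod (tri' (T n)))%R).
  induction n as [|n IH]. simpl. lra.
  eapply Rle_trans; [exact IH|]. simpl pow.
  assert (K := subtri_big _ (Tin n)). change (subtri (T n)) with (T (S n)) in K.
  assert (0 < 4 ^ n)%R by (apply pow_lt; lra). nra.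
set (A := fun n => fst (fst (T n))).
assert (Ast : forall n, (Cmod (A (S n) - A n) <= s / 2 ^ n)%R).
  intros n. apply (subtri_fst (T n)). apply Tsm.
destruct (geom_limit (fun n => fst (A n)) s) as [x1 hx1].
  intros n. eapply Rle_trans; [|exact (Ast n)]. eapply Rle_trans; [|apply Rmax_Cmod]. apply Rmax_l.
destruct (geom_limit (fun n => snd (A n)) s) as [x2 hx2].
  intros n. eapply Rle_trans; [|exact (Ast n)]. eapply Rle_trans; [|apply Rmax_Cmod]. apply Rmax_r.
set (x := (x1, x2) : C).
assert (Ax : forall n, (Cmod (A n - x) <= 4 * (s / 2 ^ n))%R).
  intros n. eapply Rle_trans; [apply Cmod_2Rmax|].
  assert (M : (Rmax (Rabs (fst (A n - x)%C)) (Rabs (snd (A n - x)%C)) <= 2 * s / 2 ^ n)%R).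
    apply Rmax_case; [apply hx1|apply hx2].
  assert (q2 : (sqrt 2 <= 2)%R).
    assert (sp := sqrt_pos 2). assert (ss := sqrt_sqrt 2 ltac:(lra)). nra.
  assert (0 <= Rmax (Rabs (fst (A n - x)%C)) (Rabs (snd (A n - x)%C)))%R.
    eapply Rle_trans; [|apply Rmax_l]. apply Rabs_pos.
  assert (0 <= sqrt 2)%R by apply sqrt_pos.
  unfold Rdiv in *. nra.
assert (tiny : forall e, (0 < e)%R -> exists n, (s / 2 ^ n < e)%R).
  intros e He. destruct (Pow_x_infinity 2 ltac:(rewrite Rabs_right; lra) (s / e + 1)) as [N hN].
  exists N. specialize (hN N (Nat.le_refl N)). rewrite Rabs_right in hN by (generalize (p2 N); lra).
  apply (Rmult_lt_reg_r (2 ^ N)); auto. unfold Rdiv. rewrite Rmult_assoc, Rinv_l by (generalize (p2 N); lra).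
  apply (Rmult_ge_compat_l e) in hN; [|lra]. replace (e * (s / e + 1))%R with (s + e)%R in hN by (field; lra). lra.
assert (xR : (Cmod x <= R0)%R).
  apply Rnot_lt_le. intros h. destruct (tiny ((Cmod x - R0) / 4)%R) as [n hn]; [lra|].
  assert (K1 := Ax n). assert (K2 := Cmod_sub_ge x (A n)). rewrite Cmod_sub_sym in K2.
  assert (K3 : (Cmod (A n) <= R0)%R). specialize (Tin n). unfold A. destruct (T n) as [[? ?] ?]. simpl in *. tauto.
  lra.
apply Cmod_small_eq0. intros e He.
destruct (Hf x xR) as [l hl].
(* A generous denominator: the final estimate produces 36 s^2, and the summand 1 covers the
   degenerate triangle with s = 0. *)
set (S0 := (144 * (s * s) + 1)%R).
assert (Sp : (0 < S0)%R) by (unfold S0; nra).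
assert (ep : (0 < e / S0)%R) by (apply Rdiv_lt_0_compat; auto).
destruct (hl _ ep) as [d [dp hd]].
destruct (tiny (d / 12)%R) as [n hn]; [lra|].
eapply Rle_trans; [exact (Tbig n)|].
set (sn := (s / 2 ^ n)%R) in *.
(* The limit point is known only within 4 [sn] of the first vertex, so the triangle is declared to
   have size 2 [sn], for which [tri_local] allows that distance. *)
assert (Loc : (Cmod (tri' (T n)) <= 9 * (e / S0) * ((2 * sn) * (2 * sn)))%R).
  specialize (Ax n). specialize (Tin n). specialize (Tsm n). unfold A in Ax. fold sn in Tsm, Ax.
  destruct (T n) as [[an bn] cn]. simpl in Ax.
  assert (sn0 : (0 <= sn)%R) by (unfold sn; apply Rdiv_le_0_compat; auto).
  apply (tri_local x (e / S0) d);
  [auto | now exists l | auto | destruct Tsm as [? [? ?]]; split; [|split]; lra | lra | lra].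
apply Rle_trans with (4 ^ n * (9 * (e / S0) * (2 * sn * (2 * sn))))%R.
  apply Rmult_le_compat_l; auto. apply pow_le; lra.
replace (4 ^ n)%R with (2 ^ n * 2 ^ n)%R by (rewrite <- Rpow_mult_distr; f_equal; ring).
replace (2 ^ n * 2 ^ n * (9 * (e / S0) * (2 * sn * (2 * sn))))%R with (e * ((36 * (s * s)) / S0))%R.
2:{ unfold sn. field. split; generalize (p2 n); lra. }
rewrite <- (Rmult_1_r e) at 2. apply Rmult_le_compat_l; [lra|].
apply (Rmult_le_reg_r S0); auto. unfold Rdiv. rewrite Rmult_assoc, Rinv_l by lra. unfold S0. nra.
Qed.

End Goursat.

Lemma sI_const c a b : sI (fun _ => c) a b = c * (b - a).
Proof. unfold sI. apply CI_const. Qed.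

Lemma ccont_const c z : ccont (fun _ => c) z.
Proof. exact (dlim_ccont _ _ _ (dlim_const c z)). Qed.

Lemma sI_approx f a b c e : cont_on_seg f a b ->
  (forall t, (0 <= t <= 1)%R -> (Cmod (f (seg a b t) - c) <= e)%R) ->
  (Cmod (sI f a b - c * (b - a)) <= e * Cmod (b - a))%R.
Proof.
intros Hf H.
assert (Cc : cont_on_seg (fun _ => - c) a b) by (intros t _; apply ccont_const).
replace (sI f a b - c * (b - a)) with (sI (fun z => f z + - c) a b).
2:{ rewrite sI_plus; auto. rewrite sI_const. ring. }
apply sI_le; auto. apply (fun P => P).
intros t Ht eps He. destruct (Hf t Ht eps He) as [d [dp hd]]. exists d; split; auto.
intros w Hw. replace (f w + - c - (f (seg a b t) + - c)) with (f w - f (seg a b t)) by ring. auto.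
Qed.

Lemma deriv_approx F f a b c e : (forall t, (0 <= t <= 1)%R -> dlim F (seg a b t) (f (seg a b t))) ->
  cont_on_seg f a b -> (forall t, (0 <= t <= 1)%R -> (Cmod (f (seg a b t) - c) <= e)%R) ->
  (Cmod (F b - F a - c * (b - a)) <= e * Cmod (b - a))%R.
Proof. intros HF Hf H. rewrite <- (sI_deriv F f); auto. now apply sI_approx. Qed.

(** Goursat on the triangle 0, z, w turns the increment of the segment integral into the integral
    over the short segment from z to w, where f is close to f z. *)
Lemma holo_primitive f : (forall z, (Cmod z < 1)%R -> exists l, dlim f z l) ->
  forall z, (Cmod z < 1)%R -> dlim (sI f 0) z (f z).
Proof.
intros Hf z Hz e He.
assert (Cf : forall w, (Cmod w < 1)%R -> ccont f w).
  intros w Hw. destruct (Hf w Hw) as [l hl]. exact (dlim_ccont _ _ _ hl).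
destruct (Cf z Hz e He) as [d [dp hd]].
set (R0 := ((1 + Cmod z) / 2)%R).
exists (Rmin d (R0 - Cmod z)). split. apply Rmin_case; unfold R0; lra.
intros w Hw. assert (w1 := Rlt_le_trans _ _ _ Hw (Rmin_l _ _)).
assert (w2 := Rlt_le_trans _ _ _ Hw (Rmin_r _ _)).
assert (wR : (Cmod w <= R0)%R) by (generalize (Cmod_sub_ge w z); lra).
assert (zR : (Cmod z <= R0)%R) by (unfold R0; lra).
assert (R1 : (R0 < 1)%R) by (unfold R0; lra).
assert (oR : (Cmod 0 <= R0)%R) by (rewrite Cmod_0; generalize (Cmod_ge_0 z); lra).
assert (cs : forall u v, (Cmod u <= R0)%R -> (Cmod v <= R0)%R -> cont_on_seg f u v).
  intros u v Hu Hv t Ht. apply Cf. apply Rle_lt_trans with R0; auto. now apply seg_norm.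
assert (G : tri f 0 z w = 0).
  apply (goursat_triangle f R0); auto. intros u Hu. apply Hf. lra.
unfold tri in G. rewrite (sI_rev f 0 w) in G by auto.
replace (sI f 0 w - sI f 0 z) with (sI f z w).
2:{ replace (sI f z w) with ((sI f 0 z + sI f z w + - sI f 0 w) + (sI f 0 w - sI f 0 z)) by ring. rewrite G. ring. }
apply sI_approx; auto. intros t Ht. left. apply hd.
apply Rle_lt_trans with (Cmod (w - z)); auto. apply seg_near; auto.
replace (z - z) with (RtoC 0) by ring. rewrite Cmod_0. apply Cmod_ge_0. lra.
Qed.

(** * Differentiation under the integral sign *)

Section Param.
Variables (F f : C -> C) (A B k : R -> C) (z0 : C) (R0 : R).
Hypothesis HF : forall z, (Cmod z < 1)%R -> dlim F z (f z).
Hypothesis Hf : forall z, (Cmod z < 1)%R -> ccont f z.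
Hypothesis HA : cpath A.
Hypothesis HB : cpath B.
Hypothesis Hk : cpath k.
Hypothesis bB : forall t, (0 <= t <= 1)%R -> (Cmod (B t) <= 1)%R.
Hypothesis bk : forall t, (0 <= t <= 1)%R -> (Cmod (k t) <= 1)%R.
Hypothesis R1 : (R0 < 1)%R.
Hypothesis inR : forall t, (0 <= t <= 1)%R -> (Cmod (A t + z0 * B t) <= R0)%R.

Let R0pos : (0 <= R0)%R.
Proof. apply Rle_trans with (Cmod (A 0%R + z0 * B 0%R)). apply Cmod_ge_0. apply inR; lra. Qed.

Let near z t : (0 <= t <= 1)%R -> (Cmod (z - z0) < (1 - R0) / 2)%R ->
  (Cmod (A t + z * B t) < 1)%R.
Proof.
intros Ht Hz. replace (A t + z * B t) with ((A t + z0 * B t) + (z - z0) * B t) by ring.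
eapply Rle_lt_trans; [apply Cmod_triangle|]. rewrite Cmod_mult.
specialize (inR t Ht). specialize (bB t Ht). generalize (Cmod_ge_0 (z - z0)) (Cmod_ge_0 (B t)); nra.
Qed.

Let path (h : C -> C) z : (forall w, (Cmod w < 1)%R -> ccont h w) -> (Cmod (z - z0) < (1 - R0) / 2)%R ->
  cpath (fun t => h (A t + z * B t)).
Proof.
intros Hh Hz t Ht. apply ccont_ccurve. apply Hh, near; auto.
apply ccurve_plus; [auto|apply ccurve_mult; [apply ccurve_const|auto]].
Qed.

Let z0near : (Cmod (z0 - z0) < (1 - R0) / 2)%R.
Proof. replace (z0 - z0) with (RtoC 0) by ring. rewrite Cmod_0. lra. Qed.

Let unif h e : (forall w, (Cmod w < 1)%R -> ccont h w) -> (0 < e)%R ->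
  exists d, (0 < d)%R /\ forall w w', (Cmod w <= R0)%R -> (Cmod (w' - w) < d)%R ->
    (Cmod (h w' - h w) < e)%R.
Proof.
intros Hh He. apply unif_cont; auto. intros z Hz. apply Hh. lra.
Qed.

Lemma ccont_param : ccont (fun z => CI (fun t => f (A t + z * B t) * k t)) z0.
Proof.
intros e He. destruct (unif f (e/2)%R Hf) as [d [dp hd]]; [lra|].
exists (Rmin d ((1 - R0) / 2)). split. apply Rmin_case; lra.
intros w Hw. assert (w1 := Rlt_le_trans _ _ _ Hw (Rmin_l _ _)).
assert (w2 := Rlt_le_trans _ _ _ Hw (Rmin_r _ _)).
assert (P : forall z, (Cmod (z - z0) < (1 - R0) / 2)%R -> cpath (fun t => f (A t + z * B t) * k t)).
  intros z Hz t Ht. apply ccurve_mult; auto. apply (path f); auto.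
rewrite <- CI_minus; auto.
apply Rle_lt_trans with (e/2)%R; [|lra]. apply CI_le.
  intros t Ht. apply ccurve_minus; [apply P|apply P]; auto.
intros t Ht. replace (f (A t + w * B t) * k t - f (A t + z0 * B t) * k t) with
 ((f (A t + w * B t) - f (A t + z0 * B t)) * k t) by ring.
rewrite Cmod_mult.
assert (K : (Cmod (f (A t + w * B t) - f (A t + z0 * B t)) < e / 2)%R).
  apply hd; auto. replace (A t + w * B t - (A t + z0 * B t)) with ((w - z0) * B t) by ring.
  rewrite Cmod_mult. specialize (bB t Ht). generalize (Cmod_ge_0 (w - z0)) (Cmod_ge_0 (B t)); nra.
specialize (bk t Ht). generalize (Cmod_ge_0 (k t)) (Cmod_ge_0 (f (A t + w * B t) - f (A t + z0 * B t))); nra.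
Qed.

(** The derivative [f] of [F] is assumed continuous. This is why the lemma is first applied to a
    primitive of a holomorphic function, whose own derivative is not yet known to be continuous. *)
Lemma dlim_param : dlim (fun z => CI (fun t => F (A t + z * B t) * k t)) z0
  (CI (fun t => f (A t + z0 * B t) * B t * k t)).
Proof.
intros e He. destruct (unif f e Hf He) as [d [dp hd]].
assert (CF : forall w, (Cmod w < 1)%R -> ccont F w) by (intros w Hw; exact (dlim_ccont _ _ _ (HF w Hw))).
exists (Rmin d ((1 - R0) / 2)). split. apply Rmin_case; lra.
intros w Hw. assert (w1 := Rlt_le_trans _ _ _ Hw (Rmin_l _ _)).
assert (w2 := Rlt_le_trans _ _ _ Hw (Rmin_r _ _)).
assert (P : forall z, (Cmod (z - z0) < (1 - R0) / 2)%R -> cpath (fun t => F (A t + z * B t) * k t)).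
  intros z Hz t Ht. apply ccurve_mult; auto. apply (path F); auto.
assert (Q : cpath (fun t => f (A t + z0 * B t) * B t * k t)).
  intros t Ht. repeat apply ccurve_mult; auto. apply (path f); auto.
assert (Q' : cpath (fun t => (w - z0) * (f (A t + z0 * B t) * B t * k t))).
  intros t Ht. apply ccurve_mult; auto. apply ccurve_const.
assert (PP : cpath (fun t => F (A t + w * B t) * k t - F (A t + z0 * B t) * k t)).
  intros t Ht. apply ccurve_minus; [apply P|apply P]; auto.
replace (CI (fun t => f (A t + z0 * B t) * B t * k t) * (w - z0)) with
  (CI (fun t => (w - z0) * (f (A t + z0 * B t) * B t * k t))) by (rewrite CI_scal; auto; ring).
rewrite <- (CI_minus (fun t => F (A t + w * B t) * k t)); auto.
rewrite <- CI_minus; auto.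
apply CI_le. intros t Ht. apply ccurve_minus; auto.
intros t Ht.
set (u := A t + w * B t). set (v := A t + z0 * B t).
assert (uv : u - v = (w - z0) * B t) by (unfold u, v; ring).
replace (F u * k t - F v * k t - (w - z0) * (f v * B t * k t)) with
 ((F u - F v - f v * (u - v)) * k t) by (rewrite uv; ring).
assert (Huv : (Cmod (u - v) <= Cmod (w - z0))%R).
  rewrite uv, Cmod_mult. specialize (bB t Ht). generalize (Cmod_ge_0 (w - z0)) (Cmod_ge_0 (B t)); nra.
assert (Hv := inR t Ht). fold v in Hv.
assert (Hu := near w t Ht w2). fold u in Hu.
assert (sg : forall s, (0 <= s <= 1)%R -> (Cmod (seg v u s) < 1)%R) by (intros s Hs; apply seg_norm_lt; auto; lra).
assert (K : (Cmod (F u - F v - f v * (u - v)) <= e * Cmod (u - v))%R).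
  apply (deriv_approx F f).
  - intros s Hs. apply HF; auto.
  - intros s Hs. apply Hf; auto.
  - intros s Hs. left. apply hd; auto. apply Rle_lt_trans with (Cmod (u - v)); [|lra].
    apply seg_near; auto. replace (v - v) with (RtoC 0) by ring. rewrite Cmod_0. apply Cmod_ge_0. lra.
rewrite Cmod_mult. specialize (bk t Ht).
apply Rle_trans with (Cmod (F u - F v - f v * (u - v)) * 1)%R.
apply Rmult_le_compat_l; auto using Cmod_ge_0.
rewrite Rmult_1_r. eapply Rle_trans; [exact K|]. apply Rmult_le_compat_l; lra.
Qed.
End Param.

Lemma is_derive_R_bound (u : R -> R) t l : is_derive u t l -> forall e, (0 < e)%R ->
  exists d, (0 < d)%R /\ forall s, (Rabs (s - t) < d)%R -> (Rabs (u s - u t - l * (s - t)) <= e * Rabs (s - t))%R.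
Proof.
intros [_ H] e He.
destruct (H t (fun P HP => HP) (mkposreal e He)) as [d hd].
exists d. split; [apply cond_pos|]. intros s Hs. specialize (hd s Hs).
unfold norm, minus, plus, opp, scal in hd; simpl in hd. unfold abs, mult in hd; simpl in hd.
replace (u s - u t - l * (s - t))%R with (u s + - u t + - ((s + - t) * l))%R by ring. exact hd.
Qed.

Lemma dcurve_pair (u v : R -> R) t l m : is_derive u t l -> is_derive v t m ->
  dcurve (fun s => (u s, v s)) t (l, m).
Proof.
intros H1 H2 e He.
destruct (is_derive_R_bound u t l H1 (e/2)%R) as [d1 [p1 h1]]; [lra|].
destruct (is_derive_R_bound v t m H2 (e/2)%R) as [d2 [p2 h2]]; [lra|].
exists (Rmin d1 d2). split; [apply Rmin_case; lra|]. intros w Hw.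
assert (w1 := Rlt_le_trans _ _ _ Hw (Rmin_l _ _)).
assert (w2 := Rlt_le_trans _ _ _ Hw (Rmin_r _ _)).
specialize (h1 w w1). specialize (h2 w w2).
set (X := (u w - u t - l * (w - t))%R) in *. set (Y := (v w - v t - m * (w - t))%R) in *.
replace ((u w, v w) - (u t, v t) - (l, m) * RtoC (w - t)) with (RtoC X + Ci * RtoC Y).
2:{ unfold X, Y. apply injective_projections; simpl; ring. }
eapply Rle_trans; [apply Cmod_triangle|]. rewrite Cmod_mult, Cmod_Ci, !Cmod_R. lra.
Qed.

(** * The circle and Cauchy's formula for the derivative *)

Definition circ (t : R) : C := (cos (2 * PI * t), sin (2 * PI * t)).
(** The conjugate of [circ t], hence its inverse; the prime does not denote a derivative. *)
Definition circ' (t : R) : C := (cos (2 * PI * t), - sin (2 * PI * t))%R.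
Definition tau : C := RtoC (2 * PI) * Ci.

Lemma tau_neq0 : tau <> 0.
Proof.
unfold tau. apply Cmult_neq_0. intros h. apply RtoC_inj in h. generalize PI_RGT_0; lra.
intros h. apply (f_equal snd) in h. simpl in h. lra.
Qed.

Lemma dcurve_circ t : dcurve circ t (tau * circ t).
Proof.
replace (tau * circ t) with ((- (2 * PI) * sin (2 * PI * t))%R, (2 * PI * cos (2 * PI * t))%R).
apply dcurve_pair; auto_derive; auto; ring.
unfold tau, circ. apply injective_projections; simpl; ring.
Qed.

Lemma dcurve_circ' t : dcurve circ' t (- tau * circ' t).
Proof.
replace (- tau * circ' t) with ((- (2 * PI) * sin (2 * PI * t))%R, (- (2 * PI) * cos (2 * PI * t))%R).
apply dcurve_pair; auto_derive; auto; ring.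
unfold tau, circ'. apply injective_projections; simpl; ring.
Qed.

Lemma circ_norm t : Cmod (circ t) = 1%R.
Proof.
unfold Cmod, circ; simpl fst; simpl snd. rewrite <- sqrt_1. f_equal.
generalize (sin2_cos2 (2 * PI * t)); unfold Rsqr; intros; lra.
Qed.

Lemma circ'_norm t : Cmod (circ' t) = 1%R.
Proof.
unfold Cmod, circ'; simpl fst; simpl snd. rewrite <- sqrt_1. f_equal.
generalize (sin2_cos2 (2 * PI * t)); unfold Rsqr; intros; lra.
Qed.

Lemma circ_circ' t : circ t * circ' t = 1.
Proof.
unfold circ, circ'. apply injective_projections; simpl; [|ring].
generalize (sin2_cos2 (2 * PI * t)); unfold Rsqr; intros; lra.
Qed.

Lemma circ_period : circ 1 = circ 0 /\ circ' 1 = circ' 0.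
Proof.
unfold circ, circ'. rewrite Rmult_1_r, Rmult_0_r, cos_2PI, sin_2PI, cos_0, sin_0. auto.
Qed.

Lemma cpath_circ : cpath circ.
Proof. intros t _. exact (dcurve_ccurve _ _ _ (dcurve_circ t)). Qed.

Lemma cpath_circ' : cpath circ'.
Proof. intros t _. exact (dcurve_ccurve _ _ _ (dcurve_circ' t)). Qed.

Lemma cpath_mult f g : cpath f -> cpath g -> cpath (fun t => f t * g t).
Proof. intros H1 H2 t Ht. apply ccurve_mult; auto. Qed.

Lemma cpath_plus f g : cpath f -> cpath g -> cpath (fun t => f t + g t).
Proof. intros H1 H2 t Ht. apply ccurve_plus; auto. Qed.

Lemma cpath_const c : cpath (fun _ => c).
Proof. intros t _. apply ccurve_const. Qed.

Lemma CI_circ' : CI circ' = 0.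
Proof.
assert (H : CI (fun t => - tau * circ' t) = circ' 1 - circ' 0).
  apply CI_deriv. intros t _. apply dcurve_circ'. apply cpath_mult. apply cpath_const. apply cpath_circ'.
rewrite CI_scal in H by apply cpath_circ'. destruct circ_period as [_ E]. rewrite E in H.
replace (CI circ') with (- (/ tau) * (- tau * CI circ')) by (field; apply tau_neq0).
rewrite H. ring.
Qed.

Section Circle.
Variables (F f : C -> C) (a : C) (r : R).
Hypothesis HF : forall z, (Cmod z < 1)%R -> dlim F z (f z).
Hypothesis Hf : forall z, (Cmod z < 1)%R -> ccont f z.
Hypothesis rp : (0 < r)%R.
Hypothesis ar : (Cmod a + r < 1)%R.

Let w t := RtoC r * circ t.
Let psi z := CI (fun t => F (a + z * w t) * circ' t).
Let psi' z := CI (fun t => f (a + z * w t) * w t * circ' t).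

Let w_norm t : Cmod (w t) = r.
Proof. unfold w. rewrite Cmod_mult, circ_norm, Cmod_R, Rabs_right; lra. Qed.

Let cw : cpath w.
Proof. apply cpath_mult. apply cpath_const. apply cpath_circ. Qed.

Let inr (z : C) t : (Cmod z <= 1)%R -> (Cmod (a + z * w t) <= Cmod a + r)%R.
Proof.
intros Hz. eapply Rle_trans; [apply Cmod_triangle|]. rewrite Cmod_mult, w_norm. nra.
Qed.

Let dpsi z : (Cmod z <= 1)%R -> dlim psi z (psi' z).
Proof.
intros Hz. apply (dlim_param F f (fun _ => a) w circ' z (Cmod a + r)); auto.
- apply cpath_const.
- apply cpath_circ'.
- intros t _. rewrite w_norm. generalize (Cmod_ge_0 a); lra.
- intros t _. rewrite circ'_norm; lra.
Qed.

(* Integration of (F(a+sw) conj e)' over the circle. *)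
Let psi_eq (s : R) : (0 <= s <= 1)%R -> RtoC s * psi' s = psi s.
Proof.
intros Hs.
assert (ns : (Cmod s <= 1)%R) by (rewrite Cmod_R, Rabs_right; lra).
assert (ins : forall t, (Cmod (a + s * w t) < 1)%R) by (intros t; generalize (inr s t ns); lra).
assert (Cp : forall t, dcurve (fun t => a + s * w t) t (s * (RtoC r * (tau * circ t)))).
  intros t.
  assert (D2 : dcurve (fun t => a + s * r * circ t) t (s * r * (tau * circ t))).
    apply (dlim_dcurve (fun z => a + s * r * z)); [|apply dcurve_circ].
    replace (s * r) with (0 + s * r * 1) by ring.
    apply (dlim_ext_loc (fun z => a + s * r * z) _ _ _ 1); [lra|intros; ring|].
    apply dlim_plus. apply dlim_const. apply dlim_scal. apply dlim_id.
  replace (s * (r * (tau * circ t))) with (s * r * (tau * circ t)) by ring.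
  intros e He. destruct (D2 e He) as [d [dp hd]].
  exists d; split; auto. intros u Hu. specialize (hd u Hu). unfold w.
  replace (a + s * (r * circ u) - (a + s * (r * circ t))) with (a + s * r * circ u - (a + s * r * circ t)) by ring.
  exact hd.
assert (PF : cpath (fun t => F (a + s * w t))).
  intros t _. apply ccont_ccurve. exact (dlim_ccont _ _ _ (HF _ (ins t))). exact (dcurve_ccurve _ _ _ (Cp t)).
assert (Pf : cpath (fun t => f (a + s * w t))).
  intros t _. apply ccont_ccurve. auto. exact (dcurve_ccurve _ _ _ (Cp t)).
assert (I := CI_deriv (fun t => F (a + s * w t) * circ' t)
  (fun t => (f (a + s * w t) * (s * (RtoC r * (tau * circ t)))) * circ' t + F (a + s * w t) * (- tau * circ' t))).
assert (I' : CI (fun t => f (a + s * w t) * (s * (r * (tau * circ t))) * circ' t +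
        F (a + s * w t) * (- tau * circ' t)) = 0).
  rewrite I.
  - unfold w. destruct circ_period as [-> ->]. ring.
  - intros t _. apply (dcurve_mult (fun t => F (a + s * w t)) circ'); [|apply dcurve_circ'].
    apply (dlim_dcurve F (fun t => a + s * w t)); auto.
  - apply cpath_plus; repeat apply cpath_mult; auto using cpath_const, cpath_circ, cpath_circ'.
assert (P1 : cpath (fun t => f (a + s * w t) * w t * circ' t)).
  repeat apply cpath_mult; auto using cpath_const, cpath_circ, cpath_circ'.
assert (P2 : cpath (fun t => F (a + s * w t) * circ' t)) by (apply cpath_mult; auto; apply cpath_circ').
rewrite (CI_ext _ (fun t => (s * tau) * (f (a + s * w t) * w t * circ' t) + (- tau) * (F (a + s * w t) * circ' t))) in I'.
2:{ intros t _. unfold w. ring. }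
rewrite CI_plus, !CI_scal in I'; auto.
2:{ apply cpath_mult; auto. apply cpath_const. }
2:{ apply cpath_mult; auto. apply cpath_const. }
fold (psi' s) in I'. fold (psi s) in I'.
replace (s * psi' s) with (/ tau * (s * tau * psi' s + - tau * psi s) + psi s) by (field; apply tau_neq0).
rewrite I'. ring.
Qed.

(** The identity [s * psi' s = psi s] says that the derivative of psi(s)/s vanishes. *)
Let quot_const (s : R) : (0 < s <= 1)%R -> psi s * / s = psi 1 * / 1.
Proof.
intros Hs.
set (g := fun t : R => RtoC s + RtoC t * RtoC (1 - s)).
assert (gE : forall t, g t = RtoC (s + t * (1 - s))%R) by (intros t; unfold g; rewrite RtoC_plus, RtoC_mult; auto).
assert (I : CI (fun _ => 0) = psi (g 1%R) * / (g 1%R) - psi (g 0%R) * / (g 0%R)).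
  apply (CI_deriv (fun t => psi (g t) * / g t)); [|apply cpath_const].
  intros t Ht. assert (gt : (0 < s + t * (1 - s) <= 1)%R) by nra.
  assert (gz : g t <> 0) by (rewrite gE; intros h; apply RtoC_inj in h; lra).
  replace (RtoC 0) with ((psi' (g t) * / g t + psi (g t) * (Copp 1 / (g t * g t))) * RtoC (1 - s)).
  apply (dlim_dcurve (fun z => psi z * / z)); [|apply dcurve_line].
  apply dlim_mult. apply dpsi. rewrite gE, Cmod_R, Rabs_right; lra.
  apply (dlim_inv (fun z => z)); auto. apply dlim_id.
  rewrite gE in *. rewrite <- psi_eq by lra. field. auto.
rewrite CI_const in I.
assert (g1 : g 1%R = 1) by (rewrite gE; f_equal; ring).
assert (g0 : g 0%R = s) by (rewrite gE; f_equal; ring).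
rewrite g1, g0 in I.
replace (psi s * / s) with (psi 1 * / 1 - (psi 1 * / 1 - psi s * / s)) by ring. rewrite <- I. ring.
Qed.

(** The quotient psi(s)/s is constant on (0,1], so psi(1) equals its limit at 0, which is psi'(0).
    There the integrand is constant, because the circle and its conjugate cancel. *)
Lemma circle_formula : CI (fun t => F (a + RtoC r * circ t) * circ' t) = RtoC r * f a.
Proof.
assert (P0 : psi 0 = 0).
  unfold psi. rewrite (CI_ext _ (fun t => F a * circ' t)).
  rewrite CI_scal by apply cpath_circ'. rewrite CI_circ'. ring.
  intros t _. do 2 f_equal. ring.
assert (P0' : psi' 0 = r * f a).
  unfold psi'. rewrite (CI_ext _ (fun t => r * f a)). apply CI_const.
  intros t _. replace (a + 0 * w t) with a by ring. unfold w.
  replace (f a * (r * circ t) * circ' t) with (r * f a * (circ t * circ' t)) by ring. rewrite circ_circ'. ring.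
assert (P1 : psi 1 = CI (fun t => F (a + r * circ t) * circ' t)).
  apply CI_ext. intros t _. unfold w. do 2 f_equal. ring.
rewrite <- P1, <- P0'.
cut (psi 1 - psi' 0 = 0). intros E. replace (psi 1) with ((psi 1 - psi' 0) + psi' 0) by ring. rewrite E; ring.
apply Cmod_small_eq0. intros e He.
assert (D := dpsi 0). destruct (D ltac:(rewrite Cmod_0; lra) e He) as [d [dp hd]].
set (s := Rmin 1 (d / 2)).
assert (Hs : (0 < s <= 1)%R) by (unfold s; split; [apply Rmin_case; lra|apply Rmin_l]).
assert (Hs2 : (s <= d / 2)%R) by apply Rmin_r.
assert (ns : Cmod (s - 0) = s) by (replace (s - 0) with (RtoC s) by ring; rewrite Cmod_R, Rabs_right; lra).
specialize (hd s ltac:(rewrite ns; lra)). rewrite P0, ns in hd.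
assert (sz : RtoC s <> 0) by (intros h; apply RtoC_inj in h; lra).
assert (Q := quot_const s Hs).
assert (E1 : psi s = s * psi 1).
  replace (psi s) with (s * (psi s * / s)) by (field; auto). rewrite Q. field.
rewrite E1 in hd. replace (s * psi 1 - 0 - psi' 0 * (s - 0)) with (s * (psi 1 - psi' 0)) in hd by ring.
rewrite Cmod_mult, Cmod_R, Rabs_right in hd by lra.
apply Rmult_le_reg_l with s; lra.
Qed.
End Circle.

(** * The derivative of a holomorphic function is holomorphic; Cauchy estimates *)

Section Regularity.
Variables f f' : C -> C.
Hypothesis Hf : forall z, (Cmod z < 1)%R -> dlim f z (f' z).

Let Cf z : (Cmod z < 1)%R -> ccont f z.
Proof. intros h. exact (dlim_ccont _ _ _ (Hf z h)). Qed.

Let F := sI f 0.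
Let HF z : (Cmod z < 1)%R -> dlim F z (f z).
Proof. apply holo_primitive. intros w Hw. exists (f' w). auto. Qed.

(** Applying [circle_formula] to [f] would require [f'] to be continuous. It is applied to the
    primitive [F] instead, whose derivative [f] is continuous, and the resulting identity is
    differentiated in the centre. *)
Let formula a r : (0 < r)%R -> (Cmod a + r < 1)%R ->
  f' a = RtoC (/ r) * CI (fun t => f (RtoC r * circ t + a * 1) * circ' t).
Proof.
intros rp ar.
assert (cp : cpath (fun t => RtoC r * circ t)) by (apply cpath_mult; [apply cpath_const|apply cpath_circ]).
assert (rn : forall t, Cmod (RtoC r * circ t) = r) by (intros t; rewrite Cmod_mult, circ_norm, Cmod_R, Rabs_right; lra).
apply (dlim_unique f a). apply Hf; lra.
assert (D : dlim (fun z => CI (fun t => F (RtoC r * circ t + z * 1) * circ' t)) a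
   (CI (fun t => f (RtoC r * circ t + a * 1) * 1 * circ' t))).
  apply (dlim_param F f (fun t => RtoC r * circ t) (fun _ => 1) circ' a (Cmod a + r)); auto.
  apply cpath_const. apply cpath_circ'. intros; rewrite Cmod_1; lra. intros; rewrite circ'_norm; lra.
  intros t _. eapply Rle_trans; [apply Cmod_triangle|]. rewrite rn. rewrite Cmult_1_r. lra.
apply (dlim_scal (RtoC (/ r))) in D.
rewrite (CI_ext _ (fun t => f (RtoC r * circ t + a * 1) * 1 * circ' t)) by (intros; ring).
eapply (dlim_ext_loc _ _ _ _ (1 - (Cmod a + r))); [lra| |exact D].
intros w Hw. simpl.
assert (Hw' : (Cmod w + r < 1)%R) by (generalize (Cmod_sub_ge w a); lra).
rewrite (CI_ext _ (fun t => F (w + RtoC r * circ t) * circ' t)).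
rewrite (circle_formula F f w r); auto. rewrite RtoC_inv by lra. field. intros h; apply RtoC_inj in h; lra.
intros t _. do 2 f_equal. ring.
Qed.

Let Cf' z : (Cmod z < 1)%R -> ccont f' z.
Proof.
intros Hz. set (r := ((1 - Cmod z) / 2)%R). assert (rp : (0 < r)%R) by (unfold r; lra).
assert (zr : (Cmod z + r < 1)%R) by (unfold r; lra).
assert (cp : cpath (fun t => RtoC r * circ t)) by (apply cpath_mult; [apply cpath_const|apply cpath_circ]).
assert (rn : forall t, Cmod (RtoC r * circ t) = r) by (intros t; rewrite Cmod_mult, circ_norm, Cmod_R, Rabs_right; lra).
assert (K : ccont (fun z => CI (fun t => f (RtoC r * circ t + z * 1) * circ' t)) z).
  apply (ccont_param f (fun t => RtoC r * circ t) (fun _ => 1) circ' z (Cmod z + r)); auto.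
  apply cpath_const. apply cpath_circ'. intros; rewrite Cmod_1; lra. intros; rewrite circ'_norm; lra.
  intros t _. eapply Rle_trans; [apply Cmod_triangle|]. rewrite rn. rewrite Cmult_1_r. lra.
intros e He. destruct (K (e * r)%R) as [d [dp hd]]. apply Rmult_lt_0_compat; lra.
exists (Rmin d (1 - (Cmod z + r))). split. apply Rmin_case; lra.
intros w Hw. assert (w1 := Rlt_le_trans _ _ _ Hw (Rmin_l _ _)).
assert (w2 := Rlt_le_trans _ _ _ Hw (Rmin_r _ _)).
rewrite (formula w r), (formula z r); auto. 2:{ generalize (Cmod_sub_ge w z); lra. }
specialize (hd w w1). simpl in hd.
match goal with |- (Cmod (?c * ?x - ?c * ?y) < _)%R => replace (c * x - c * y) with (c * (x - y)) by ring end.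
rewrite Cmod_mult, Cmod_R, Rabs_right. 2:{ apply Rle_ge, Rlt_le, Rinv_0_lt_compat; auto. }
apply (Rmult_lt_reg_l r); auto. rewrite <- Rmult_assoc, Rinv_r by lra. lra.
Qed.

(** The integral formula gives continuity of [f'] first; that allows differentiating the same
    formula once more. *)
Lemma holo_deriv z : (Cmod z < 1)%R -> exists l, dlim f' z l.
Proof.
intros Hz. set (r := ((1 - Cmod z) / 2)%R). assert (rp : (0 < r)%R) by (unfold r; lra).
assert (zr : (Cmod z + r < 1)%R) by (unfold r; lra).
assert (cp : cpath (fun t => RtoC r * circ t)) by (apply cpath_mult; [apply cpath_const|apply cpath_circ]).
assert (rn : forall t, Cmod (RtoC r * circ t) = r) by (intros t; rewrite Cmod_mult, circ_norm, Cmod_R, Rabs_right; lra).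
assert (D : dlim (fun z => CI (fun t => f (RtoC r * circ t + z * 1) * circ' t)) z
   (CI (fun t => f' (RtoC r * circ t + z * 1) * 1 * circ' t))).
  apply (dlim_param f f' (fun t => RtoC r * circ t) (fun _ => 1) circ' z (Cmod z + r)); auto.
  apply cpath_const. apply cpath_circ'. intros; rewrite Cmod_1; lra. intros; rewrite circ'_norm; lra.
  intros t _. eapply Rle_trans; [apply Cmod_triangle|]. rewrite rn. rewrite Cmult_1_r. lra.
apply (dlim_scal (RtoC (/ r))) in D.
eexists. eapply (dlim_ext_loc _ _ _ _ (1 - (Cmod z + r))); [lra| |exact D].
intros w Hw. simpl. symmetry. apply formula; auto. generalize (Cmod_sub_ge w z); lra.
Qed.

Lemma cauchy_estimate a r M : (0 < r)%R -> (Cmod a + r < 1)%R ->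
  (forall w, (Cmod (w - a) <= r)%R -> (Cmod (f w) <= M)%R) -> (Cmod (f' a) <= M / r)%R.
Proof.
intros rp ar HM.
assert (rn : forall t, Cmod (RtoC r * circ t) = r) by (intros t; rewrite Cmod_mult, circ_norm, Cmod_R, Rabs_right; lra).
rewrite (formula a r); auto. rewrite Cmod_mult, Cmod_R, Rabs_right.
2:{ apply Rle_ge, Rlt_le, Rinv_0_lt_compat; auto. }
unfold Rdiv. rewrite Rmult_comm. apply Rmult_le_compat_r. apply Rlt_le, Rinv_0_lt_compat; auto.
apply CI_le.
- intros t Ht. apply ccurve_mult; [|apply cpath_circ'; auto].
  apply ccont_ccurve. apply Cf. eapply Rle_lt_trans; [apply Cmod_triangle|]. rewrite rn, Cmult_1_r. lra.
  apply ccurve_plus. apply ccurve_mult. apply ccurve_const. apply cpath_circ; auto. apply ccurve_const.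
- intros t Ht. rewrite Cmod_mult, circ'_norm, Rmult_1_r. apply HM.
  replace (RtoC r * circ t + a * 1 - a) with (RtoC r * circ t) by ring. rewrite rn; lra.
Qed.

Lemma mean_value_le a b M : (Cmod a < 1)%R -> (Cmod b < 1)%R ->
  (forall t, (0 <= t <= 1)%R -> (Cmod (f' (seg a b t)) <= M)%R) -> (Cmod (f b - f a) <= M * Cmod (b - a))%R.
Proof.
intros Ha Hb HM.
assert (sg : forall s, (0 <= s <= 1)%R -> (Cmod (seg a b s) < 1)%R) by (intros s Hs; apply seg_norm_lt; auto).
replace (f b - f a) with (f b - f a - 0 * (b - a)) by ring.
apply (deriv_approx f f').
- intros t Ht. apply Hf; auto.
- intros t Ht. apply Cf'; auto.
- intros t Ht. replace (f' (seg a b t) - 0) with (f' (seg a b t)) by ring. auto.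
Qed.
End Regularity.

(** * Calculus of holomorphic functions on the disc and of the integration operator *)

Definition hol (f : C -> C) : Prop := forall z, (Cmod z < 1)%R -> exists l, dlim f z l.

Lemma Cderiv_eq f z l : dlim f z l -> Cderiv f z = l.
Proof.
intros H. unfold Cderiv.
destruct (excluded_middle_informative _) as [E|E].
- destruct (ClassicalEpsilon.constructive_indefinite_description _ E) as [m hm]. simpl.
  apply (dlim_unique f z); auto. now apply dlim_is_derive.
- exfalso. apply E. exists l. now apply dlim_is_derive.
Qed.

Lemma hol_dlim f z : hol f -> (Cmod z < 1)%R -> dlim f z (Cderiv f z).
Proof. intros H Hz. destruct (H z Hz) as [l hl]. now rewrite (Cderiv_eq f z l hl). Qed.

Lemma hol_ccont f z : hol f -> (Cmod z < 1)%R -> ccont f z.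
Proof. intros H Hz. exact (dlim_ccont _ _ _ (hol_dlim f z H Hz)). Qed.

Lemma hol_Cderiv f : hol f -> hol (Cderiv f).
Proof. intros H z Hz. apply (holo_deriv f (Cderiv f)); auto. intros w Hw. now apply hol_dlim. Qed.

Lemma hol_Cderiv_n k f : hol f -> hol (Cderiv_n k f).
Proof. intros H. induction k as [|k IH]; simpl; auto. now apply hol_Cderiv. Qed.

Lemma dlim_ext_disc f g z l : (forall w, (Cmod w < 1)%R -> f w = g w) -> (Cmod z < 1)%R ->
  dlim f z l -> dlim g z l.
Proof.
intros E Hz. apply (dlim_ext_loc f g z l (1 - Cmod z)); [lra|].
intros w Hw. apply E. generalize (Cmod_sub_ge w z); lra.
Qed.

Lemma Cderiv_ext f g z : (forall w, (Cmod w < 1)%R -> f w = g w) -> hol f -> (Cmod z < 1)%R ->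
  Cderiv f z = Cderiv g z.
Proof. intros E H Hz. symmetry. apply Cderiv_eq. apply (dlim_ext_disc f); auto. now apply hol_dlim. Qed.

Lemma Cderiv_n_ext k f g : (forall w, (Cmod w < 1)%R -> f w = g w) -> hol f -> forall z, (Cmod z < 1)%R ->
  Cderiv_n k f z = Cderiv_n k g z.
Proof.
intros E H. induction k as [|k IH]; simpl; auto.
intros z Hz. apply Cderiv_ext; auto. now apply hol_Cderiv_n.
Qed.

Lemma hol_const c : hol (fun _ => c).
Proof. intros z _. eexists. apply dlim_const. Qed.

Lemma hol_id : hol (fun z => z).
Proof. intros z _. eexists. apply dlim_id. Qed.

Lemma hol_plus f g : hol f -> hol g -> hol (fun z => f z + g z).
Proof. intros H1 H2 z Hz. eexists. apply dlim_plus; apply hol_dlim; auto. Qed.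

Lemma hol_minus f g : hol f -> hol g -> hol (fun z => f z - g z).
Proof. intros H1 H2 z Hz. eexists. apply dlim_minus; apply hol_dlim; auto. Qed.

Lemma hol_mult f g : hol f -> hol g -> hol (fun z => f z * g z).
Proof. intros H1 H2 z Hz. eexists. apply dlim_mult; apply hol_dlim; auto. Qed.

Lemma hol_pow f n : hol f -> hol (fun z => f z ^ n).
Proof. intros H z Hz. eexists. apply dlim_pow; apply hol_dlim; auto. Qed.

Lemma hol_inv f : hol f -> (forall z, (Cmod z < 1)%R -> f z <> 0) -> hol (fun z => / f z).
Proof. intros H H0 z Hz. eexists. apply dlim_inv. apply hol_dlim; auto. auto. Qed.

Lemma Cderiv_minus f g z : hol f -> hol g -> (Cmod z < 1)%R ->
  Cderiv (fun z => f z - g z) z = Cderiv f z - Cderiv g z.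
Proof. intros H1 H2 Hz. apply Cderiv_eq. apply dlim_minus; apply hol_dlim; auto. Qed.

Lemma Cderiv_plus f g z : hol f -> hol g -> (Cmod z < 1)%R ->
  Cderiv (fun z => f z + g z) z = Cderiv f z + Cderiv g z.
Proof. intros H1 H2 Hz. apply Cderiv_eq. apply dlim_plus; apply hol_dlim; auto. Qed.

Lemma Cderiv_scal c f z : hol f -> (Cmod z < 1)%R -> Cderiv (fun z => c * f z) z = c * Cderiv f z.
Proof. intros H1 Hz. apply Cderiv_eq. apply dlim_scal; apply hol_dlim; auto. Qed.

Lemma Cderiv_n_minus k f g : hol f -> hol g -> forall z, (Cmod z < 1)%R ->
  Cderiv_n k (fun z => f z - g z) z = Cderiv_n k f z - Cderiv_n k g z.
Proof.
intros H1 H2. induction k as [|k IH]; simpl; auto. intros z Hz.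
rewrite <- Cderiv_minus by auto using hol_Cderiv_n.
apply Cderiv_ext; auto. apply hol_Cderiv_n. now apply hol_minus.
Qed.

Lemma Cderiv_n_plus k f g : hol f -> hol g -> forall z, (Cmod z < 1)%R ->
  Cderiv_n k (fun z => f z + g z) z = Cderiv_n k f z + Cderiv_n k g z.
Proof.
intros H1 H2. induction k as [|k IH]; simpl; auto. intros z Hz.
rewrite <- Cderiv_plus by auto using hol_Cderiv_n.
apply Cderiv_ext; auto. apply hol_Cderiv_n. now apply hol_plus.
Qed.

Lemma Cderiv_n_scal k c f : hol f -> forall z, (Cmod z < 1)%R ->
  Cderiv_n k (fun z => c * f z) z = c * Cderiv_n k f z.
Proof.
intros H1. induction k as [|k IH]; simpl; auto. intros z Hz.
rewrite <- Cderiv_scal by auto using hol_Cderiv_n.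
apply Cderiv_ext; auto. apply hol_Cderiv_n. apply (hol_mult (fun _ => c)); auto using hol_const.
Qed.

Lemma Iop_sI f z : Iop f z = sI f 0 z.
Proof. apply CI_ext. intros t _. unfold seg. f_equal; [f_equal|]; ring. Qed.

Lemma dlim_Iop f z : hol f -> (Cmod z < 1)%R -> dlim (Iop f) z (f z).
Proof.
intros H Hz. apply (dlim_ext_disc (sI f 0)); auto. intros w _. now rewrite Iop_sI.
now apply holo_primitive.
Qed.

Lemma hol_Iop f : hol f -> hol (Iop f).
Proof. intros H z Hz. eexists. now apply dlim_Iop. Qed.

Lemma Cderiv_Iop f z : hol f -> (Cmod z < 1)%R -> Cderiv (Iop f) z = f z.
Proof. intros H Hz. apply Cderiv_eq. now apply dlim_Iop. Qed.

Lemma Iop_0 f : Iop f 0 = 0.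
Proof.
rewrite Iop_sI. unfold sI. rewrite (CI_ext _ (fun _ => 0)). apply CI_const. intros; ring.
Qed.

Lemma ray_disc z t : (Cmod z < 1)%R -> (0 <= t <= 1)%R -> (Cmod (seg 0 z t) < 1)%R.
Proof. intros Hz Ht. apply seg_norm_lt; auto. rewrite Cmod_0; lra. Qed.

Lemma hol_ray f z : hol f -> (Cmod z < 1)%R -> cont_on_seg f 0 z.
Proof. intros H Hz t Ht. apply hol_ccont; auto. now apply ray_disc. Qed.

Lemma Iop_ext f g z : (forall w, (Cmod w < 1)%R -> f w = g w) -> (Cmod z < 1)%R -> Iop f z = Iop g z.
Proof.
intros E Hz. rewrite !Iop_sI. apply CI_ext. intros t Ht. rewrite E; auto. now apply ray_disc.
Qed.

Lemma Iop_minus f g z : hol f -> hol g -> (Cmod z < 1)%R ->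
  Iop (fun z => f z - g z) z = Iop f z - Iop g z.
Proof.
intros Hf Hg Hz. rewrite !Iop_sI. unfold sI. rewrite <- CI_minus.
apply CI_ext. intros; ring. apply cpath_sI, hol_ray; auto. apply cpath_sI, hol_ray; auto.
Qed.

Lemma hol_Iop_n n f : hol f -> hol (Iop_n n f).
Proof. intros H. induction n as [|n IH]; simpl; auto. now apply hol_Iop. Qed.

Lemma Iop_n_ext n f g : (forall w, (Cmod w < 1)%R -> f w = g w) -> forall z, (Cmod z < 1)%R ->
  Iop_n n f z = Iop_n n g z.
Proof. intros E. induction n as [|n IH]; simpl; auto. intros z Hz. apply Iop_ext; auto. Qed.

Lemma Iop_n_minus n f g : hol f -> hol g -> forall z, (Cmod z < 1)%R ->
  Iop_n n (fun z => f z - g z) z = Iop_n n f z - Iop_n n g z.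
Proof.
intros Hf Hg. induction n as [|n IH]; simpl; auto. intros z Hz.
rewrite <- Iop_minus by auto using hol_Iop_n. apply Iop_ext; auto.
Qed.

(** A plain recursion, convenient for induction; [bigop_csum] identifies it with the sum in the
    definition of the operator. *)
Fixpoint csum (n : nat) (F : nat -> C) : C := match n with 0%nat => 0 | S n => csum n F + F n end.

Lemma csum_ext n F G : (forall k, (k < n)%nat -> F k = G k) -> csum n F = csum n G.
Proof. intros H. induction n as [|n IH]; simpl; auto. rewrite IH, H; auto. Qed.

Lemma csum_minus n F G : csum n (fun k => F k - G k) = csum n F - csum n G.
Proof. induction n as [|n IH]; simpl. ring. rewrite IH. ring. Qed.

Lemma csum_eq0 n (F : nat -> C) : (forall k, (k < n)%nat -> F k = 0) -> csum n F = 0.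
Proof. intros H. induction n as [|n IH]; simpl; auto. rewrite IH, H; auto. ring. Qed.

Lemma hol_csum n (F : nat -> C -> C) : (forall k, (k < n)%nat -> hol (F k)) -> hol (fun z => csum n (fun k => F k z)).
Proof.
intros H. induction n as [|n IH]; simpl. apply hol_const. apply hol_plus; auto.
Qed.

Lemma Cderiv_n_csum m n (F : nat -> C -> C) z : (forall k, (k < n)%nat -> hol (F k)) -> (Cmod z < 1)%R ->
  Cderiv_n m (fun z => csum n (fun k => F k z)) z = csum n (fun k => Cderiv_n m (F k) z).
Proof.
intros H Hz. induction n as [|n IH]; simpl.
- clear H. revert z Hz. induction m as [|m IH]; simpl; auto. intros z Hz.
  rewrite <- (Cderiv_ext (fun _ => 0) _ z); auto. apply Cderiv_eq. apply dlim_const.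
  intros w Hw; rewrite IH; auto. apply hol_const.
- rewrite Cderiv_n_plus, IH; auto. apply hol_csum; auto.
Qed.

Definition Lop (n : nat) (g : nat -> C -> C) (f : C -> C) (z : C) : C :=
  csum n (fun k => Cderiv_n k f z * g k z).

Lemma hol_Lop n g f : (forall k, (k < n)%nat -> hol (g k)) -> hol f -> hol (Lop n g f).
Proof.
intros Hg Hf. apply (hol_csum n (fun k z => Cderiv_n k f z * g k z)).
intros k Hk. apply hol_mult; auto. now apply hol_Cderiv_n.
Qed.

Lemma Lop_minus n g f h z : hol f -> hol h -> (Cmod z < 1)%R ->
  Lop n g (fun z => f z - h z) z = Lop n g f z - Lop n g h z.
Proof.
intros Hf Hh Hz. unfold Lop. rewrite <- csum_minus. apply csum_ext. intros k _.
rewrite Cderiv_n_minus; auto. ring.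
Qed.

Lemma hol_cauchy f a r M : hol f -> (0 < r)%R -> (Cmod a + r < 1)%R ->
  (forall w, (Cmod (w - a) <= r)%R -> (Cmod (f w) <= M)%R) -> (Cmod (Cderiv f a) <= M / r)%R.
Proof. intros H. apply (cauchy_estimate f). intros z Hz. now apply hol_dlim. Qed.

Lemma hol_mean_value f a b M : hol f -> (Cmod a < 1)%R -> (Cmod b < 1)%R ->
  (forall t, (0 <= t <= 1)%R -> (Cmod (Cderiv f (seg a b t)) <= M)%R) -> (Cmod (f b - f a) <= M * Cmod (b - a))%R.
Proof. intros H. apply (mean_value_le f). intros z Hz. now apply hol_dlim. Qed.

Lemma hol_bounded f R0 : hol f -> (R0 < 1)%R ->
  exists M, (0 < M)%R /\ forall w, (Cmod w <= R0)%R -> (Cmod (f w) <= M)%R.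
Proof. intros H H1. apply bounded_on_disc. intros z Hz. apply hol_ccont; auto. lra. Qed.

(** Two Cauchy estimates, each giving up a margin [r], bound the second derivative. The constant
    depends on [f] only through [M], so the expansion survives pointwise limits of locally bounded
    families. *)
Lemma hol_taylor2 f z w r M : hol f -> (0 < r)%R -> (Cmod z + 3 * r < 1)%R ->
  (forall u, (Cmod (u - z) <= 3 * r)%R -> (Cmod (f u) <= M)%R) -> (Cmod (w - z) <= r)%R ->
  (Cmod (f w - f z - Cderiv f z * (w - z)) <= M / r / r * Cmod (w - z) * Cmod (w - z))%R.
Proof.
intros H rp zr HM Hw.
assert (D1 : forall u, (Cmod (u - z) <= 2 * r)%R -> (Cmod (Cderiv f u) <= M / r)%R).
  intros u Hu. apply hol_cauchy; auto. generalize (Cmod_sub_ge u z); lra.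
  intros v Hv. apply HM. generalize (Cmod_tri3 v u z); lra.
assert (D2 : forall u, (Cmod (u - z) <= r)%R -> (Cmod (Cderiv (Cderiv f) u) <= M / r / r)%R).
  intros u Hu. apply hol_cauchy; auto using hol_Cderiv. generalize (Cmod_sub_ge u z); lra.
  intros v Hv. apply D1. generalize (Cmod_tri3 v u z); lra.
assert (zz : Cmod (z - z) = 0%R) by (replace (z - z) with (RtoC 0) by ring; apply Cmod_0).
assert (z0 := Cmod_ge_0 z).
assert (din : forall u, (Cmod (u - z) <= r)%R -> (Cmod u < 1)%R) by (intros u Hu; generalize (Cmod_sub_ge u z); lra).
assert (W0 := Cmod_ge_0 (w - z)).
apply (deriv_approx f (Cderiv f)).
- intros t Ht. apply hol_dlim; auto. apply din, seg_near; auto. rewrite zz; lra.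
- intros t Ht. apply hol_ccont. now apply hol_Cderiv. apply din, seg_near; auto. rewrite zz; lra.
- intros t Ht.
  assert (N : (Cmod (seg z w t - z) <= Cmod (w - z))%R) by (apply seg_near; auto; lra).
  apply Rle_trans with (M / r / r * Cmod (seg z w t - z))%R.
  apply hol_mean_value; auto using hol_Cderiv; try lra. apply din; lra.
  intros s Hs. apply D2. apply seg_near; auto; lra.
  apply Rmult_le_compat_l; auto.
  apply Rle_trans with (Cmod (Cderiv (Cderiv f) z)). apply Cmod_ge_0. apply D2; lra.
Qed.

(** * Bumps that vanish to a given order at their centre *)

Lemma order_vanish a j chi : hol chi -> forall k, (k <= j)%nat -> exists chik c, hol chik /\ (1 <= c)%R /\
  chik a = RtoC c * chi a /\
  forall z, (Cmod z < 1)%R -> Cderiv_n k (fun z => (z - a) ^ j * chi z) z = (z - a) ^ (j - k) * chik z.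
Proof.
intros H. induction k as [|k IH]; intros Hk.
- exists chi, 1%R. split; [auto|split;[lra|split;[ring|]]]. intros z _. simpl. now rewrite Nat.sub_0_r.
- destruct IH as [h [c [Hh [Hc [Ha E]]]]]; [lia|].
  set (i := (j - S k)%nat). assert (Ei : (j - k)%nat = S i) by (unfold i; lia).
  assert (Hza : hol (fun z => z - a)) by (apply hol_minus; [apply hol_id | apply hol_const]).
  (* Differentiating (z - a)^(i+1) h leaves (z - a)^i times this function; at a only the first term
     survives, so the constants multiply to a falling factorial, which is at least 1. *)
  exists (fun z => RtoC (INR (S i)) * h z + (z - a) * Cderiv h z), (INR (S i) * c)%R.
  split; [|split; [|split]].
  + apply hol_plus; apply hol_mult; auto using hol_const, hol_Cderiv.
  + rewrite S_INR. generalize (pos_INR i); nra.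
  + rewrite Ha, RtoC_mult. ring.
  + intros z Hz. change (Cderiv_n (S k) (fun z => (z - a) ^ j * chi z) z) with
      (Cderiv (Cderiv_n k (fun z => (z - a) ^ j * chi z)) z). fold i.
    rewrite <- (Cderiv_ext (fun z => (z - a) ^ S i * h z)); auto.
    2:{ intros w Hw. rewrite E, Ei; auto. }
    2:{ apply hol_mult; auto. apply (hol_pow (fun z => z - a)); auto. }
    apply Cderiv_eq.
    replace ((z - a) ^ i * (RtoC (INR (S i)) * h z + (z - a) * Cderiv h z)) with
     ((RtoC (INR (S i)) * (z - a) ^ (S i - 1) * (1 - 0)) * h z + (z - a) ^ S i * Cderiv h z).
    2:{ replace (S i - 1)%nat with i by lia. change ((z - a) ^ S i) with ((z - a) * (z - a) ^ i). ring. }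
    apply (dlim_mult (fun z => (z - a) ^ S i)). 2: now apply hol_dlim.
    apply (dlim_pow (fun z => z - a)). apply dlim_minus; [apply dlim_id | apply dlim_const].
Qed.

Definition den (a z : C) : C := 1 - Cconj a * z.

(** The third bound says that a disc automorphism has modulus at most 1: |1 - conj(a) z|^2 - |z -
    a|^2 = (1 - |a|^2)(1 - |z|^2). *)
Lemma den_ge a z : (Cmod a < 1)%R -> (Cmod z < 1)%R ->
  (1 - Cmod z <= Cmod (den a z) /\ 1 - Cmod a <= Cmod (den a z) /\ Cmod (z - a) <= Cmod (den a z))%R.
Proof.
intros Ha Hz.
assert (K := Cmod_sub_ge 1 (Cconj a * z)). fold (den a z) in K.
rewrite Cmod_1, Cmod_mult, Cmod_conj in K.
assert (a0 := Cmod_ge_0 a). assert (z0 := Cmod_ge_0 z).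
split; [nra|split; [nra|]].
apply Rsqr_incr_0_var; [|apply Cmod_ge_0]. rewrite !Rsqr_pow2.
assert (A2 : (Cmod a ^ 2 <= 1)%R) by nra. assert (Z2 : (Cmod z ^ 2 <= 1)%R) by nra.
rewrite Cmod2_alt in A2, Z2. rewrite !Cmod2_alt. unfold Re, Im in *.
destruct a as [a1 a2], z as [z1 z2]; unfold den; simpl in *.
assert (P := Rmult_le_pos (1 - (a1 * (a1 * 1) + a2 * (a2 * 1))) (1 - (z1 * (z1 * 1) + z2 * (z2 * 1)))
  ltac:(lra) ltac:(lra)). nra.
Qed.

(** Up to sign, the m-th power of the disc automorphism exchanging 0 and a, times (1 - conj(a)
    z)^(-b). Hence [b] alone governs the size and [m] only the order of vanishing at a. *)
Definition kern (a : C) (m b : nat) (z : C) : C := (z - a) ^ m * (/ den a z) ^ (b + m).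

Lemma den_neq0 a z : (Cmod a < 1)%R -> (Cmod z < 1)%R -> den a z <> 0.
Proof. intros Ha Hz. apply Cmod_gt_0. destruct (den_ge a z Ha Hz). lra. Qed.

Lemma dlim_den a z : dlim (den a) z (- Cconj a).
Proof.
replace (- Cconj a) with (0 - Cconj a * 1) by ring.
apply (dlim_minus (fun _ => 1) (fun z => Cconj a * z)). apply dlim_const. apply dlim_scal, dlim_id.
Qed.

Lemma hol_invden a n : (Cmod a < 1)%R -> hol (fun z => (/ den a z) ^ n).
Proof.
intros Ha. apply (hol_pow (fun z => / den a z)). apply hol_inv.
intros z _. eexists. apply dlim_den. intros z Hz. now apply den_neq0.
Qed.

Lemma hol_kern a m b : (Cmod a < 1)%R -> hol (kern a m b).
Proof.
intros Ha. apply (hol_mult (fun z => (z - a) ^ m)). apply (hol_pow (fun z => z - a)).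
apply hol_minus; [apply hol_id | apply hol_const]. now apply hol_invden.
Qed.

Lemma kern_le a m b z : (Cmod a < 1)%R -> (Cmod z < 1)%R ->
  (Cmod (kern a m b z) <= (/ Cmod (den a z)) ^ b)%R.
Proof.
intros Ha Hz. destruct (den_ge a z Ha Hz) as [h1 [h2 h3]].
unfold kern. rewrite Cmod_mult, !Cmod_pow, Cmod_inv by now apply den_neq0.
set (D := Cmod (den a z)) in *. assert (Dp : (0 < D)%R) by lra.
rewrite pow_add. rewrite (Rmult_comm (_ ^ b)), <- Rmult_assoc, <- Rpow_mult_distr.
rewrite <- (Rmult_1_l ((/ D) ^ b)) at 2. apply Rmult_le_compat_r.
apply pow_le, Rlt_le, Rinv_0_lt_compat; auto.
rewrite <- (pow1 m). apply pow_incr. split.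
apply Rmult_le_pos. apply Cmod_ge_0. apply Rlt_le, Rinv_0_lt_compat; auto.
apply Rmult_le_reg_r with D; auto. rewrite Rmult_assoc, Rinv_l; lra.
Qed.

(** A derivative costs one more factor 1/|1 - conj(a) z|. The constant counts m from the numerator
    and b + m from the denominator. *)
Lemma kern_deriv_le a m b z : (Cmod a < 1)%R -> (Cmod z < 1)%R ->
  (Cmod (Cderiv (kern a m b) z) <= INR (b + m + m) * (/ Cmod (den a z)) ^ (b + 1))%R.
Proof.
intros Ha Hz. destruct (den_ge a z Ha Hz) as [h1 [h2 h3]].
assert (dn := den_neq0 a z Ha Hz).
rewrite (Cderiv_eq (kern a m b) z
  (RtoC (INR m) * (z - a) ^ (m - 1) * (1 - 0) * (/ den a z) ^ (b + m) +
   (z - a) ^ m * (RtoC (INR (b + m)) * (/ den a z) ^ (b + m - 1) * (- - Cconj a / (den a z * den a z))))).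
2:{ apply (dlim_mult (fun z => (z - a) ^ m)).
    apply (dlim_pow (fun z => z - a)). apply dlim_minus; [apply dlim_id | apply dlim_const].
    apply (dlim_pow (fun z => / den a z)). apply dlim_inv; auto. apply dlim_den. }
replace (1 - 0) with (RtoC 1) by ring. rewrite Cmult_1_r.
eapply Rle_trans; [apply Cmod_triangle|].
unfold Cdiv. rewrite !Cmod_mult, !Cmod_pow, !Cmod_inv, !Cmod_opp, Cmod_mult, Cmod_conj by (try apply Cmult_neq_0; auto).
rewrite !Cmod_R, !Rabs_right by (apply Rle_ge, pos_INR).
set (D := Cmod (den a z)) in *. assert (Dp : (0 < D)%R) by lra.
set (x := Cmod (z - a)) in *. assert (x0 : (0 <= x)%R) by apply Cmod_ge_0.
set (y := (/ D)%R). assert (yp : (0 < y)%R) by (apply Rinv_0_lt_compat; auto).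
assert (xy : (0 <= x * y <= 1)%R).
  split. nra. unfold y. apply Rmult_le_reg_r with D; auto. rewrite Rmult_assoc, Rinv_l; lra.
assert (pw : forall k, (0 <= (x * y) ^ k <= 1)%R).
  intros k. split. apply pow_le; tauto. rewrite <- (pow1 k). apply pow_incr; auto.
assert (yb : forall k, (0 < y ^ k)%R) by (intros; apply pow_lt; auto).
replace (/ (D * D))%R with (y * y)%R by (unfold y; field; lra).
rewrite !plus_INR.
assert (T1 : (INR m * x ^ (m - 1) * y ^ (b + m) <= INR m * y ^ (b + 1))%R).
  destruct m as [|m]. simpl; lra.
  replace (S m - 1)%nat with m by lia. replace (b + S m)%nat with (m + (b + 1))%nat by lia.
  rewrite pow_add, Rmult_assoc. rewrite <- (Rmult_assoc (x ^ m)), <- Rpow_mult_distr.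
  apply Rmult_le_compat_l. apply pos_INR. generalize (pw m) (yb (b + 1)%nat); nra.
assert (T2 : (x ^ m * ((INR b + INR m) * y ^ (b + m - 1) * (Cmod a * (y * y))) <= (INR b + INR m) * y ^ (b + 1))%R).
  (* The truncated exponent [b + m - 1] is wrong for b = m = 0, where the term is 0 anyway. *)
  destruct (Nat.eq_dec (b + m) 0) as [e0|ne].
    assert (b = 0 /\ m = 0)%nat as [-> ->] by lia. simpl. lra.
  replace (x ^ m * ((INR b + INR m) * y ^ (b + m - 1) * (Cmod a * (y * y))))%R with
    ((INR b + INR m) * ((x * y) ^ m * Cmod a * y ^ (b + 1)))%R.
  2:{ rewrite Rpow_mult_distr.
      replace ((INR b + INR m) * (x ^ m * y ^ m * Cmod a * y ^ (b + 1)))%R with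
        (x ^ m * (INR b + INR m) * Cmod a * (y ^ m * y ^ (b + 1)))%R by ring.
      rewrite <- pow_add. replace (m + (b + 1))%nat with ((b + m - 1) + 2)%nat by lia. rewrite pow_add. ring. }
  apply Rmult_le_compat_l. generalize (pos_INR b) (pos_INR m); lra.
  rewrite <- (Rmult_1_l (y ^ (b + 1))) at 2. apply Rmult_le_compat_r. apply Rlt_le, yb.
  generalize (pw m) (Cmod_ge_0 a); nra.
lra.
Qed.

Lemma kern_vanish a m b k : (Cmod a < 1)%R -> (k < m)%nat -> Cderiv_n k (kern a m b) a = 0.
Proof.
intros Ha Hk. destruct (order_vanish a m _ (hol_invden a (b + m) Ha) k) as [h [c [_ [_ [_ E]]]]]; [lia|].
unfold kern. rewrite E; auto. replace (a - a) with (RtoC 0) by ring.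
replace (m - k)%nat with (S (m - k - 1))%nat by lia. simpl. ring.
Qed.

(** At the centre the denominator is 1 - |a|^2, at most 2(1 - |a|), and the combinatorial factor of
    the m-th derivative is at least 1. *)
Lemma kern_top a m b : (Cmod a < 1)%R ->
  (((/ (2 * (1 - Cmod a))) ^ (b + m)) <= Cmod (Cderiv_n m (kern a m b) a))%R.
Proof.
intros Ha. destruct (order_vanish a m _ (hol_invden a (b + m) Ha) m) as [h [c [_ [Hc [Hh E]]]]]; [lia|].
unfold kern. rewrite E; auto. rewrite Nat.sub_diag. simpl. rewrite Cmult_1_l, Hh.
rewrite Cmod_mult, Cmod_R, Rabs_right, Cmod_pow, Cmod_inv by (try apply den_neq0; auto; lra).
assert (Dd : Cmod (den a a) = (1 - Cmod a ^ 2)%R).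
  unfold den. replace (1 - Cconj a * a) with (RtoC (1 - Cmod a ^ 2)).
  rewrite Cmod_R, Rabs_right; auto. generalize (Cmod_ge_0 a); nra.
  rewrite RtoC_minus, Cmod2_conj. ring.
rewrite Dd. assert (a0 := Cmod_ge_0 a).
apply Rle_trans with (1 * (/ (1 - Cmod a ^ 2)) ^ (b + m))%R.
rewrite Rmult_1_l. apply pow_incr. split. apply Rlt_le, Rinv_0_lt_compat; lra.
apply Rinv_le_contravar; nra.
apply Rmult_le_compat_r; auto. apply pow_le, Rlt_le, Rinv_0_lt_compat; nra.
Qed.

(** * Montel's theorem along a free ultrafilter *)

Definition free_ultrafilter (U : (nat -> Prop) -> Prop) : Prop :=
  (forall A B : nat -> Prop, (forall j, A j -> B j) -> U A -> U B) /\
  (forall A B : nat -> Prop, U A -> U B -> U (fun j => A j /\ B j)) /\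
  (forall A : nat -> Prop, U A \/ U (fun j => ~ A j)) /\
  (forall A : nat -> Prop, U A -> exists j, A j) /\
  (forall N, U (fun j => (N <= j)%nat)).

(* Limits along a free ultrafilter exist pointwise at once, without diagonal extraction. *)
Section Montel.
Variable U : (nat -> Prop) -> Prop.
Hypothesis HU : free_ultrafilter U.
Let Umono A B : (forall j, A j -> B j) -> U A -> U B := proj1 HU A B.
Let Uand A B : U A -> U B -> U (fun j => A j /\ B j) := proj1 (proj2 HU) A B.
Let Uem A : U A \/ U (fun j => ~ A j) := proj1 (proj2 (proj2 HU)) A.
Let Uex A : U A -> exists j, A j := proj1 (proj2 (proj2 (proj2 HU))) A.
Let Utail N : U (fun j => (N <= j)%nat) := proj2 (proj2 (proj2 (proj2 HU))) N.

Let Utriv (A : nat -> Prop) : (forall j, A j) -> U A.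
Proof. intros H. apply (Umono (fun j => (0 <= j)%nat)); auto. Qed.

Let Ufin n (A : nat -> nat -> Prop) : (forall i, U (A i)) -> U (fun j => forall i, (i < n)%nat -> A i j).
Proof.
intros H. induction n as [|n IH].
- apply Utriv. intros j i Hi. lia.
- apply (Umono _ _) with (2 := Uand _ _ IH (H n)). intros j [h1 h2] i Hi.
  destruct (Nat.eq_dec i n) as [->|ne]; auto. apply h1. lia.
Qed.

(** The limit is the supremum of the levels t that the sequence exceeds on a set of the ultrafilter;
    the dichotomy [Uem] gives the upper estimate. *)
Let ulim_R (x : nat -> R) M : (forall j, (Rabs (x j) <= M)%R) ->
  exists l, forall e, (0 < e)%R -> U (fun j => (Rabs (x j - l) < e)%R).
Proof.
intros H. assert (Hb : forall j, (- M <= x j <= M)%R) by (intros j; apply Rabs_le_between; auto).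
destruct (completeness (fun t => U (fun j => (t <= x j)%R))) as [l [l1 l2]].
- exists M. intros t Ht. destruct (Uex _ Ht) as [j hj]. specialize (Hb j). lra.
- exists (- M)%R. apply Utriv. intros j. specialize (Hb j); lra.
- exists l. intros e He.
  assert (A1 : U (fun j => ~ (l + e / 2 <= x j)%R)).
    destruct (Uem (fun j => (l + e / 2 <= x j)%R)) as [h|h]; auto.
    specialize (l1 _ h). lra.
  assert (A2 : exists t, U (fun j => (t <= x j)%R) /\ (l - e < t)%R).
    apply NNPP. intros h. assert (K : (l <= l - e)%R). apply l2. intros t Ht.
    apply Rnot_lt_le. intros h'. apply h. exists t; auto. lra.
  destruct A2 as [t [ht1 ht2]].
  apply (Umono _ _) with (2 := Uand _ _ A1 ht1). intros j [h1 h2]. apply Rabs_def1; lra.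
Qed.

Let ulim_C (x : nat -> C) M : (forall j, (Cmod (x j) <= M)%R) ->
  exists l, forall e, (0 < e)%R -> U (fun j => (Cmod (x j - l) < e)%R).
Proof.
intros H.
destruct (ulim_R (fun j => fst (x j)) M) as [l1 h1].
  intros j. eapply Rle_trans; [|apply (H j)]. eapply Rle_trans; [|apply Rmax_Cmod]. apply Rmax_l.
destruct (ulim_R (fun j => snd (x j)) M) as [l2 h2].
  intros j. eapply Rle_trans; [|apply (H j)]. eapply Rle_trans; [|apply Rmax_Cmod]. apply Rmax_r.
exists (l1, l2). intros e He.
apply (Umono _ _) with (2 := Uand _ _ (h1 (e/2)%R ltac:(lra)) (h2 (e/2)%R ltac:(lra))).
intros j [k1 k2].
replace (x j - (l1, l2)) with (RtoC (fst (x j) - l1) + Ci * RtoC (snd (x j) - l2)).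
2:{ apply injective_projections; simpl; ring. }
eapply Rle_lt_trans; [apply Cmod_triangle|]. rewrite Cmod_mult, Cmod_Ci, !Cmod_R. lra.
Qed.

Variable f : nat -> C -> C.
Hypothesis Hf : forall j, hol (f j).
Hypothesis bf : forall r, (r < 1)%R -> exists M, forall j z, (Cmod z <= r)%R -> (Cmod (f j z) <= M)%R.

Let lim_ex z : exists l, (Cmod z < 1)%R -> forall e, (0 < e)%R -> U (fun j => (Cmod (f j z - l) < e)%R).
Proof.
destruct (Rlt_le_dec (Cmod z) 1) as [h|h].
- destruct (bf _ h) as [M hM]. destruct (ulim_C (fun j => f j z) M) as [l hl].
  intros j. apply hM. lra. exists l. auto.
- exists 0. intros; lra.
Qed.

Let F z := proj1_sig (ClassicalEpsilon.constructive_indefinite_description _ (lim_ex z)).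
Let FP z : (Cmod z < 1)%R -> forall e, (0 < e)%R -> U (fun j => (Cmod (f j z - F z) < e)%R).
Proof. exact (proj2_sig (ClassicalEpsilon.constructive_indefinite_description _ (lim_ex z))). Qed.

(** The derivatives at z are bounded and converge along the ultrafilter too. The Taylor remainder,
    uniform in j, passes to the limit and shows that this limit is the derivative of [F]. *)
Let holF : hol F.
Proof.
intros z Hz. set (r := ((1 - Cmod z) / 4)%R).
assert (rp : (0 < r)%R) by (unfold r; lra). assert (zr : (Cmod z + 3 * r < 1)%R) by (unfold r; lra).
destruct (bf _ zr) as [M hM].
assert (HM : forall j u, (Cmod (u - z) <= 3 * r)%R -> (Cmod (f j u) <= M)%R).
  intros j u Hu. apply hM. generalize (Cmod_sub_ge u z); lra.
destruct (ulim_C (fun j => Cderiv (f j) z) (M / r)) as [l hl].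
  intros j. apply hol_cauchy; auto. lra. intros w Hw. apply HM. lra.
assert (M0 : (0 <= M)%R).
  apply Rle_trans with (Cmod (f 0%nat z)). apply Cmod_ge_0. apply HM.
  replace (z - z) with (RtoC 0) by ring. rewrite Cmod_0. lra.
set (K := (M / r / r)%R).
assert (K0 : (0 <= K)%R) by (unfold K; repeat apply Rdiv_le_0_compat; auto).
assert (T : forall w, (Cmod (w - z) <= r)%R -> (Cmod (F w - F z - l * (w - z)) <= K * Cmod (w - z) * Cmod (w - z))%R).
  intros w Hw. apply Rnot_lt_le. intros h.
  remember (Cmod (F w - F z - l * (w - z)) - K * Cmod (w - z) * Cmod (w - z))%R as gap eqn:gapE.
  set (e := (gap / (4 * (1 + Cmod (w - z))))%R).
  assert (W := Cmod_ge_0 (w - z)).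
  assert (gp : (0 < gap)%R) by lra.
  assert (ep : (0 < e)%R) by (unfold e; apply Rdiv_lt_0_compat; lra).
  assert (Ee : (e * (1 + Cmod (w - z)) = gap / 4)%R) by (unfold e; field; lra).
  assert (Hw1 : (Cmod w < 1)%R) by (generalize (Cmod_sub_ge w z); lra).
  (* One index j brings the two values and the derivative within e of their limits at once, too
     close for the assumed gap. *)
  destruct (Uex _ (Uand _ _ (Uand _ _ (FP w Hw1 e ep) (FP z Hz e ep)) (hl e ep))) as [j [[j1 j2] j3]].
  assert (T := hol_taylor2 (f j) z w r M (Hf j) rp zr (HM j) Hw). fold K in T.
  assert (N1 := Cmod_triangle (f j w - f j z - Cderiv (f j) z * (w - z)) ((f j z - F z) + ((Cderiv (f j) z - l) * (w - z) - (f j w - F w)))).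
  replace ((f j w - f j z - Cderiv (f j) z * (w - z)) + ((f j z - F z) + ((Cderiv (f j) z - l) * (w - z) - (f j w - F w))))
    with (F w - F z - l * (w - z)) in N1 by ring.
  assert (N2 := Cmod_triangle (f j z - F z) ((Cderiv (f j) z - l) * (w - z) - (f j w - F w))).
  assert (N3 := Cmod_sub_le ((Cderiv (f j) z - l) * (w - z)) (f j w - F w)).
  rewrite Cmod_mult in N3.
  assert (N4 : (Cmod (Cderiv (f j) z - l) * Cmod (w - z) <= e * Cmod (w - z))%R) by (apply Rmult_le_compat_r; lra).
  assert (0 <= e * Cmod (w - z))%R by (apply Rmult_le_pos; lra).
  lra.
exists l. intros e He. exists (Rmin r (e / (K + 1))). split. apply Rmin_case; auto. apply Rdiv_lt_0_compat; lra.
intros w Hw. assert (w1 := Rlt_le_trans _ _ _ Hw (Rmin_l _ _)).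
assert (w2 := Rlt_le_trans _ _ _ Hw (Rmin_r _ _)).
eapply Rle_trans; [apply T; lra|]. apply Rmult_le_compat_r. apply Cmod_ge_0.
apply (Rmult_lt_compat_r (K + 1)) in w2; [|lra].
unfold Rdiv in w2; rewrite Rmult_assoc, Rinv_l in w2 by lra. generalize (Cmod_ge_0 (w - z)); nra.
Qed.

(** The family is uniformly Lipschitz on a slightly larger disc, so convergence on a finite grid
    suffices. An ultrafilter is closed under finite intersections only, which is why the grid must
    be finite. *)
Let unif_lim r e : (0 <= r < 1)%R -> (0 < e)%R ->
  U (fun j => forall z, (Cmod z <= r)%R -> (Cmod (f j z - F z) <= e)%R).
Proof.
intros Hr He. set (s := ((1 - r) / 3)%R). assert (sp : (0 < s)%R) by (unfold s; lra).
assert (s3 : (r + 2 * s < 1)%R) by (unfold s; lra).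
destruct (bf _ s3) as [M hM].
assert (M0 : (0 <= M)%R).
  apply Rle_trans with (Cmod (f 0%nat 0)). apply Cmod_ge_0. apply hM. rewrite Cmod_0. lra.
set (L := (M / s)%R). assert (L0 : (0 <= L)%R) by (apply Rdiv_le_0_compat; auto).
assert (Lip : forall j z w, (Cmod z <= r + s)%R -> (Cmod w <= r + s)%R -> (Cmod (f j w - f j z) <= L * Cmod (w - z))%R).
  intros j z w Hz Hw. apply hol_mean_value; auto; try lra.
  intros t Ht. assert (N := seg_norm z w t (r + s) Ht Hz Hw). apply hol_cauchy; auto. lra.
  intros u Hu. apply hM. generalize (Cmod_sub_ge u (seg z w t)); lra.
set (d := Rmin (s / 2) (e / (8 * (L + 1)))).
assert (dp : (0 < d)%R) by (unfold d; apply Rmin_case; [lra|apply Rdiv_lt_0_compat; lra]).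
assert (ds : (d <= s / 2)%R) by apply Rmin_l.
assert (de : (d * (L + 1) <= e / 8)%R).
  apply Rle_trans with (e / (8 * (L + 1)) * (L + 1))%R. apply Rmult_le_compat_r; [lra|apply Rmin_r].
  right. field. lra.
destruct (nfloor_ex (2 / d)) as [N [_ HN]]; [apply Rdiv_le_0_compat; lra|].
set (pt := fun i k : nat => (INR i * d - 1, INR k * d - 1)%R : C).
(* The grid fills the square around the disc; grid points outside the disc are excluded by the guard
   on their modulus. *)
assert (G : U (fun j => forall i, (i < S N)%nat -> forall k, (k < S N)%nat ->
   (Cmod (pt i k) < 1)%R -> (Cmod (f j (pt i k) - F (pt i k)) < e / 4)%R)).
  apply Ufin. intros i.
  apply (Ufin (S N) (fun k j => (Cmod (pt i k) < 1)%R -> (Cmod (f j (pt i k) - F (pt i k)) < e / 4)%R)). intros k.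
  destruct (Rlt_le_dec (Cmod (pt i k)) 1) as [h|h].
  apply (Umono _ _) with (2 := FP _ h (e/4)%R ltac:(lra)). auto.
  apply Utriv. intros; lra.
assert (FL : forall z w, (Cmod z <= r + s)%R -> (Cmod w <= r + s)%R -> (Cmod (w - z) <= 2 * d)%R ->
   (Cmod (F w - F z) <= e / 2)%R).
  intros z w Hz Hw Hwz.
  destruct (Uex _ (Uand _ _ (FP z ltac:(lra) (e/8)%R ltac:(lra)) (FP w ltac:(lra) (e/8)%R ltac:(lra)))) as [j [j1 j2]].
  assert (A := Lip j z w Hz Hw).
  assert (B := Cmod_tri3 (F w) (f j w) (F z)). assert (B2 := Cmod_tri3 (f j w) (f j z) (F z)).
  rewrite Cmod_sub_sym in j2.
  assert (L * Cmod (w - z) <= L * (2 * d))%R by (apply Rmult_le_compat_l; auto). nra.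
apply (Umono _ _) with (2 := G). clear G. intros j G z Hz.
assert (grid : forall x, (-1 <= x <= 1)%R -> exists i, (i < S N)%nat /\ (Rabs (INR i * d - 1 - x) <= d)%R).
  intros x Hx. destruct (nfloor_ex ((x + 1) / d)) as [i [h1 h2]]; [apply Rdiv_le_0_compat; lra|].
  apply (Rmult_le_compat_r d) in h1; [|lra]. apply (Rmult_lt_compat_r d) in h2; [|lra].
  unfold Rdiv in h1, h2. rewrite Rmult_assoc, Rinv_l in h1, h2 by lra.
  exists i. split. 2: apply Rabs_le_between; lra.
  apply INR_lt. rewrite S_INR. apply (Rmult_lt_reg_r d); auto.
  apply (Rmult_lt_compat_r d) in HN; [|lra]. unfold Rdiv in HN. rewrite Rmult_assoc, Rinv_l in HN by lra. lra.
assert (Mz := Rmax_Cmod z).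
destruct (grid (fst z)) as [i [hi1 hi2]].
  apply Rabs_le_between. apply Rle_trans with r; [|lra]. eapply Rle_trans; [|exact Hz]. eapply Rle_trans; [|exact Mz]. apply Rmax_l.
destruct (grid (snd z)) as [k [hk1 hk2]].
  apply Rabs_le_between. apply Rle_trans with r; [|lra]. eapply Rle_trans; [|exact Hz]. eapply Rle_trans; [|exact Mz]. apply Rmax_r.
assert (D : (Cmod (pt i k - z) <= 2 * d)%R).
  replace (pt i k - z) with (RtoC (INR i * d - 1 - fst z) + Ci * RtoC (INR k * d - 1 - snd z)).
  2:{ apply injective_projections; simpl; ring. }
  eapply Rle_trans; [apply Cmod_triangle|]. rewrite Cmod_mult, Cmod_Ci, !Cmod_R. lra.
set (w := pt i k) in *.
assert (wr : (Cmod w <= r + s)%R) by (generalize (Cmod_sub_ge w z); lra).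
specialize (G i hi1 k hk1 ltac:(fold w; lra)). fold w in G.
assert (A := Lip j z w ltac:(lra) wr). assert (A2 := FL z w ltac:(lra) wr D).
assert (B := Cmod_tri3 (f j z) (f j w) (F z)). assert (B2 := Cmod_tri3 (f j w) (F w) (F z)).
rewrite (Cmod_sub_sym (f j z) (f j w)) in B.
assert (L * Cmod (w - z) <= L * (2 * d))%R by (apply Rmult_le_compat_l; auto). nra.
Qed.

Lemma montel : exists F, hol F /\ forall r e N, (0 <= r < 1)%R -> (0 < e)%R ->
  exists j, (N <= j)%nat /\ forall z, (Cmod z <= r)%R -> (Cmod (f j z - F z) <= e)%R.
Proof.
exists F. split; [exact holF|]. intros r e N Hr He.
apply Uex. apply Uand; auto.
Qed.
End Montel.

End ComplexAnalysis.

(** * Measurability of functions on the disc and on pairs of its points *)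

Module PlaneMeasure.

From HB Require Import structures.
From mathcomp Require Import all_boot all_order all_algebra.
From mathcomp Require Import all_classical all_reals all_analysis measurable_realfun.
From mathcomp Require Import Rstruct Rstruct_topology.
Set Implicit Arguments.
Unset Strict Implicit.
Unset Printing Implicit Defensive.
Import Order.TTheory GRing.Theory Num.Theory numFieldNormedType.Exports.
Local Open Scope classical_set_scope.
Local Open Scope ring_scope.

Notation PL := (measurableTypeR R * measurableTypeR R)%type.
Notation mu := (@lebesgue_measure R \x @lebesgue_measure R)%E.

Definition boxq (q : rat * rat * rat) : set PL :=
  [set z | `|z.1 - ratr q.1.1| < ratr q.2 /\ `|z.2 - ratr q.1.2| < ratr q.2].

Lemma measurable_box (a b r s : R) :
  measurable ([set z | `|z.1 - a| < r /\ `|z.2 - b| < s] : set PL).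
Proof.
have -> : [set z : PL | `|z.1 - a| < r /\ `|z.2 - b| < s] = ball a r `*` ball b s.
  by apply/seteqP; split => z /=; rewrite /ball /= !(distrC a) !(distrC b).
by apply: measurableX; exact: measurable_ball.
Qed.

(** The measurable structure of the plane is generated by rectangles, so an open set is exhibited as
    a countable union of rational boxes contained in it. *)
Lemma open_plane_measurable (O : set PL) :
  (forall z, O z -> exists2 e : R, 0 < e & forall w : PL, `|w.1 - z.1| < e -> `|w.2 - z.2| < e -> O w) ->
  measurable O.
Proof.
move=> HO.
have -> : O = \bigcup_q (if `[< boxq q `<=` O >] then boxq q else set0).
  apply/seteqP; split => z.
    move=> Oz; have [e e0 he] := HO z Oz.
    have [r /andP[]] : exists r : rat, 0 < (ratr r : R) < e / 2.
      have [r] := @rat_in_itvoo R 0 (e / 2) ltac:(by rewrite divr_gt0).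
      by rewrite in_itv /= => h; exists r.
    move=> r0 re.
    have [p] := @rat_in_itvoo R (z.1 - ratr r) z.1 ltac:(by rewrite ltrBlDr ltrDl).
    have [q] := @rat_in_itvoo R (z.2 - ratr r) z.2 ltac:(by rewrite ltrBlDr ltrDl).
    rewrite !in_itv /= => /andP[q1 q2] /andP[p1 p2].
    have zb : boxq (p, q, r) z.
      split => /=; rewrite ltr_distl; apply/andP; split.
      - by apply: lt_trans p2; rewrite ltrBlDr ltrDl.
      - by rewrite -ltrBlDr.
      - by apply: lt_trans q2; rewrite ltrBlDr ltrDl.
      - by rewrite -ltrBlDr.
    exists (p, q, r) => //=.
    case: asboolP => // -[] w [/= w1 w2]; case: zb => /= z1 z2.
    have e2 : ratr r + ratr r < e by rewrite [ltRHS](splitr e) ltrD.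
    apply: he.
    - apply: le_lt_trans (ler_distD (ratr p) _ _) _; apply: lt_trans e2.
      by apply: ltrD => //; rewrite distrC.
    - apply: le_lt_trans (ler_distD (ratr q) _ _) _; apply: lt_trans e2.
      by apply: ltrD => //; rewrite distrC.
  by move=> [q _] /=; case: asboolP => // h /h.
apply: countable_bigcupT_measurable; first exact: countableP.
move=> q; case: asboolP => _ //; exact: measurable_box.
Qed.

Lemma measurable_Cmod : measurable_fun setT (Cmod : PL -> (R : realType)).
Proof.
have -> : (Cmod : PL -> (R : realType)) = fun z => (z.1 ^+ 2 + z.2 ^+ 2) `^ 2^-1.
  apply/funext => z; rewrite /Cmod RsqrtE powR12_sqrt ?addr_ge0 ?sqr_ge0 //.
  by rewrite !RpowE.
apply: (measurableT_comp (f := fun x : (R : realType) => x `^ 2^-1)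
  (g := fun z : PL => z.1 ^+ 2 + z.2 ^+ 2 : (R : realType))); first exact: measurable_powR.
by apply: measurable_funD; apply: measurable_funX; [exact: measurable_fst|exact: measurable_snd].
Qed.

Lemma measurable_Disc : measurable (Disc : set PL).
Proof.
have := measurable_fun_ltr measurable_Cmod (measurable_cst (1 : (R : realType))).
by move=> /(_ measurableT [set true] I); rewrite setTI.
Qed.

Definition meas (h : C -> R) : Prop := measurable_fun (Disc : set PL) (h : PL -> (R : realType)).

Lemma DiscE (z : C) : Disc z <-> Rlt (Cmod z) 1.
Proof. by split => [/RltP|h]; [|apply/RltP]. Qed.

Lemma meas_continuous (h : C -> R) :
  (forall z, Rlt (Cmod z) 1 -> forall e, Rlt 0 e -> exists d, Rlt 0 d /\
     forall w, Rlt (Cmod (Cminus w z)) d -> Rlt (Rabs (Rminus (h w) (h z))) e) -> meas h.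
Proof.
move=> H; apply: (measurability _ (RGenOInfty.measurableE R)) => //= _ [_ [t ->] <-].
apply: open_plane_measurable => z [/DiscE Dz] /=; rewrite in_itv /= andbT => tz.
have [d [/RltP d0 hd]] := H z Dz (h z - t) ltac:(by apply/RltP; rewrite subr_gt0).
(* Half of [d] keeps the values above t, half of the distance to the circle keeps the box inside the
   disc; the halves pay for |x| + |y| as a bound of the modulus. *)
pose e := Order.min (d / 2) ((1 - Cmod z) / 2).
have e0 : 0 < e.
  by rewrite lt_min !divr_gt0 // subr_gt0; apply/RltP.
exists e => // w w1 w2.
have wz : Cmod (Cminus w z) < e * 2.
  apply: le_lt_trans (_ : _ <= `|w.1 - z.1| + `|w.2 - z.2|) _; last first.
    by rewrite mulr_natr mulr2n ltrD.
  have -> : Cminus w z = Cplus (RtoC (w.1 - z.1)) (Cmult Ci (RtoC (w.2 - z.2))).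
    by apply: injective_projections; simpl; ring.
  apply/RleP; apply: Rle_trans (Cmod_triangle _ _) _; rewrite Cmod_mult Cmod_Ci !Cmod_R !RabsE.
  by apply/RleP; rewrite RplusE RmultE mul1r.
split.
  apply/DiscE; have := Cmod_sub_ge w z => /RleP; rewrite RminusE => h1.
  apply/RltP; move: h1; rewrite lerBlDl => /le_lt_trans; apply.
  rewrite -ltrBrDl; apply: lt_le_trans wz _.
  by rewrite -ler_pdivlMr // ge_min lexx orbT.
rewrite in_itv /= andbT.
have /RltP := hd w ltac:(by apply/RltP; apply: lt_le_trans wz _; rewrite -ler_pdivlMr // ge_min lexx).
rewrite RabsE RminusE distrC => /(le_lt_trans (ler_norm _)).
by rewrite ltrBlDr addrC -ltrBlDr opprB addrC subrK.
Qed.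

(** At 0 the value is 0 for every exponent other than 0, while [pw 0 0] is 1. Adding exponents
    therefore needs a positive base, and zeros of functions are treated separately below. *)
Definition pw (x p : R) : R := powR x p.
(** Real-valued indicators let an integral over a subset be written as an integral of a product over
    the whole disc. *)
Definition ilt (x y : R) : R := if Rlt_dec x y then 1 else 0.
Definition ile (x y : R) : R := if Rle_dec x y then 1 else 0.

Section MeasurableRules.
Context d (T : measurableType d) (D : set T).
Hypothesis mD : measurable D.
Implicit Types f g : T -> (R : realType).

Lemma mfun_pw f p : measurable_fun D f -> measurable_fun D (fun x => pw (f x) p : (R : realType)).
Proof. exact: (measurableT_comp (f := fun x : (R : realType) => x `^ p) (measurable_powR _)). Qed.

Lemma mfun_ilt f g : measurable_fun D f -> measurable_fun D g ->
  measurable_fun D (fun x => ilt (f x) (g x) : (R : realType)).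
Proof.
move=> mf mg.
have -> : (fun x => ilt (f x) (g x) : (R : realType)) = fun x => if f x < g x then 1 else 0.
  apply/funext => x; rewrite /ilt; case: Rlt_dec => [/RltP -> //|h].
  by case: ifP => // /RltP.
by apply: measurable_fun_if => //; apply: measurable_fun_ltr.
Qed.

Lemma mfun_ile f g : measurable_fun D f -> measurable_fun D g ->
  measurable_fun D (fun x => ile (f x) (g x) : (R : realType)).
Proof.
move=> mf mg.
have -> : (fun x => ile (f x) (g x) : (R : realType)) = fun x => if f x <= g x then 1 else 0.
  apply/funext => x; rewrite /ile; case: Rle_dec => [/RleP -> //|h].
  by case: ifP => // /RleP.
by apply: measurable_fun_if => //; apply: measurable_fun_ler.
Qed.
End MeasurableRules.

Lemma meas_ext h h' : (forall z, Rlt (Cmod z) 1 -> h z = h' z) -> meas h -> meas h'.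
Proof.
move=> E; apply: eq_measurable_fun => z; rewrite inE => /DiscE; exact: E.
Qed.

Lemma meas_const c : meas (fun=> c).
Proof. exact: measurable_cst. Qed.

Lemma meas_plus h k : meas h -> meas k -> meas (fun z => Rplus (h z) (k z)).
Proof. by move=> mh mk; apply: (measurable_funD mh mk). Qed.

Lemma meas_minus h k : meas h -> meas k -> meas (fun z => Rminus (h z) (k z)).
Proof. by move=> mh mk; apply: (measurable_funB mh mk). Qed.

Lemma meas_mult h k : meas h -> meas k -> meas (fun z => Rmult (h z) (k z)).
Proof. by move=> mh mk; apply: (measurable_funM mh mk). Qed.

Lemma meas_pw h p : meas h -> meas (fun z => pw (h z) p).
Proof. exact: mfun_pw. Qed.

Lemma meas_ilt h k : meas h -> meas k -> meas (fun z => ilt (h z) (k z)).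
Proof. by apply: mfun_ilt; exact: measurable_Disc. Qed.

Lemma meas_ile h k : meas h -> meas k -> meas (fun z => ile (h z) (k z)).
Proof. by apply: mfun_ile; exact: measurable_Disc. Qed.

Lemma Cmod_coord (z a : C) : Cmod (Cminus z a) =
  ((z.1 - a.1) ^+ 2 + (z.2 - a.2) ^+ 2) `^ 2^-1.
Proof.
by rewrite /Cmod RsqrtE powR12_sqrt ?addr_ge0 ?sqr_ge0 // !RpowE.
Qed.

Lemma meas_dist a : meas (fun z => Cmod (Cminus z a)).
Proof.
rewrite /meas; under eq_fun do rewrite Cmod_coord.
apply: (measurableT_comp (f := fun x : (R : realType) => x `^ 2^-1)); first exact: measurable_powR.
apply: (@measurable_funD _ _ _ _ (fun z : PL => (z.1 - a.1) ^+ 2)).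
  apply: measurable_funX; apply: measurable_funB; last exact: measurable_cst.
  exact: measurable_funTS measurable_fst.
apply: measurable_funX; apply: measurable_funB; last exact: measurable_cst.
exact: measurable_funTS measurable_snd.
Qed.

Lemma meas_Cmod : meas Cmod.
Proof. exact: measurable_funTS measurable_Cmod. Qed.

Lemma meas_hol f : hol f -> meas (fun z => Cmod (f z)).
Proof.
move=> hf; apply: meas_continuous => z Dz e e0.
have [d [d0 hd]] := hol_ccont f z hf Dz e e0.
exists d; split => // w /hd h; apply: Rle_lt_trans h.
apply: Rabs_le; split.
  have := Cmod_sub_ge (f z) (f w); rewrite Cmod_sub_sym => H; lra.
exact: Cmod_sub_ge.
Qed.

Definition D2 : set (PL * PL) := (Disc : set PL) `*` (Disc : set PL).

Lemma measurable_D2 : measurable D2.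
Proof. by apply: measurableX; exact: measurable_Disc. Qed.

Definition meas2 (k : C -> C -> R) : Prop :=
  measurable_fun D2 (fun x : PL * PL => k x.1 x.2 : (R : realType)).

Lemma meas2_const c : meas2 (fun _ _ => c).
Proof. exact: measurable_cst. Qed.

Lemma meas2_mult h k : meas2 h -> meas2 k -> meas2 (fun z w => Rmult (h z w) (k z w)).
Proof. by move=> mh mk; apply: (measurable_funM mh mk). Qed.

Lemma meas2_pw h p : meas2 h -> meas2 (fun z w => pw (h z w) p).
Proof. exact: mfun_pw. Qed.

Lemma meas2_ilt h k : meas2 h -> meas2 k -> meas2 (fun z w => ilt (h z w) (k z w)).
Proof. by apply: mfun_ilt; exact: measurable_D2. Qed.

Lemma meas2_ile h k : meas2 h -> meas2 k -> meas2 (fun z w => ile (h z w) (k z w)).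
Proof. by apply: mfun_ile; exact: measurable_D2. Qed.

Lemma meas2_fst h : meas h -> meas2 (fun z _ => h z).
Proof.
move=> mh; apply: (measurable_comp (f := h : PL -> (R : realType)) measurable_Disc _ mh).
  by move=> _ [x [x1 _] <-].
exact: measurable_funTS measurable_fst.
Qed.

Lemma meas2_snd h : meas h -> meas2 (fun _ w => h w).
Proof.
move=> mh; apply: (measurable_comp (f := h : PL -> (R : realType)) measurable_Disc _ mh).
  by move=> _ [x [_ x1] <-].
exact: measurable_funTS measurable_snd.
Qed.

Lemma meas2_dist : meas2 (fun z w => Cmod (Cminus z w)).
Proof.
rewrite /meas2; under eq_fun do rewrite Cmod_coord.
apply: (measurableT_comp (f := fun x : (R : realType) => x `^ 2^-1)); first exact: measurable_powR.
apply: (@measurable_funD _ _ _ _ (fun x : PL * PL => (x.1.1 - x.2.1) ^+ 2)).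
  apply: measurable_funX; apply: measurable_funB; apply: measurable_funTS.
    exact: (measurableT_comp measurable_fst measurable_fst).
  exact: (measurableT_comp measurable_fst measurable_snd).
apply: measurable_funX; apply: measurable_funB; apply: measurable_funTS.
  exact: (measurableT_comp measurable_snd measurable_fst).
exact: (measurableT_comp measurable_snd measurable_snd).
Qed.

Lemma meas2_section k z : meas2 k -> Rlt (Cmod z) 1 -> meas (k z).
Proof.
move=> mk Dz.
apply: (measurable_comp (F := D2) (f := fun x : PL * PL => k x.1 x.2 : (R : realType)) (g := fun w : PL => (z : PL, w))).
- exact: measurable_D2.
- by move=> _ [w Dw <-]; split => //=; apply/DiscE.
- exact: mk.
- by apply: measurable_funTS; exact: pair1_measurable.
Qed.

(** * Integral bounds over the disc and areas of small discs *)

Definition nn (h : C -> R) : Prop := meas h /\ forall z, Rlt (Cmod z) 1 -> Rle 0 (h z).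

Definition Int (h : C -> R) : \bar R := (\int[mu]_(z in (Disc : set PL)) (h z)%:E)%E.

(** A finite bound stated with a real number keeps extended reals out of all later estimates. The
    area measure is not normalised here; [pinv] restores the factor. *)
Definition IB (h : C -> R) (B : R) : Prop := (Int h <= B%:E)%E.

Lemma nn_ge0 h (z : PL) : nn h -> Disc z -> (0 <= (h z)%:E)%E.
Proof. by move=> [_ h0] /DiscE Dz; rewrite lee_fin; apply/RleP; exact: h0. Qed.

Lemma nn_meas h : nn h -> measurable_fun (Disc : set PL) (EFin \o (h : PL -> (R : realType))).
Proof. by move=> [mh _]; apply/measurable_EFinP. Qed.

Lemma Int_ge0 h : nn h -> (0 <= Int h)%E.
Proof. by move=> nh; apply: integral_ge0 => z Dz; exact: nn_ge0. Qed.

Lemma le_Int h k : nn h -> nn k -> (forall z, Rlt (Cmod z) 1 -> Rle (h z) (k z)) -> (Int h <= Int k)%E.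
Proof.
move=> nh nk hk; apply: ge0_le_integral => //.
- exact: measurable_Disc.
- by move=> z; apply: nn_ge0.
- exact: nn_meas.
- exact: nn_meas.
- by move=> z /DiscE Dz; rewrite lee_fin; apply/RleP; exact: hk.
Qed.

Lemma IB_le h k B : nn h -> nn k -> (forall z, Rlt (Cmod z) 1 -> Rle (h z) (k z)) -> IB k B -> IB h B.
Proof. by move=> nh nk hk; apply: le_trans; exact: le_Int. Qed.

Lemma IB_weak h B B' : Rle B B' -> IB h B -> IB h B'.
Proof. by move=> /RleP BB' hB; apply: le_trans hB _; rewrite lee_fin. Qed.

Lemma IB_ge0 h B : nn h -> IB h B -> Rle 0 B.
Proof. by move=> nh hB; apply/RleP; rewrite -lee_fin; apply: le_trans hB; exact: Int_ge0. Qed.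

Lemma IntD h k : nn h -> nn k -> Int (fun z => Rplus (h z) (k z)) = (Int h + Int k)%E.
Proof.
move=> nh nk; rewrite /Int -ge0_integralD //; first exact: measurable_Disc.
- by move=> z; apply: nn_ge0.
- exact: nn_meas.
- by move=> z; apply: nn_ge0.
- exact: nn_meas.
Qed.

Lemma IntZ c h : Rle 0 c -> nn h -> Int (fun z => Rmult c (h z)) = (c%:E * Int h)%E.
Proof.
move=> /RleP c0 nh; rewrite /Int -ge0_integralZl //; first exact: measurable_Disc.
- exact: nn_meas.
- by move=> z; apply: nn_ge0.
Qed.

Lemma IB_plus h k B B' : nn h -> nn k -> IB h B -> IB k B' -> IB (fun z => Rplus (h z) (k z)) (Rplus B B').
Proof. by move=> nh nk hB kB; rewrite /IB IntD // EFinD; apply: leeD. Qed.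

Lemma IB_scal c h B : Rle 0 c -> nn h -> IB h B -> IB (fun z => Rmult c (h z)) (Rmult c B).
Proof.
move=> c0 nh hB; rewrite /IB IntZ // EFinM; apply: lee_wpmul2l => //.
by rewrite lee_fin; apply/RleP.
Qed.

Lemma IB_real h B : nn h -> IB h B -> exists b, Rle b B /\ Int h = b%:E.
Proof.
move=> nh hB; have := Int_ge0 nh.
move: hB; rewrite /IB; case: (Int h) => [b| |] //= hb _.
by exists b; split => //; apply/RleP; rewrite -lee_fin.
Qed.

(** Unlike monotonicity, this keeps the total of the two bounds, as is needed when disjoint pieces
    share one integral. *)
Lemma IB_split h k B : nn h -> nn k -> IB (fun z => Rplus (h z) (k z)) B ->
  exists B1 B2, IB h B1 /\ IB k B2 /\ Rle (Rplus B1 B2) B.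
Proof.
move=> nh nk hB.
have nhk : nn (fun z => Rplus (h z) (k z)).
  split; first by apply: meas_plus; [case: nh|case: nk].
  by move=> z Dz; apply: Rplus_le_le_0_compat; [case: nh => _|case: nk => _]; apply.
have hle : IB h B.
  apply: IB_le hB => // z Dz; case: nk => _ /(_ z Dz) ?; lra.
have kle : IB k B.
  apply: IB_le hB => // z Dz; case: nh => _ /(_ z Dz) ?; lra.
have [b1 [_ E1]] := IB_real nh hle; have [b2 [_ E2]] := IB_real nk kle.
exists b1, b2; rewrite /IB E1 E2; do 2 (split => //).
by move: hB; rewrite /IB IntD // E1 E2 -EFinD lee_fin => /RleP.
Qed.

Lemma ball_le_box (a : C) (r : R) (z : PL) : Rlt (Cmod (Cminus z a)) r -> (ball a.1 r `*` ball a.2 r) z.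
Proof.
move=> h; have := Rmax_Cmod (Cminus z a) => M.
split; rewrite /ball /= distrC; apply/RltP; apply: Rle_lt_trans h; apply: Rle_trans M.
  by apply: Rle_trans (Rmax_l _ _); rewrite RabsE; right.
by apply: Rle_trans (Rmax_r _ _); rewrite RabsE; right.
Qed.

Lemma mu_box (a b r : R) : 0 <= r -> mu (ball a r `*` ball b r) = ((r *+ 2) * (r *+ 2))%:E.
Proof.
move=> r0; rewrite product_measure1E; [|exact: measurable_ball|exact: measurable_ball].
by rewrite EFinM; congr (_ * _)%E; exact: lebesgue_measure_ball.
Qed.

Lemma ilt_ge0 x y : Rle 0 (ilt x y).
Proof. by rewrite /ilt; case: Rlt_dec => ? /=; [exact: Rle_0_1|exact: Rle_refl]. Qed.

Lemma ile_ge0 x y : Rle 0 (ile x y).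
Proof. by rewrite /ile; case: Rle_dec => ? /=; [exact: Rle_0_1|exact: Rle_refl]. Qed.

Lemma nn_ball a r : nn (fun z => ilt (Cmod (Cminus z a)) r).
Proof.
split; first by apply: meas_ilt; [exact: meas_dist|exact: meas_const].
by move=> z _; exact: ilt_ge0.
Qed.

(** The disc lies in a square of side 2r; 4 in place of pi is good enough throughout. *)
Lemma IB_area a r : Rle 0 r -> IB (fun z => ilt (Cmod (Cminus z a)) r) (Rmult 4 (Rmult r r)).
Proof.
move=> /RleP r0; pose box : set PL := ball a.1 r `*` ball a.2 r.
have mb : measurable box by apply: measurableX; exact: measurable_ball.
apply: (@le_trans _ _ (\int[mu]_(z in (Disc : set PL)) (\1_box z)%:E)%E).
  apply: ge0_le_integral => //.
  - exact: measurable_Disc.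
  - by move=> z _; rewrite lee_fin; apply/RleP; exact: ilt_ge0.
  - by apply: nn_meas; exact: nn_ball.
  - by apply/measurable_EFinP; exact: measurable_indic.
  - move=> z _; rewrite lee_fin /ilt; case: Rlt_dec => [h|?] /=; last by rewrite indicE ler0n.
    by rewrite indicE mem_set //; exact: ball_le_box.
rewrite integral_indic //; last exact: measurable_Disc.
apply: (@le_trans _ _ (mu box)).
  by apply: le_measure; rewrite ?inE //; apply: measurableI => //; exact: measurable_Disc.
by rewrite mu_box // lee_fin !RmultE; apply/RleP; rewrite !mulr2n -!RplusE -!RmultE; lra.
Qed.

(** The square of side r with the same centre lies in the disc, its corners being at distance r/sqrt
    2. *)
Lemma Int_area_ge a r : Rle 0 r -> Rle (Rplus (Cmod a) r) 1 ->
  ((Rmult r r)%:E <= Int (fun z => ilt (Cmod (Cminus z a)) r))%E.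
Proof.
move=> /RleP r0 ar; pose box : set PL := ball a.1 (r / 2) `*` ball a.2 (r / 2).
have mb : measurable box by apply: measurableX; exact: measurable_ball.
have r20 : 0 <= r / 2 by rewrite divr_ge0.
have bin z : box z -> Rlt (Cmod (Cminus z a)) r.
  move=> [/=]; rewrite /ball /= => /RltP b1 /RltP b2.
  rewrite -RabsE in b1; rewrite -RabsE in b2.
  apply: Rle_lt_trans (Cmod_2Rmax _) _.
  have sp := sqrt_pos 2; have ss := sqrt_sqrt 2 ltac:(lra).
  have E1 : Rabs (Cminus z a).1 = Rabs (a.1 - z.1) by rewrite -Rabs_Ropp; congr Rabs; simpl; ring.
  have E2 : Rabs (Cminus z a).2 = Rabs (a.2 - z.2) by rewrite -Rabs_Ropp; congr Rabs; simpl; ring.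
  have r2E : r / 2 = Rdiv r 2 by rewrite RdivE.
  rewrite r2E in b1 b2.
  have bm : Rlt (Rmax (Rabs (Cminus z a).1) (Rabs (Cminus z a).2)) (Rdiv r 2).
    by apply: Rmax_lub_lt; rewrite ?E1 ?E2.
  have m0 : Rle 0 (Rmax (Rabs (Cminus z a).1) (Rabs (Cminus z a).2)).
    by apply: Rle_trans (Rmax_l _ _); exact: Rabs_pos.
  nra.
have binD z : box z -> Disc z.
  move=> /bin h; apply/DiscE; have := Cmod_sub_ge z a => h1; lra.
apply: (@le_trans _ _ (\int[mu]_(z in (Disc : set PL)) (\1_box z)%:E)%E).
  rewrite integral_indic //; last exact: measurable_Disc.
  have -> : box `&` Disc = box by apply/setIidPl => z; exact: binD.
  have h2 : r / 2 *+ 2 = r by rewrite mulr2n -splitr.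
  by rewrite [leRHS](mu_box a.1 a.2 r20) h2.
apply: ge0_le_integral => //.
- exact: measurable_Disc.
- by apply/measurable_EFinP; exact: measurable_indic.
- by apply: nn_meas; exact: nn_ball.
- move=> z _; rewrite lee_fin indicE; case: (boolP (z \in box)) => [|_]; last by apply/RleP; exact: ilt_ge0.
  by rewrite inE => /bin h; rewrite /ilt; case: Rlt_dec.
Qed.

Lemma IB_area_ge c a r B : Rle 0 c -> Rle 0 r -> Rle (Rplus (Cmod a) r) 1 ->
  IB (fun z => Rmult c (ilt (Cmod (Cminus z a)) r)) B -> Rle (Rmult c (Rmult r r)) B.
Proof.
move=> c0 r0 ar; rewrite /IB IntZ //; last exact: nn_ball.
move=> h; apply/RleP; rewrite -lee_fin; apply: le_trans h.
rewrite EFinM; apply: lee_wpmul2l; first by rewrite lee_fin; apply/RleP.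
exact: Int_area_ge.
Qed.

Lemma pw_ge0 x p : Rle 0 (pw x p).
Proof. by apply/RleP; exact: powR_ge0. Qed.

Lemma pw_gt0 x p : Rlt 0 x -> Rlt 0 (pw x p).
Proof. by move=> /RltP x0; apply/RltP; exact: powR_gt0. Qed.

Lemma pw_le x y p : Rle 0 p -> Rle 0 x -> Rle x y -> Rle (pw x p) (pw y p).
Proof.
move=> /RleP p0 /RleP x0 /RleP xy; apply/RleP; apply: ge0_ler_powR => //; rewrite nnegrE //.
exact: le_trans xy.
Qed.

Lemma pw_mult x y p : Rle 0 x -> Rle 0 y -> pw (Rmult x y) p = Rmult (pw x p) (pw y p).
Proof. by move=> /RleP x0 /RleP y0; exact: powRM. Qed.

Lemma pw_plus x p q : Rlt 0 x -> pw x (Rplus p q) = Rmult (pw x p) (pw x q).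
Proof. by move=> /RltP x0; apply: powRD; rewrite (gt_eqF x0) implybT. Qed.

Lemma pw_pw x p q : pw (pw x p) q = pw x (Rmult p q).
Proof. by rewrite /pw powRrM. Qed.

Lemma pw_1 x : Rle 0 x -> pw x 1 = x.
Proof. by move=> /RleP x0; exact: powRr1. Qed.

Lemma pw_one p : pw 1 p = 1.
Proof. by rewrite /pw powR1. Qed.

Lemma pw_0r x : pw x 0 = 1.
Proof. exact: powRr0. Qed.

Lemma pw_0 p : p <> 0 -> pw 0 p = 0.
Proof. by move=> /eqP p0; exact: powR0. Qed.

Lemma pw_opp x p : pw x (Ropp p) = Rinv (pw x p).
Proof. exact: powRN. Qed.

Lemma pw_nat x n : Rle 0 x -> pw x (INR n) = pow x n.
Proof. by move=> /RleP x0; rewrite INRE RpowE /pw powR_mulrn. Qed.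

Lemma Int_setE (E : C -> R -> R) h r : (forall z, E z r = 0 \/ E z r = 1) ->
  Int (fun z => Rmult (E z r) (h z)) =
  (\int[mu]_(z in ((Disc : set PL) `&` [set z | E z r = 1%R])) (h z)%:E)%E.
Proof.
move=> E01; rewrite integral_mkcondr; apply: eq_integral => z _.
rewrite patchE; case: (boolP (z \in _)) => [|/negP zE].
  by rewrite inE /= => ->; rewrite RmultE mul1r.
by case: (E01 z) => Ez; rewrite ?Ez ?RmultE ?mul0r //; case: zE; rewrite inE.
Qed.

Lemma ilt01 x y : ilt x y = 0 \/ ilt x y = 1.
Proof. by rewrite /ilt; case: Rlt_dec => h; [right|left]. Qed.

Lemma ile01 x y : ile x y = 0 \/ ile x y = 1.
Proof. by rewrite /ile; case: Rle_dec => h; [right|left]. Qed.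

Lemma ilt1 x y : ilt x y = 1 <-> Rlt x y.
Proof.
rewrite /ilt; case: Rlt_dec => h; split => // /eqP; by rewrite eq_sym oner_eq0.
Qed.

Lemma ile1 x y : ile x y = 1 <-> Rle x y.
Proof.
rewrite /ile; case: Rle_dec => h; split => // /eqP; by rewrite eq_sym oner_eq0.
Qed.

(** * A Schur-type bound from Tonelli's theorem *)

Section TonelliKernel.
Context d (T : measurableType d) (K : realType) (m : {sigma_finite_measure set T -> \bar K}).
Variables (D : set T) (k : T * T -> K) (h H : T -> K) (M : K).
Hypotheses (mD : measurable D) (mk : measurable_fun (D `*` D) k)
  (mh : measurable_fun D h) (mH : measurable_fun D H).
Hypothesis k0 : forall z w, D z -> D w -> 0 <= k (z, w).
Hypothesis h0 : forall z, D z -> 0 <= h z.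
Hypothesis H0 : forall z, D z -> 0 <= H z.
Hypothesis M0 : 0 <= M.
Hypothesis Hk : forall z, D z -> ((H z)%:E <= \int[m]_(w in D) (k (z, w) * h w)%:E)%E.
Hypothesis kM : forall w, D w -> (\int[m]_(z in D) (k (z, w))%:E <= M%:E)%E.

(** Extension by 0 makes the integrand measurable and nonnegative on the whole product, where
    Tonelli's theorem applies. *)
Let F : T * T -> \bar K := (fun x => (k x * h x.2)%:E) \_ (D `*` D).

Let F0 x : (0 <= F x)%E.
Proof.
rewrite /F patchE; case: ifPn => // /set_mem [d1 d2].
by rewrite lee_fin mulr_ge0 //; [case: x d1 d2 => z w; exact: k0|exact: h0].
Qed.

Let mF : measurable_fun setT F.
Proof.
apply/(measurable_restrictT _ _).1; first exact: measurableX.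
apply/measurable_EFinP; apply: measurable_funM => //.
apply: (measurable_comp (f := h) mD _ mh); first by move=> _ [x [_ x1] <-].
exact: measurable_funTS measurable_snd.
Qed.

Let FE1 z : D z -> (\int[m]_w F (z, w))%E = (\int[m]_(w in D) (k (z, w) * h w)%:E)%E.
Proof.
move=> Dz; rewrite [RHS]integral_mkcond; apply: eq_integral => w _.
rewrite /F !patchE; case: (boolP (w \in D)) => wD.
  by rewrite ifT //; apply/mem_set; split => //=; exact: set_mem wD.
by rewrite ifF //; apply/negP => /set_mem [_ /= /mem_set]; rewrite (negbTE wD).
Qed.

Let FE2 w : D w -> (\int[m]_z F (z, w))%E = (\int[m]_(z in D) ((h w)%:E * (k (z, w))%:E))%E.
Proof.
move=> Dw; rewrite [RHS]integral_mkcond; apply: eq_integral => z _.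
rewrite /F !patchE; case: (boolP (z \in D)) => zD.
  by rewrite ifT -?EFinM ?(mulrC (h w)) //; apply/mem_set; split => //=; exact: set_mem zD.
by rewrite ifF //; apply/negP => /set_mem [/= /mem_set]; rewrite (negbTE zD).
Qed.

Let FE0 w : ~ D w -> (\int[m]_z F (z, w))%E = 0%E.
Proof.
move=> Dw; apply: integral0_eq => z _; rewrite /F patchE ifF //.
by apply/negP => /set_mem [_ /=].
Qed.

Let mkw w : D w -> measurable_fun D (fun z => k (z, w)).
Proof.
move=> Dw.
apply: (measurable_comp (F := D `*` D) (f := k) (g := fun z : T => (z, w))) => //.
- exact: measurableX.
- by move=> _ [z Dz <-]; split.
- by apply: measurable_funTS; exact: pair2_measurable.
Qed.

Lemma tonelli_kernel : (\int[m]_(z in D) (H z)%:E <= M%:E * \int[m]_(z in D) (h z)%:E)%E.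
Proof.
apply: (@le_trans _ _ (\int[m]_z \int[m]_w F (z, w))%E).
  rewrite integral_mkcond; apply: ge0_le_integral => //.
  - by move=> z _; rewrite patchE; case: ifPn => // /set_mem Dz; rewrite lee_fin; exact: H0.
  - by apply/(measurable_restrictT _ _).1 => //; apply/measurable_EFinP.
  - exact: (measurable_fun_fubini_tonelli_F F mF F0).
  - move=> z _; rewrite patchE; case: ifPn => [/set_mem Dz|_]; last exact: integral_ge0.
    by rewrite FE1 //; exact: Hk.
rewrite (fubini_tonelli F mF F0).
apply: (@le_trans _ _ (\int[m]_(w in D) (M%:E * (h w)%:E))%E); last first.
  by rewrite ge0_integralZl //; apply/measurable_EFinP.
rewrite [leRHS]integral_mkcond; apply: ge0_le_integral => //.
- by move=> w _; apply: integral_ge0.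
- exact: (measurable_fun_fubini_tonelli_G F mF F0).
- apply/(measurable_restrictT _ _).1 => //.
  by apply: measurable_funeM; apply/measurable_EFinP.
- move=> w _; rewrite patchE; case: ifPn => [/set_mem Dw|/negP Dw]; last first.
    by rewrite FE0 // => h'; apply: Dw; exact: mem_set.
  rewrite FE2 // ge0_integralZl //; last 3 first.
  - by apply/measurable_EFinP; exact: mkw.
  - by move=> z Dz; rewrite lee_fin; exact: k0.
  - by rewrite lee_fin; exact: h0.
  rewrite muleC; apply: lee_wpmul2r; last exact: kM.
  by rewrite lee_fin; exact: h0.
Qed.
End TonelliKernel.

(* The library's product measure is canonically sigma-finite only for (sub)probabilities,
   hence this copy of the Lebesgue measure of the plane. *)
Definition plane (K : realType) : set (measurableTypeR K * measurableTypeR K)%type -> \bar K :=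
  (@lebesgue_measure K \x @lebesgue_measure K)%E.

HB.instance Definition _ (K : realType) := Measure.on (@plane K).

Lemma plane_sigma_finite (K : realType) : sigma_finite setT (@plane K).
Proof.
exists (fun n => (ball (0 : K) n%:R : set (measurableTypeR K)) `*` (ball (0 : K) n%:R : set (measurableTypeR K))).
  apply/esym/seteqP; split => // z _.
  exists (Num.truncn (Num.max `|z.1| `|z.2|)).+1 => //=.
  have := truncnS_gt (Num.max `|z.1| `|z.2|).
  by rewrite gt_max => /andP[z1 z2]; split; rewrite /ball /= sub0r normrN.
move=> n; split; first by apply: measurableX; exact: measurable_ball.
have -> : @plane K (ball (0 : K) n%:R `*` ball (0 : K) n%:R) = ((n%:R *+ 2) * (n%:R *+ 2))%:E.
  rewrite [LHS]product_measure1E; [|exact: measurable_ball|exact: measurable_ball].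
  by rewrite EFinM; congr (_ * _)%E; exact: lebesgue_measure_ball.
by rewrite ltry.
Qed.

HB.instance Definition _ (K : realType) :=
  Measure_isSigmaFinite.Build _ _ _ (@plane K) (@plane_sigma_finite K).

Definition tonelli_plane (K : realType) :=
  @tonelli_kernel _ (measurableTypeR K * measurableTypeR K)%type K (@plane K).

Section Tonelli.
Variables (H h : C -> R) (k : C -> C -> R) (M B : R).
Hypotheses (nH : nn H) (nh : nn h) (mk : meas2 k).
Hypothesis k0 : forall z w, Rlt (Cmod z) 1 -> Rlt (Cmod w) 1 -> Rle 0 (k z w).
Hypothesis Hk : forall z, Rlt (Cmod z) 1 -> forall b, IB (fun w => Rmult (k z w) (h w)) b -> Rle (H z) b.
Hypothesis kM : forall w, Rlt (Cmod w) 1 -> IB (fun z => k z w) M.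
Hypothesis hB : IB h B.

Let nk w : Rlt (Cmod w) 1 -> nn (fun z => k z w).
Proof.
move=> Dw; split; last by move=> z Dz; exact: k0.
apply: (measurable_comp (F := D2) (f := fun x : PL * PL => k x.1 x.2 : (R : realType)) (g := fun z : PL => (z, w : PL))).
- exact: measurable_D2.
- by move=> _ [z Dz <-]; split => //=; apply/DiscE.
- exact: mk.
- by apply: measurable_funTS; exact: pair2_measurable.
Qed.

(** The hypothesis [Hk] quantifies over real bounds b instead of naming the integral, so where the
    inner integral is infinite it demands nothing and the comparison is trivial. *)
Lemma tonelli_bound : IB H (Rmult M B).
Proof.
have D0 : Rlt (Cmod (RtoC 0)) 1 by rewrite Cmod_0; exact: Rlt_0_1.
have M0 : Rle 0 M by exact: IB_ge0 (nk D0) (kM D0).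
rewrite /IB RmultE EFinM; apply: (@le_trans _ _ (M%:E * Int h)%E); last first.
  by apply: lee_wpmul2l => //; rewrite lee_fin; apply/RleP.
apply: (@tonelli_plane R Disc (fun x => k x.1 x.2) h H M measurable_Disc).
- exact: mk.
- by case: nh.
- by case: nH.
- by move=> z w /DiscE Dz /DiscE Dw; apply/RleP; exact: k0.
- by move=> z /DiscE Dz; apply/RleP; case: nh => _; apply.
- by move=> z /DiscE Dz; apply/RleP; case: nH => _; apply.
- by apply/RleP.
- move=> z /DiscE Dz.
  have nkh : nn (fun w => Rmult (k z w) (h w)).
    split; first by apply: meas_mult; [exact: meas2_section|case: nh].
    move=> w Dw; apply: Rmult_le_pos; [exact: k0|by case: nh => _; apply].
  have := Int_ge0 nkh; have := Hk Dz; rewrite /IB /Int.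
  case: (integral _ _ _) => [b| |] //= Hb _; last by rewrite leey.
  by rewrite lee_fin; apply/RleP; exact: Hb.
- by move=> w /DiscE Dw; exact: kM.
Qed.
End Tonelli.

(** * Change of variables under dilations *)

Section Dilation.
Variables (K : realType) (rho : K).
Hypothesis rho0 : 0 < rho.
Local Notation P := (measurableTypeR K * measurableTypeR K)%type.

Let dil (x : K) : K := rho * x.

Let mdil : measurable_fun setT (dil : measurableTypeR K -> measurableTypeR K).
Proof. exact: mulrl_measurable. Qed.

Let nrho : {nonneg K} := NngNum (ltW rho0).

Let push1 : {measure set (measurableTypeR K) -> \bar K} :=
  measure_function_pushforward__canonical__measure_function_Measure (@lebesgue_measure K) mdil.

(** By uniqueness of Lebesgue measure it is enough to compare the two measures on half-open
    intervals; the planar version then follows on rectangles. *)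
Lemma lebesgue_dilation (A : set (measurableTypeR K)) : measurable A ->
  lebesgue_measure A = mscale nrho push1 A.
Proof.
move=> mA; apply: (lebesgue_measure_unique (mu := mscale nrho push1)) => //.
move=> X [[a b] _ <-] /=; rewrite /mscale /push1 /= /pushforward /=.
have -> : dil @^-1` `]a, b]%classic = `](a / rho), (b / rho)]%classic.
  apply/seteqP; split => x /=; rewrite !in_itv /= /dil => /andP[h1 h2].
    by rewrite ltr_pdivrMr // ler_pdivlMr // mulrC h1 h2.
  by move: h1 h2; rewrite ltr_pdivrMr // ler_pdivlMr // mulrC => -> ->.
rewrite !lebesgue_measure_itv /= !lte_fin ltr_pM2r ?invr_gt0 //.
case: ifPn => _; last by rewrite mule0.
by rewrite -!EFinB -EFinM -mulrBl mulrC divfK // gt_eqF.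
Qed.

Let phi (z : P) : P := (rho * z.1, rho * z.2).

Let mphi : measurable_fun setT phi.
Proof.
apply: measurable_fun_pair.
  by apply: (measurableT_comp mdil); exact: measurable_fst.
by apply: (measurableT_comp mdil); exact: measurable_snd.
Qed.

Let nrho2 : {nonneg K} := NngNum (mulr_ge0 (ltW rho0) (ltW rho0)).

Let push2 : {measure set P -> \bar K} :=
  measure_function_pushforward__canonical__measure_function_Measure (@plane K) mphi.

Let plane_dilation (X : set P) : measurable X ->
  @plane K X = mscale nrho2 push2 X.
Proof.
move=> mX; apply: (product_measure_unique (m' := mscale nrho2 push2)) => //.
move=> A B mA mB.
change ((rho * rho)%:E * @plane K ((dil @^-1` A) `*` (dil @^-1` B)) =
  lebesgue_measure A * lebesgue_measure B)%E.
have mpre (S : set (measurableTypeR K)) : measurable S -> measurable (dil @^-1` S : set (measurableTypeR K)).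
  by move=> mS; rewrite -[X in measurable X]setTI; exact: mdil.
rewrite [X in (_ * X)%E](product_measure1E _ _); [|exact: mpre|exact: mpre].
rewrite [in RHS](lebesgue_dilation mA) [in RHS](lebesgue_dilation mB).
by rewrite /mscale /push1 /= /pushforward EFinM muleACA.
Qed.

Lemma integral_dilation (A : set P) (f : P -> \bar K) : measurable A -> measurable_fun A f ->
  (forall z, A z -> (0 <= f z)%E) ->
  (\int[@plane K]_(z in A) f z = (rho * rho)%:E * \int[@plane K]_(z in phi @^-1` A) f (phi z))%E.
Proof.
move=> mA mf f0.
rewrite (eq_measure_integral (mscale nrho2 push2)); last first.
  by move=> X mX _; exact: plane_dilation.
have f0' : {in A, forall z, (0 <= f z)%E} by move=> z; rewrite inE; exact: f0.
transitivity ((rho * rho)%:E * \int[push2]_(z in A) f z)%E; first by apply: ge0_integral_mscale.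
by rewrite [X in (_ * X)%E = _](ge0_integral_pushforward mphi (@plane K) mA mf f0').
Qed.
End Dilation.

Lemma IB_scale rho h B : Rlt 0 rho -> Rle rho 1 -> nn h ->
  IB (fun z => Rmult (ilt (Cmod z) rho) (h z)) B ->
  IB (fun z => h (Cmult (RtoC rho) z)) (Rdiv B (Rmult rho rho)).
Proof.
move=> /RltP rho0 /RleP rho1 nh.
rewrite /IB (Int_setE (E := fun z r => ilt (Cmod z) r)); last by move=> z; exact: ilt01.
pose phi (z : PL) : PL := (rho * z.1, rho * z.2).
have phiE z : phi z = Cmult (RtoC rho) z.
  by apply: injective_projections; rewrite /phi /=; simpl; rewrite -!RmultE; ring.
have phin z : Cmod (phi z) = rho * Cmod z.
  rewrite phiE Cmod_mult Cmod_R Rabs_right //; apply: Rle_ge; apply/RleP; exact: ltW.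
have -> : (Disc : set PL) `&` [set z | ilt (Cmod z) rho = 1] = [set z | Cmod z < rho].
  apply/seteqP; split => z /=.
    by move=> [_ /ilt1/RltP].
  by move=> h'; split; [exact: lt_le_trans h' rho1|apply/ilt1; apply/RltP].
set Dr := [set z : PL | Cmod z < rho].
have mDr : measurable Dr.
  have := measurable_fun_ltr measurable_Cmod (measurable_cst (rho : (R : realType))).
  by move=> /(_ measurableT [set true] I); rewrite setTI.
have DrD : Dr `<=` Disc by move=> z /= h'; exact: lt_le_trans h' rho1.
have mh : measurable_fun Dr (EFin \o (h : PL -> (R : realType))).
  apply: (measurable_funS measurable_Disc DrD).
  by apply/measurable_EFinP; case: nh.
have h0 z : Dr z -> (0 <= (h z)%:E)%E.
  by move=> /DrD/DiscE Dz; rewrite lee_fin; apply/RleP; case: nh => _; apply.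
have preD : phi @^-1` Dr = Disc.
  apply/seteqP; split => z /=; rewrite /Dr /= phin.
    by rewrite -[ltRHS]mulr1 ltr_pM2l.
  by move=> h'; rewrite -[ltRHS]mulr1 ltr_pM2l.
have := integral_dilation rho0 mDr mh h0; rewrite -/phi preD => E.
have -> : Int (fun z => h (Cmult (RtoC rho) z)) = (\int[@plane R]_(z in (Disc : set PL)) (EFin \o h) (phi z))%E.
  by apply: eq_integral => z _ /=; rewrite phiE.
have -> : (\int[mu]_(z in Dr) (h z)%:E)%E = (\int[@plane R]_(z in Dr) (EFin \o h) z)%E by [].
rewrite E => H; rewrite RdivE RmultE.
have rr0 : 0 < rho * rho by rewrite mulr_gt0.
by rewrite EFinM lee_pdivlMr // muleC.
Qed.

(** * Exhaustion of the disc and tails of integrals *)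

Definition radius (i : nat) : R := 1 - i.+1%:R^-1.

Lemma radius_lt1 i : radius i < 1.
Proof. by rewrite ltrBlDr ltrDl invr_gt0. Qed.

Lemma radius_ge0 i : 0 <= radius i.
Proof. by rewrite subr_ge0 invf_le1 ?ltr0n // ler1n. Qed.

Lemma radius_mono i j : (i <= j)%N -> radius i <= radius j.
Proof. by move=> ij; rewrite lerD2l lerN2 lef_pV2 ?posrE ?ltr0n // ler_nat. Qed.

Lemma IB_exhaust h B : nn h ->
  (forall r, Rle 0 r -> Rlt r 1 -> IB (fun z => Rmult (ile (Cmod z) r) (h z)) B) -> IB h B.
Proof.
move=> nh H.
pose F i : set PL := (Disc : set PL) `&` [set z | ile (Cmod z) (radius i) = 1].
have FE i : F i = [set z | Cmod z <= radius i].
  apply/seteqP; split => z /=.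
    by move=> [_ /ile1/RleP].
  move=> h'; split; last by apply/ile1; apply/RleP.
  exact: le_lt_trans h' (radius_lt1 i).
have UF : \bigcup_i F i = Disc.
  apply/seteqP; split => [z [i _ []] //|z Dz].
  have y0 : 0 < 1 - Cmod z by rewrite subr_gt0.
  have [i hi] : exists i, Cmod z <= radius i.
    exists (Num.truncn (1 - Cmod z)^-1).
    rewrite lerBrDl -lerBrDr -[leRHS]invrK lef_pV2 ?posrE ?ltr0n ?invr_gt0 //.
    by apply: ltW; exact: truncnS_gt.
  by exists i => //; rewrite FE.
have mF i : measurable (F i).
  rewrite FE; have := measurable_fun_ler measurable_Cmod (measurable_cst (radius i : (R : realType))).
  by move=> /(_ measurableT [set true] I); rewrite setTI.
have FD i : F i `<=` Disc by move=> z [].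
have cv : (\int[mu]_(x in F i) (EFin \o h) x @[i --> \oo] --> \int[mu]_(x in \bigcup_i F i) (EFin \o h) x)%E.
  apply: ge0_nondecreasing_set_cvg_integral => //.
  - move=> i j ij; apply/subsetPset; rewrite !FE => z /= h'; apply: le_trans h' _.
    exact: radius_mono.
  - by move=> i; apply: (measurable_funS measurable_Disc (FD i)); apply/measurable_EFinP; case: nh.
  - by move=> i z /FD/DiscE Dz; rewrite lee_fin; apply/RleP; case: nh => _; apply.
rewrite UF in cv; rewrite /IB /Int -(cvg_lim _ cv) //.
apply: lime_le; first by apply: cvgP cv.
apply: nearW => i.
have := H _ (elimT RleP (radius_ge0 i)) (elimT RltP (radius_lt1 i)).
by rewrite /IB (Int_setE (E := fun z r => ile (Cmod z) r)) // => z; exact: ile01.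
Qed.

(** If no concentric disc carried more than b - e of the total mass b, [IB_exhaust] would bound the
    whole mass by b - e. Once a disc carries more, less than e is left outside it. *)
Lemma IB_tail h B : nn h -> IB h B -> forall e, Rlt 0 e ->
  exists r, Rle 0 r /\ Rlt r 1 /\ IB (fun z => Rmult (ilt r (Cmod z)) (h z)) e.
Proof.
move=> nh hB e e0.
have [b [_ hb]] := IB_real nh hB.
have nE (E : C -> R -> R) r : (forall z : C, E z r = 0 \/ E z r = 1) -> meas (fun z => E z r) -> nn (fun z => Rmult (E z r) (h z)).
  move=> E01 mE; split; first by apply: meas_mult => //; case: nh.
  move=> z Dz; apply: Rmult_le_pos; last by case: nh => _; apply.
  by case: (E01 z) => ->; [exact: Rle_refl|exact: Rle_0_1].
have n1 r : nn (fun z => Rmult (ile (Cmod z) r) (h z)).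
  apply: (nE (fun z r => ile (Cmod z) r)); first by move=> z; exact: ile01.
  by apply: meas_ile; [exact: meas_Cmod|exact: meas_const].
have n2 r : nn (fun z => Rmult (ilt r (Cmod z)) (h z)).
  apply: (nE (fun z r => ilt r (Cmod z))); first by move=> z; exact: ilt01.
  by apply: meas_ilt; [exact: meas_const|exact: meas_Cmod].
have [[r [r0 [r1 hr]]]|no] := pselect (exists r, Rle 0 r /\ Rlt r 1 /\
    ~ IB (fun z => Rmult (ile (Cmod z) r) (h z)) (Rminus b e)); last first.
  have : IB h (Rminus b e).
    apply: IB_exhaust => // r r0 r1; apply: contrapT => hr; apply: no; exists r; split => //.
  rewrite /IB hb lee_fin => /RleP; lra.
exists r; do 2 (split => //).
have sumE : IB (fun z => Rplus (Rmult (ile (Cmod z) r) (h z)) (Rmult (ilt r (Cmod z)) (h z))) b.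
  rewrite /IB; set S := Int _; have -> : S = Int h; last by rewrite hb.
  congr Int; apply/funext => z; rewrite /ile /ilt.
  by case: Rle_dec => h1; case: Rlt_dec => h2; 
    rewrite ?RplusE ?RmultE ?mul1r ?mul0r ?addr0 ?add0r //; exfalso; lra.
have [B1 [B2 [k1 [k2 k12]]]] := IB_split (n1 r) (n2 r) sumE.
apply: IB_weak k2; apply: Rnot_lt_le => e2; apply: hr; apply: IB_weak k1; lra.
Qed.

(** * Translation of the definitions into integral bounds *)

Lemma holo_hol f : holo f <-> hol f.
Proof.
split => H z.
  by move=> /DiscE /H [l hl]; exists l; apply/dlim_is_derive.
by move=> /DiscE /H [l hl]; exists l; apply/dlim_is_derive.
Qed.

Definition pinv : R := (pi : R)^-1.

Lemma pinv_gt0 : Rlt 0 pinv.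
Proof. by apply/RltP; rewrite invr_gt0 pi_gt0. Qed.

Lemma intdA_IB h : nn h -> (intdA h < +oo)%E <-> exists B, IB h B.
Proof.
move=> nh; have -> : intdA h = (pinv%:E * Int h)%E by [].
split.
  have := Int_ge0 nh; rewrite /IB; case: (Int h) => [b _ _| |] //=.
    by exists b.
  by rewrite gt0_muley // lte_fin; apply/RltP; exact: pinv_gt0.
move=> [B hB]; have [b [_ ->]] := IB_real nh hB.
by rewrite -EFinM ltry.
Qed.

Definition nrm (p : R) (f : C -> C) (z : C) : R := pw (Cmod (f z)) p.

Lemma nn_nrm p f : hol f -> nn (nrm p f).
Proof.
move=> hf; split; first by apply: meas_pw; exact: meas_hol.
by move=> z _; exact: pw_ge0.
Qed.

Lemma Bergman_hol p f : Bergman p f <-> hol f /\ exists B, IB (nrm p f) B.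
Proof.
rewrite /Bergman /Lpint; split => [[/holo_hol hf]|[hf]].
  by move=> /(intdA_IB (nn_nrm p hf)) h; split.
by move=> /(intdA_IB (nn_nrm p hf)) h; split => //; apply/holo_hol.
Qed.

Lemma Bnorm_ge0 p f : Rle 0 (Bnorm p f).
Proof. by apply/RleP; exact: powR_ge0. Qed.

Lemma Bnorm_fin p f b : Int (nrm p f) = b%:E -> Bnorm p f = pw (Rmult pinv b) (Rinv p).
Proof.
move=> E; rewrite /Bnorm; have -> : Lpint p f = (pinv%:E * Int (nrm p f))%E by [].
by rewrite E -EFinM.
Qed.

Lemma Bnorm_le p f B : Rlt 0 p -> hol f -> IB (nrm p f) B -> Rle (Bnorm p f) (pw (Rmult pinv B) (Rinv p)).
Proof.
move=> p0 hf hB; have [b [bB E]] := IB_real (nn_nrm p hf) hB.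
have b0 : Rle 0 b.
  by apply: (IB_ge0 (nn_nrm p hf)); rewrite /IB E.
rewrite (Bnorm_fin E); apply: pw_le.
- by left; exact: Rinv_0_lt_compat.
- by apply: Rmult_le_pos => //; left; exact: pinv_gt0.
- by apply: Rmult_le_compat_l => //; left; exact: pinv_gt0.
Qed.

Lemma IB_Bnorm p f M : Rlt 0 p -> Bergman p f -> Rle (Bnorm p f) M ->
  IB (nrm p f) (Rdiv (pw M p) pinv).
Proof.
move=> p0 /Bergman_hol [hf [B hB]]; have [b [bB E]] := IB_real (nn_nrm p hf) hB.
have b0 : Rle 0 b.
  by apply: (IB_ge0 (nn_nrm p hf)); rewrite /IB E.
rewrite (Bnorm_fin E) => H; rewrite /IB E lee_fin; apply/RleP.
have pp := pinv_gt0.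
have := pw_le (Rlt_le _ _ p0) (pw_ge0 _ _) H.
rewrite pw_pw Rinv_l; last by apply: Rgt_not_eq.
rewrite pw_1; last by apply: Rmult_le_pos => //; left.
move=> h; apply: (Rmult_le_reg_l pinv) => //; apply: Rle_trans h _; right.
by field; apply: Rgt_not_eq.
Qed.

(** An ultrafilter refining the filter of eventual properties contains all tails, hence is free. *)
Lemma exists_free_ultrafilter : exists U, free_ultrafilter U.
Proof.
have [G [GU FG]] := ultraFilterLemma (eventually_filter).
exists (fun A => G (fun j => A j)); split; [|split; [|split; [|split]]].
- by move=> A B AB; apply: filterS => j; exact: AB.
- by move=> A B; exact: filterI.
- by move=> A; exact: in_ultra_setVsetC.
- by move=> A /filter_ex.
- by move=> N; apply: FG; exists N => // j /=; move/ssrnat.leP.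
Qed.

Lemma bigop_csum n (F : nat -> C) : \big[Cplus/RtoC 0%R]_(k < n) F (nat_of_ord k) = csum n F.
Proof.
elim: n F => [|n IH] F; first by rewrite big_ord0.
have csumS m (G : nat -> C) : csum m.+1 G = Cplus (G 0%N) (csum m (fun k => G k.+1)).
  elim: m => [|m IHm]; first by rewrite /= Cplus_0_l Cplus_0_r.
  have -> : csum m.+2 G = Cplus (csum m.+1 G) (G m.+1) by [].
  by rewrite IHm -Cplus_assoc.
by rewrite big_ord_recl csumS -(IH (fun k => F k.+1)).
Qed.

Lemma Ig_Lop n g f : Ig n g f = Iop_n n (Lop n g f).
Proof. by rewrite /Ig; congr Iop_n; apply/funext => z; rewrite (bigop_csum n (fun k => Cmult (Cderiv_n k f z) (g k z))). Qed.

Lemma IB_value h B : nn h -> IB h B -> exists b, Rle 0 b /\ forall B', IB h B' <-> Rle b B'.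
Proof.
move=> nh hB; have [b [_ E]] := IB_real nh hB; exists b; split.
  by apply: (IB_ge0 nh); rewrite /IB E.
by move=> B'; rewrite /IB E lee_fin; split => /RleP.
Qed.

(** Young's inequality for the product of t and 1 with conjugate exponents p and p/(p-1). It is the
    tangent line of t^p at 1, used later to prove Jensen's inequality. *)
Lemma bernoulli_pw p t : Rlt 1 p -> Rle 0 t ->
  Rle (Rmult p t) (Rplus (pw t p) (Rminus p 1)).
Proof.
move=> p1 t0.
have p0 : 0 < p by apply/RltP; apply: Rlt_trans p1; exact: Rlt_0_1.
have p1' : 1 < p by apply/RltP.
have pn : p != 0 by rewrite gt_eqF.
have pn1 : p - 1 != 0 by rewrite subr_eq0 gt_eqF.
have t0' : 0 <= t by apply/RleP.
have q0 : 0 < p / (p - 1) by rewrite divr_gt0 // subr_gt0.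
have c : p^-1 + (p / (p - 1))^-1 = 1 by rewrite invf_div -[X in X + _]mul1r -mulrDl addrC subrK divff.
have := conjugate_powR t0' ler01 p0 q0 c.
rewrite mulr1 powR1 => H.
apply/RleP; have := ler_wpM2l (ltW p0) H.
suff -> : p * (t `^ p / p + 1 / (p / (p - 1))) = Rplus (pw t p) (Rminus p 1) by [].
by rewrite /pw RplusE RminusE mulrDr div1r invf_div [p * (_ / p)]mulrC divfK // [p * (_ / p)]mulrC divfK.
Qed.

End PlaneMeasure.
Import PlaneMeasure.

Section BergmanSpaces.
Local Open Scope R_scope.

(** * Inequalities for real powers *)

Lemma ilt_1 x y : x < y -> ilt x y = 1.
Proof. intros h. exact (proj2 (ilt1 x y) h). Qed.

Lemma ilt_0 x y : y <= x -> ilt x y = 0.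
Proof. intros h. unfold ilt. destruct (Rlt_dec x y) as [h'|h']; [lra|reflexivity]. Qed.

Lemma ile_1 x y : x <= y -> ile x y = 1.
Proof. intros h. exact (proj2 (ile1 x y) h). Qed.

Lemma ile_0 x y : y < x -> ile x y = 0.
Proof. intros h. unfold ile. destruct (Rle_dec x y) as [h'|h']; [lra|reflexivity]. Qed.

Lemma ilt_le1 x y : ilt x y <= 1.
Proof. destruct (Rlt_le_dec x y) as [h|h]; [rewrite (ilt_1 _ _ h)|rewrite (ilt_0 _ _ h)]; lra. Qed.

Lemma pw_one1 p : pw 1 p = 1.
Proof. exact (pw_one p). Qed.

Lemma pw_zero p : 0 < p -> pw 0 p = 0.
Proof. intros h. exact (pw_0 (p := p) (Rgt_not_eq _ _ h)). Qed.

Lemma pw_le1 x p : 0 <= p -> 0 <= x -> x <= 1 -> pw x p <= 1.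
Proof. intros hp h0 h1. rewrite <- (pw_one1 p). now apply pw_le. Qed.

Lemma pw_ge1 x p : 0 <= p -> 1 <= x -> 1 <= pw x p.
Proof. intros hp h1. rewrite <- (pw_one1 p). apply pw_le; lra. Qed.

Lemma pw_inv x p : 0 < p -> 0 <= x -> pw (pw x p) (/ p) = x.
Proof. intros hp hx. rewrite pw_pw, Rinv_r by lra. now apply pw_1. Qed.

Lemma pw_inv' x p : 0 < p -> 0 <= x -> pw (pw x (/ p)) p = x.
Proof. intros hp hx. rewrite pw_pw, Rinv_l by lra. now apply pw_1. Qed.

Lemma pw_le_rev x y p : 0 < p -> 0 <= x -> 0 <= y -> pw x p <= pw y p -> x <= y.
Proof.
intros hp hx hy h. rewrite <- (pw_inv x p), <- (pw_inv y p) by auto.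
apply pw_le; auto. left; now apply Rinv_0_lt_compat. apply pw_ge0.
Qed.

Lemma pw_div x y p : 0 <= x -> 0 < y -> pw (x / y) p = pw x p / pw y p.
Proof.
intros hx hy. unfold Rdiv.
assert (hy' : 0 < / y) by now apply Rinv_0_lt_compat.
rewrite pw_mult by lra. f_equal.
assert (E : pw y p * pw (/ y) p = 1) by (rewrite <- pw_mult, Rinv_r, pw_one1; lra).
assert (P : 0 < pw y p) by now apply pw_gt0.
apply (Rmult_eq_reg_l (pw y p)); [|lra]. rewrite E, Rinv_r; lra.
Qed.

Lemma pw_small_exp t p : 0 < p -> p <= 1 -> 0 <= t -> t <= 1 -> t <= pw t p.
Proof.
intros hp h1 h0 ht. destruct (Rle_lt_or_eq_dec 0 t h0) as [tp|<-].
2:{ rewrite pw_zero; lra. }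
rewrite <- (pw_1 (x := t)) at 1 by auto.
replace 1 with (p + (1 - p)) at 1 by ring. rewrite pw_plus by auto.
assert (A := pw_le1 t (1 - p) ltac:(lra) h0 ht).
assert (B := pw_ge0 t p). nra.
Qed.

Lemma pw_large_exp t p q : 0 <= q -> q <= p -> 0 <= t -> t <= 1 -> 0 < q -> pw t p <= pw t q.
Proof.
intros hq hqp h0 ht q0. destruct (Rle_lt_or_eq_dec 0 t h0) as [tp|<-].
2:{ rewrite !pw_zero; lra. }
replace p with (q + (p - q)) by ring. rewrite pw_plus by auto.
assert (A := pw_le1 t (p - q) ltac:(lra) h0 ht).
assert (B := pw_ge0 t q). nra.
Qed.

Lemma pw_add_le x y p : 0 < p -> 0 <= x -> 0 <= y -> pw (x + y) p <= pw 2 p * (pw x p + pw y p).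
Proof.
intros hp hx hy.
assert (A := pw_ge0 x p). assert (B := pw_ge0 y p). assert (D := pw_ge0 2 p).
destruct (Rle_lt_dec x y) as [h|h].
- apply Rle_trans with (pw (2 * y) p). apply pw_le; lra. rewrite pw_mult by lra. nra.
- apply Rle_trans with (pw (2 * x) p). apply pw_le; lra. rewrite pw_mult by lra. nra.
Qed.

(** With (1 + D)^p = 1 + e, the case y at most D x costs only the factor 1 + e on x^p, and otherwise
    x is absorbed into y. A constant near 1 is what later permits absorption. *)
Lemma pw_add_eps p e : 0 < p -> 0 < e -> exists K, 0 < K /\ forall x y, 0 <= x -> 0 <= y ->
  pw (x + y) p <= (1 + e) * pw x p + K * pw y p.
Proof.
intros hp he. set (D := pw (1 + e) (/ p) - 1).
assert (ED : pw (1 + D) p = 1 + e) by (unfold D; replace (1 + (pw (1 + e) (/ p) - 1)) with (pw (1 + e) (/ p)) by ring; apply pw_inv'; lra).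
assert (Dp : 0 < D).
  apply Rnot_le_lt. intros h.
  assert (pw (1 + D) p <= 1). apply pw_le1; try lra. unfold D. generalize (pw_ge0 (1 + e) (/ p)); lra. lra.
exists (pw (/ D + 1) p). split. apply pw_gt0. generalize (Rinv_0_lt_compat D Dp); lra.
intros x y hx hy. assert (A := pw_ge0 x p). assert (B := pw_ge0 y p).
assert (E := pw_ge0 (/ D + 1) p).
destruct (Rle_lt_dec y (D * x)) as [h|h].
- apply Rle_trans with (pw ((1 + D) * x) p). apply pw_le; lra.
  rewrite pw_mult by lra. rewrite ED. nra.
- assert (Di : 0 < / D) by now apply Rinv_0_lt_compat.
  apply Rle_trans with (pw ((/ D + 1) * y) p).
  apply pw_le; try lra. assert (x <= / D * y). apply (Rmult_le_reg_l D); auto. rewrite <- Rmult_assoc, Rinv_r; lra. lra.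
  rewrite pw_mult by lra. nra.
Qed.

(** After division by x + y both numbers lie in [0,1], where t is at most t^p; the two fractions add
    up to 1. *)
Lemma pw_subadd x y p : 0 < p -> p <= 1 -> 0 <= x -> 0 <= y -> pw (x + y) p <= pw x p + pw y p.
Proof.
intros hp h1 hx hy. destruct (Rle_lt_or_eq_dec 0 (x + y) ltac:(lra)) as [s|s].
2:{ rewrite <- s, pw_zero by auto. generalize (pw_ge0 x p) (pw_ge0 y p); lra. }
assert (H : forall u, 0 <= u -> u <= x + y -> u / (x + y) * pw (x + y) p <= pw u p).
  intros u hu hs.
  assert (E : pw u p = pw (u / (x + y)) p * pw (x + y) p).
    rewrite <- pw_mult; try lra. f_equal. field. lra. apply Rdiv_le_0_compat; lra.
  rewrite E. apply Rmult_le_compat_r. apply pw_ge0. apply pw_small_exp; auto.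
  apply Rdiv_le_0_compat; lra. apply (Rmult_le_reg_r (x + y)); auto. unfold Rdiv. rewrite Rmult_assoc, Rinv_l; lra.
assert (H1 := H x hx ltac:(lra)). assert (H2 := H y hy ltac:(lra)).
replace (pw (x + y) p) with (x / (x + y) * pw (x + y) p + y / (x + y) * pw (x + y) p). lra. field. lra.
Qed.

(** Compare Y^q with e X^(p-q). If it is smaller, the first term dominates alone; otherwise X is
    below (Y^q/e)^(1/(p-q)), and substituting this yields the second term with its exact
    constant. *)
Lemma young_pw p q e X Y : 0 < q -> q < p -> 0 < e -> 0 <= X -> 0 <= Y ->
  pw X q * pw Y q <= e * pw X p + pw e (- (q / (p - q))) * pw Y (p * q / (p - q)).
Proof.
intros hq hqp he hX hY.
assert (A := pw_ge0 X p). assert (B := pw_ge0 Y (p * q / (p - q))). assert (D := pw_ge0 e (- (q / (p - q)))).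
destruct (Rle_lt_or_eq_dec 0 X hX) as [Xp|<-]. 2:{ rewrite (pw_zero q) by auto. nra. }
assert (EX : pw X p = pw X q * pw X (p - q)) by (rewrite <- pw_plus; [f_equal; ring|auto]).
destruct (Rle_lt_dec (pw Y q) (e * pw X (p - q))) as [h|h].
- assert (G := pw_ge0 X q). rewrite EX in *. nra.
- assert (Yp : 0 < Y).
    destruct (Rle_lt_or_eq_dec 0 Y hY) as [|E]; auto. rewrite <- E, (pw_zero q) in h by auto.
    generalize (pw_ge0 X (p - q)); nra.
  set (v := / (p - q)). assert (vp : 0 < v) by (apply Rinv_0_lt_compat; lra).
  assert (ei : 0 < / e) by now apply Rinv_0_lt_compat.
  assert (HX : X <= pw (/ e * pw Y q) v).
    unfold v. rewrite <- (pw_inv X (p - q)) at 1 by lra. apply pw_le. left; exact vp. apply pw_ge0.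
    left. apply (Rmult_lt_reg_l e); auto. rewrite <- Rmult_assoc, Rinv_r, Rmult_1_l by lra. exact h.
  assert (HXq : pw X q <= pw (pw (/ e * pw Y q) v) q) by (apply pw_le; lra).
  assert (E : pw (pw (/ e * pw Y q) v) q = pw e (- (q / (p - q))) * pw Y (q * q / (p - q))).
    rewrite pw_pw, pw_mult by (try apply pw_ge0; lra). rewrite pw_pw. f_equal.
    rewrite pw_opp. replace (/ e) with (1 / e) by (field; lra). rewrite pw_div, pw_one1 by lra.
    unfold Rdiv. rewrite Rmult_1_l. do 2 f_equal. unfold v. ring.
    f_equal. unfold v, Rdiv. ring.
  rewrite E in HXq.
  assert (EY : pw Y (p * q / (p - q)) = pw Y (q * q / (p - q)) * pw Y q).
    rewrite <- pw_plus by auto. f_equal. field. lra.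
  rewrite EY. assert (G := pw_ge0 Y q).
  assert (pw X q * pw Y q <= pw e (- (q / (p - q))) * pw Y (q * q / (p - q)) * pw Y q) by (apply Rmult_le_compat_r; auto).
  nra.
Qed.

(** * Nonnegative measurable functions, the distance to the circle, finite sums *)

Lemma nn_plus h k : nn h -> nn k -> nn (fun z => h z + k z).
Proof.
intros [m1 p1] [m2 p2]. split. now apply meas_plus.
intros z Dz. specialize (p1 z Dz). specialize (p2 z Dz). lra.
Qed.

Lemma nn_mult h k : nn h -> nn k -> nn (fun z => h z * k z).
Proof.
intros [m1 p1] [m2 p2]. split. now apply meas_mult.
intros z Dz. apply Rmult_le_pos; auto.
Qed.

Lemma nn_const c : 0 <= c -> nn (fun _ => c).
Proof. intros h. split. apply meas_const. auto. Qed.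

Lemma nn_scal c h : 0 <= c -> nn h -> nn (fun z => c * h z).
Proof. intros hc hh. apply (nn_mult (fun _ => c)); auto. now apply nn_const. Qed.

Lemma nn_pw h p : meas h -> nn (fun z => pw (h z) p).
Proof. intros m. split. now apply meas_pw. intros; apply pw_ge0. Qed.

Lemma nn_ilt h k : meas h -> meas k -> nn (fun z => ilt (h z) (k z)).
Proof. intros m1 m2. split. now apply meas_ilt. intros; apply ilt_ge0. Qed.

Lemma nn_ile h k : meas h -> meas k -> nn (fun z => ile (h z) (k z)).
Proof. intros m1 m2. split. now apply meas_ile. intros; apply ile_ge0. Qed.

Lemma nn_ext h k : (forall z, Cmod z < 1 -> h z = k z) -> nn h -> nn k.
Proof.
intros E [m p]. split. now apply (meas_ext (h := h)). intros z Dz. rewrite <- E; auto.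
Qed.

Definition dd (z : C) : R := 1 - Cmod z.

Lemma meas_dd : meas dd.
Proof. apply meas_minus. apply meas_const. apply meas_Cmod. Qed.

Lemma nn_dd a : nn (fun z => pw (dd z) a).
Proof. apply nn_pw, meas_dd. Qed.

Lemma dd_pos z : Cmod z < 1 -> 0 < dd z.
Proof. unfold dd; lra. Qed.

Lemma dd_le1 z : dd z <= 1.
Proof. unfold dd; generalize (Cmod_ge_0 z); lra. Qed.

Lemma dd_lip z w : dd z <= dd w + Cmod (z - w)%C.
Proof. unfold dd. generalize (Cmod_sub_ge w z). rewrite Cmod_sub_sym. lra. Qed.

Lemma IB_ext h k B : (forall z, Cmod z < 1 -> h z = k z) -> nn h -> IB h B -> IB k B.
Proof.
intros E nh. apply IB_le; auto. now apply (nn_ext h). intros z Dz. rewrite E; auto. lra.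
Qed.

Lemma IB_const c : 0 <= c -> IB (fun _ => c) (4 * c).
Proof.
intros hc. assert (A := IB_area 0%C (r := 1) Rle_0_1).
apply (IB_scal hc) in A. 2: apply nn_ball.
apply (IB_weak (B := c * (4 * (1 * 1)))). lra.
revert A. apply IB_le. now apply nn_const. apply nn_scal; auto. apply nn_ball.
intros z Dz. rewrite ilt_1. lra. replace (z - 0)%C with z by ring. auto.
Qed.

Fixpoint rsum (n : nat) (F : nat -> R) : R := match n with O => 0 | S n => rsum n F + F n end.

Lemma rsum_le n F G : (forall i, (i < n)%nat -> F i <= G i) -> rsum n F <= rsum n G.
Proof. intros H. induction n as [|n IH]; simpl. lra. apply Rplus_le_compat; auto. Qed.

Lemma rsum_ext n F G : (forall i, (i < n)%nat -> F i = G i) -> rsum n F = rsum n G.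
Proof. intros H. induction n as [|n IH]; simpl. auto. rewrite IH, H; auto. Qed.

Lemma rsum_ge0 n F : (forall i, (i < n)%nat -> 0 <= F i) -> 0 <= rsum n F.
Proof. intros H. induction n as [|n IH]; simpl. lra. apply Rplus_le_le_0_compat; auto. Qed.

Lemma rsum_scal n c F : rsum n (fun i => c * F i) = c * rsum n F.
Proof. induction n as [|n IH]; simpl. ring. rewrite IH. ring. Qed.

Lemma rsum_plus n F G : rsum n (fun i => F i + G i) = rsum n F + rsum n G.
Proof. induction n as [|n IH]; simpl. ring. rewrite IH. ring. Qed.

Lemma rsum_term n F i : (forall i, (i < n)%nat -> 0 <= F i) -> (i < n)%nat -> F i <= rsum n F.
Proof.
intros H. induction n as [|n IH]; intros Hi. lia. simpl.
assert (A : 0 <= rsum n F) by (apply rsum_ge0; auto). assert (B := H n ltac:(lia)).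
destruct (Nat.eq_dec i n) as [->|ne]. lra. specialize (IH ltac:(auto) ltac:(lia)). lra.
Qed.

Lemma nn_rsum n (h : nat -> C -> R) : (forall i, (i < n)%nat -> nn (h i)) -> nn (fun z => rsum n (fun i => h i z)).
Proof.
intros H. induction n as [|n IH]; simpl. apply nn_const; lra. apply nn_plus; auto.
Qed.

Lemma IB_rsum n (h : nat -> C -> R) B : (forall i, (i < n)%nat -> nn (h i)) ->
  (forall i, (i < n)%nat -> IB (h i) (B i)) -> IB (fun z => rsum n (fun i => h i z)) (rsum n B).
Proof.
intros H HB. induction n as [|n IH]; simpl.
- apply (IB_weak (B := 4 * 0)). lra. apply IB_const; lra.
- apply IB_plus; auto. apply nn_rsum; auto.
Qed.

(** The individual bounds [v i] add up to at most the bound of the sum, so later estimates of each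
    term can be summed without depending on [n]. *)
Lemma IB_rsum_split n (h : nat -> C -> R) B : (forall i, (i < n)%nat -> nn (h i)) ->
  IB (fun z => rsum n (fun i => h i z)) B ->
  exists v, (forall i, (i < n)%nat -> IB (h i) (v i)) /\ rsum n v <= B.
Proof.
revert B. induction n as [|n IH]; intros B H HB; simpl in *.
- exists (fun _ => 0). split. intros; lia. simpl. apply (IB_ge0 (h := fun _ => 0)); auto. apply nn_const; lra.
- destruct (IB_split (h := fun z => rsum n (fun i => h i z)) (k := h n) (B := B)) as [B1 [B2 [h1 [h2 h3]]]]; auto.
  apply nn_rsum; auto.
  destruct (IH B1) as [v [hv1 hv2]]; auto.
  exists (fun i => if Nat.eq_dec i n then B2 else v i). split.
  + intros i Hi. destruct (Nat.eq_dec i n) as [->|ne]; auto. apply hv1; lia.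
  + simpl. destruct (Nat.eq_dec n n) as [_|ne]; [|lia].
    rewrite (rsum_ext _ _ v). lra. intros i Hi. destruct (Nat.eq_dec i n); [lia|auto].
Qed.

Lemma pw_rsum n p F : 0 < p -> (forall i, (i < n)%nat -> 0 <= F i) ->
  pw (rsum n F) p <= pw 2 (INR n * p) * rsum n (fun i => pw (F i) p).
Proof.
intros hp H. induction n as [|n IH]; simpl rsum.
- rewrite pw_zero by auto. lra.
- assert (A : 0 <= rsum n F) by (apply rsum_ge0; auto). assert (B := H n ltac:(lia)).
  eapply Rle_trans; [apply pw_add_le; auto|].
  rewrite S_INR. replace ((INR n + 1) * p) with (p + INR n * p) by ring. rewrite pw_plus by lra.
  rewrite Rmult_assoc. apply Rmult_le_compat_l. apply pw_ge0.
  specialize (IH ltac:(auto)).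
  assert (C1 : 1 <= pw 2 (INR n * p)). apply pw_ge1. generalize (pos_INR n); nra. lra.
  assert (C2 := pw_ge0 (F n) p).
  apply Rle_trans with (pw 2 (INR n * p) * rsum n (fun i => pw (F i) p) + pw 2 (INR n * p) * pw (F n) p); nra.
Qed.

Lemma Cmod_csum n F : Cmod (csum n F) <= rsum n (fun i => Cmod (F i)).
Proof.
induction n as [|n IH]; simpl. rewrite Cmod_0; lra.
eapply Rle_trans; [apply Cmod_triangle|]. lra.
Qed.

(** * The local mean value inequality *)

(** Some point exceeds half of a positive supremum, so neither compactness nor an attained maximum
    is required. *)
Lemma near_sup (T : Type) (P : T -> Prop) (F : T -> R) M x0 : P x0 -> 0 < F x0 ->
  (forall w, P w -> F w <= M) -> exists w0, P w0 /\ 0 < F w0 /\ forall w, P w -> F w <= 2 * F w0.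
Proof.
intros h0 p0 hM.
destruct (completeness (fun y => exists w, P w /\ y = F w)) as [S [ub lub]].
- exists M. intros y [w [Pw ->]]. auto.
- exists (F x0), x0. auto.
- assert (S0 : F x0 <= S) by (apply ub; exists x0; auto).
  apply NNPP. intros no.
  assert (S <= S / 2); [|lra].
  apply lub. intros y [w [Pw ->]].
  apply Rnot_lt_le. intros h. apply no. exists w. split; [exact Pw|]. split; [lra|].
  intros w' Pw'. assert (F w' <= S) by (apply ub; exists w'; auto). lra.
Qed.

Lemma pw_inv_le X Y c p : 0 < p -> 0 <= X -> 0 <= Y -> 0 <= c ->
  pw X p <= c * pw Y p -> X <= pw c (/ p) * Y.
Proof.
intros hp hX hY hc h. apply (pw_le_rev _ _ p); auto.
- apply Rmult_le_pos; auto. apply pw_ge0.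
- rewrite pw_mult by (auto; apply pw_ge0). now rewrite pw_inv'.
Qed.

(* The Cauchy estimate on a disc where [f] is nearly maximal for the weight
   [|f w|^p (r - |w - a|)^2] replaces subharmonicity of [|f|^p]. *)
Lemma sub_mean_interior p : 0 < p -> exists K, 0 < K /\ forall f a r B, hol f -> 0 < r ->
  Cmod a + r < 1 -> IB (fun w => ilt (Cmod (w - a)%C) r * nrm p f w) B ->
  pw (Cmod (f a)) p * (r * r) <= K * B.
Proof.
intros hp. set (L := pw 8 (/ p)).
assert (L1 : 1 <= L). apply pw_ge1. left; now apply Rinv_0_lt_compat. lra.
assert (P2 : 0 < pw 2 p) by (apply pw_gt0; lra).
(* The quantity at a is at most twice that at [w0], which is |f(w0)|^p (2s)^2 with s = 4 L t; hence
   2 * 4 * 16 L^2 t^2. The factor 2^p comes from |f| being at least |f(w0)|/2 near [w0]. *)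
exists (128 * (L * L) * pw 2 p). split. repeat apply Rmult_lt_0_compat; lra.
intros f a r B hf hr har hB.
assert (nB : nn (fun w => ilt (Cmod (w - a)%C) r * nrm p f w)) by (apply nn_mult; [apply nn_ball|now apply nn_nrm]).
assert (B0 := IB_ge0 nB hB).
set (F := fun w => pw (Cmod (f w)) p * (r - Cmod (w - a)%C) ^ 2).
destruct (Req_dec (pw (Cmod (f a)) p) 0) as [E|E].
{ rewrite E, Rmult_0_l. apply Rmult_le_pos; auto. left. repeat apply Rmult_lt_0_compat; lra. }
assert (Ea : 0 < pw (Cmod (f a)) p) by (generalize (pw_ge0 (Cmod (f a)) p); lra).
assert (EFa : F a = pw (Cmod (f a)) p * (r * r)).
{ unfold F. replace (a - a)%C with (RtoC 0) by ring. rewrite Cmod_0. ring. }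
destruct (hol_bounded f (Cmod a + r) hf har) as [M [Mp hM]].
destruct (near_sup _ (fun w => Cmod (w - a)%C <= r) F (pw M p * r ^ 2) a) as [w0 [hw0 [F0 hF]]].
- replace (a - a)%C with (RtoC 0) by ring. rewrite Cmod_0. lra.
- rewrite EFa. repeat apply Rmult_lt_0_compat; auto.
- intros w hw. unfold F. assert (A := Cmod_ge_0 (w - a)%C).
  apply Rmult_le_compat. apply pw_ge0. apply pow2_ge_0.
  apply pw_le. lra. apply Cmod_ge_0. apply hM. generalize (Cmod_sub_ge w a); lra.
  simpl. nra.
- set (s := (r - Cmod (w0 - a)%C) / 2).
  assert (Ew0 : 0 < pw (Cmod (f w0)) p).
  { assert (A := pw_ge0 (Cmod (f w0)) p). destruct (Rle_lt_or_eq_dec _ _ A) as [|E']; auto. unfold F in F0. rewrite <- E' in F0. lra. }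
  assert (s0 : 0 < s).
  { unfold s. destruct (Req_dec (r - Cmod (w0 - a)%C) 0) as [E'|E']; [|lra]. unfold F in F0. rewrite E' in F0. simpl in F0. lra. }
  assert (Es : r - Cmod (w0 - a)%C = 2 * s) by (unfold s; field).
  (* Near-maximality gives a factor 2, and the weight drops from (2s)^2 to no less than s^2; this is
     the 8 in [L]. *)
  assert (H1 : forall w, Cmod (w - w0)%C <= s -> Cmod (f w) <= L * Cmod (f w0)).
  { intros w hw. assert (T := Cmod_tri3 w w0 a).
    apply pw_inv_le; try apply Cmod_ge_0; try lra.
    assert (Q := hF w ltac:(lra)). unfold F in Q. rewrite Es in Q.
    assert (A := pw_ge0 (Cmod (f w)) p).
    assert (s ^ 2 <= (r - Cmod (w - a)%C) ^ 2) by (apply pow_incr; lra).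
    apply (Rmult_le_reg_r (s ^ 2)). apply pow_lt; lra.
    simpl in *. nra. }
  assert (w01 : Cmod w0 + 2 * s < 1) by (generalize (Cmod_sub_ge w0 a); lra).
  assert (H2 : forall w, Cmod (w - w0)%C <= s / 2 -> Cmod (Cderiv f w) <= L * Cmod (f w0) / (s / 2)).
  { intros w hw. apply hol_cauchy; auto. lra. generalize (Cmod_sub_ge w w0); lra.
    intros v hv. apply H1. assert (T := Cmod_tri3 v w w0). lra. }
  (* The derivative bound L |f(w0)| / (s/2) times this [t] is exactly |f(w0)|/2, so |f| stays above
     half its central value. *)
  set (t := s / (4 * L)).
  assert (tp : 0 < t) by (apply Rdiv_lt_0_compat; lra).
  assert (ts : t * (4 * L) = s) by (unfold t; field; lra).
  assert (H3 : forall w, Cmod (w - w0)%C < t -> Cmod (f w0) / 2 <= Cmod (f w)).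
  { intros w hw. assert (A := Cmod_ge_0 (w - w0)%C). assert (G := Cmod_ge_0 (f w0)).
    assert (D : Cmod (f w - f w0)%C <= L * Cmod (f w0) / (s / 2) * Cmod (w - w0)%C).
    { apply hol_mean_value; auto. lra. generalize (Cmod_sub_ge w w0); nra.
      intros u hu. apply H2. apply seg_near; auto. replace (w0 - w0)%C with (RtoC 0) by ring. rewrite Cmod_0; lra. nra. }
    assert (D2 : L * Cmod (f w0) / (s / 2) * Cmod (w - w0)%C <= L * Cmod (f w0) / (s / 2) * t).
    { apply Rmult_le_compat_l. apply Rdiv_le_0_compat. nra. lra. lra. }
    replace (L * Cmod (f w0) / (s / 2) * t) with (Cmod (f w0) / 2) in D2 by (rewrite <- ts; field; lra).
    generalize (Cmod_sub_ge (f w0) (f w)). rewrite (Cmod_sub_sym (f w0)). lra. }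
  assert (Q : pw (Cmod (f w0) / 2) p * (t * t) <= B).
  { apply (IB_area_ge (a := w0)); try lra. apply pw_ge0. nra.
    revert hB. apply IB_le; auto.
    apply nn_scal. apply pw_ge0. apply nn_ball.
    intros w hw. destruct (Rlt_le_dec (Cmod (w - w0)%C) t) as [h|h].
    - rewrite !ilt_1; auto. rewrite Rmult_1_r, Rmult_1_l. apply pw_le. lra. generalize (Cmod_ge_0 (f w0)); lra. auto.
      assert (T := Cmod_tri3 w w0 a). nra.
    - rewrite (ilt_0 _ _ h), Rmult_0_r. apply nB; auto. }
  rewrite pw_div in Q by (try apply Cmod_ge_0; lra).
  assert (Fa := hF a). rewrite EFa in Fa.
  eapply Rle_trans. apply Fa. replace (a - a)%C with (RtoC 0) by ring. rewrite Cmod_0; lra.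
  unfold F. rewrite Es, <- ts.
  apply Rle_trans with (128 * (L * L) * pw 2 p * (pw (Cmod (f w0)) p / pw 2 p * (t * t))).
  right; field; lra. apply Rmult_le_compat_l; auto. left; repeat apply Rmult_lt_0_compat; lra.
Qed.

(** Halving the radius allows a disc that touches the unit circle, at the price of a factor 4. *)
Lemma sub_mean p : 0 < p -> exists K, 0 < K /\ forall f a r B, hol f -> 0 < r ->
  Cmod a + r <= 1 -> IB (fun w => ilt (Cmod (w - a)%C) r * nrm p f w) B ->
  pw (Cmod (f a)) p * (r * r) <= K * B.
Proof.
intros hp. destruct (sub_mean_interior p hp) as [K [K0 HK]]. exists (4 * K). split. lra.
intros f a r B hf hr har hB.
assert (Q : pw (Cmod (f a)) p * (r / 2 * (r / 2)) <= K * B); [|lra].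
apply HK; auto; try lra.
revert hB. apply IB_le; try (apply nn_mult; [apply nn_ball|now apply nn_nrm]).
intros w hw. apply Rmult_le_compat_r. apply pw_ge0.
destruct (Rlt_le_dec (Cmod (w - a)%C) (r / 2)) as [h|h].
rewrite !ilt_1; lra. rewrite (ilt_0 _ _ h). apply ilt_ge0.
Qed.

(** * Local averages, and weighted bounds for derivatives *)

Lemma pw_m2 x : 0 < x -> pw x (-(2)) = / (x * x).
Proof.
intros h. rewrite pw_opp. replace 2 with (INR 2) by (simpl; ring). rewrite pw_nat by lra. f_equal. simpl; ring.
Qed.

(* Supported on the pairs that lie in a common disc of radius comparable to the distance to the circle. *)
Definition near_kernel (K : R) (z u : C) : R :=
  ilt (Cmod (z - u)%C) (K * dd z) * (ile (dd z) (K * dd u) * ile (dd u) (K * dd z)).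

Lemma near_kernel_1 K z u : Cmod (z - u)%C < K * dd z -> dd z <= K * dd u -> dd u <= K * dd z ->
  near_kernel K z u = 1.
Proof. intros h1 h2 h3. unfold near_kernel. rewrite ilt_1, !ile_1; auto. ring. Qed.

Lemma near_kernel_ge0 K z u : 0 <= near_kernel K z u.
Proof. repeat apply Rmult_le_pos; try apply ilt_ge0; apply ile_ge0. Qed.

Lemma meas2_near_kernel K : meas2 (fun z u => near_kernel K z u * pw (dd z) (-(2))).
Proof.
assert (m1 : meas2 (fun z _ => dd z)) by apply (meas2_fst meas_dd).
assert (m2 : meas2 (fun _ u => dd u)) by apply (meas2_snd meas_dd).
assert (k1 : meas2 (fun z _ => K * dd z)) by (apply meas2_mult; [apply meas2_const|auto]).
assert (k2 : meas2 (fun _ u => K * dd u)) by (apply meas2_mult; [apply meas2_const|auto]).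
apply meas2_mult. 2: now apply meas2_pw.
apply meas2_mult. apply meas2_ilt; auto. apply meas2_dist.
apply meas2_mult; apply meas2_ile; auto.
Qed.

(** On the support z lies within K^2 d(u) of u and d(z) is at least d(u)/K; area 4 K^4 d(u)^2 times
    K^2 / d(u)^2. *)
Lemma near_kernel_mass K u : 1 <= K -> Cmod u < 1 ->
  IB (fun z => near_kernel K z u * pw (dd z) (-(2))) (4 * K ^ 6).
Proof.
intros hK hu. assert (du := dd_pos u hu).
assert (A := IB_area u (r := K * K * dd u) ltac:(nra)).
apply (IB_scal (c := K * K * / (dd u * dd u))) in A. 2: apply Rmult_le_pos; [nra|left; apply Rinv_0_lt_compat; nra].
2: apply nn_ball.
replace (4 * K ^ 6) with (K * K * / (dd u * dd u) * (4 * (K * K * dd u * (K * K * dd u)))) by (field; lra).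
assert (n1 : nn (fun z => near_kernel K z u * pw (dd z) (-(2)))).
{ split. apply meas_mult. apply meas_mult. apply meas_ilt. apply meas_dist. apply meas_mult. apply meas_const. apply meas_dd.
  apply meas_mult; apply meas_ile; first [apply meas_dd|apply meas_const|apply meas_mult; first [apply meas_dd|apply meas_const]].
  apply meas_pw, meas_dd. intros z hz. apply Rmult_le_pos. apply near_kernel_ge0. apply pw_ge0. }
revert A. apply IB_le; auto.
{ apply nn_scal. apply Rmult_le_pos; [nra|left; apply Rinv_0_lt_compat; nra]. apply nn_ball. }
intros z hz. assert (dz := dd_pos z hz). rewrite pw_m2 by auto.
assert (P : 0 <= K * K * / (dd u * dd u)) by (apply Rmult_le_pos; [nra|left; apply Rinv_0_lt_compat; nra]).
unfold near_kernel.
destruct (Rlt_le_dec (Cmod (z - u)%C) (K * dd z)) as [h1|h1].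
2:{ rewrite (ilt_0 _ _ h1), !Rmult_0_l. apply Rmult_le_pos; auto. apply ilt_ge0. }
destruct (Rle_lt_dec (dd z) (K * dd u)) as [h2|h2].
2:{ rewrite (ile_0 _ _ h2), Rmult_0_l, Rmult_0_r, Rmult_0_l. apply Rmult_le_pos; auto. apply ilt_ge0. }
destruct (Rle_lt_dec (dd u) (K * dd z)) as [h3|h3].
2:{ rewrite (ile_0 _ _ h3), !Rmult_0_r, Rmult_0_l. apply Rmult_le_pos; auto. apply ilt_ge0. }
rewrite (ilt_1 _ _ h1), !ile_1 by auto. rewrite ilt_1 by nra.
rewrite !Rmult_1_l, Rmult_1_r.
apply (Rmult_le_reg_l (dd z * dd z)). nra. rewrite Rinv_r by nra.
apply (Rmult_le_reg_r (dd u * dd u)). nra.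
replace (dd z * dd z * (K * K * / (dd u * dd u)) * (dd u * dd u)) with (dd z * K * (dd z * K)) by (field; lra).
nra.
Qed.

(** The value of |f|^p at w is replaced by its mean over the disc of radius d(w)/2, which lies in
    the kernel's support seen from z; Tonelli then removes the kernel. Since w enters only
    pointwise, it may depend on z in any way, and no measurable selection is made. *)
Lemma local_sup p al L c : 0 < p -> 0 <= al -> 1 <= L -> 0 <= c -> exists K, 0 < K /\
  forall f H B, hol f -> nn H ->
  (forall z, Cmod z < 1 -> exists w, Cmod w < 1 /\ Cmod (w - z)%C <= L * dd z /\ dd z <= L * dd w /\
    H z <= c * (pw (dd z) al * nrm p f w)) ->
  IB (fun z => nrm p f z * pw (dd z) al) B -> IB H (K * B).
Proof.
intros hp hal hL hc. destruct (sub_mean p hp) as [S [S0 HS]].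
set (K := 2 * L + 2). assert (K1 : 1 <= K) by (unfold K; lra).
set (Ka := pw K al). assert (Ka1 : 1 <= Ka) by (apply pw_ge1; lra).
(* The summand 1 keeps the constant positive when c = 0, so it may be divided by. *)
set (C0 := c * (4 * L * L) * S * Ka + 1).
assert (Cc : 0 <= c * (4 * L * L) * S * Ka).
{ repeat apply Rmult_le_pos; lra. }
exists (C0 * (4 * K ^ 6)). split.
{ apply Rmult_lt_0_compat. unfold C0; lra. apply Rmult_lt_0_compat. lra. apply pow_lt; lra. }
intros f H B hf nH Hw hB.
assert (nfd : nn (fun z => nrm p f z * pw (dd z) al)) by (apply nn_mult; [now apply nn_nrm|apply nn_dd]).
assert (m0 : meas2 (fun z u => C0 * (near_kernel K z u * pw (dd z) (-(2))))).
{ apply meas2_mult. apply meas2_const. apply meas2_near_kernel. }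
assert (C0p : 0 < C0) by (unfold C0; lra).
apply (tonelli_bound (h := fun z => nrm p f z * pw (dd z) al)
  (k := fun z u => C0 * (near_kernel K z u * pw (dd z) (-(2))))); auto.
- intros z w _ _. apply Rmult_le_pos. lra. apply Rmult_le_pos. apply near_kernel_ge0. apply pw_ge0.
- intros z hz b hb. destruct (Hw z hz) as [w [hw1 [hw2 [hw3 hw4]]]].
  assert (dz := dd_pos z hz). assert (dw := dd_pos w hw1).
  assert (Pz : 0 < pw (dd z) al) by now apply pw_gt0.
  assert (dwz : dd w <= (1 + L) * dd z) by (generalize (dd_lip w z); lra).
  set (A := C0 * / (dd z * dd z) * (/ Ka * pw (dd z) al)).
  assert (Ap : 0 < A).
  { unfold A. repeat apply Rmult_lt_0_compat; auto; apply Rinv_0_lt_compat. nra. lra. }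
  assert (Q : pw (Cmod (f w)) p * (dd w / 2 * (dd w / 2)) <= S * (/ A * b)).
  { apply HS; auto. lra. unfold dd in *; lra.
    assert (nk : nn (fun u => C0 * (near_kernel K z u * pw (dd z) (-(2))) * (nrm p f u * pw (dd u) al))).
    { split. apply meas_mult. apply (meas2_section m0 hz). apply nfd.
      intros u hu. apply Rmult_le_pos. apply Rmult_le_pos. lra. apply Rmult_le_pos. apply near_kernel_ge0. apply pw_ge0. now apply nfd. }
    apply (IB_scal (c := / A)) in hb; auto. 2: left; now apply Rinv_0_lt_compat.
    revert hb. apply IB_le.
    apply nn_mult; [apply nn_ball|now apply nn_nrm].
    apply nn_scal; auto. left; now apply Rinv_0_lt_compat.
    intros u hu. assert (N0 : 0 <= nrm p f u) by apply pw_ge0.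
    destruct (Rlt_le_dec (Cmod (u - w)%C) (dd w / 2)) as [h|h].
    2:{ rewrite (ilt_0 _ _ h), Rmult_0_l. apply Rmult_le_pos. left; now apply Rinv_0_lt_compat. now apply nk. }
    rewrite (ilt_1 _ _ h), Rmult_1_l.
    assert (T := Cmod_tri3 z w u). rewrite (Cmod_sub_sym z w), (Cmod_sub_sym w u) in T.
    assert (du1 : dd w <= 2 * dd u). { generalize (dd_lip w u). rewrite Cmod_sub_sym. lra. }
    assert (du2 : dd u <= dd w + dd w / 2). { generalize (dd_lip u w). lra. }
    rewrite near_kernel_1. 2: unfold K; nra. 2: unfold K; nra. 2: unfold K; nra.
    rewrite pw_m2, Rmult_1_l by auto.
    assert (Pu : / Ka * pw (dd z) al <= pw (dd u) al).
    { apply (Rmult_le_reg_l Ka). lra. rewrite <- Rmult_assoc, Rinv_r, Rmult_1_l by lra.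
      unfold Ka. rewrite <- pw_mult by (generalize (dd_pos u hu); lra). apply pw_le; auto. lra.
      unfold K. nra. }
    apply (Rmult_le_reg_l A); auto. rewrite <- Rmult_assoc, Rinv_r, Rmult_1_l by lra.
    unfold A. assert (0 < / (dd z * dd z)) by (apply Rinv_0_lt_compat; nra).
    replace (C0 * / (dd z * dd z) * (nrm p f u * pw (dd u) al)) with (C0 * / (dd z * dd z) * nrm p f u * pw (dd u) al) by ring.
    replace (C0 * / (dd z * dd z) * (/ Ka * pw (dd z) al) * nrm p f u) with (C0 * / (dd z * dd z) * nrm p f u * (/ Ka * pw (dd z) al)) by ring.
    apply Rmult_le_compat_l; auto. apply Rmult_le_pos; auto. nra. }
  fold (nrm p f w) in Q.
  assert (N0 : 0 <= nrm p f w) by apply pw_ge0.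
  assert (Q2 : nrm p f w * (dd z * dd z) <= 4 * L * L * (S * (/ A * b))).
  { apply Rle_trans with (4 * L * L * (nrm p f w * (dd w / 2 * (dd w / 2)))).
    replace (4 * L * L * (nrm p f w * (dd w / 2 * (dd w / 2)))) with (nrm p f w * (L * dd w * (L * dd w))) by field.
    apply Rmult_le_compat_l; auto. nra.
    apply Rmult_le_compat_l; auto. nra. }
  assert (EA : / A = / C0 * (dd z * dd z) * Ka * / pw (dd z) al).
  { unfold A. field. repeat split; lra. }
  assert (b0 : 0 <= b).
  { assert (0 <= / A * b); [|apply (Rmult_le_reg_l (/ A)); [now apply Rinv_0_lt_compat|lra]].
    apply (Rmult_le_reg_l (4 * L * L * S)). repeat apply Rmult_lt_0_compat; lra. rewrite Rmult_0_r.
    apply Rle_trans with (nrm p f w * (dd z * dd z)). apply Rmult_le_pos; auto; nra. lra. }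
  eapply Rle_trans. apply hw4.
  apply Rle_trans with (c * (4 * L * L) * S * Ka * / C0 * b).
  + apply (Rmult_le_reg_r (dd z * dd z)). nra.
    replace (c * (pw (dd z) al * nrm p f w) * (dd z * dd z)) with (c * pw (dd z) al * (nrm p f w * (dd z * dd z))) by ring.
    apply Rle_trans with (c * pw (dd z) al * (4 * L * L * (S * (/ A * b)))).
    apply Rmult_le_compat_l; auto. apply Rmult_le_pos; lra.
    rewrite EA. right. field. split; lra.
  + rewrite <- (Rmult_1_l b) at 2. apply Rmult_le_compat_r; auto.
    apply (Rmult_le_reg_r C0); auto. rewrite Rmult_assoc, Rinv_l, Rmult_1_r, Rmult_1_l by lra. unfold C0; lra.
- intros u hu. apply IB_scal. lra.
  split. assert (A := near_kernel_mass K u K1 hu).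
  { apply meas_mult. apply meas_mult. apply meas_ilt. apply meas_dist. apply meas_mult. apply meas_const. apply meas_dd.
  apply meas_mult; apply meas_ile; first [apply meas_dd|apply meas_const|apply meas_mult; first [apply meas_dd|apply meas_const]].
  apply meas_pw, meas_dd. }
  intros z hz. apply Rmult_le_pos. apply near_kernel_ge0. apply pw_ge0.
  now apply near_kernel_mass.
Qed.

(** Cauchy's estimate bounds d(z)|f'(z)| by values of f in the disc of radius d(z)/2 around z, which
    is the situation of [local_sup]. *)
Lemma deriv_weighted_bound p al : 0 < p -> 0 <= al -> exists K, 0 < K /\ forall f B, hol f ->
  IB (fun z => nrm p f z * pw (dd z) al) B ->
  IB (fun z => nrm p (Cderiv f) z * pw (dd z) (al + p)) (K * B).
Proof.
intros hp hal. destruct (local_sup p al 2 (pw 4 p) hp hal ltac:(lra) (pw_ge0 _ _)) as [K [K0 HK]].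
exists K. split; auto. intros f B hf. apply HK; auto.
{ apply nn_mult. apply nn_nrm. now apply hol_Cderiv. apply nn_dd. }
intros z hz. assert (dz := dd_pos z hz).
(* Cauchy's estimate alone would give 2 in the denominator for a supremum; the 4 provides a point,
   since otherwise f'(z) would be at most half of itself. *)
assert (exists w, Cmod (w - z)%C <= dd z / 2 /\ Cmod (Cderiv f z) * dd z / 4 <= Cmod (f w)) as [w [h1 h2]].
{ apply NNPP. intros no.
  assert (A : Cmod (Cderiv f z) <= Cmod (Cderiv f z) * dd z / 4 / (dd z / 2)).
  { apply hol_cauchy; auto. lra. unfold dd; lra. intros w hw.
    apply Rnot_lt_le. intros h. apply no. exists w. lra. }
  replace (Cmod (Cderiv f z) * dd z / 4 / (dd z / 2)) with (Cmod (Cderiv f z) / 2) in A by (field; lra).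
  assert (G := Cmod_ge_0 (Cderiv f z)).
  apply no. exists z. replace (z - z)%C with (RtoC 0) by ring. rewrite Cmod_0. split. lra.
  replace (Cmod (Cderiv f z)) with 0 by lra. generalize (Cmod_ge_0 (f z)); lra. }
exists w. assert (T := dd_lip z w). rewrite Cmod_sub_sym in T. split. unfold dd in *; lra.
split. lra. split. lra.
unfold nrm. rewrite pw_plus by auto.
replace (pw 4 p * (pw (dd z) al * pw (Cmod (f w)) p)) with (pw (dd z) al * (pw 4 p * pw (Cmod (f w)) p)) by ring.
replace (pw (Cmod (Cderiv f z)) p * (pw (dd z) al * pw (dd z) p)) with (pw (dd z) al * (pw (Cmod (Cderiv f z)) p * pw (dd z) p)) by ring.
apply Rmult_le_compat_l. apply pw_ge0.
rewrite <- !pw_mult by (try apply Cmod_ge_0; lra). apply pw_le. lra.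
apply Rmult_le_pos. apply Cmod_ge_0. lra. lra.
Qed.

(** * Dilations and dyadic shells *)

Lemma Cmod_scal r z : 0 <= r -> Cmod (r * z)%C = r * Cmod z.
Proof. intros h. now rewrite Cmod_mult, Cmod_R, Rabs_pos_eq. Qed.

Lemma hol_dilate f rho : 0 <= rho <= 1 -> hol f -> hol (fun z => f (rho * z)%C).
Proof.
intros hr hf z hz. assert (hz' : Cmod (rho * z)%C < 1).
{ rewrite Cmod_scal by lra. generalize (Cmod_ge_0 z); nra. }
exists (rho * Cderiv f (rho * z))%C. intros eps he.
destruct (hol_dlim f _ hf hz' eps he) as [d [d0 hd]].
exists d. split; auto. intros w hw.
replace (f (rho * w) - f (rho * z) - rho * Cderiv f (rho * z) * (w - z))%C
  with (f (rho * w) - f (rho * z) - Cderiv f (rho * z) * (rho * w - rho * z))%C by ring.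
assert (A := Cmod_ge_0 (w - z)%C).
assert (E : Cmod (rho * w - rho * z)%C = rho * Cmod (w - z)%C).
{ rewrite <- Cmod_scal by lra. f_equal. ring. }
eapply Rle_trans. apply hd. rewrite E. nra.
rewrite E. apply Rmult_le_compat_l; nra.
Qed.

(** The mean value inequality on the segment from rho z to z; doubling the constant replaces a
    supremum of |f'| by its value at some point. *)
Lemma dilate_increment f z rho : hol f -> Cmod z < 1 -> 0 <= rho <= 1 ->
  exists w, Cmod w <= Cmod z /\ Cmod (w - z)%C <= 1 - rho /\
    Cmod (f z - f (rho * z))%C <= 2 * (1 - rho) * Cmod (Cderiv f w).
Proof.
intros hf hz hr. apply NNPP. intros no.
set (D := Cmod (f z - f (rho * z)%C)%C).
assert (Ez : Cmod (rho * z - z)%C = (1 - rho) * Cmod z).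
{ rewrite Cmod_sub_sym. replace (z - rho * z)%C with (RtoC (1 - rho) * z)%C. apply Cmod_scal; lra.
  rewrite RtoC_minus. ring. }
assert (Cz := Cmod_ge_0 z).
assert (Er : Cmod (rho * z)%C <= Cmod z) by (rewrite Cmod_scal by lra; nra).
assert (A : forall t, 0 <= t <= 1 -> 2 * (1 - rho) * Cmod (Cderiv f (seg (rho * z)%C z t)) < D).
{ intros t ht. apply Rnot_le_lt. intros h. apply no. exists (seg (rho * z)%C z t). split; [|split]; auto.
  apply seg_norm; auto; lra. apply seg_near; auto. rewrite Ez; nra.
  replace (z - z)%C with (RtoC 0) by ring. rewrite Cmod_0; lra. }
assert (D0 : 0 < D). { generalize (A 0 ltac:(lra)) (Cmod_ge_0 (Cderiv f (seg (rho * z)%C z 0))); intros; nra. }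
destruct (Req_dec rho 1) as [->|ne].
{ unfold D in D0. replace (1 * z)%C with z in D0 by ring. replace (f z - f z)%C with (RtoC 0) in D0 by ring.
  rewrite Cmod_0 in D0; lra. }
assert (Q : D <= D / (2 * (1 - rho)) * Cmod (z - rho * z)%C).
{ apply hol_mean_value; auto. lra. intros t ht. left. apply (Rmult_lt_reg_l (2 * (1 - rho))). lra.
  replace (2 * (1 - rho) * (D / (2 * (1 - rho)))) with D by (field; lra). now apply A. }
rewrite Cmod_sub_sym, Ez in Q.
replace (D / (2 * (1 - rho)) * ((1 - rho) * Cmod z)) with (D / 2 * Cmod z) in Q by (field; lra). nra.
Qed.

Definition hf_pow (j : nat) : R := (/ 2) ^ j.

Lemma hf_pow_gt0 j : 0 < hf_pow j.
Proof. apply pow_lt; lra. Qed.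

Lemma hf_powS j : hf_pow (S j) = hf_pow j / 2.
Proof. unfold hf_pow. simpl. field. Qed.

Lemma hf_pow_anti i j : (i <= j)%nat -> hf_pow j <= hf_pow i.
Proof. intros h. induction h. lra. rewrite hf_powS. generalize (hf_pow_gt0 m); lra. Qed.

Lemma hf_pow_small e : 0 < e -> exists j, hf_pow j < e.
Proof.
intros he. destruct (pow_lt_1_zero (/ 2) ltac:(rewrite Rabs_pos_eq; lra) e he) as [N HN].
exists N. generalize (HN N (le_n _)). rewrite Rabs_pos_eq; auto. left; apply hf_pow_gt0.
Qed.

Definition shell (j : nat) (z : C) : R := ilt (hf_pow (S j)) (dd z) * ile (dd z) (hf_pow j).

Lemma nn_shell j : nn (shell j).
Proof. apply nn_mult; [apply nn_ilt|apply nn_ile]; first [apply meas_dd|apply meas_const]. Qed.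

Lemma shell_cases j z : (shell j z = 1 /\ hf_pow (S j) < dd z <= hf_pow j) \/
  (shell j z = 0 /\ ~ (hf_pow (S j) < dd z <= hf_pow j)).
Proof.
unfold shell. destruct (Rlt_le_dec (hf_pow (S j)) (dd z)) as [h|h].
2:{ right. rewrite (ilt_0 _ _ h). split; lra. }
destruct (Rle_lt_dec (dd z) (hf_pow j)) as [h'|h'].
- left. rewrite (ilt_1 _ _ h), (ile_1 _ _ h'). split; lra.
- right. rewrite (ile_0 _ _ h'). split; lra.
Qed.

Lemma shell_ge0 j z : 0 <= shell j z.
Proof. destruct (shell_cases j z) as [[-> _]|[-> _]]; lra. Qed.

(** The shells are half-open and hence disjoint, so at most one summand is active at a point. *)
Lemma shell_sum_cases k N z F :
  (exists i, (i < N)%nat /\ hf_pow (S (k + i)) < dd z <= hf_pow (k + i) /\ rsum N (fun i => shell (k + i) z * F i) = F i)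
  \/ rsum N (fun i => shell (k + i) z * F i) = 0.
Proof.
induction N as [|N IH]; simpl. now right.
destruct IH as [[i [hi [hz E]]]|E].
- left. exists i. split; [lia|]. split; auto. rewrite E.
  destruct (shell_cases (k + N) z) as [[_ h]|[-> _]]; [|ring].
  exfalso. assert (hf_pow (k + N) <= hf_pow (S (k + i))) by (apply hf_pow_anti; lia). lra.
- rewrite E. destruct (shell_cases (k + N) z) as [[-> h]|[-> _]].
  + left. exists N. split; [lia|]. split; auto. ring.
  + right. ring.
Qed.

Lemma shell_cover k N z : hf_pow (k + N) < dd z -> hf_pow k < dd z \/
  exists i, (i < N)%nat /\ shell (k + i) z = 1.
Proof.
induction N as [|N IH]; intros h. left. now rewrite Nat.add_0_r in h.
destruct (Rlt_le_dec (hf_pow (k + N)) (dd z)) as [h'|h'].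
- destruct (IH h') as [|[i [hi E]]]; auto. right. exists i. split; auto; lia.
- right. exists N. split. lia. destruct (shell_cases (k + N) z) as [[E _]|[_ E]]; auto.
  exfalso. apply E. rewrite Nat.add_succ_r in h. lra.
Qed.

(** With T = 2^(-j-1), a point at distance d from the circle moves to distance d + (1 -
    [ratio k j])(1 - d). Dividing by 1 - T sends d = T exactly to (k + 1) T, while d = 2T goes below
    (k + 2) T. So k = 1 and k = 2 fill separate halves of the range from 2T to 4T. *)
Definition ratio (k : R) (j : nat) : R := 1 - k * (hf_pow (S j) / (1 - hf_pow (S j))).

Definition shell_img (k : R) (j : nat) (z : C) : R :=
  ilt (hf_pow (S j)) (1 - / ratio k j * Cmod z) * ile (1 - / ratio k j * Cmod z) (hf_pow j).

(** The worst case is k = 2 and T = 1/32, where the ratio is 1 - 2/31. *)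
Lemma ratio_bounds k j : 1 <= k <= 2 -> (4 <= j)%nat -> 29 / 31 <= ratio k j < 1 /\ 1 - ratio k j <= 3 * hf_pow (S j).
Proof.
intros hk hj. unfold ratio. assert (T0 := hf_pow_gt0 (S j)).
assert (T1 : hf_pow (S j) <= / 32). { replace (/ 32) with (hf_pow 5). apply hf_pow_anti; lia. unfold hf_pow; field. }
set (T := hf_pow (S j)) in *. set (u := T / (1 - T)).
assert (Eu : u * (1 - T) = T) by (unfold u; field; lra).
assert (u0 : 0 < u) by (apply Rdiv_lt_0_compat; lra).
split; nra.
Qed.

(* The dilations by [ratio 1 j] and [ratio 2 j] carry the shell [j] into two
   disjoint halves of the shell [j - 1]. *)
Lemma shell_img_le j z : (3 <= j)%nat -> shell_img 1 (S j) z + shell_img 2 (S j) z <= shell j z.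
Proof.
intros hj. unfold shell_img.
destruct (ratio_bounds 1 (S j) ltac:(lra) ltac:(lia)) as [r1 _].
destruct (ratio_bounds 2 (S j) ltac:(lra) ltac:(lia)) as [r2 _].
assert (T0 := hf_pow_gt0 (S (S j))).
assert (T1 : hf_pow (S (S j)) <= / 32). { replace (/ 32) with (hf_pow 5). apply hf_pow_anti; lia. unfold hf_pow; field. }
assert (E1 : hf_pow (S j) = 2 * hf_pow (S (S j))) by (rewrite (hf_powS (S j)); field).
assert (E2 : hf_pow j = 4 * hf_pow (S (S j))) by (rewrite (hf_powS (S j)), (hf_powS j); field).
set (R1 := ratio 1 (S j)) in *. set (R2 := ratio 2 (S j)) in *.
assert (ER1 : (1 - R1) * (1 - hf_pow (S (S j))) = hf_pow (S (S j))) by (unfold R1, ratio; field; lra).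
assert (ER2 : (1 - R2) * (1 - hf_pow (S (S j))) = 2 * hf_pow (S (S j))) by (unfold R2, ratio; field; lra).
set (T := hf_pow (S (S j))) in *. rewrite E1.
set (d1 := 1 - / R1 * Cmod z). set (d2 := 1 - / R2 * Cmod z).
assert (Ed1 : dd z = 1 - R1 * (1 - d1)) by (unfold d1, dd; field; lra).
assert (Ed2 : dd z = 1 - R2 * (1 - d2)) by (unfold d2, dd; field; lra).
assert (C1 : (ilt T d1 * ile d1 (2 * T) = 1 /\ 2 * T < dd z <= 3 * T) \/ ilt T d1 * ile d1 (2 * T) = 0).
{ destruct (Rlt_le_dec T d1) as [h|h]. 2: right; rewrite (ilt_0 _ _ h); ring.
  destruct (Rle_lt_dec d1 (2 * T)) as [h'|h']. 2: right; rewrite (ile_0 _ _ h'); ring.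
  left. rewrite (ilt_1 _ _ h), (ile_1 _ _ h'). split. ring. rewrite Ed1. nra. }
assert (C2 : (ilt T d2 * ile d2 (2 * T) = 1 /\ 3 * T < dd z <= 4 * T) \/ ilt T d2 * ile d2 (2 * T) = 0).
{ destruct (Rlt_le_dec T d2) as [h|h]. 2: right; rewrite (ilt_0 _ _ h); ring.
  destruct (Rle_lt_dec d2 (2 * T)) as [h'|h']. 2: right; rewrite (ile_0 _ _ h'); ring.
  left. rewrite (ilt_1 _ _ h), (ile_1 _ _ h'). split. ring. rewrite Ed2. nra. }
assert (S0 := shell_ge0 j z).
destruct (shell_cases j z) as [[Es _]|[Es h]]; rewrite Es in *.
- destruct C1 as [[-> h1]| ->]; destruct C2 as [[-> h2]| ->]; lra.
- destruct C1 as [[-> h1]| ->]; destruct C2 as [[-> h2]| ->]; try lra; exfalso; apply h; lra.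
Qed.

Lemma nn_shell_img k j : nn (shell_img k j).
Proof.
assert (m : meas (fun z => 1 - / ratio k j * Cmod z)).
{ apply meas_minus. apply meas_const. apply (meas_mult (meas_const _)). apply meas_Cmod. }
apply nn_mult; [apply nn_ilt|apply nn_ile]; auto; apply meas_const.
Qed.

Lemma shell_img_dilate k j z : 0 < ratio k j -> shell_img k j (ratio k j * z)%C = shell j z.
Proof.
intros h. unfold shell_img, shell, dd. rewrite Cmod_scal by lra.
now rewrite <- Rmult_assoc, Rinv_l, Rmult_1_l by lra.
Qed.

Lemma nn_nrm_diff q f g : hol f -> hol g -> nn (fun z => pw (Cmod (f z - g z)%C) q).
Proof. intros hf hg. apply (nn_nrm q (f := fun z => (f z - g z)%C)). now apply hol_minus. Qed.

(** The images of shell j + 1 under the two dilations share the mass v of shell j, so both dilates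
    together cost v once, up to the Jacobian. *)
Lemma shell_average_bound q G j v W : hol G -> (3 <= j)%nat -> 0 <= W ->
  IB (fun z => W * (shell j z * nrm q G z)) v ->
  IB (fun z => W * shell (S j) z * (nrm q G (ratio 1 (S j) * z)%C + nrm q G (ratio 2 (S j) * z)%C)) (6 / 5 * v).
Proof.
intros hG hj hW hv.
assert (n0 := nn_nrm q hG).
assert (ni : forall k, nn (fun z => W * (shell_img k (S j) z * nrm q G z))).
{ intros k. apply nn_scal; auto. apply nn_mult; auto. apply nn_shell_img. }
assert (r1 := proj1 (ratio_bounds 1 (S j) ltac:(lra) ltac:(lia))).
assert (r2 := proj1 (ratio_bounds 2 (S j) ltac:(lra) ltac:(lia))).
assert (hs : IB (fun z => W * (shell_img 1 (S j) z * nrm q G z) + W * (shell_img 2 (S j) z * nrm q G z)) v).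
{ revert hv. apply IB_le. now apply nn_plus. apply nn_scal; auto. apply nn_mult; auto. apply nn_shell.
  intros z hz. assert (A := shell_img_le j z hj). assert (B : 0 <= nrm q G z) by apply pw_ge0.
  rewrite <- Rmult_plus_distr_l. apply Rmult_le_compat_l; auto. nra. }
destruct (IB_split (ni 1) (ni 2) hs) as [v1 [v2 [h1 [h2 h12]]]].
assert (D : forall k u, 29 / 31 <= ratio k (S j) < 1 -> 1 <= k <= 2 ->
  IB (fun z => W * (shell_img k (S j) z * nrm q G z)) u ->
  IB (fun z => W * (shell (S j) z * nrm q G (ratio k (S j) * z)%C)) (6 / 5 * u)).
{ intros k u hr hk hu. assert (u0 := IB_ge0 (ni k) hu).
  assert (E := IB_scale (rho := ratio k (S j)) (h := fun z => W * (shell_img k (S j) z * nrm q G z)) (B := u)).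
  apply (IB_weak (B := u / (ratio k (S j) * ratio k (S j)))).
  { unfold Rdiv. rewrite (Rmult_comm (6 * / 5)). apply Rmult_le_compat_l; auto.
    (* The square of 29/31 exceeds 5/6, so the Jacobian 1/rho^2 is at most 6/5. *)
    replace (6 * / 5) with (/ (5 / 6)) by field. apply Rinv_le_contravar; nra. }
  apply (IB_ext (fun z => W * (shell_img k (S j) (ratio k (S j) * z)%C * nrm q G (ratio k (S j) * z)%C))).
  - intros z hz. rewrite shell_img_dilate by lra. reflexivity.
  - apply (nn_ext (fun z => W * (shell (S j) z * nrm q G (ratio k (S j) * z)%C))).
    intros z hz. rewrite shell_img_dilate by lra. reflexivity.
    apply nn_scal; auto. apply nn_mult. apply nn_shell. apply (nn_nrm q (f := fun z => G (ratio k (S j) * z)%C)).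
    apply hol_dilate; auto; lra.
  - apply E; try lra; auto. revert hu. apply IB_le; auto.
    apply nn_mult; auto. apply nn_ilt. apply meas_Cmod. apply meas_const.
    intros z hz. assert (A := ilt_le1 (Cmod z) (ratio k (S j))). assert (B := proj2 (ni k) z hz). nra. }
assert (nd : forall k, 29 / 31 <= ratio k (S j) < 1 -> nn (fun z => W * (shell (S j) z * nrm q G (ratio k (S j) * z)%C))).
{ intros k hr. apply nn_scal; auto. apply nn_mult. apply nn_shell. apply (nn_nrm q (f := fun z => G (ratio k (S j) * z)%C)).
  apply hol_dilate; auto; lra. }
apply (IB_weak (B := 6 / 5 * v1 + 6 / 5 * v2)). lra.
eapply IB_ext; [| |apply (IB_plus (nd 1 r1) (nd 2 r2) (D 1 v1 r1 ltac:(lra) h1) (D 2 v2 r2 ltac:(lra) h2))].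
intros z hz. simpl. ring. apply nn_plus; auto.
Qed.

(** * The weighted bound for primitives *)

Section WeightedPrimitive.
Variables (q al : R) (hq : 0 < q) (hal : 0 <= al).

Let wt (j : nat) : R := pw (hf_pow j) al.

Lemma wt_ge0 j : 0 <= wt j.
Proof. apply pw_ge0. Qed.

Lemma wt_le1 j : wt j <= 1.
Proof. apply pw_le1; auto. left; apply hf_pow_gt0. replace 1 with (hf_pow 0). apply hf_pow_anti; lia. reflexivity. Qed.

Lemma wt_anti j : wt (S j) <= wt j.
Proof. apply pw_le; auto. left; apply hf_pow_gt0. apply hf_pow_anti; lia. Qed.

(** On shell j the increment is at most 2(1 - rho)|G'(w)|, where 1 - rho is at most 3 * 2^(-j-1),
    below 3 d(z). This gives the 6, and the 4 in the distance condition. The 2^al compares the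
    weight of the shell with d(z)^al. *)
Lemma shell_increment_bound : exists K, 0 < K /\ forall G B k N, hol G -> 1 <= k <= 2 ->
  IB (fun z => nrm q (Cderiv G) z * pw (dd z) (al + q)) B ->
  IB (fun z => rsum N (fun i => shell (4 + i) z * (wt (4 + i) * pw (Cmod (G z - G (ratio k (4 + i) * z))%C) q))) (K * B).
Proof.
destruct (local_sup q (al + q) 4 (pw 2 al * pw 6 q) hq ltac:(lra) ltac:(lra)) as [K [K0 HK]].
{ apply Rmult_le_pos; apply pw_ge0. }
exists K. split; auto. intros G B k N hG hk hB. apply (HK (Cderiv G)); auto. now apply hol_Cderiv.
{ apply nn_rsum. intros i _. apply nn_mult. apply nn_shell. apply nn_scal. apply wt_ge0.
  apply (nn_nrm_diff q G (fun z => G (ratio k (4 + i) * z)%C)); auto. apply hol_dilate; auto.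
  generalize (ratio_bounds k (4 + i) hk ltac:(lia)); lra. }
intros z hz. assert (dz := dd_pos z hz).
destruct (shell_sum_cases 4 N z (fun i => wt (4 + i) * pw (Cmod (G z - G (ratio k (4 + i) * z))%C) q))
  as [[i [hi [hd ->]]]| ->].
2:{ exists z. replace (z - z)%C with (RtoC 0) by ring. rewrite Cmod_0. split; auto. split. lra. split. lra.
    repeat apply Rmult_le_pos; apply pw_ge0. }
destruct (ratio_bounds k (4 + i) hk ltac:(lia)) as [r1 r2].
destruct (dilate_increment G z (ratio k (4 + i)) hG hz ltac:(lra)) as [w [w1 [w2 w3]]].
exists w. split. lra. split. lra. split. unfold dd in *; lra.
assert (P1 : wt (4 + i) <= pw 2 al * pw (dd z) al).
{ unfold wt. rewrite <- pw_mult by lra. apply pw_le; auto. left; apply hf_pow_gt0. rewrite hf_powS in hd. lra. }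
assert (P2 : pw (Cmod (G z - G (ratio k (4 + i) * z))%C) q <= pw 6 q * pw (dd z) q * nrm q (Cderiv G) w).
{ unfold nrm. rewrite <- !pw_mult by (try apply Cmod_ge_0; lra). apply pw_le. lra. apply Cmod_ge_0.
  eapply Rle_trans. apply w3. apply Rmult_le_compat_r. apply Cmod_ge_0. lra. }
rewrite pw_plus by auto.
eapply Rle_trans. apply Rmult_le_compat. apply wt_ge0. apply pw_ge0. apply P1. apply P2. right; ring.
Qed.

(** For |z| below 15/16 the dilation by 0 reaches the point where G vanishes. All distances to the
    circle are then comparable up to 16, so the weight costs only a constant. *)
Lemma core_bound : exists K, 0 < K /\ forall G B, hol G -> G (RtoC 0) = RtoC 0 ->
  IB (fun z => nrm q (Cderiv G) z * pw (dd z) (al + q)) B ->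
  IB (fun z => ilt (hf_pow 4) (dd z) * nrm q G z) (K * B).
Proof.
destruct (local_sup q (al + q) 16 (pw 2 q * pw 16 (al + q)) hq ltac:(lra) ltac:(lra)) as [K [K0 HK]].
{ apply Rmult_le_pos; apply pw_ge0. }
exists K. split; auto. intros G B hG G0 hB. apply (HK (Cderiv G)); auto. now apply hol_Cderiv.
{ apply nn_mult. apply nn_ilt. apply meas_const. apply meas_dd. now apply nn_nrm. }
intros z hz. assert (dz := dd_pos z hz).
destruct (Rlt_le_dec (hf_pow 4) (dd z)) as [h|h].
2:{ exists z. replace (z - z)%C with (RtoC 0) by ring. rewrite Cmod_0. split; auto. split. lra. split. lra.
    rewrite (ilt_0 _ _ h), Rmult_0_l. repeat apply Rmult_le_pos; apply pw_ge0. }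
rewrite (ilt_1 _ _ h). assert (E4 : hf_pow 4 = / 16) by (unfold hf_pow; field). rewrite E4 in h.
destruct (dilate_increment G z 0 hG hz ltac:(lra)) as [w [w1 [w2 w3]]].
exists w. split. lra. split. lra. split. unfold dd in *; lra.
rewrite Rmult_1_l.
replace (G z - G (0 * z))%C with (G z) in w3.
2:{ replace (0 * z)%C with (RtoC 0) by ring. rewrite G0. ring. }
apply Rle_trans with (pw 2 q * nrm q (Cderiv G) w).
{ unfold nrm. rewrite <- pw_mult by (try apply Cmod_ge_0; lra). apply pw_le. lra. apply Cmod_ge_0. lra. }
rewrite Rmult_assoc. apply Rmult_le_compat_l. apply pw_ge0.
rewrite <- Rmult_assoc, <- pw_mult by lra.
rewrite <- (Rmult_1_l (nrm q (Cderiv G) w)) at 1. apply Rmult_le_compat_r. apply pw_ge0.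
apply pw_ge1; lra.
Qed.

(** The mass on the core and on N shells, with the weight replaced by its value at the outer radius
    bound of each shell. Truncation at N makes the integral finite before any bound is known. *)
Let total (G : C -> C) (N : nat) (z : C) : R :=
  ilt (hf_pow 4) (dd z) * nrm q G z + rsum N (fun i => shell (4 + i) z * (wt (4 + i) * nrm q G z)).

Lemma nn_total G N : hol G -> nn (total G N).
Proof.
intros hG. assert (n0 := nn_nrm q hG). apply nn_plus. apply nn_mult; auto. apply nn_ilt. apply meas_const. apply meas_dd.
apply nn_rsum. intros i _. apply nn_mult. apply nn_shell. apply nn_scal; auto. apply wt_ge0.
Qed.

Lemma total_finite G N : hol G -> exists B, IB (total G N) B.
Proof.
intros hG. assert (t0 := hf_pow_gt0 (4 + N)).
destruct (hol_bounded G (1 - hf_pow (4 + N)) hG ltac:(lra)) as [M [M0 HM]].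
exists (4 * ((1 + INR N) * pw M q)).
assert (Nn := pos_INR N).
assert (c0 : 0 <= (1 + INR N) * pw M q) by (apply Rmult_le_pos; [lra|apply pw_ge0]).
generalize (IB_const _ c0). apply IB_le. now apply nn_total. now apply nn_const.
intros z hz. unfold total. rewrite Rmult_plus_distr_r, Rmult_1_l.
assert (HM' : hf_pow (4 + N) <= dd z -> nrm q G z <= pw M q).
{ intros h. apply pw_le. lra. apply Cmod_ge_0. apply HM. unfold dd in h; lra. }
apply Rplus_le_compat.
- destruct (Rlt_le_dec (hf_pow 4) (dd z)) as [h|h].
  + rewrite (ilt_1 _ _ h), Rmult_1_l. apply HM'. left. eapply Rle_lt_trans; [|apply h]. apply hf_pow_anti; lia.
  + rewrite (ilt_0 _ _ h), Rmult_0_l. apply pw_ge0.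
- assert (P := pw_ge0 M q).
  destruct (shell_sum_cases 4 N z (fun i => wt (4 + i) * nrm q G z)) as [[i [hi [hd ->]]]| ->].
  2: apply Rmult_le_pos; auto.
  assert (A := wt_le1 (4 + i)). assert (A' := wt_ge0 (4 + i)).
  assert (B : nrm q G z <= pw M q).
  { apply HM'. left. eapply Rle_lt_trans; [|apply hd]. apply hf_pow_anti; lia. }
  assert (B' : 0 <= nrm q G z) by apply pw_ge0.
  assert (1 <= INR N). { replace 1 with (INR 1) by reflexivity. apply le_INR; lia. }
  nra.
Qed.

(** Each shell appears moved one step inwards but with the weight of the original shell, which is
    smaller; the innermost one, shell 3, lies in the core. *)
Lemma shifted_total G N z : 0 <= nrm q G z ->
  rsum N (fun i => wt (4 + i) * (shell (3 + i) z * nrm q G z)) <= total G N z.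
Proof.
intros h. unfold total.
assert (H : forall N, rsum (S N) (fun i => wt (4 + i) * (shell (3 + i) z * nrm q G z)) <=
  ilt (hf_pow 4) (dd z) * nrm q G z + rsum N (fun i => shell (4 + i) z * (wt (4 + i) * nrm q G z))).
{ clear N. induction N as [|N IH].
  - cbn [rsum]. rewrite Rplus_0_l, Rplus_0_r. rewrite !Nat.add_0_r.
    assert (A := wt_le1 4). assert (A' := wt_ge0 4).
    destruct (shell_cases 3 z) as [[-> h3]|[-> _]].
    + rewrite (ilt_1 (hf_pow 4) (dd z)) by apply h3. nra.
    + rewrite Rmult_0_l, Rmult_0_r. apply Rmult_le_pos; auto. apply ilt_ge0.
  - set (F := fun i => wt (4 + i) * (shell (3 + i) z * nrm q G z)) in *.
    set (F' := fun i => shell (4 + i) z * (wt (4 + i) * nrm q G z)) in *.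
    replace (rsum (S (S N)) F) with (rsum (S N) F + F (S N)) by reflexivity.
    replace (rsum (S N) F') with (rsum N F' + F' N) by reflexivity.
    assert (F (S N) <= F' N); [|lra].
    unfold F, F'. replace (3 + S N)%nat with (4 + N)%nat by lia.
    assert (A := wt_anti (4 + N)). replace (S (4 + N)) with (4 + S N)%nat in A by lia.
    assert (0 <= shell (4 + N) z * nrm q G z) by (apply Rmult_le_pos; auto; apply shell_ge0).
    nra. }
destruct N as [|N].
- simpl. rewrite Rplus_0_r. apply Rmult_le_pos; auto. apply ilt_ge0.
- eapply Rle_trans. apply H. apply Rplus_le_compat_l. cbn [rsum].
  assert (0 <= shell (4 + N) z * (wt (4 + N) * nrm q G z)); [|lra].
  apply Rmult_le_pos; [apply shell_ge0|apply Rmult_le_pos; auto; apply wt_ge0].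
Qed.

(** The constant is independent of [N]. Truncation matters only for the finiteness of the quantity x
    that is absorbed. *)
Lemma total_bound : exists K, 0 < K /\ forall G B N, hol G -> G (RtoC 0) = RtoC 0 ->
  IB (fun z => nrm q (Cderiv G) z * pw (dd z) (al + q)) B -> IB (total G N) (K * B).
Proof.
destruct shell_increment_bound as [K1 [K1p H1]]. destruct core_bound as [K2 [K2p H2]].
destruct (pw_add_eps q (/ 4) hq ltac:(lra)) as [Ce [Ce0 HCe]].
(* This solves x <= (K2 + Ce K1) B + (3/4) x. *)
exists (4 * (K2 + Ce * K1)). split. nra.
intros G B N hG G0 hB.
destruct (total_finite G N hG) as [Bf hBf]. assert (nt := nn_total G N hG).
destruct (IB_value nt hBf) as [x [x0 hx]].
assert (n0 := nn_nrm q hG).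
assert (nv : forall i, (i < N)%nat -> nn (fun z => wt (4 + i) * (shell (3 + i) z * nrm q G z))).
{ intros i _. apply nn_scal. apply wt_ge0. apply nn_mult; auto. apply nn_shell. }
destruct (IB_rsum_split N (fun i z => wt (4 + i) * (shell (3 + i) z * nrm q G z)) x) as [v [hv1 hv2]]; auto.
{ apply (IB_le (k := total G N)); auto. now apply nn_rsum.
  intros z hz. apply shifted_total. apply pw_ge0. apply hx. lra. }
set (T := fun i z => wt (4 + i) * shell (4 + i) z * (nrm q G (ratio 1 (4 + i) * z)%C + nrm q G (ratio 2 (4 + i) * z)%C)).
assert (ndl : forall k i, 1 <= k <= 2 -> nn (fun z => nrm q G (ratio k (4 + i) * z)%C)).
{ intros k i hk. apply (nn_nrm q (f := fun z => G (ratio k (4 + i) * z)%C)). apply hol_dilate; auto.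
  generalize (ratio_bounds k (4 + i) hk ltac:(lia)); lra. }
assert (nT : forall i, (i < N)%nat -> nn (T i)).
{ intros i _. apply nn_mult. apply nn_scal. apply wt_ge0. apply nn_shell. apply nn_plus; apply ndl; lra. }
assert (hT : IB (fun z => rsum N (fun i => T i z)) (6 / 5 * x)).
{ apply (IB_weak (B := rsum N (fun i => 6 / 5 * v i))). rewrite rsum_scal. lra.
  apply IB_rsum; auto. intros i hi. apply (shell_average_bound q G (3 + i) (v i) (wt (4 + i))); auto. lia. apply wt_ge0. }
set (D := fun k z => rsum N (fun i => shell (4 + i) z * (wt (4 + i) * pw (Cmod (G z - G (ratio k (4 + i) * z))%C) q))).
assert (nD : forall k, 1 <= k <= 2 -> nn (D k)).
{ intros k hk. apply nn_rsum. intros i _. apply nn_mult. apply nn_shell. apply nn_scal. apply wt_ge0.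
  apply (nn_nrm_diff q G (fun z => G (ratio k (4 + i) * z)%C)); auto. apply hol_dilate; auto.
  generalize (ratio_bounds k (4 + i) hk ltac:(lia)); lra. }
assert (hD1 := H1 G B 1 N hG ltac:(lra) hB). assert (hD2 := H1 G B 2 N hG ltac:(lra) hB).
assert (hP := H2 G B hG G0 hB).
fold (D 1) in hD1. fold (D 2) in hD2.
set (P := fun z => ilt (hf_pow 4) (dd z) * nrm q G z) in *.
assert (nP : nn P). { apply nn_mult; auto. apply nn_ilt. apply meas_const. apply meas_dd. }
assert (nTs : nn (fun z => rsum N (fun i => T i z))) by now apply nn_rsum.
assert (nDs : nn (fun z => D 1 z + D 2 z)) by (apply nn_plus; apply nD; lra).
(* Each of the two dilates costs 5/4 of a shell mass, 6/5 for the change of variables, and their images share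
   one shell: on average 3/4 of the total reappears on the right and is absorbed. *)
assert (Q : IB (total G N) (K2 * B + (5 / 8 * (6 / 5 * x) + Ce / 2 * (K1 * B + K1 * B)))).
{ assert (hsum : IB (fun z => P z + (5 / 8 * rsum N (fun i => T i z) + Ce / 2 * (D 1 z + D 2 z)))
    (K2 * B + (5 / 8 * (6 / 5 * x) + Ce / 2 * (K1 * B + K1 * B)))).
  { apply IB_plus; auto. apply nn_plus; apply nn_scal; auto; lra.
    apply IB_plus. apply nn_scal; auto; lra. apply nn_scal; auto; lra. apply IB_scal; auto; lra.
    apply IB_scal; auto; try lra. apply IB_plus; auto; apply nD; lra. }
  revert hsum. apply IB_le; auto. apply nn_plus; auto. apply nn_plus; apply nn_scal; auto; lra.
  intros z hz. unfold total. apply Rplus_le_compat_l. unfold D.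
  rewrite <- rsum_plus, <- !rsum_scal, <- rsum_plus. apply rsum_le. intros i hi. unfold T.
  assert (E : forall k, nrm q G z <= 5 / 4 * nrm q G (ratio k (4 + i) * z)%C + Ce * pw (Cmod (G z - G (ratio k (4 + i) * z))%C) q).
  { intros k. unfold nrm. eapply Rle_trans; [|eapply Rle_trans; [apply (HCe (Cmod (G (ratio k (4 + i) * z)%C)) (Cmod (G z - G (ratio k (4 + i) * z))%C)); apply Cmod_ge_0|lra]].
    apply pw_le. lra. apply Cmod_ge_0. generalize (Cmod_sub_ge (G z) (G (ratio k (4 + i) * z)%C)). lra. }
  assert (E1 := E 1). assert (E2 := E 2).
  assert (Y : 0 <= wt (4 + i) * shell (4 + i) z) by (apply Rmult_le_pos; [apply wt_ge0|apply shell_ge0]).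
  set (N0 := nrm q G z) in *. set (a1 := nrm q G (ratio 1 (4 + i) * z)%C) in *. set (a2 := nrm q G (ratio 2 (4 + i) * z)%C) in *.
  set (b1 := pw (Cmod (G z - G (ratio 1 (4 + i) * z))%C) q) in *. set (b2 := pw (Cmod (G z - G (ratio 2 (4 + i) * z))%C) q) in *.
  set (S4 := shell (4 + i) z) in *. set (W := wt (4 + i)) in *.
  replace (S4 * (W * N0)) with (W * S4 * N0) by ring.
  replace (5 / 8 * (W * S4 * (a1 + a2)) + Ce / 2 * (S4 * (W * b1) + S4 * (W * b2))) with
    (W * S4 * (5 / 8 * (a1 + a2) + Ce / 2 * (b1 + b2))) by ring.
  apply Rmult_le_compat_l; auto. lra. }
apply hx. apply hx in Q. lra.
Qed.

Lemma primitive_weighted_bound : exists K, 0 < K /\ forall G B, hol G -> G (RtoC 0) = RtoC 0 ->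
  IB (fun z => nrm q (Cderiv G) z * pw (dd z) (al + q)) B ->
  IB (fun z => nrm q G z * pw (dd z) al) (K * B).
Proof.
destruct total_bound as [K [K0 HK]]. exists K. split; auto. intros G B hG G0 hB.
assert (n0 := nn_nrm q hG).
assert (nf : nn (fun z => nrm q G z * pw (dd z) al)) by (apply nn_mult; auto; apply nn_dd).
apply IB_exhaust; auto. intros r r0 r1.
destruct (hf_pow_small (1 - r) ltac:(lra)) as [N HN].
generalize (HK G B N hG G0 hB). apply IB_le. apply nn_mult; auto. apply nn_ile. apply meas_Cmod. apply meas_const.
now apply nn_total.
intros z hz. assert (Z := proj2 (nn_total G N hG) z hz).
destruct (Rle_lt_dec (Cmod z) r) as [h|h].
2:{ now rewrite (ile_0 _ _ h), Rmult_0_l. }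
rewrite (ile_1 _ _ h), Rmult_1_l. assert (dz := dd_pos z hz). assert (N0 : 0 <= nrm q G z) by apply pw_ge0.
assert (St : 0 <= rsum N (fun i => shell (4 + i) z * (wt (4 + i) * nrm q G z))).
{ apply rsum_ge0. intros i _. apply Rmult_le_pos; [apply shell_ge0|apply Rmult_le_pos; auto; apply wt_ge0]. }
(* The N shells beyond the core reach past radius r, so the truncated mass dominates the integrand
   on the whole disc of radius r. *)
assert (hcov : hf_pow (4 + N) < dd z).
{ apply Rle_lt_trans with (hf_pow N). apply hf_pow_anti; lia. unfold dd; lra. }
unfold total in *. destruct (shell_cover 4 N z hcov) as [h4|[i [hi E]]].
- rewrite (ilt_1 _ _ h4). assert (A : pw (dd z) al <= 1) by (apply pw_le1; auto; [lra|apply dd_le1]). nra.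
- apply Rle_trans with (0 + shell (4 + i) z * (wt (4 + i) * nrm q G z)).
  + rewrite E, Rplus_0_l, Rmult_1_l, Rmult_comm. apply Rmult_le_compat_r; auto. apply pw_le; auto. lra.
    destruct (shell_cases (4 + i) z) as [[_ ?]|[E' _]]; [lra|rewrite E' in E; lra].
  + apply Rplus_le_compat. apply Rmult_le_pos; auto. apply ilt_ge0.
    apply (rsum_term N (fun i => shell (4 + i) z * (wt (4 + i) * nrm q G z))); auto.
    intros j _. apply Rmult_le_pos; [apply shell_ge0|apply Rmult_le_pos; auto; apply wt_ge0].
Qed.

End WeightedPrimitive.

(** * Iterated bounds and the operator *)

Lemma deriv_n_weighted_bound p al k : 0 < p -> 0 <= al -> exists K, 0 < K /\ forall f B, hol f ->
  IB (fun z => nrm p f z * pw (dd z) al) B ->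
  IB (fun z => nrm p (Cderiv_n k f) z * pw (dd z) (al + INR k * p)) (K * B).
Proof.
intros hp hal. induction k as [|k [K [K0 HK]]].
- exists 1. split. lra. intros f B hf. simpl. now rewrite Rmult_0_l, Rplus_0_r, Rmult_1_l.
- destruct (deriv_weighted_bound p (al + INR k * p) hp) as [K' [K0' HK']].
  { generalize (pos_INR k); nra. }
  exists (K' * K). split. nra. intros f B hf hB. rewrite S_INR.
  replace (al + (INR k + 1) * p) with (al + INR k * p + p) by ring. rewrite Rmult_assoc.
  apply (HK' (Cderiv_n k f)). now apply hol_Cderiv_n. now apply HK.
Qed.

Lemma primitive_n_weighted_bound q al k : 0 < q -> 0 <= al -> exists K, 0 < K /\ forall f B, hol f ->
  IB (fun z => nrm q f z * pw (dd z) (al + INR k * q)) B ->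
  IB (fun z => nrm q (Iop_n k f) z * pw (dd z) al) (K * B).
Proof.
(* The weight exponent varies in the induction: the k inner integrations are done with the exponent
   al + q, and the outermost one lowers it to al. *)
intros hq. revert al. induction k as [|k IH]; intros al hal.
- exists 1. split. lra. intros f B hf. simpl. now rewrite Rmult_0_l, Rplus_0_r, Rmult_1_l.
- destruct (IH (al + q) ltac:(lra)) as [K [K0 HK]].
  destruct (primitive_weighted_bound q al hq hal) as [K' [K0' HK']].
  exists (K' * K). split. nra. intros f B hf hB. rewrite S_INR in hB.
  replace (al + (INR k + 1) * q) with (al + q + INR k * q) in hB by ring. rewrite Rmult_assoc.
  assert (hk : hol (Iop_n k f)) by now apply hol_Iop_n.
  apply (HK' (Iop (Iop_n k f))). now apply hol_Iop. apply Iop_0.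
  apply (IB_ext (fun z => nrm q (Iop_n k f) z * pw (dd z) (al + q))).
  + intros z hz. unfold nrm. now rewrite Cderiv_Iop.
  + apply nn_mult. now apply nn_nrm. apply nn_dd.
  + now apply HK.
Qed.

Definition Top (n : nat) (g : nat -> C -> C) (f : C -> C) : C -> C := Iop_n n (Lop n g f).

Definition symb (n : nat) (g : nat -> C -> C) (k : nat) (z : C) : R :=
  Cmod (g k z) * pw (dd z) (INR (n - k)).

Lemma symb_ge0 n g k z : 0 <= symb n g k z.
Proof. apply Rmult_le_pos. apply Cmod_ge_0. apply pw_ge0. Qed.

Lemma meas_symb n g k : hol (g k) -> meas (symb n g k).
Proof. intros h. apply meas_mult. now apply meas_hol. apply meas_pw, meas_dd. Qed.

(** The weight d^n is distributed as d^k on the k-th derivative and d^(n-k) on its symbol. *)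
Lemma Lop_pointwise q n g f z : 0 < q -> Cmod z < 1 ->
  nrm q (Lop n g f) z * pw (dd z) (INR n * q) <=
  pw 2 (INR n * q) * rsum n (fun k => pw (Cmod (Cderiv_n k f z) * pw (dd z) (INR k)) q * pw (symb n g k z) q).
Proof.
intros hq hz. assert (dz := dd_pos z hz).
apply Rle_trans with (pw (rsum n (fun k => Cmod (Cderiv_n k f z) * pw (dd z) (INR k) * symb n g k z)) q).
- rewrite <- pw_pw. unfold nrm. rewrite <- pw_mult by (try apply Cmod_ge_0; apply pw_ge0).
  apply pw_le. lra. apply Rmult_le_pos. apply Cmod_ge_0. apply pw_ge0.
  apply Rle_trans with (pw (dd z) (INR n) * rsum n (fun k => Cmod (Cderiv_n k f z * g k z)%C)).
  { rewrite Rmult_comm. apply Rmult_le_compat_l. apply pw_ge0. apply Cmod_csum. }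
  rewrite <- rsum_scal. right. apply rsum_ext. intros k hk. rewrite Cmod_mult.
  replace (INR n) with (INR k + INR (n - k)) by (rewrite <- plus_INR; f_equal; lia).
  rewrite pw_plus by auto. unfold symb. ring.
- assert (P : forall k, 0 <= Cmod (Cderiv_n k f z) * pw (dd z) (INR k)).
  { intros k. apply Rmult_le_pos. apply Cmod_ge_0. apply pw_ge0. }
  eapply Rle_trans. apply pw_rsum; auto. intros k hk. apply Rmult_le_pos; auto. apply symb_ge0.
  right. f_equal. apply rsum_ext. intros k hk. apply pw_mult; auto. apply symb_ge0.
Qed.

(** * Integrable symbols give a bounded operator *)

Section Sufficiency.
Variables (n : nat) (g : nat -> C -> C) (p q : R).
Hypotheses (hg : forall k, (k < n)%nat -> hol (g k)) (hq : 0 < q) (hqp : q < p).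
Let s := p * q / (p - q).
Hypothesis hsymb : forall k, (k < n)%nat -> exists B, IB (fun z => pw (symb n g k z) s) B.

Lemma symb_uniform : exists B, 0 <= B /\ forall k, (k < n)%nat -> IB (fun z => pw (symb n g k z) s) B.
Proof.
assert (H : forall m, (m <= n)%nat -> exists B, 0 <= B /\ forall k, (k < m)%nat -> IB (fun z => pw (symb n g k z) s) B).
{ induction m as [|m IH]; intros hm. exists 0. split. lra. intros; lia.
  destruct IH as [B [B0 HB]]. lia. destruct (hsymb m hm) as [B' HB'].
  exists (Rmax B B'). split. eapply Rle_trans; [apply B0|apply Rmax_l].
  intros k hk. destruct (Nat.eq_dec k m) as [->|ne].
  apply (IB_weak (B := B')); auto. apply Rmax_r.
  apply (IB_weak (B := B)). apply Rmax_l. apply HB; lia. }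
now apply H.
Qed.

Let weight k f z := Cmod (Cderiv_n k f z) * pw (dd z) (INR k).

Lemma nn_weight r k f : hol f -> nn (fun z => pw (weight k f z) r).
Proof. intros hf. apply nn_pw. apply meas_mult. apply meas_hol. now apply hol_Cderiv_n. apply meas_pw, meas_dd. Qed.

Lemma nn_symb r k : (k < n)%nat -> nn (fun z => pw (symb n g k z) r).
Proof. intros hk. apply nn_pw. apply meas_symb. now apply hg. Qed.

Lemma weight_bound : exists K, 0 < K /\ forall f A, hol f -> IB (nrm p f) A ->
  forall k, (k < n)%nat -> IB (fun z => pw (weight k f z) p) (K * A).
Proof.
assert (H : forall m, exists K, 0 < K /\ forall f A, hol f -> IB (nrm p f) A ->
  forall k, (k < m)%nat -> IB (fun z => pw (weight k f z) p) (K * A)).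
{ induction m as [|m [K [K0 HK]]]. exists 1. split. lra. intros; lia.
  destruct (deriv_n_weighted_bound p 0 m ltac:(lra) ltac:(lra)) as [K' [K0' HK']].
  exists (K + K'). split. lra. intros f A hf hA k hk.
  assert (A0 := IB_ge0 (nn_nrm p hf) hA).
  destruct (Nat.eq_dec k m) as [->|ne].
  - apply (IB_weak (B := K' * A)). nra.
    eapply IB_ext; [| |apply (HK' f A hf)].
    + intros z hz. unfold nrm, weight. rewrite pw_mult by (try apply Cmod_ge_0; apply pw_ge0).
      now rewrite pw_pw, Rplus_0_l.
    + apply nn_mult. apply nn_nrm. now apply hol_Cderiv_n. apply nn_dd.
    + revert hA. apply IB_ext. intros z hz. now rewrite pw_0r, Rmult_1_r. now apply nn_nrm.
  - apply (IB_weak (B := K * A)). nra. apply HK; auto. lia. }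
apply H.
Qed.

Lemma Top_bound_of_terms : exists K, 0 < K /\ forall f A, hol f -> 0 <= A ->
  (forall k, (k < n)%nat -> IB (fun z => pw (weight k f z) q * pw (symb n g k z) q) A) ->
  IB (nrm q (Top n g f)) (K * A).
Proof.
destruct (primitive_n_weighted_bound q 0 n hq ltac:(lra)) as [K [K0 HK]].
assert (P2 : 0 < pw 2 (INR n * q)) by (apply pw_gt0; lra).
exists (K * (pw 2 (INR n * q) * (INR n + 1))). split.
{ apply Rmult_lt_0_compat; auto. apply Rmult_lt_0_compat; auto. generalize (pos_INR n); lra. }
intros f A hf A0 hA. assert (hL : hol (Lop n g f)) by now apply hol_Lop.
assert (nt : forall k, (k < n)%nat -> nn (fun z => pw (weight k f z) q * pw (symb n g k z) q)).
{ intros k hk. apply nn_mult. now apply nn_weight. now apply nn_symb. }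

apply (IB_ext (fun z => nrm q (Iop_n n (Lop n g f)) z * pw (dd z) 0)).
{ intros z hz. now rewrite pw_0r, Rmult_1_r. }
{ apply nn_mult. apply nn_nrm. now apply hol_Iop_n. apply nn_dd. }
rewrite Rmult_assoc. apply HK; auto. rewrite Rplus_0_l.
apply (IB_weak (B := pw 2 (INR n * q) * rsum n (fun _ => A))).
{ rewrite Rmult_assoc. apply Rmult_le_compat_l. lra. clear -A0. induction n as [|m IH]; cbn [rsum]. simpl; lra. rewrite S_INR. lra. }
apply (IB_le (k := fun z => pw 2 (INR n * q) * rsum n (fun k => pw (weight k f z) q * pw (symb n g k z) q))).
- apply nn_mult. now apply nn_nrm. apply nn_dd.
- apply nn_scal. lra. now apply nn_rsum.
- intros z hz. now apply Lop_pointwise.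
- apply IB_scal. lra. now apply nn_rsum. now apply IB_rsum.
Qed.

(** The parameter [e] is left free, because the bound becomes homogeneous in f only after e is
    adapted to the norm. *)
Lemma Top_young_bound : exists K, 0 < K /\ forall f A e, hol f -> 0 < e -> IB (nrm p f) A ->
  IB (nrm q (Top n g f)) (K * (e * A + pw e (- (q / (p - q))))).
Proof.
destruct symb_uniform as [B [B0 HB]]. destruct weight_bound as [K1 [K10 H1]].
destruct Top_bound_of_terms as [K2 [K20 H2]].
exists (K2 * (K1 + B)). split. apply Rmult_lt_0_compat; lra.
intros f A e hf he hA. assert (A0 := IB_ge0 (nn_nrm p hf) hA). assert (P := pw_ge0 e (- (q / (p - q)))).
apply (IB_weak (B := K2 * (e * (K1 * A) + pw e (- (q / (p - q))) * B))).
{ rewrite Rmult_assoc. apply Rmult_le_compat_l. lra. assert (0 <= e * A) by nra. nra. }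
apply H2; auto. { assert (0 <= e * (K1 * A)) by (apply Rmult_le_pos; nra). nra. }
intros k hk.
apply (IB_le (k := fun z => e * pw (weight k f z) p + pw e (- (q / (p - q))) * pw (symb n g k z) s)).
- apply nn_mult. now apply nn_weight. now apply nn_symb.
- apply nn_plus; apply nn_scal; try lra. now apply nn_weight. now apply nn_symb.
- intros z hz. apply young_pw; auto. apply Rmult_le_pos. apply Cmod_ge_0. apply pw_ge0. apply symb_ge0.
- apply IB_plus. apply nn_scal. lra. now apply nn_weight. apply nn_scal; auto. now apply nn_symb.
  apply IB_scal. lra. now apply nn_weight. now apply H1. apply IB_scal; auto. now apply nn_symb.
Qed.

(** A positive t above the norm is used so that f = 0 needs no separate treatment. *)
Lemma Top_norm_bound : exists c, 0 < c /\ forall f t, Bergman p f -> Bnorm p f <= t -> 0 < t ->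
  Bergman q (Top n g f) /\ Bnorm q (Top n g f) <= c * t.
Proof.
destruct Top_young_bound as [K [K0 HK]]. assert (pi0 := pinv_gt0).
assert (pi1 : 0 < / pinv) by now apply Rinv_0_lt_compat.
set (c0 := pinv * (K * (/ pinv + 1))).
assert (c00 : 0 < c0) by (apply Rmult_lt_0_compat; auto; apply Rmult_lt_0_compat; lra).
exists (pw c0 (/ q)). split. now apply pw_gt0.
intros f t hf ht t0. assert (hA := IB_Bnorm (p := p) (M := t) ltac:(lra) hf ht).
destruct (proj1 (Bergman_hol p f) hf) as [hol_f _].
(* With e = t^(q-p) both e t^p and e^(-q/(p-q)) equal t^q. *)
assert (Q := HK f _ (pw t (- (p - q))) hol_f (pw_gt0 _ t0) hA).
assert (hT : hol (Top n g f)) by (apply hol_Iop_n; now apply hol_Lop).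
split. apply Bergman_hol. split; auto. eexists; apply Q.
apply Rle_trans with (pw (c0 * pw t q) (/ q)).
2:{ right. rewrite pw_mult by (try apply pw_ge0; lra). f_equal. apply pw_inv; lra. }
replace (c0 * pw t q) with (pinv * (K * (pw t (- (p - q)) * (pw t p / pinv) + pw (pw t (- (p - q))) (- (q / (p - q)))))).
now apply Bnorm_le.
rewrite pw_pw. replace (- (p - q) * - (q / (p - q))) with q by (field; lra).
replace (pw t (- (p - q)) * (pw t p / pinv)) with (pw t q / pinv).
unfold c0. field; lra.
replace q with (- (p - q) + p) at 1 by ring. rewrite pw_plus by auto. field; lra.
Qed.

(** Inside radius r the smallness of X is used together with Y^q <= 1 + Y^s, valid since s is at
    least q. Outside, Young's inequality leaves only the tail of Y^s. *)
Lemma young_cutoff e r eta : 0 < e -> 0 <= eta -> forall X Y x, 0 <= X -> 0 <= Y -> (x <= r -> X <= eta) ->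
  pw X q * pw Y q <= e * pw X p + pw e (- (q / (p - q))) * (ilt r x * pw Y s) + pw eta q * (1 + pw Y s).
Proof.
intros he heta X Y x hX hY h.
assert (A := pw_ge0 X p). assert (B := pw_ge0 Y s). assert (P := pw_ge0 e (- (q / (p - q)))). assert (E := pw_ge0 eta q).
destruct (Rlt_le_dec r x) as [h'|h'].
- rewrite (ilt_1 _ _ h'), Rmult_1_l. assert (0 <= pw eta q * (1 + pw Y s)) by nra.
  assert (Z := young_pw p q e X Y hq hqp he hX hY). fold s in Z. lra.
- rewrite (ilt_0 _ _ h'). assert (pw X q <= pw eta q) by (apply pw_le; auto; lra).
  assert (pw Y q <= 1 + pw Y s).
  { destruct (Rle_lt_dec Y 1) as [y|y]. generalize (pw_le1 Y q ltac:(lra) hY y); lra.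
    replace s with (q + q * q / (p - q)) by (unfold s; field; lra). rewrite pw_plus by lra.
    assert (0 <= q * q / (p - q)) by (apply Rdiv_le_0_compat; nra).
    assert (1 <= pw Y (q * q / (p - q))) by (apply pw_ge1; lra).
    assert (0 <= pw Y q) by apply pw_ge0. nra. }
  assert (0 <= pw X q) by apply pw_ge0. assert (0 <= pw Y q) by apply pw_ge0.
  assert (0 <= e * pw X p) by nra.
  apply Rle_trans with (pw eta q * (1 + pw Y s)). apply Rmult_le_compat; auto. lra.
Qed.
End Sufficiency.

(** * Compactness *)

(** Each derivative needs a margin for Cauchy's estimate; moving half of the remaining way to the
    circle at every step keeps the radius below 1. *)
Lemma Cderiv_n_small k r : 0 <= r < 1 -> exists r' K, r <= r' < 1 /\ 0 < K /\ forall u eta, hol u ->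
  (forall z, Cmod z <= r' -> Cmod (u z) <= eta) -> forall z, Cmod z <= r -> Cmod (Cderiv_n k u z) <= K * eta.
Proof.
revert r. induction k as [|k IH]; intros r hr.
- exists r, 1. split. lra. split. lra. intros u eta hu H z hz. rewrite Rmult_1_l. now apply H.
- destruct (IH ((1 + r) / 2) ltac:(lra)) as [r' [K [hr' [K0 HK]]]].
  exists r', (K / ((1 - r) / 2)). split. lra. split. apply Rdiv_lt_0_compat; lra.
  intros u eta hu H z hz.
  replace (K / ((1 - r) / 2) * eta) with (K * eta / ((1 - r) / 2)) by (field; lra).
  apply (hol_cauchy (Cderiv_n k u)); try lra. now apply hol_Cderiv_n.
  intros w hw. apply HK; auto. generalize (Cmod_sub_ge w z); lra.
Qed.

Lemma Cderiv_n_small_upto n r : 0 <= r < 1 -> exists r' K, r <= r' < 1 /\ 0 < K /\ forall u eta, hol u ->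
  0 <= eta -> (forall z, Cmod z <= r' -> Cmod (u z) <= eta) ->
  forall k z, (k < n)%nat -> Cmod z <= r -> Cmod (Cderiv_n k u z) <= K * eta.
Proof.
intros hr. induction n as [|n [r1 [K1 [h1 [K10 H1]]]]].
- exists r, 1. split. lra. split. lra. intros; lia.
- destruct (Cderiv_n_small n r hr) as [r2 [K2 [h2 [K20 H2]]]].
  exists (Rmax r1 r2), (K1 + K2). split. split. eapply Rle_trans; [apply h1|apply Rmax_l].
  apply Rmax_lub_lt; lra. split. lra. intros u eta hu he H k z hk hz.
  assert (L := Rmax_l r1 r2). assert (L' := Rmax_r r1 r2).
  destruct (Nat.eq_dec k n) as [->|ne].
  + apply Rle_trans with (K2 * eta). apply H2; auto. intros w hw. apply H; lra. nra.
  + apply Rle_trans with (K1 * eta). apply H1; auto. intros w hw. apply H; lra. lia. nra.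
Qed.

(** [sub_mean] on discs of radius 1 - r supplies the local boundedness that Montel's theorem
    needs. *)
Lemma Bergman_local_bound p B r : 0 < p -> r < 1 -> exists M, forall f z, hol f -> IB (nrm p f) B ->
  Cmod z <= r -> Cmod (f z) <= M.
Proof.
intros hp hr. destruct (sub_mean p hp) as [K [K0 HK]].
exists (pw (K * B / ((1 - r) * (1 - r))) (/ p)). intros f z hf hB hz.
assert (i0 : 0 < / p) by now apply Rinv_0_lt_compat.
rewrite <- (pw_inv (Cmod (f z)) p) by (auto; apply Cmod_ge_0).
apply pw_le. lra. apply pw_ge0.
apply (Rmult_le_reg_r ((1 - r) * (1 - r))). nra.
replace (K * B / ((1 - r) * (1 - r)) * ((1 - r) * (1 - r))) with (K * B) by (field; lra).
apply HK; auto; try lra.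
revert hB. apply IB_le. apply nn_mult. apply nn_ball. now apply nn_nrm. now apply nn_nrm.
intros w hw. assert (A := ilt_le1 (Cmod (w - z)%C) (1 - r)). assert (0 <= nrm p f w) by apply pw_ge0. nra.
Qed.

(** In place of Fatou's lemma: on each smaller disc |F| is at most |f j| + 1 for some j, and these
    discs exhaust the unit disc. *)
Lemma Bergman_limit p B f F : 0 < p -> hol F -> (forall j : nat, hol (f j) /\ IB (nrm p (f j)) B) ->
  (forall r, 0 <= r < 1 -> exists j, forall z, Cmod z <= r -> Cmod (f j z - F z)%C <= 1) ->
  IB (nrm p F) (pw 2 p * (B + 4)).
Proof.
intros hp hF hf H. apply IB_exhaust. now apply nn_nrm. intros r r0 r1.
destruct (H r (conj r0 r1)) as [j hj]. destruct (hf j) as [hh hB].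
assert (n1 := nn_nrm p hh). assert (c1 := IB_const 1 Rle_0_1). rewrite Rmult_1_r in c1.
assert (P := pw_ge0 2 p).
apply (IB_le (k := fun z => pw 2 p * (nrm p (f j) z + 1))).
- apply nn_mult. apply nn_ile. apply meas_Cmod. apply meas_const. now apply nn_nrm.
- apply nn_scal; auto. apply nn_plus; auto. apply nn_const; lra.
- intros z hz. assert (N := pw_ge0 (Cmod (f j z)) p).
  destruct (Rle_lt_dec (Cmod z) r) as [h|h].
  2:{ rewrite (ile_0 _ _ h), Rmult_0_l. apply Rmult_le_pos; auto. unfold nrm; lra. }
  rewrite (ile_1 _ _ h), Rmult_1_l.
  apply Rle_trans with (pw (Cmod (f j z) + 1) p).
  + apply pw_le. lra. apply Cmod_ge_0. generalize (Cmod_sub_ge (F z) (f j z)) (hj z h).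
    rewrite (Cmod_sub_sym (F z)). lra.
  + rewrite <- (pw_one1 p) at 2. apply pw_add_le; auto. apply Cmod_ge_0. lra.
- apply IB_scal; auto. apply nn_plus; auto. apply nn_const; lra. apply IB_plus; auto. apply nn_const; lra.
Qed.

Lemma nrm_minus_bound p f F B B' : 0 < p -> hol f -> hol F -> IB (nrm p f) B -> IB (nrm p F) B' ->
  IB (nrm p (fun z => f z - F z)%C) (pw 2 p * (B + B')).
Proof.
intros hp hf hF hB hB'. assert (P := pw_ge0 2 p).
apply (IB_le (k := fun z => pw 2 p * (nrm p f z + nrm p F z))).
- apply nn_nrm. now apply hol_minus.
- apply nn_scal; auto. apply nn_plus; now apply nn_nrm.
- intros z hz. apply Rle_trans with (pw (Cmod (f z) + Cmod (F z)) p).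
  apply pw_le. lra. apply Cmod_ge_0. apply Cmod_sub_le. apply pw_add_le; auto; apply Cmod_ge_0.
- apply IB_scal; auto. apply nn_plus; now apply nn_nrm. apply IB_plus; auto; now apply nn_nrm.
Qed.

Lemma hol_Top n g f : (forall k, (k < n)%nat -> hol (g k)) -> hol f -> hol (Top n g f).
Proof. intros hg hf. apply hol_Iop_n. now apply hol_Lop. Qed.

Lemma Top_minus n g f h z : (forall k, (k < n)%nat -> hol (g k)) -> hol f -> hol h -> Cmod z < 1 ->
  Top n g (fun z => f z - h z)%C z = (Top n g f z - Top n g h z)%C.
Proof.
intros hg hf hh hz. unfold Top. rewrite <- Iop_n_minus by (auto using hol_Lop).
apply Iop_n_ext; auto. intros w hw. now apply Lop_minus.
Qed.

Lemma IB_combination X T Y e P c a b d : nn X -> nn T -> nn Y -> 0 <= e -> 0 <= P -> 0 <= c ->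
  IB X a -> IB T b -> IB Y d ->
  nn (fun z => e * X z + P * T z + c * (1 + Y z)) /\
  IB (fun z => e * X z + P * T z + c * (1 + Y z)) (e * a + P * b + c * (4 * 1 + d)).
Proof.
intros nX nT nY he hP hc hX hT hY.
assert (n1 : nn (fun _ : C => 1)) by (apply nn_const; lra).
assert (n2 := nn_plus _ _ n1 nY).
assert (n3 := nn_scal c _ hc n2). assert (n4 := nn_scal e _ he nX). assert (n5 := nn_scal P _ hP nT).
assert (n6 := nn_plus _ _ n4 n5).
split. exact (nn_plus _ _ n6 n3).
assert (h1 := IB_const 1 Rle_0_1).
exact (IB_plus n6 n3 (IB_plus n4 n5 (IB_scal he nX hX) (IB_scal hP nT hT)) (IB_scal hc n2 (IB_plus n1 nY h1 hY))).
Qed.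

Section Compactness.
Variables (n : nat) (g : nat -> C -> C) (p q : R).
Hypotheses (hg : forall k, (k < n)%nat -> hol (g k)) (hq : 0 < q) (hqp : q < p).
Let s := p * q / (p - q).
Hypothesis hsymb : forall k, (k < n)%nat -> exists B, IB (fun z => pw (symb n g k z) s) B.

Let nn_tail k r : (k < n)%nat -> nn (fun z => ilt r (Cmod z) * pw (symb n g k z) s).
Proof. intros hk. apply nn_mult. apply nn_ilt. apply meas_const. apply meas_Cmod. now apply nn_symb. Qed.

Lemma symb_tail e : 0 < e -> exists r, 0 <= r < 1 /\
  forall k, (k < n)%nat -> IB (fun z => ilt r (Cmod z) * pw (symb n g k z) s) e.
Proof.
intros he.
assert (H : forall m, (m <= n)%nat -> exists r, 0 <= r < 1 /\
  forall k, (k < m)%nat -> IB (fun z => ilt r (Cmod z) * pw (symb n g k z) s) e).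
{ induction m as [|m IH]; intros hm. exists 0. split. lra. intros; lia.
  destruct IH as [r [r0 Hr]]. lia. destruct (hsymb m hm) as [B HB].
  destruct (IB_tail (h := fun z => pw (symb n g m z) s) (B := B) ltac:(now apply nn_symb) HB he) as [r' [r0' [r1' Hr']]].
  assert (mono : forall a b k, (k < n)%nat -> a <= b -> IB (fun z => ilt a (Cmod z) * pw (symb n g k z) s) e ->
    IB (fun z => ilt b (Cmod z) * pw (symb n g k z) s) e).
  { intros a b k hk hab. apply IB_le; auto. intros z hz. apply Rmult_le_compat_r. apply pw_ge0.
    destruct (Rlt_le_dec b (Cmod z)) as [h|h]. rewrite !ilt_1; lra. rewrite (ilt_0 _ _ h). apply ilt_ge0. }
  exists (Rmax r r'). split. split. eapply Rle_trans; [apply r0|apply Rmax_l]. apply Rmax_lub_lt; lra.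
  intros k hk. destruct (Nat.eq_dec k m) as [->|ne].
  apply (mono r'); auto. apply Rmax_r. apply (mono r). lia. apply Rmax_l. apply Hr; lia. }
now apply H.
Qed.

(** Three errors are made small in a forced order: e against the p-mass, then r against the tail
    multiplied by the large factor e^(-q/(p-q)), and finally the size of u on the remaining compact
    disc. *)
Lemma Top_vanishing A delta : 0 <= A -> 0 < delta -> exists r eta, 0 <= r < 1 /\ 0 < eta /\
  forall u, hol u -> IB (nrm p u) A -> (forall z, Cmod z <= r -> Cmod (u z) <= eta) ->
  IB (nrm q (Top n g u)) delta.
Proof.
intros hA hd.
destruct (symb_uniform n g p q hsymb) as [B [B0 HB]].
destruct (weight_bound n p q hq hqp) as [K1 [K10 H1]].
destruct (Top_bound_of_terms n g q hg hq) as [K2 [K20 H2]].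
set (d1 := delta / K2 / 3). assert (d10 : 0 < d1) by (repeat apply Rdiv_lt_0_compat; lra).
set (e := d1 / (K1 * A + 1)). assert (e0 : 0 < e) by (apply Rdiv_lt_0_compat; nra).
assert (He : e * (K1 * A) <= d1).
{ unfold e. apply (Rmult_le_reg_r (K1 * A + 1)). nra.
  replace (d1 / (K1 * A + 1) * (K1 * A) * (K1 * A + 1)) with (d1 * (K1 * A)) by (field; nra). nra. }
set (P := pw e (- (q / (p - q)))). assert (P0 : 0 < P) by now apply pw_gt0.
destruct (symb_tail (d1 / P) ltac:(now apply Rdiv_lt_0_compat)) as [r [hr Hr]].
destruct (Cderiv_n_small_upto n r hr) as [r' [K [hr' [K0 HK]]]].
set (eta1 := pw (d1 / (4 + B)) (/ q)).
assert (eta10 : 0 < eta1) by (apply pw_gt0; apply Rdiv_lt_0_compat; lra).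
assert (Heta : pw eta1 q = d1 / (4 + B)).
{ apply pw_inv'; auto. left; apply Rdiv_lt_0_compat; lra. }
exists r', (eta1 / K). split. lra. split. now apply Rdiv_lt_0_compat.
intros u hu huA hsmall.
replace delta with (K2 * (d1 + d1 + d1)) by (unfold d1; field; lra).
apply H2; auto. lra. intros k hk.
assert (nX := nn_weight p k u hu). assert (nY := nn_symb n g hg s k hk).
assert (P1 := pw_ge0 eta1 q). assert (nt := nn_tail k r hk).
destruct (IB_combination _ _ _ e P (pw eta1 q) (K1 * A) (d1 / P) B nX nt nY (Rlt_le _ _ e0) (Rlt_le _ _ P0) P1
  (H1 u A hu huA k hk) (Hr k hk) (HB k hk)) as [nc hc].
apply (IB_weak (B' := d1 + d1 + d1)) in hc.
2:{ rewrite Heta. replace (d1 / (4 + B) * (4 * 1 + B)) with d1 by (field; lra).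
    replace (P * (d1 / P)) with d1 by (field; lra). lra. }
revert hc. apply IB_le.
- apply nn_mult. now apply nn_weight. now apply nn_symb.
- exact nc.
- intros z hz. apply (young_cutoff p q hq hqp e r eta1); auto. lra. apply Rmult_le_pos. apply Cmod_ge_0. apply pw_ge0. apply symb_ge0.
  intros hzr. assert (D : Cmod (Cderiv_n k u z) <= K * (eta1 / K)).
  { apply HK; auto. left; now apply Rdiv_lt_0_compat. }
  replace (K * (eta1 / K)) with eta1 in D by (field; lra).
  assert (Z : pw (dd z) (INR k) <= 1). { apply pw_le1. apply pos_INR. left; now apply dd_pos. apply dd_le1. }
  assert (0 <= pw (dd z) (INR k)) by apply pw_ge0. assert (0 <= Cmod (Cderiv_n k u z)) by apply Cmod_ge_0. nra.
Qed.

(** The differences f j - F stay in a ball of A^p and are uniformly small on compact discs for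
    arbitrarily late j, so [Top_vanishing] applies to them. *)
Lemma Top_compact (f : nat -> C -> C) M : (forall j, Bergman p (f j)) -> (forall j, Bnorm p (f j) <= M) ->
  exists F, Bergman p F /\ forall delta N, 0 < delta -> exists j, (N <= j)%nat /\
    Bnorm q (fun z => Top n g (f j) z - Top n g F z)%C <= delta.
Proof.
intros hf hM. assert (hp : 0 < p) by lra.
set (B := pw M p / pinv).
assert (hB : forall j, hol (f j) /\ IB (nrm p (f j)) B).
{ intros j. split. now destruct (proj1 (Bergman_hol p (f j)) (hf j)). now apply IB_Bnorm. }
destruct exists_free_ultrafilter as [U HU].
destruct (montel U HU f) as [F [hF HF]].
- intros j. apply hB.
- intros r hr. destruct (Bergman_local_bound p B r hp ltac:(lra)) as [M' HM']. exists M'.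
  intros j z hz. destruct (hB j). now apply HM'.
- assert (hFB : IB (nrm p F) (pw 2 p * (B + 4))).
  { apply (Bergman_limit p B f F hp hF hB). intros r hr. destruct (HF r 1 0%nat hr Rlt_0_1) as [j [_ hj]]. now exists j. }
  exists F. split. apply Bergman_hol. split; auto. now eexists; apply hFB.
  intros delta N hd.
  set (A := pw 2 p * (B + pw 2 p * (B + 4))).
  assert (hA : forall j, IB (nrm p (fun z => f j z - F z)%C) A).
  { intros j. destruct (hB j). now apply nrm_minus_bound. }
  assert (hu : forall j, hol (fun z => f j z - F z)%C) by (intros j; apply hol_minus; auto; apply hB).
  assert (pi0 := pinv_gt0).
  assert (A0 : 0 <= A) by (apply (IB_ge0 (nn_nrm p (hu 0%nat)) (hA 0%nat))).
  assert (D0 : 0 < pw delta q / pinv) by (apply Rdiv_lt_0_compat; auto; now apply pw_gt0).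
  destruct (Top_vanishing A (pw delta q / pinv) A0 D0) as [r [eta [hr [he H]]]].
  destruct (HF r eta N hr he) as [j [hj hs]]. exists j. split; auto.
  assert (Q := H _ (hu j) (hA j) hs).
  assert (hT : hol (fun z => Top n g (f j) z - Top n g F z)%C).
  { apply hol_minus; apply hol_Top; auto. apply hB. }
  apply Rle_trans with (pw (pinv * (pw delta q / pinv)) (/ q)).
  + apply (Bnorm_le hq hT). revert Q. apply IB_ext.
    intros z hz. unfold nrm. rewrite Top_minus; auto. apply hB. apply nn_nrm. now apply hol_Top.
  + right. replace (pinv * (pw delta q / pinv)) with (pw delta q) by (field; lra). apply pw_inv; lra.
Qed.
End Compactness.

(** * Separated points and test functions *)

(** On the ring |z - a| ~ 2^j t the function is at most 8 * 8^(-j) and the area at most 4 * 4^j t^2;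
    the geometric series of 32 t^2 / 2^j sums to 64 t^2. *)
Lemma cubic_decay_bound a t h : Cmod a < 1 -> 0 < t -> nn h ->
  (forall z, Cmod z < 1 -> h z <= 1 /\ h z * Cmod (z - a)%C ^ 3 <= t ^ 3) -> IB h (64 * (t * t)).
Proof.
intros ha ht nh H.
set (W := fun j z => 8 * (/ 8) ^ j * ilt (Cmod (z - a)%C) (2 ^ j * t)).
assert (c0 : forall j, 0 <= 8 * (/ 8) ^ j) by (intros j; apply Rmult_le_pos; [lra|apply pow_le; lra]).
assert (nW : forall j, nn (W j)) by (intros j; apply nn_scal; auto; apply nn_ball).
assert (P : forall z J, Cmod z < 1 -> Cmod (z - a)%C < 2 ^ J * t -> h z <= rsum (S J) (fun j => W j z)).
{ intros z J hz. destruct (H z hz) as [h1 h2]. induction J as [|J IH]; intros hJ.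
  - simpl. unfold W. rewrite ilt_1 by exact hJ. simpl. lra.
  - change (rsum (S (S J)) (fun j => W j z)) with (rsum (S J) (fun j => W j z) + W (S J) z).
    destruct (Rlt_le_dec (Cmod (z - a)%C) (2 ^ J * t)) as [h'|h'].
    + assert (0 <= W (S J) z) by now apply nW. specialize (IH h'). lra.
    + assert (0 <= rsum (S J) (fun j => W j z)) by (apply rsum_ge0; intros; now apply nW).
      assert (E : W (S J) z = (/ 8) ^ J). { unfold W. rewrite ilt_1 by exact hJ. simpl. field. }
      rewrite E. assert (Hz := proj2 nh z hz).
      assert (Q : h z * (2 ^ J * t) ^ 3 <= t ^ 3).
      { eapply Rle_trans; [|apply h2]. apply Rmult_le_compat_l; auto. apply pow_incr. split; auto.
        apply Rmult_le_pos. apply pow_le; lra. lra. }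
      assert (E8 : (2 ^ J) ^ 3 * (/ 8) ^ J = 1).
      { rewrite <- pow_mult, Nat.mul_comm, pow_mult, <- Rpow_mult_distr. replace (2 ^ 3 * / 8) with 1 by field. apply pow1. }
      assert (p8 : 0 < (/ 8) ^ J) by (apply pow_lt; lra).
      assert (t3 : 0 < t ^ 3) by (apply pow_lt; lra).
      rewrite Rpow_mult_distr in Q.
      assert (h z * (2 ^ J) ^ 3 <= 1) by (apply (Rmult_le_reg_r (t ^ 3)); auto; lra).
      assert (h z * (2 ^ J) ^ 3 * (/ 8) ^ J <= 1 * (/ 8) ^ J) by (apply Rmult_le_compat_r; lra).
      rewrite Rmult_assoc, E8 in *. lra. }
(* Finitely many rings suffice: once 2^J t exceeds 2, the diameter of the unit disc, everything is
   covered. *)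
destruct (Pow_x_infinity 2 ltac:(rewrite Rabs_pos_eq; lra) (2 / t + 1)) as [J HJ].
specialize (HJ J (le_n _)). rewrite Rabs_pos_eq in HJ by (apply pow_le; lra).
apply (IB_le (k := fun z => rsum (S J) (fun j => W j z))); auto.
- now apply nn_rsum.
- intros z hz. apply P; auto. assert (Cmod (z - a)%C < 2) by (generalize (Cmod_sub_le z a); lra).
  apply Rlt_le_trans with ((2 / t) * t). unfold Rdiv. rewrite Rmult_assoc, Rinv_l; lra.
  apply Rmult_le_compat_r; lra.
- apply (IB_weak (B := rsum (S J) (fun j => 8 * (/ 8) ^ j * (4 * (2 ^ j * t * (2 ^ j * t)))))).
  + assert (E : forall n, rsum n (fun j => 8 * (/ 8) ^ j * (4 * (2 ^ j * t * (2 ^ j * t)))) = 64 * (t * t) * (1 - (/ 2) ^ n)).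
    { induction n as [|n IHn]; simpl. ring. rewrite IHn.
      assert (E2 : (/ 8) ^ n * (2 ^ n * 2 ^ n) = (/ 2) ^ n) by (rewrite <- !Rpow_mult_distr; f_equal; field).
      replace (8 * (/ 8) ^ n * (4 * (2 ^ n * t * (2 ^ n * t)))) with (32 * (t * t) * ((/ 8) ^ n * (2 ^ n * 2 ^ n))) by ring.
      rewrite E2. field. }
    rewrite E. assert (0 < (/ 2) ^ S J) by (apply pow_lt; lra). assert (0 < t * t) by nra. nra.
  + apply IB_rsum; auto. intros j _. apply IB_scal; auto. apply nn_ball. apply IB_area.
    apply Rmult_le_pos. apply pow_le; lra. lra.
Qed.

(** Equivalent to disjointness of the discs of radius [ka * dd (a i)], in a form checked by the
    triangle inequality. *)
Definition separated (ka : R) (N : nat) (a : nat -> C) : Prop :=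
  (forall i, (i < N)%nat -> Cmod (a i) < 1) /\
  forall i j, (j < i)%nat -> (i < N)%nat -> ka * (dd (a i) + dd (a j)) <= Cmod (a i - a j)%C.

Lemma separated_split ka N a H B : 0 < ka <= 1 -> separated ka N a -> nn H -> IB H B -> exists v,
  (forall i, (i < N)%nat -> IB (fun z => ilt (Cmod (z - a i)%C) (ka * dd (a i)) * H z) (v i)) /\ rsum N v <= B.
Proof.
intros hk [ha hs] nH hB.
assert (ne : forall i, (i < N)%nat -> nn (fun z => ilt (Cmod (z - a i)%C) (ka * dd (a i)) * H z)).
{ intros i hi. apply nn_mult; auto. apply nn_ball. }
apply (IB_rsum_split N (fun i z => ilt (Cmod (z - a i)%C) (ka * dd (a i)) * H z) B ne).
revert hB. apply IB_le; auto. now apply nn_rsum. intros z hz.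
assert (Q : forall m, (m <= N)%nat -> rsum m (fun i => ilt (Cmod (z - a i)%C) (ka * dd (a i)) * H z) = 0 \/
  exists i, (i < m)%nat /\ Cmod (z - a i)%C < ka * dd (a i) /\
   rsum m (fun i => ilt (Cmod (z - a i)%C) (ka * dd (a i)) * H z) = H z).
{ induction m as [|m IH]; intros hm; simpl. now left. destruct (Rlt_le_dec (Cmod (z - a m)%C) (ka * dd (a m))) as [h|h].
  - rewrite (ilt_1 _ _ h). destruct IH as [E|[i [hi [h' _]]]]. lia.
    + right. exists m. split. lia. split; auto. rewrite E. ring.
    + exfalso. assert (S1 := hs m i hi ltac:(lia)). assert (T := Cmod_tri3 (a m) z (a i)).
      rewrite (Cmod_sub_sym (a m) z) in T. lra.
  - rewrite (ilt_0 _ _ h). destruct IH as [E|[i [hi [h' E]]]]. lia.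
    + left. rewrite E. ring.
    + right. exists i. split. lia. split; auto. rewrite E. ring. }
assert (H0 := proj2 nH z hz).
destruct (Q N (le_n _)) as [E|[i [_ [_ E]]]]; rewrite E; lra.
Qed.

(** Each e i is spread over its own disc, of area at least the square of the radius; disjointness
    bounds the sum by one integral. *)
Lemma separated_sum ka N a e k B : 0 < ka <= 1 -> separated ka N a ->
  (forall i, (i < N)%nat -> 0 <= e i) -> nn k -> IB k B ->
  (forall i z, (i < N)%nat -> Cmod z < 1 -> Cmod (z - a i)%C < ka * dd (a i) -> e i <= k z) ->
  rsum N (fun i => e i * (ka * dd (a i) * (ka * dd (a i)))) <= B.
Proof.
intros hk hs he nk hB H. destruct (separated_split ka N a k B hk hs nk hB) as [v [hv1 hv2]].
eapply Rle_trans; [|apply hv2]. apply rsum_le. intros i hi.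
assert (ha := proj1 hs i hi). assert (di := dd_pos (a i) ha).
apply (IB_area_ge (a := a i)); auto. nra. unfold dd in *; nra.
generalize (hv1 i hi). apply IB_le.
- apply nn_scal; auto. apply nn_ball.
- apply nn_mult; auto. apply nn_ball.
- intros z hz. destruct (Rlt_le_dec (Cmod (z - a i)%C) (ka * dd (a i))) as [h|h].
  + rewrite (ilt_1 _ _ h), Rmult_1_r, Rmult_1_l. now apply H.
  + rewrite (ilt_0 _ _ h). lra.
Qed.

(** Jensen's inequality for weights of total at most U: the tangent line bound [bernoulli_pw] at
    y_i/S, where S is the sum of the y_i u_i divided by U, is multiplied by u_i and summed. *)
Lemma weighted_jensen p N y u U : 1 < p -> 0 < U -> (forall i, (i < N)%nat -> 0 <= y i) ->
  (forall i, (i < N)%nat -> 0 <= u i) -> rsum N u <= U ->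
  pw (rsum N (fun i => y i * u i)) p <= pw U (p - 1) * rsum N (fun i => pw (y i) p * u i).
Proof.
intros hp hU hy hu hs.
assert (R0 : 0 <= rsum N (fun i => y i * u i)) by (apply rsum_ge0; intros; apply Rmult_le_pos; auto).
assert (R1 : 0 <= rsum N (fun i => pw (y i) p * u i)).
{ apply rsum_ge0; intros; apply Rmult_le_pos; auto. apply pw_ge0. }
destruct (Rle_lt_or_eq_dec _ _ R0) as [Rp|E].
2:{ rewrite <- E, pw_zero by lra. apply Rmult_le_pos; auto. apply pw_ge0. }
set (S := rsum N (fun i => y i * u i) / U).
assert (S0 : 0 < S) by now apply Rdiv_lt_0_compat.
assert (ES : rsum N (fun i => y i * u i) = U * S) by (unfold S; field; lra).
assert (P0 : 0 < pw S p) by now apply pw_gt0.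
assert (Q : rsum N (fun i => p / S * (y i * u i)) <= rsum N (fun i => / pw S p * (pw (y i) p * u i) + (p - 1) * u i)).
{ apply rsum_le. intros i hi.
  assert (B := bernoulli_pw (p := p) (t := y i / S) hp ltac:(apply Rdiv_le_0_compat; auto)).
  assert (B' : p * (y i / S) <= pw (y i / S) p + (p - 1)) by exact B.
  rewrite pw_div in B' by auto.
  apply (Rmult_le_compat_r (u i)) in B'; auto.
  replace (p / S * (y i * u i)) with (p * (y i / S) * u i) by (field; lra).
  replace (/ pw S p * (pw (y i) p * u i) + (p - 1) * u i) with ((pw (y i) p / pw S p + (p - 1)) * u i) by (field; lra).
  exact B'. }
rewrite rsum_plus, !rsum_scal, ES in Q.
replace (p / S * (U * S)) with (p * U) in Q by (field; lra).
set (V := rsum N (fun i => pw (y i) p * u i)) in *.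
assert (UV : U <= / pw S p * V) by nra.
assert (UV' : pw S p * U <= V).
{ apply (Rmult_le_compat_l (pw S p)) in UV; try lra. rewrite <- Rmult_assoc, Rinv_r, Rmult_1_l in UV; lra. }
rewrite ES, pw_mult by lra. replace p with ((p - 1) + 1) at 1 by ring. rewrite pw_plus by auto.
rewrite pw_1 by lra.
replace (pw U (p - 1) * U * pw S p) with (pw U (p - 1) * (pw S p * U)) by ring.
apply Rmult_le_compat_l; auto. apply pw_ge0.
Qed.

(** The quotient (1 - |a|)/|1 - conj(a) z|; the inverse is written as a power because measurability
    of powers is at hand. *)
Definition bump (a z : C) : R := dd a * pw (Cmod (den a z)) (- (1)).

Lemma hol_den a : hol (den a).
Proof. apply hol_minus. apply hol_const. apply hol_mult. apply hol_const. apply hol_id. Qed.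

Lemma pw_m1 x : 0 < x -> pw x (- (1)) = / x.
Proof. intros h. rewrite pw_opp. f_equal. apply pw_1. lra. Qed.

Lemma den_gt0 a z : Cmod a < 1 -> Cmod z < 1 -> 0 < Cmod (den a z).
Proof. intros ha hz. destruct (den_ge a z ha hz). lra. Qed.

Lemma bump_den a z : Cmod a < 1 -> Cmod z < 1 -> bump a z = dd a * / Cmod (den a z).
Proof. intros ha hz. unfold bump. rewrite pw_m1; auto. now apply den_gt0. Qed.

Lemma nn_bump a : Cmod a < 1 -> nn (bump a).
Proof.
intros ha. apply nn_scal. left; now apply dd_pos. apply nn_pw. apply meas_hol. apply hol_den.
Qed.

Lemma bump_le1 a z : Cmod a < 1 -> Cmod z < 1 -> 0 <= bump a z <= 1.
Proof.
intros ha hz. split. now apply nn_bump. rewrite bump_den by auto. assert (D := den_gt0 a z ha hz).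
apply (Rmult_le_reg_r (Cmod (den a z))); auto. rewrite Rmult_assoc, Rinv_l by lra.
destruct (den_ge a z ha hz) as [_ [h _]]. unfold dd. lra.
Qed.

Lemma bump_dist a z : Cmod a < 1 -> Cmod z < 1 -> bump a z * Cmod (z - a)%C <= dd a.
Proof.
intros ha hz. rewrite bump_den by auto. assert (D := den_gt0 a z ha hz). assert (da := dd_pos a ha).
apply (Rmult_le_reg_r (Cmod (den a z))); auto.
replace (dd a * / Cmod (den a z) * Cmod (z - a)%C * Cmod (den a z)) with (dd a * Cmod (z - a)%C) by (field; lra).
apply Rmult_le_compat_l. lra. apply (den_ge a z ha hz).
Qed.

Lemma bump_cubic a h : Cmod a < 1 -> nn h -> (forall z, Cmod z < 1 -> h z <= bump a z ^ 3) ->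
  IB h (64 * (dd a * dd a)).
Proof.
intros ha nh H. apply (cubic_decay_bound a); auto. now apply dd_pos.
intros z hz. specialize (H z hz). destruct (bump_le1 a z ha hz) as [b0 b1].
split. eapply Rle_trans. apply H. rewrite <- (pow1 3). now apply pow_incr.
assert (D := Cmod_ge_0 (z - a)%C).
apply Rle_trans with (bump a z ^ 3 * Cmod (z - a)%C ^ 3).
apply Rmult_le_compat_r; auto. now apply pow_le.
rewrite <- Rpow_mult_distr. apply pow_incr. split. nra. now apply bump_dist.
Qed.

Lemma pow_le_pow_lt1 x i j : 0 <= x <= 1 -> (i <= j)%nat -> x ^ j <= x ^ i.
Proof.
intros hx h. induction h. lra. simpl. assert (0 <= x ^ m) by (apply pow_le; lra). nra.
Qed.

(** For fixed z the sum over the centres is compared with an integral over the position of the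
    centre. After multiplication by d(z)^2/d(a_i)^2, two bump factors and the extra factor become
    the cube of d(z)/|1 - conj(a_i) z|, which decays cubically in the distance to z. *)
Lemma separated_bump_sum ka N a b z : 0 < ka <= 1 -> separated ka N a -> (3 <= b)%nat -> Cmod z < 1 ->
  rsum N (fun i => bump (a i) z ^ b * (dd z * / Cmod (den (a i) z))) <= 2048 / (ka * ka).
Proof.
intros hk hs hb hz. assert (dz := dd_pos z hz).
set (k0 := fun w => pw (2 * dd z) 3 * pw (2 * dd z + Cmod (w - z)%C) (- (3))).
assert (E3 : forall x, 0 <= x -> pw x 3 = x ^ 3).
{ intros x hx. replace 3 with (INR 3) by (simpl; ring). now apply pw_nat. }
assert (Ek : forall w, k0 w = (2 * dd z * / (2 * dd z + Cmod (w - z)%C)) ^ 3).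
{ intros w. assert (D := Cmod_ge_0 (w - z)%C). unfold k0. rewrite pw_opp, !E3 by lra. rewrite (Rpow_mult_distr (2 * dd z)), pow_inv. reflexivity. }
assert (nk : nn k0).
{ apply nn_scal. apply pw_ge0. apply nn_pw. apply meas_plus. apply meas_const. apply meas_dist. }
assert (hk0 : IB k0 (64 * (2 * dd z * (2 * dd z)))).
{ apply (cubic_decay_bound z); auto. lra. intros w hw. rewrite Ek. assert (D := Cmod_ge_0 (w - z)%C).
  assert (I : 0 < / (2 * dd z + Cmod (w - z)%C)) by (apply Rinv_0_lt_compat; lra).
  assert (I1 : (2 * dd z + Cmod (w - z)%C) * / (2 * dd z + Cmod (w - z)%C) = 1) by (apply Rinv_r; lra).
  split. rewrite <- (pow1 3). apply pow_incr. nra.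
  rewrite <- Rpow_mult_distr. apply pow_incr. split. repeat apply Rmult_le_pos; lra. nra. }
assert (nk8 := nn_scal 8 _ ltac:(lra) nk).
assert (Q := separated_sum ka N a (fun i => bump (a i) z ^ b * (dd z * / Cmod (den (a i) z)) * (dd z * dd z) / (dd (a i) * dd (a i)))
  (fun w => 8 * k0 w) (8 * (64 * (2 * dd z * (2 * dd z)))) hk hs).
assert (hs1 := proj1 hs).
assert (t : rsum N (fun i => bump (a i) z ^ b * (dd z * / Cmod (den (a i) z)) * (dd z * dd z) / (dd (a i) * dd (a i)) *
  (ka * dd (a i) * (ka * dd (a i)))) <= 8 * (64 * (2 * dd z * (2 * dd z)))).
{ apply Q; auto.
  - intros i hi. assert (ha := hs1 i hi). assert (da := dd_pos _ ha). assert (D := den_gt0 _ _ ha hz).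
    apply Rdiv_le_0_compat; [|nra]. apply Rmult_le_pos; [|nra]. apply Rmult_le_pos.
    apply pow_le. now apply bump_le1. apply Rmult_le_pos. lra. left; now apply Rinv_0_lt_compat.
  - apply IB_scal; auto. lra.
  - intros i w hi hw hwi. assert (ha := hs1 i hi). assert (da := dd_pos _ ha). assert (D := den_gt0 _ _ ha hz).
    destruct (den_ge _ _ ha hz) as [D1 [D2 D3]]. fold (dd z) in D1. fold (dd (a i)) in D2.
    assert (T := Cmod_tri3 w (a i) z). rewrite (Cmod_sub_sym (a i) z) in T.
    assert (Dw := Cmod_ge_0 (w - z)%C). assert (I0 : 0 < / Cmod (den (a i) z)) by now apply Rinv_0_lt_compat.
    (* The denominator dominates d(z), d(a_i) and |a_i - z|, and w is within d(a_i) of a_i; two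
       units each for 2 d(z) and |w - z|. *)
    assert (hd : 2 * dd z + Cmod (w - z)%C <= 4 * Cmod (den (a i) z)) by nra.
    rewrite Ek.
    apply Rle_trans with ((dd z * / Cmod (den (a i) z)) ^ 3).
    + apply (Rmult_le_reg_r (dd (a i) * dd (a i))). nra. unfold Rdiv. rewrite Rmult_assoc, Rinv_l, Rmult_1_r by nra.
      replace ((dd z * / Cmod (den (a i) z)) ^ 3 * (dd (a i) * dd (a i))) with
        (bump (a i) z ^ 2 * (dd z * / Cmod (den (a i) z)) * (dd z * dd z)) by (rewrite bump_den by auto; ring).
      apply Rmult_le_compat_r. nra. apply Rmult_le_compat_r. apply Rmult_le_pos; lra.
      apply pow_le_pow_lt1. now apply bump_le1. lia.
    + replace (8 * (2 * dd z * / (2 * dd z + Cmod (w - z)%C)) ^ 3) with ((4 * dd z * / (2 * dd z + Cmod (w - z)%C)) ^ 3) by ring.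
      apply pow_incr. split. apply Rmult_le_pos; lra.
      rewrite Rmult_comm, (Rmult_comm 4), Rmult_assoc, Rmult_comm. apply Rmult_le_compat_l. lra.
      apply (Rmult_le_reg_r (2 * dd z + Cmod (w - z)%C)). lra. rewrite Rmult_assoc, Rinv_l, Rmult_1_r by lra.
      apply (Rmult_le_reg_l (Cmod (den (a i) z))); auto. rewrite <- Rmult_assoc, Rinv_r; lra. }
assert (E : rsum N (fun i => bump (a i) z ^ b * (dd z * / Cmod (den (a i) z)) * (dd z * dd z) / (dd (a i) * dd (a i)) *
  (ka * dd (a i) * (ka * dd (a i)))) = ka * ka * (dd z * dd z) * rsum N (fun i => bump (a i) z ^ b * (dd z * / Cmod (den (a i) z)))).
{ rewrite <- rsum_scal. apply rsum_ext. intros i hi. assert (ha := hs1 i hi). assert (da := dd_pos _ ha).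
  field. split. assert (D := den_gt0 _ _ ha hz); lra. lra. }
rewrite E in t.
apply (Rmult_le_reg_l (ka * ka * (dd z * dd z))). apply Rmult_lt_0_compat; nra.
eapply Rle_trans. apply t. right. field. lra.
Qed.

(** The power d(a_i)^b normalises the i-th summand to modulus at most y_i [bump (a i) z ^ b]; [e]
    carries the signs. *)
Definition test (m b N : nat) (a : nat -> C) (y e : nat -> R) (z : C) : C :=
  csum N (fun i => RtoC (e i * (y i * dd (a i) ^ b)) * kern (a i) m b z)%C.

Section TestFunctions.
Variables (m b N : nat) (a : nat -> C) (y e : nat -> R).
Hypotheses (ha : forall i, (i < N)%nat -> Cmod (a i) < 1) (hy : forall i, (i < N)%nat -> 0 <= y i)
  (he : forall i, (i < N)%nat -> Rabs (e i) <= 1).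

Let hol_term i : (i < N)%nat -> hol (fun z => RtoC (e i * (y i * dd (a i) ^ b)) * kern (a i) m b z)%C.
Proof. intros hi. apply hol_mult. apply hol_const. apply hol_kern. now apply ha. Qed.

Lemma hol_test : hol (test m b N a y e).
Proof. apply (hol_csum N (fun i z => RtoC (e i * (y i * dd (a i) ^ b)) * kern (a i) m b z)%C). exact hol_term. Qed.

Let coef_le i : (i < N)%nat -> Cmod (RtoC (e i * (y i * dd (a i) ^ b))) <= y i * dd (a i) ^ b.
Proof.
intros hi. rewrite Cmod_R, Rabs_mult.
assert (0 <= y i * dd (a i) ^ b). { apply Rmult_le_pos. now apply hy. apply pow_le. left; apply dd_pos. now apply ha. }
rewrite (Rabs_pos_eq (y i * _)) by auto. rewrite <- (Rmult_1_l (y i * dd (a i) ^ b)) at 2. apply Rmult_le_compat_r; auto.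
Qed.

Lemma test_le z : Cmod z < 1 -> Cmod (test m b N a y e z) <= rsum N (fun i => y i * bump (a i) z ^ b).
Proof.
intros hz. eapply Rle_trans. apply Cmod_csum. apply rsum_le. intros i hi. rewrite Cmod_mult.
rewrite bump_den by auto. rewrite Rpow_mult_distr.
replace (y i * (dd (a i) ^ b * (/ Cmod (den (a i) z)) ^ b)) with (y i * dd (a i) ^ b * (/ Cmod (den (a i) z)) ^ b) by ring.
apply Rmult_le_compat; auto; try apply Cmod_ge_0. apply kern_le; auto.
Qed.

Lemma test_deriv_le z : Cmod z < 1 -> Cmod (Cderiv (test m b N a y e) z) * dd z <=
  INR (b + m + m) * rsum N (fun i => y i * (bump (a i) z ^ b * (dd z * / Cmod (den (a i) z)))).
Proof.
intros hz. assert (dz := dd_pos z hz).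
assert (E : Cderiv (test m b N a y e) z = csum N (fun i => RtoC (e i * (y i * dd (a i) ^ b)) * Cderiv (kern (a i) m b) z)%C).
{ etransitivity. exact (Cderiv_n_csum 1 N (fun i z => RtoC (e i * (y i * dd (a i) ^ b)) * kern (a i) m b z)%C z hol_term hz).
  apply csum_ext. intros i hi. exact (Cderiv_scal _ _ _ (hol_kern (a i) m b (ha i hi)) hz). }
rewrite E, <- rsum_scal, Rmult_comm.
eapply Rle_trans. apply Rmult_le_compat_l. lra. apply Cmod_csum.
rewrite <- rsum_scal. apply rsum_le. intros i hi. rewrite Cmod_mult.
rewrite bump_den by auto. assert (D := den_gt0 _ _ (ha i hi) hz).
assert (K := kern_deriv_le (a i) m b z (ha i hi) hz).
apply Rle_trans with (dd z * (y i * dd (a i) ^ b * (INR (b + m + m) * (/ Cmod (den (a i) z)) ^ (b + 1)))).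
- apply Rmult_le_compat_l. lra. apply Rmult_le_compat; auto; apply Cmod_ge_0.
- right. rewrite Rpow_mult_distr, pow_add. ring.
Qed.
End TestFunctions.

Lemma pw_rsum_subadd n p F : 0 < p <= 1 -> (forall i, (i < n)%nat -> 0 <= F i) ->
  pw (rsum n F) p <= rsum n (fun i => pw (F i) p).
Proof.
intros hp H. induction n as [|n IH]; cbn [rsum]. rewrite pw_zero; lra.
eapply Rle_trans. apply pw_subadd; try lra. apply rsum_ge0; auto. apply H; auto.
apply Rplus_le_compat_r. auto.
Qed.

(** For p at most 1 subadditivity separates the summands, and b p >= 3 gives each the cubic decay
    that makes it integrable on the scale of its centre. *)
Lemma test_norm_small p m b : 0 < p <= 1 -> 3 <= INR b * p -> forall N a y e,
  (forall i, (i < N)%nat -> Cmod (a i) < 1) -> (forall i, (i < N)%nat -> 0 <= y i) ->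
  (forall i, (i < N)%nat -> Rabs (e i) <= 1) ->
  IB (nrm p (test m b N a y e)) (64 * rsum N (fun i => pw (y i) p * (dd (a i) * dd (a i)))).
Proof.
intros hp hb N a y e ha hy he.
assert (nb : forall i, (i < N)%nat -> nn (fun z => pw (bump (a i) z) (INR b * p))) by (intros i hi; apply nn_pw; apply nn_bump; auto).
assert (nt : forall i, (i < N)%nat -> nn (fun z => pw (y i) p * pw (bump (a i) z) (INR b * p))).
{ intros i hi. apply nn_scal; auto. apply pw_ge0. }
apply (IB_le (k := fun z => rsum N (fun i => pw (y i) p * pw (bump (a i) z) (INR b * p)))).
- apply nn_nrm. now apply hol_test.
- now apply nn_rsum.
- intros z hz. apply Rle_trans with (pw (rsum N (fun i => y i * bump (a i) z ^ b)) p).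
  apply pw_le. lra. apply Cmod_ge_0. apply test_le; auto.
  assert (B0 : forall i, (i < N)%nat -> 0 <= bump (a i) z ^ b) by (intros i hi; apply pow_le; apply bump_le1; auto).
  eapply Rle_trans. apply pw_rsum_subadd; auto. intros i hi. apply Rmult_le_pos; auto.
  apply rsum_le. intros i hi. rewrite pw_mult by auto. right. f_equal. rewrite <- pw_pw. f_equal.
  symmetry. apply pw_nat. apply bump_le1; auto.
- apply (IB_weak (B := rsum N (fun i => pw (y i) p * (64 * (dd (a i) * dd (a i)))))).
  { rewrite <- rsum_scal. right. apply rsum_ext. intros; ring. }
  apply IB_rsum; auto. intros i hi. apply IB_scal; auto. apply pw_ge0. apply bump_cubic; auto.
  intros z hz. destruct (bump_le1 (a i) z (ha i hi) hz) as [b0 b1].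
  rewrite <- (pw_nat 3 b0). apply pw_large_exp; auto; simpl; lra.
Qed.

(** Jensen's inequality needs weights with a bounded sum, but the sum of the powers
    [bump (a i) z ^ b] can grow logarithmically at the circle. Differentiation supplies the extra
    factor d(z)/|1 - conj(a_i) z|, which bounds the sum; the bound for primitives then returns from
    f' to f - f(0). *)
Lemma test_norm_large p m b : 1 < p -> (3 <= b)%nat -> exists K, 0 < K /\ forall N a y e,
  separated (/ 8) N a -> (forall i, (i < N)%nat -> 0 <= y i) -> (forall i, (i < N)%nat -> Rabs (e i) <= 1) ->
  IB (nrm p (test m b N a y e)) (K * rsum N (fun i => pw (y i) p * (dd (a i) * dd (a i)))).
Proof.
intros hp hb. destruct (primitive_weighted_bound p 0 ltac:(lra) ltac:(lra)) as [K [K0 HK]].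
set (U := 2048 / (/ 8 * / 8)). assert (U0 : 0 < U) by (unfold U; lra).
set (Pu := pw U (p - 1)). assert (Pu0 : 0 < Pu) by now apply pw_gt0.
set (Cb := pw (INR (b + m + m)) p). assert (Cb0 : 0 <= Cb) by apply pw_ge0.
assert (P2 : 0 < pw 2 p) by (apply pw_gt0; lra).
exists (pw 2 p * (K * (Cb * (Pu * 64)) + 4 * Pu)). split.
{ apply Rmult_lt_0_compat; auto. assert (0 <= K * (Cb * (Pu * 64))) by (repeat apply Rmult_le_pos; lra). lra. }
intros N a y e hs hy he. assert (ha := proj1 hs).
set (S2 := rsum N (fun i => pw (y i) p * (dd (a i) * dd (a i)))).
set (f := test m b N a y e). assert (hf : hol f) by (apply hol_test; auto).
set (u := fun i z => bump (a i) z ^ b * (dd z * / Cmod (den (a i) z))).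
assert (hu : forall z, Cmod z < 1 -> (forall i, (i < N)%nat -> 0 <= u i z) /\ rsum N (fun i => u i z) <= U).
{ intros z hz. assert (dz := dd_pos z hz). split. intros i hi. apply Rmult_le_pos. apply pow_le. apply bump_le1; auto.
  apply Rmult_le_pos. lra. left. apply Rinv_0_lt_compat. apply den_gt0; auto.
  unfold u, U. apply separated_bump_sum; auto. lra. }
assert (jens : forall z, Cmod z < 1 -> pw (rsum N (fun i => y i * u i z)) p <= Pu * rsum N (fun i => pw (y i) p * u i z)).
{ intros z hz. destruct (hu z hz). now apply weighted_jensen. }
assert (nu : forall i, (i < N)%nat -> nn (u i)).
{ intros i hi. apply (nn_ext (fun z => pw (bump (a i) z) (INR b) * (dd z * pw (Cmod (den (a i) z)) (- (1))))).
  - intros z hz. unfold u. rewrite pw_nat by (apply bump_le1; auto). rewrite pw_m1; auto. apply den_gt0; auto.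
  - apply nn_mult. apply nn_pw. apply nn_bump; auto. apply nn_mult.
    apply (nn_ext (fun z => pw (dd z) 1)). intros z hz. apply pw_1. left; now apply dd_pos. apply nn_dd.
    apply nn_pw. apply meas_hol. apply hol_den. }
assert (u_int : forall i, (i < N)%nat -> IB (u i) (64 * (dd (a i) * dd (a i)))).
{ intros i hi. apply bump_cubic; auto. intros z hz. destruct (bump_le1 (a i) z (ha i hi) hz) as [b0 b1].
  assert (D := den_gt0 _ _ (ha i hi) hz). destruct (den_ge _ _ (ha i hi) hz) as [D1 _]. fold (dd z) in D1.
  assert (dz := dd_pos z hz).
  apply Rle_trans with (bump (a i) z ^ b * 1).
  - apply Rmult_le_compat_l. now apply pow_le. apply (Rmult_le_reg_r (Cmod (den (a i) z))); auto.
    rewrite Rmult_assoc, Rinv_l; lra.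
  - rewrite Rmult_1_r. now apply pow_le_pow_lt1. }
assert (nyu : forall i, (i < N)%nat -> nn (fun z => pw (y i) p * u i z)).
{ intros i hi. apply nn_scal; auto. apply pw_ge0. }
assert (nsum := nn_rsum N (fun i z => pw (y i) p * u i z) nyu).
assert (hsum : IB (fun z => rsum N (fun i => pw (y i) p * u i z)) (64 * S2)).
{ apply (IB_weak (B := rsum N (fun i => pw (y i) p * (64 * (dd (a i) * dd (a i)))))).
  { unfold S2. rewrite <- rsum_scal. right. apply rsum_ext. intros; ring. }
  apply IB_rsum; auto. intros i hi. apply IB_scal; auto. apply pw_ge0. }
assert (hD : IB (fun z => nrm p (Cderiv f) z * pw (dd z) (0 + p)) (Cb * (Pu * (64 * S2)))).
{ assert (n1 := nn_scal Pu _ (Rlt_le _ _ Pu0) nsum). assert (n2 := nn_scal Cb _ Cb0 n1).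
  apply (IB_le (k := fun z => Cb * (Pu * rsum N (fun i => pw (y i) p * u i z)))); auto.
  - apply nn_mult. apply nn_nrm. now apply hol_Cderiv. apply nn_dd.
  - intros z hz. rewrite Rplus_0_l. assert (dz := dd_pos z hz). unfold nrm.
    rewrite <- pw_mult by (try apply Cmod_ge_0; lra).
    apply Rle_trans with (Cb * pw (rsum N (fun i => y i * u i z)) p).
    2: apply Rmult_le_compat_l; auto.
    unfold Cb. rewrite <- pw_mult. apply pw_le. lra. apply Rmult_le_pos. apply Cmod_ge_0. lra.
    apply test_deriv_le; auto. apply pos_INR. apply rsum_ge0. intros i hi. apply Rmult_le_pos; auto. now apply hu.
  - apply IB_scal; auto. apply IB_scal; auto; lra. }
set (G := fun z => (f z - f 0)%C).
assert (hG : hol G) by (apply hol_minus; auto; apply hol_const).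
assert (hGB : IB (nrm p G) (K * (Cb * (Pu * (64 * S2))))).
{ apply (IB_ext (fun z => nrm p G z * pw (dd z) 0)).
  intros z hz. now rewrite pw_0r, Rmult_1_r. apply nn_mult. now apply nn_nrm. apply nn_dd.
  apply (HK G _ hG). unfold G. ring.
  revert hD. apply IB_ext. intros z hz. unfold nrm. apply (f_equal (fun c : C => pw (Cmod c) p * pw (dd z) (0 + p))).
  
  unfold G. symmetry. etransitivity. apply (Cderiv_minus f (fun _ => f 0%C)); auto. apply hol_const.
  rewrite (Cderiv_eq (fun _ => f 0%C) z 0%C). ring. apply dlim_const.
  apply nn_mult. apply nn_nrm. now apply hol_Cderiv. apply nn_dd. }
(* At 0 the denominators are 1, so the weights are d(a_i)^b, which do not exceed d(a_i)^2. *)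
assert (f0 : pw (Cmod (f 0%C)) p <= Pu * S2).
{ assert (z0 : Cmod 0%C < 1) by (rewrite Cmod_0; lra).
  assert (E : forall i, (i < N)%nat -> u i 0%C = bump (a i) 0%C ^ b /\ bump (a i) 0%C = dd (a i)).
  { intros i hi. assert (Ed : Cmod (den (a i) 0%C) = 1). { unfold den. replace (1 - Cconj (a i) * 0)%C with (RtoC 1) by ring. apply Cmod_1. }
    unfold u. rewrite bump_den by auto. rewrite Ed. unfold dd at 2. rewrite Cmod_0. split; field. }
  apply Rle_trans with (pw (rsum N (fun i => y i * u i 0%C)) p).
  { apply pw_le. lra. apply Cmod_ge_0. eapply Rle_trans. apply test_le; auto.
    right. apply rsum_ext. intros i hi. now rewrite (proj1 (E i hi)). }
  eapply Rle_trans. now apply jens. apply Rmult_le_compat_l. lra. apply rsum_le. intros i hi.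
  apply Rmult_le_compat_l. apply pw_ge0. destruct (E i hi) as [-> ->].
  replace (dd (a i) * dd (a i)) with (dd (a i) ^ 2) by ring. apply pow_le_pow_lt1. split. left; apply dd_pos; auto. apply dd_le1. lia. }
apply (IB_weak (B := pw 2 p * (K * (Cb * (Pu * (64 * S2))) + 4 * (Pu * S2)))). right; ring.
assert (S20 : 0 <= Pu * S2).
{ eapply Rle_trans; [|apply f0]. apply pw_ge0. }
assert (n1 := nn_nrm p hG). assert (n2 : nn (fun _ : C => Pu * S2)) by now apply nn_const.
assert (n3 := nn_plus _ _ n1 n2).
apply (IB_le (k := fun z => pw 2 p * (nrm p G z + Pu * S2))).
- now apply nn_nrm.
- apply nn_scal; auto. lra.
- intros z hz. apply Rle_trans with (pw (Cmod (G z) + Cmod (f 0%C)) p).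
  { apply pw_le. lra. apply Cmod_ge_0. unfold G. generalize (Cmod_sub_ge (f z) (f 0%C)); lra. }
  eapply Rle_trans. apply pw_add_le; try apply Cmod_ge_0; lra.
  apply Rmult_le_compat_l. lra. apply Rplus_le_compat_l. exact f0.
- apply IB_scal; auto. lra. apply IB_plus; auto. now apply IB_const.
Qed.

Lemma test_norm p m b : 0 < p -> (3 <= b)%nat -> 3 <= INR b * p -> exists K, 0 < K /\ forall N a y e,
  separated (/ 8) N a -> (forall i, (i < N)%nat -> 0 <= y i) -> (forall i, (i < N)%nat -> Rabs (e i) <= 1) ->
  IB (nrm p (test m b N a y e)) (K * rsum N (fun i => pw (y i) p * (dd (a i) * dd (a i)))).
Proof.
intros hp hb hbp. destruct (Rle_lt_dec p 1) as [h|h]. 2: now apply test_norm_large.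
exists 64. split. lra. intros N a y e [ha _] hy he. apply test_norm_small; auto.
Qed.

(** * Linearity of the symbol operator and averages over signs *)

Lemma Lop_plus n g f h z : hol f -> hol h -> Cmod z < 1 ->
  Lop n g (fun z => f z + h z)%C z = (Lop n g f z + Lop n g h z)%C.
Proof.
intros hf hh hz. unfold Lop. induction n as [|n IH]; simpl. ring.
rewrite IH, Cderiv_n_plus by auto. ring.
Qed.

Lemma Lop_scal n g c f z : hol f -> Cmod z < 1 -> Lop n g (fun z => c * f z)%C z = (c * Lop n g f z)%C.
Proof.
intros hf hz. unfold Lop. induction n as [|n IH]; simpl. ring.
rewrite IH, Cderiv_n_scal by auto. ring.
Qed.

Lemma Lop_csum n g N (F : nat -> C -> C) z : (forall i, (i < N)%nat -> hol (F i)) -> Cmod z < 1 ->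
  Lop n g (fun z => csum N (fun i => F i z)) z = csum N (fun i => Lop n g (F i) z).
Proof.
intros hF hz. induction N as [|N IH]; simpl.
- unfold Lop. apply csum_eq0. intros k hk.
  assert (E : Cderiv_n k (fun _ => 0%C) z = 0%C).
  { rewrite (Cderiv_n_ext k (fun _ => 0%C) (fun z => 0 * 0)%C); auto.
    rewrite (Cderiv_n_scal k 0 (fun _ => 0%C)) by (auto; apply hol_const). ring.
    intros w hw. ring. apply hol_const. }
  rewrite E. ring.
- rewrite (Lop_plus n g (fun z => csum N (fun i => F i z)) (F N)); auto.
  now rewrite IH by auto. apply hol_csum; auto.
Qed.

(* The mean of [|v + e_0 psi_0 + ... + e_(N-1) psi_(N-1)|^q] over all signs [e_i = 1, -1]. *)
Fixpoint sign_mean (q : R) (psi : nat -> C) (N : nat) (v : C) : R :=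
  match N with
  | O => pw (Cmod v) q
  | S N => (sign_mean q psi N (v + psi N)%C + sign_mean q psi N (v - psi N)%C) / 2
  end.

(** At the bottom of the recursion this says that one of |v1|, |v2| is at least |v1 - v2|/2, which
    holds for every exponent. *)
Lemma sign_mean_pair q psi N v1 v2 : 0 < q ->
  pw (Cmod (v1 - v2)%C / 2) q <= sign_mean q psi N v1 + sign_mean q psi N v2.
Proof.
intros hq. revert v1 v2. induction N as [|N IH]; intros v1 v2; simpl.
- assert (A := Cmod_sub_le v1 v2). assert (D := Cmod_ge_0 (v1 - v2)%C).
  assert (P1 := pw_ge0 (Cmod v1) q). assert (P2 := pw_ge0 (Cmod v2) q).
  destruct (Rle_lt_dec (Cmod v1) (Cmod v2)) as [h|h].
  + apply Rle_trans with (pw (Cmod v2) q); [apply pw_le|]; lra.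
  + apply Rle_trans with (pw (Cmod v1) q); [apply pw_le|]; lra.
- assert (A := IH (v1 + psi N)%C (v2 + psi N)%C). assert (B := IH (v1 - psi N)%C (v2 - psi N)%C).
  replace (v1 + psi N - (v2 + psi N))%C with (v1 - v2)%C in A by ring.
  replace (v1 - psi N - (v2 - psi N))%C with (v1 - v2)%C in B by ring. lra.
Qed.

(** The two signs of psi_i are paired; their difference 2 psi_i does not depend on the other signs.
    This one-term lower bound replaces Khinchine's inequality. *)
Lemma sign_mean_term q psi N v i : 0 < q -> (i < N)%nat -> pw (Cmod (psi i)) q / 2 <= sign_mean q psi N v.
Proof.
intros hq. revert v. induction N as [|N IH]; intros v hi. lia. simpl.
destruct (Nat.eq_dec i N) as [->|ne].
- assert (A := sign_mean_pair q psi N (v + psi N)%C (v - psi N)%C hq).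
  replace (v + psi N - (v - psi N))%C with (RtoC 2 * psi N)%C in A.
  2:{ replace (RtoC 2) with (RtoC 1 + RtoC 1)%C by (rewrite <- RtoC_plus; f_equal; ring). ring. }
  rewrite Cmod_scal in A by lra. replace (2 * Cmod (psi N) / 2) with (Cmod (psi N)) in A by field. lra.
- assert (A := IH (v + psi N)%C ltac:(lia)). assert (B := IH (v - psi N)%C ltac:(lia)). lra.
Qed.

Lemma nn_sign_mean q (psi : nat -> C -> C) N v : (forall i, (i < N)%nat -> hol (psi i)) -> hol v ->
  nn (fun z => sign_mean q (fun i => psi i z) N (v z)).
Proof.
revert v. induction N as [|N IH]; intros v hpsi hv; simpl. now apply nn_nrm.
assert (n1 := IH (fun z => v z + psi N z)%C ltac:(auto) ltac:(apply hol_plus; auto)).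
assert (n2 := IH (fun z => v z - psi N z)%C ltac:(auto) ltac:(apply hol_minus; auto)).
apply (nn_ext (fun z => / 2 * (sign_mean q (fun i => psi i z) N (v z + psi N z)%C + sign_mean q (fun i => psi i z) N (v z - psi N z)%C))).
intros z hz. field. apply nn_scal. lra. now apply nn_plus.
Qed.

Lemma IB_sign_mean q (psi : nat -> C -> C) N W B v : (forall i, (i < N)%nat -> hol (psi i)) -> hol v -> nn W ->
  (forall e, (forall i, (i < N)%nat -> Rabs (e i) <= 1) ->
    IB (fun z => nrm q (fun z => v z + csum N (fun i => RtoC (e i) * psi i z))%C z * W z) B) ->
  IB (fun z => sign_mean q (fun i => psi i z) N (v z) * W z) B.
Proof.
revert v. induction N as [|N IH]; intros v hpsi hv nW H.
(* With no summands left, any admissible sign vector gives the integral of |v|^q times the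
   weight. *)
- eapply IB_ext; [| |apply (H (fun _ => 0))].
  + intros z hz. unfold nrm. simpl. now rewrite Cplus_0_r.
  + apply nn_mult; auto. apply nn_nrm. apply hol_plus; auto. apply (hol_csum 0 (fun i z => RtoC 0 * psi i z)%C). intros; lia.
  + intros; lia.
- assert (hP := hpsi N ltac:(auto)).
  assert (hv1 : hol (fun z => v z + psi N z)%C) by now apply hol_plus.
  assert (hv2 : hol (fun z => v z - psi N z)%C) by now apply hol_minus.
  assert (n1 := nn_mult _ _ (nn_sign_mean q psi N _ ltac:(auto) hv1) nW).
  assert (n2 := nn_mult _ _ (nn_sign_mean q psi N _ ltac:(auto) hv2) nW).
  assert (step : forall s, Rabs s <= 1 -> forall e, (forall i, (i < N)%nat -> Rabs (e i) <= 1) ->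
    IB (fun z => nrm q (fun z => v z + RtoC s * psi N z + csum N (fun i => RtoC (e i) * psi i z))%C z * W z) B).
  { intros s hs e he.
    eapply IB_ext; [| |apply (H (fun i => if Nat.eq_dec i N then s else e i))].
    - intros z hz. unfold nrm. f_equal. f_equal. f_equal. simpl csum.
      destruct (Nat.eq_dec N N) as [_|ne]; [|lia].
      rewrite (csum_ext N _ (fun i => RtoC (e i) * psi i z)%C). ring.
      intros i hi. destruct (Nat.eq_dec i N); [lia|auto].
    - apply nn_mult; auto. apply nn_nrm. apply hol_plus; auto.
      apply (hol_csum (S N) (fun i z => RtoC (if Nat.eq_dec i N then s else e i) * psi i z)%C).
      intros i hi. apply hol_mult. apply hol_const. auto.
    - intros i hi. destruct (Nat.eq_dec i N); auto. apply he; lia. }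
  assert (h1 : IB (fun z => sign_mean q (fun i => psi i z) N (v z + psi N z)%C * W z) B).
  { apply (IH (fun z => v z + psi N z)%C); auto. intros e he.
    eapply IB_ext; [| |apply (step 1 ltac:(rewrite Rabs_R1; lra) e he)].
    intros z hz. unfold nrm. now rewrite Cmult_1_l.
    apply nn_mult; auto. apply nn_nrm. apply hol_plus. apply hol_plus; auto. apply hol_mult; auto. apply hol_const.
    apply (hol_csum N (fun i z => RtoC (e i) * psi i z)%C). intros; apply hol_mult; auto. apply hol_const. }
  assert (h2 : IB (fun z => sign_mean q (fun i => psi i z) N (v z - psi N z)%C * W z) B).
  { apply (IH (fun z => v z - psi N z)%C); auto. intros e he.
    eapply IB_ext; [| |apply (step (- (1)) ltac:(rewrite Rabs_Ropp, Rabs_R1; lra) e he)].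
    intros z hz. unfold nrm. f_equal. f_equal. f_equal. f_equal. rewrite RtoC_opp. ring.
    apply nn_mult; auto. apply nn_nrm. apply hol_plus. apply hol_plus; auto. apply hol_mult; auto. apply hol_const.
    apply (hol_csum N (fun i z => RtoC (e i) * psi i z)%C). intros; apply hol_mult; auto. apply hol_const. }
  apply (IB_weak (B := / 2 * (B + B))). lra.
  assert (n3 := nn_plus _ _ n1 n2).
  generalize (IB_scal (c := / 2) ltac:(lra) n3 (IB_plus n1 n2 h1 h2)).
  apply IB_ext. intros z hz. simpl. field. apply nn_scal. lra. exact n3.
Qed.

Lemma Lop_kern_diag m g a b : Cmod a < 1 ->
  Lop (S m) g (kern a m b) a = (Cderiv_n m (kern a m b) a * g m a)%C.
Proof.
intros ha. unfold Lop. simpl csum. rewrite csum_eq0. apply Cplus_0_l.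
intros k hk. rewrite kern_vanish by auto. apply Cmult_0_l.
Qed.

(** * Boundedness forces summability of the top symbol *)

Section Necessity.
Variables (n : nat) (g : nat -> C -> C) (p q : R).
Hypotheses (hg : forall k, (k < n)%nat -> hol (g k)) (hq : 0 < q) (hqp : q < p).
Let s := p * q / (p - q).
Let W := fun z => pw (dd z) (INR n * q).

(** The statement of the downward induction: only the first m symbols are kept, but the weight still
    carries the full n. *)
Definition Lop_bounded (m : nat) : Prop := exists B, 0 <= B /\ forall f, hol f -> IB (nrm p f) 1 ->
  IB (fun z => nrm q (Lop m g f) z * pw (dd z) (INR n * q)) B.

Lemma bump_exponent : exists b, (3 <= b)%nat /\ 3 <= INR b * p.
Proof.
destruct (INR_unbounded (3 + 3 / p)) as [b hb]. exists b.
assert (0 < 3 / p) by (apply Rdiv_lt_0_compat; lra).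
split. apply INR_le. simpl. lra. apply Rle_trans with (3 / p * p). right; field; lra.
apply Rmult_le_compat_r; lra.
Qed.

(* Averaging over signs isolates each bump near its own centre. *)
Lemma test_terms_bound m : (m < n)%nat -> Lop_bounded (S m) -> exists K, 0 < K /\ exists K1, 0 < K1 /\ forall N a y, separated (/ 8) N a -> (forall i, (i < N)%nat -> 0 <= y i) ->
  K1 * rsum N (fun i => pw (y i) p * (dd (a i) * dd (a i))) <= 1 ->
  rsum N (fun i => pw (y i * symb n g m (a i)) q * (dd (a i) * dd (a i))) <= K.
Proof.
intros hm [B [B0 HB]]. destruct bump_exponent as [b [hb hbp]].
destruct (test_norm p m b ltac:(lra) hb hbp) as [K1 [K10 H1]].
destruct (sub_mean q hq) as [K2 [K20 H2]].
assert (hgm : forall k, (k < S m)%nat -> hol (g k)) by (intros; apply hg; lia).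
set (c := pw ((/ 2) ^ (b + m)) q). assert (c0 : 0 < c) by (apply pw_gt0; apply pow_lt; lra).
set (P := pw 2 (INR n * q)). assert (P0 : 0 < P) by (apply pw_gt0; lra).
exists (64 * / c * (K2 * (2 * P)) * (B + 1)). split.
{ apply Rmult_lt_0_compat; [|lra]. apply Rmult_lt_0_compat. apply Rmult_lt_0_compat. lra. now apply Rinv_0_lt_compat. nra. }
exists K1. split; auto.
intros N a y hs hy hS. assert (ha := proj1 hs).
set (coef := fun i => y i * dd (a i) ^ b).
set (psi := fun i => Lop (S m) g (fun z => RtoC (coef i) * kern (a i) m b z)%C).
assert (hk : forall i, (i < N)%nat -> hol (fun z => RtoC (coef i) * kern (a i) m b z)%C).
{ intros i hi. apply hol_mult. apply hol_const. apply hol_kern; auto. }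
assert (hpsi : forall i, (i < N)%nat -> hol (psi i)) by (intros i hi; apply hol_Lop; auto).
assert (nW : nn W) by apply nn_dd.
assert (nH := nn_mult _ _ (nn_sign_mean q psi N (fun _ => 0%C) hpsi (hol_const _)) nW).
assert (hH : IB (fun z => sign_mean q (fun i => psi i z) N 0%C * W z) B).
{ apply (IB_sign_mean q psi N W B (fun _ => 0%C)); auto. apply hol_const. intros e he.
  assert (hf : hol (test m b N a y e)) by (apply hol_test; auto).
  assert (Q : IB (nrm p (test m b N a y e)) 1).
  { eapply IB_weak; [|apply H1; auto]. exact hS. }
  generalize (HB _ hf Q). apply IB_ext.
  - intros z hz. unfold nrm, W. apply (f_equal (fun c : C => pw (Cmod c) q * pw (dd z) (INR n * q))).
    rewrite Cplus_0_l. unfold test.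
    rewrite (Lop_csum (S m) g N (fun i z => RtoC (e i * (y i * dd (a i) ^ b)) * kern (a i) m b z)%C); auto.
    + apply csum_ext. intros i hi. unfold psi.
      rewrite (Lop_scal (S m) g _ (kern (a i) m b)) by (auto; apply hol_kern; auto).
      rewrite (Lop_scal (S m) g _ (kern (a i) m b)) by (auto; apply hol_kern; auto).
      unfold coef. rewrite (RtoC_mult (e i)). ring.
    + intros i hi. apply hol_mult. apply hol_const. apply hol_kern; auto.
  - apply nn_mult; auto. apply nn_nrm. apply hol_Lop; auto. }
destruct (separated_split (/ 8) N a _ B ltac:(lra) hs nH hH) as [v [hv1 hv2]].
assert (T : forall i, (i < N)%nat -> pw (y i * symb n g m (a i)) q * (dd (a i) * dd (a i)) <=
  64 * / c * (K2 * (2 * P)) * v i).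
{ intros i hi. assert (di := dd_pos _ (ha i hi)). set (d := dd (a i)) in *.
  (* The 2 is lost in [sign_mean_term]. On the disc of radius d/8 the weight is at least 1/P times
     its value at the centre, since there d <= 2 [dd z]. *)
  set (A := / (2 * P) * pw d (INR n * q)).
  assert (A0 : 0 < A) by (apply Rmult_lt_0_compat; [apply Rinv_0_lt_compat; lra|now apply pw_gt0]).
  assert (E1 : pw (Cmod (psi i (a i))) q * (/ 8 * d * (/ 8 * d)) <= K2 * (/ A * v i)).
  { apply H2; auto. nra. unfold d, dd in *; lra.
    assert (iA : 0 < / A) by now apply Rinv_0_lt_compat.
    assert (nH' := nn_mult _ _ (nn_ball (a i) (/ 8 * d)) nH).
    generalize (IB_scal (Rlt_le _ _ iA) nH' (hv1 i hi)). apply IB_le.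
    - apply nn_mult. apply nn_ball. apply nn_nrm; auto.
    - apply nn_scal; auto. lra.
    - intros z hz. destruct (Rlt_le_dec (Cmod (z - a i)%C) (/ 8 * d)) as [h|h].
      2:{ rewrite (ilt_0 _ _ h), !Rmult_0_l, Rmult_0_r. lra. }
      rewrite (ilt_1 _ _ h), !Rmult_1_l.
      assert (S1 := sign_mean_term q (fun i => psi i z) N 0%C i hq hi). cbv beta in S1. fold (nrm q (psi i) z) in S1.
      assert (dz : d <= 2 * dd z) by (generalize (dd_lip (a i) z); rewrite Cmod_sub_sym; fold d; lra).
      assert (W1 : / P * pw d (INR n * q) <= W z).
      { apply (Rmult_le_reg_l P); auto. rewrite <- Rmult_assoc, Rinv_r, Rmult_1_l by lra.
        unfold P, W. rewrite <- pw_mult by (generalize (dd_pos z hz); lra). apply pw_le; auto.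
        apply Rmult_le_pos. apply pos_INR. lra. lra. }
      apply (Rmult_le_reg_l A); auto. rewrite <- Rmult_assoc, Rinv_r, Rmult_1_l by lra.
      assert (N0 : 0 <= nrm q (psi i) z) by apply pw_ge0.
      replace (A * nrm q (psi i) z) with (nrm q (psi i) z / 2 * (/ P * pw d (INR n * q))) by (unfold A; field; lra).
      apply Rmult_le_compat; auto. lra. apply Rmult_le_pos. left; now apply Rinv_0_lt_compat. apply pw_ge0. }
  (* At a_i only the top symbol sees the bump. The powers of d from the coefficient, the kernel and
     the weight d^n combine to d^(n-m), the power in the symbol. *)
  assert (E2 : (/ 2) ^ (b + m) * (y i * symb n g m (a i)) <= Cmod (psi i (a i)) * d ^ n).
  { unfold psi. rewrite (Lop_scal (S m) g _ (kern (a i) m b)) by (auto; apply hol_kern; auto).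
    rewrite Lop_kern_diag by auto. rewrite !Cmod_mult, Cmod_R, Rabs_pos_eq.
    2:{ apply Rmult_le_pos; auto. apply pow_le; fold d; lra. }
    assert (KT := kern_top (a i) m b (ha i hi)). fold (dd (a i)) in KT. fold d in KT.
    unfold symb, coef. fold d. rewrite pw_nat by lra.
    assert (Cg := Cmod_ge_0 (g m (a i))).
    replace n with (m + (n - m))%nat at 2 by lia. rewrite (pow_add d m).
    replace ((/ 2) ^ (b + m) * (y i * (Cmod (g m (a i)) * d ^ (n - m)))) with
      (y i * d ^ b * ((/ (2 * d)) ^ (b + m) * Cmod (g m (a i))) * (d ^ m * d ^ (n - m))).
    2:{ rewrite Rinv_mult, Rpow_mult_distr, (pow_add (/ d)), (pow_inv d). rewrite (pow_inv d m). field.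
        split; apply pow_nonzero; lra. }
    apply Rmult_le_compat_r. apply Rmult_le_pos; apply pow_le; lra.
    apply Rmult_le_compat_l. apply Rmult_le_pos; auto. apply pow_le; lra.
    apply Rmult_le_compat_r; auto. }
  assert (Y0 : 0 <= y i * symb n g m (a i)) by (apply Rmult_le_pos; auto; apply symb_ge0).
  assert (E3 : c * pw (y i * symb n g m (a i)) q <= pw (Cmod (psi i (a i))) q * pw d (INR n * q)).
  { unfold c. rewrite <- pw_mult by (auto; apply pow_le; lra). rewrite <- pw_pw, <- pw_mult by (try apply Cmod_ge_0; apply pw_ge0).
    apply pw_le. lra. apply Rmult_le_pos; auto. apply pow_le; lra. rewrite pw_nat by lra. exact E2. }
  assert (E4 : c * pw (y i * symb n g m (a i)) q * (d * d) <= 64 * (pw d (INR n * q) * (K2 * (/ A * v i)))).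
  { apply Rle_trans with (64 * (pw d (INR n * q) * (pw (Cmod (psi i (a i))) q * (/ 8 * d * (/ 8 * d))))).
    replace (64 * (pw d (INR n * q) * (pw (Cmod (psi i (a i))) q * (/ 8 * d * (/ 8 * d))))) with
      (pw (Cmod (psi i (a i))) q * pw d (INR n * q) * (d * d)) by field.
    apply Rmult_le_compat_r; auto. nra.
    apply Rmult_le_compat_l. lra. apply Rmult_le_compat_l. apply pw_ge0. exact E1. }
  assert (D0 : 0 < pw d (INR n * q)) by now apply pw_gt0.
  replace (64 * (pw d (INR n * q) * (K2 * (/ A * v i)))) with (64 * (K2 * (2 * P)) * v i) in E4 by (unfold A; field; lra).
  apply (Rmult_le_reg_l c); auto.
  replace (c * (64 * / c * (K2 * (2 * P)) * v i)) with (64 * (K2 * (2 * P)) * v i) by (field; lra). lra. }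
eapply Rle_trans. apply rsum_le. exact T. rewrite rsum_scal. apply Rmult_le_compat_l; [|lra].
apply Rmult_le_pos. apply Rmult_le_pos. lra. left; now apply Rinv_0_lt_compat. nra.
Qed.

(** With y_i = lam Y_i^(s/p) both sums become multiples of S, the sum of Y_i^s d(a_i)^2, because
    q(s/p + 1) = s. Normalising lam leaves S^(1 - q/p) bounded, and S may be divided out because it
    is a finite sum. *)
Lemma symb_sum_bound m : (m < n)%nat -> Lop_bounded (S m) -> exists K, 0 <= K /\ forall N a,
  separated (/ 8) N a -> rsum N (fun i => pw (symb n g m (a i)) s * (dd (a i) * dd (a i))) <= K.
Proof.
intros hm hL. destruct (test_terms_bound m hm hL) as [K [K0 [K1 [K10 H]]]].
set (D := K * pw K1 (q / p)). assert (D0 : 0 < D) by (apply Rmult_lt_0_compat; auto; now apply pw_gt0).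
exists (pw D (/ (1 - q / p))). split. apply pw_ge0. intros N a hs. assert (ha := proj1 hs).
set (S := rsum N (fun i => pw (symb n g m (a i)) s * (dd (a i) * dd (a i)))).
assert (S0 : 0 <= S).
{ apply rsum_ge0. intros i hi. apply Rmult_le_pos. apply pw_ge0. assert (di := dd_pos _ (ha i hi)); nra. }
destruct (Rle_lt_or_eq_dec _ _ S0) as [Sp|<-]. 2: apply pw_ge0.
assert (qp : 0 < 1 - q / p).
{ assert (q / p < 1); [|lra]. apply (Rmult_lt_reg_r p). lra. unfold Rdiv. rewrite Rmult_assoc, Rinv_l; lra. }
(* This makes lam^p K1 S equal to 1, the admissible size of the test function. *)
set (lam := pw (K1 * S) (- / p)).
assert (KS : 0 < K1 * S) by now apply Rmult_lt_0_compat.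
assert (Q := H N a (fun i => lam * pw (symb n g m (a i)) (s / p)) hs).
assert (Q1 : rsum N (fun i => pw (lam * pw (symb n g m (a i)) (s / p) * symb n g m (a i)) q * (dd (a i) * dd (a i))) <= K).
{ apply Q.
  - intros i hi. apply Rmult_le_pos; apply pw_ge0.
  - apply Rle_trans with (K1 * (/ (K1 * S) * S)). apply Rmult_le_compat_l. lra. unfold S at 2. rewrite <- rsum_scal.
    apply rsum_le. intros i hi. cbv beta. rewrite pw_mult by apply pw_ge0. unfold lam. rewrite !pw_pw.
    replace (- / p * p) with (- (1)) by (field; lra). replace (s / p * p) with s by (field; lra).
    rewrite pw_opp. replace (pw (K1 * S) 1) with (K1 * S) by (symmetry; apply pw_1; lra). right; ring.
    right. field. lra. }
assert (Q2 : pw lam q * S <= K).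
{ eapply Rle_trans; [|apply Q1]. unfold S. rewrite <- rsum_scal. apply rsum_le. intros i hi.
  assert (Y0 := symb_ge0 n g m (a i)). rewrite <- Rmult_assoc. apply Rmult_le_compat_r.
  assert (di := dd_pos _ (ha i hi)); nra.
  rewrite Rmult_assoc, pw_mult by (try apply Rmult_le_pos; auto; apply pw_ge0).
  apply Rmult_le_compat_l. apply pw_ge0.
  destruct (Rle_lt_or_eq_dec _ _ Y0) as [Yp|<-].
  - right. rewrite pw_mult, pw_pw by (auto; apply pw_ge0). rewrite <- pw_plus by auto. f_equal. unfold s. field. lra.
  - rewrite (pw_zero s). apply pw_ge0. unfold s. apply Rdiv_lt_0_compat; nra. }
unfold lam in Q2. rewrite pw_pw in Q2. replace (- / p * q) with (- (q / p)) in Q2 by (field; lra).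
rewrite pw_opp, pw_mult in Q2 by lra.
assert (a1 : 0 < pw K1 (q / p)) by now apply pw_gt0. assert (a2 : 0 < pw S (q / p)) by now apply pw_gt0.
assert (E : S = pw S (q / p) * pw S (1 - q / p)).
{ rewrite <- pw_plus by auto. replace (q / p + (1 - q / p)) with 1 by ring. symmetry. apply pw_1; lra. }
rewrite E in Q2 at 2.
replace (/ (pw K1 (q / p) * pw S (q / p)) * (pw S (q / p) * pw S (1 - q / p))) with (/ pw K1 (q / p) * pw S (1 - q / p)) in Q2 by (field; lra).
assert (Q3 : pw S (1 - q / p) <= D).
{ unfold D. rewrite Rmult_comm. apply (Rmult_le_reg_l (/ pw K1 (q / p))). now apply Rinv_0_lt_compat.
  rewrite <- Rmult_assoc, Rinv_l, Rmult_1_l; lra. }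
rewrite <- (pw_inv S (1 - q / p)) by lra. apply pw_le; auto. left; now apply Rinv_0_lt_compat. apply pw_ge0.
Qed.
End Necessity.

(** * Greedy choice of the centres *)

(** If the distance is D, then d(a_j) <= 2 D and so d(a_i) <= 3 D; the sum is at most 5 D, within
    the allowed 8 D. *)
Lemma half_separated N a : (forall i, (i < N)%nat -> Cmod (a i) < 1) ->
  (forall i j, (j < i)%nat -> (i < N)%nat -> dd (a j) / 2 <= Cmod (a i - a j)%C) -> separated (/ 8) N a.
Proof.
intros ha H. split; auto. intros i j hji hi. specialize (H i j hji hi).
assert (L := dd_lip (a i) (a j)). assert (X := Cmod_ge_0 (a i - a j)%C). lra.
Qed.

Section Greedy.
Variables (G : C -> R) (r : R).
Hypotheses (hr : 0 <= r < 1) (G0 : forall z, Cmod z < 1 -> 0 <= G z)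
  (Gb : exists M, forall z, Cmod z <= r -> G z <= M).

Let caught (a : C) (z : C) : Prop := Cmod (z - a)%C < dd a / 2 /\ G z <= 2 * G a.

Definition greedy (N : nat) (a : nat -> C) : Prop :=
  (forall i, (i < N)%nat -> Cmod (a i) <= r) /\
  (forall i j, (j < i)%nat -> (i < N)%nat -> dd (a j) / 2 <= Cmod (a i - a j)%C).

Lemma greedy_separated N a : greedy N a -> separated (/ 8) N a.
Proof. intros [h1 h2]. apply half_separated; auto. intros i hi. specialize (h1 i hi). lra. Qed.

(** Disjoint discs of radius at least (1 - r)/8 fit only finitely often into the unit disc. *)
Lemma greedy_size N a : greedy N a -> INR N * ((1 - r) / 8 * ((1 - r) / 8)) <= 4.
Proof.
intros h. assert (Q := separated_sum (/ 8) N a (fun _ => 1) (fun _ => 1) (4 * 1) ltac:(lra) (greedy_separated N a h)).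
assert (Q' : rsum N (fun i => 1 * (/ 8 * dd (a i) * (/ 8 * dd (a i)))) <= 4 * 1).
{ apply Q. intros; lra. apply nn_const; lra. apply IB_const; lra. intros; lra. }
rewrite Rmult_1_r in Q'. eapply Rle_trans; [|apply Q'].
apply Rle_trans with (rsum N (fun _ => (1 - r) / 8 * ((1 - r) / 8))).
- right. clear. induction N as [|N IH]; cbn [rsum]. simpl; ring. rewrite <- IH, S_INR. ring.
- apply rsum_le. intros i hi. assert (hi' := proj1 h i hi). unfold dd. nra.
Qed.

(** Every point is either caught by a chosen centre or still outside all the discs. The next centre
    is nearly maximal for G among the latter, so it controls G on whatever its own disc removes. *)
Lemma greedy_step N : (exists n a, greedy n a /\ forall z, Cmod z <= r -> exists i, (i < n)%nat /\ caught (a i) z) \/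
  (exists a, greedy N a /\ forall z, Cmod z <= r -> (exists i, (i < N)%nat /\ caught (a i) z) \/
     forall i, (i < N)%nat -> dd (a i) / 2 <= Cmod (z - a i)%C).
Proof.
induction N as [|N IH].
- right. exists (fun _ => RtoC 0). split. split; intros; lia. intros z hz. right. intros; lia.
- destruct IH as [|[a [ga ha]]]. now left.
  set (P := fun z => Cmod z <= r /\ forall i, (i < N)%nat -> dd (a i) / 2 <= Cmod (z - a i)%C).
  destruct (classic (exists z, P z)) as [[z0 hz0]|no].
  2:{ left. exists N, a. split; auto. intros z hz. destruct (ha z hz) as [|h]; auto.
      exfalso. apply no. exists z. split; auto. }
  assert (exists c, P c /\ forall z, P z -> G z <= 2 * G c) as [c [Pc hc]].
  { destruct (classic (exists z, P z /\ 0 < G z)) as [[z1 [P1 h1]]|no].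
    - destruct Gb as [M HM]. destruct (near_sup _ P G M z1 P1 h1) as [c [Pc [_ hc]]].
      intros w [hw _]. auto. now exists c.
    (* If G vanishes on all that remains, any remaining point serves. *)
    - exists z0. split; auto. intros z hz. assert (G z <= 0). { apply Rnot_lt_le. intros h. apply no. now exists z. }
      assert (0 <= G z0). { apply G0. destruct hz0; lra. } lra. }
  right. exists (fun i => if Nat.eq_dec i N then c else a i). split; [split|].
  + intros i hi. destruct (Nat.eq_dec i N). apply Pc. apply ga; lia.
  + intros i j hji hi. destruct (Nat.eq_dec j N); [lia|]. destruct (Nat.eq_dec i N) as [->|ne].
    apply Pc. lia. apply ga; lia.
  + intros z hz. destruct (ha z hz) as [[i [hi h]]|h].
    { left. exists i. split. lia. destruct (Nat.eq_dec i N); [lia|auto]. }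
    destruct (Rlt_le_dec (Cmod (z - c)%C) (dd c / 2)) as [hl|hl].
    * left. exists N. split. lia. destruct (Nat.eq_dec N N); [|lia]. split; auto. apply hc. split; auto.
    * right. intros i hi. destruct (Nat.eq_dec i N); auto. apply h; lia.
Qed.

Lemma greedy_cover : exists N a, separated (/ 8) N a /\
  forall z, Cmod z <= r -> exists i, (i < N)%nat /\ Cmod (z - a i)%C < dd (a i) / 2 /\ G z <= 2 * G (a i).
Proof.
set (e := (1 - r) / 8 * ((1 - r) / 8)). assert (e0 : 0 < e) by (unfold e; nra).
destruct (INR_unbounded (4 / e)) as [N hN].
destruct (greedy_step N) as [[n [a [ga ha]]]|[a [ga _]]].
- exists n, a. split; auto. now apply greedy_separated.
- exfalso. assert (A := greedy_size N a ga). fold e in A.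
  assert (4 / e * e < INR N * e) by (apply Rmult_lt_compat_r; lra).
  replace (4 / e * e) with 4 in H by (field; lra). lra.
Qed.
End Greedy.

(** The integral over the disc of radius r is at most the sum of 2 G(a_i) times the area bound 4
    (d(a_i)/2)^2 = d(a_i)^2, independently of r and of the number of centres. *)
Lemma greedy_integral G r K : 0 <= r < 1 -> nn G -> (exists M, forall z, Cmod z <= r -> G z <= M) ->
  (forall N a, separated (/ 8) N a -> rsum N (fun i => G (a i) * (dd (a i) * dd (a i))) <= K) ->
  IB (fun z => ile (Cmod z) r * G z) (2 * K).
Proof.
intros hr nG Gb H. destruct (greedy_cover G r hr (proj2 nG) Gb) as [N [a [ha hc]]].
assert (h1 := proj1 ha).
assert (nb : forall i, (i < N)%nat -> nn (fun z => 2 * G (a i) * ilt (Cmod (z - a i)%C) (dd (a i) / 2))).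
{ intros i hi. apply nn_scal. assert (0 <= G (a i)) by (apply nG; auto). lra. apply nn_ball. }
apply (IB_le (k := fun z => rsum N (fun i => 2 * G (a i) * ilt (Cmod (z - a i)%C) (dd (a i) / 2)))).
- apply nn_mult; auto. apply nn_ile. apply meas_Cmod. apply meas_const.
- now apply nn_rsum.
- intros z hz. destruct (Rle_lt_dec (Cmod z) r) as [h|h].
  + rewrite (ile_1 _ _ h), Rmult_1_l. destruct (hc z h) as [i [hi [hd hG]]].
    eapply Rle_trans; [|apply (rsum_term N (fun i => 2 * G (a i) * ilt (Cmod (z - a i)%C) (dd (a i) / 2)) i); auto].
    rewrite (ilt_1 _ _ hd). lra. intros j hj. now apply (nb j hj).
  + rewrite (ile_0 _ _ h), Rmult_0_l. apply rsum_ge0. intros j hj. now apply (nb j hj).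
- apply (IB_weak (B := rsum N (fun i => 2 * G (a i) * (4 * (dd (a i) / 2 * (dd (a i) / 2)))))).
  + rewrite (rsum_ext _ _ (fun i => 2 * (G (a i) * (dd (a i) * dd (a i))))) by (intros; field).
    rewrite rsum_scal. apply Rmult_le_compat_l. lra. now apply H.
  + apply IB_rsum; auto. intros i hi. apply IB_scal. assert (0 <= G (a i)) by (apply nG; auto). lra.
    apply nn_ball. apply IB_area. assert (di := dd_pos _ (h1 i hi)). lra.
Qed.

Lemma Cderiv_n_Iop_n k f z : hol f -> Cmod z < 1 -> Cderiv_n k (Iop_n k f) z = f z.
Proof.
intros hf. revert z. induction k as [|k IH]; intros z hz; auto.
assert (E : Cderiv_n (S k) (Iop_n (S k) f) = Cderiv_n k (Cderiv (Iop_n (S k) f))) by apply Nat.iter_succ_r.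
rewrite E, <- (IH z hz). apply Cderiv_n_ext; auto.
- intros w hw. apply Cderiv_Iop; auto. now apply hol_Iop_n.
- apply hol_Cderiv. now apply hol_Iop_n.
Qed.

(** * Downward induction over the symbols *)

Section Conclusion.
Variables (n : nat) (g : nat -> C -> C) (p q : R).
Hypotheses (hg : forall k, (k < n)%nat -> hol (g k)) (hq : 0 < q) (hqp : q < p).
Let s := p * q / (p - q).

Lemma s_gt0 : 0 < s.
Proof. apply Rdiv_lt_0_compat; nra. Qed.

Lemma symb_integrable_of_Lop_bounded m : (m < n)%nat -> Lop_bounded n g p q (S m) ->
  exists B, IB (fun z => pw (symb n g m z) s) B.
Proof.
intros hm hL. destruct (symb_sum_bound n g p q hg hq hqp m hm hL) as [K [K0 HK]].
exists (2 * K). assert (nG := nn_symb n g hg s m hm). apply IB_exhaust; auto. intros r r0 r1.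
apply greedy_integral; auto.
destruct (hol_bounded (g m) r (hg m hm) r1) as [M [M0 HM]]. exists (pw (M * 1) s). intros z hz.
assert (hz1 : Cmod z < 1) by lra. assert (dz := dd_pos z hz1).
apply pw_le. left; apply s_gt0. apply symb_ge0.
apply Rmult_le_compat; auto. apply Cmod_ge_0. apply pw_ge0. apply pw_le1. apply pos_INR. lra. apply dd_le1.
Qed.

(** Once the top symbol is integrable, Young's inequality with e = 1 bounds its term on the unit
    ball, so it can be subtracted. *)
Lemma Lop_bounded_pred m : (m < n)%nat -> Lop_bounded n g p q (S m) ->
  (exists B, IB (fun z => pw (symb n g m z) s) B) -> Lop_bounded n g p q m.
Proof.
intros hm [B [B0 HB]] [B1 HB1].
destruct (weight_bound n p q hq hqp) as [K [K0 HK]].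
assert (nY := nn_symb n g hg s m hm). assert (B10 := IB_ge0 nY HB1).
assert (P := pw_ge0 2 q). exists (pw 2 q * (B + (K * 1 + B1))). split.
{ apply Rmult_le_pos; lra. }
intros f hf hB. assert (hgm : forall k, (k < S m)%nat -> hol (g k)) by (intros; apply hg; lia).
assert (hL : hol (Lop m g f)) by (apply hol_Lop; auto). assert (hL1 : hol (Lop (S m) g f)) by (apply hol_Lop; auto).
assert (n1 : nn (fun z => nrm q (Lop (S m) g f) z * pw (dd z) (INR n * q))) by (apply nn_mult; [now apply nn_nrm|apply nn_dd]).
assert (nX := nn_weight p m f hf). assert (n2 := nn_plus _ _ nX nY). assert (n3 := nn_plus _ _ n1 n2).
generalize (IB_scal P n3 (IB_plus n1 n2 (HB f hf hB) (IB_plus nX nY (HK f 1 hf hB m hm) HB1))).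
apply IB_le. apply nn_mult. now apply nn_nrm. apply nn_dd. now apply nn_scal.
intros z hz. assert (dz := dd_pos z hz). assert (D := pw_ge0 (dd z) (INR n * q)).
assert (Y := young_pw p q 1 (Cmod (Cderiv_n m f z) * pw (dd z) (INR m)) (symb n g m z) hq hqp Rlt_0_1
  ltac:(apply Rmult_le_pos; [apply Cmod_ge_0|apply pw_ge0]) (symb_ge0 _ _ _ _)).
rewrite pw_one1, !Rmult_1_l in Y.
set (X := (Cderiv_n m f z * g m z)%C).
assert (E : Lop m g f z = (Lop (S m) g f z - X)%C) by (unfold Lop, X; simpl; ring).
assert (T : nrm q (Lop m g f) z <= pw 2 q * (nrm q (Lop (S m) g f) z + pw (Cmod X) q)).
{ unfold nrm. rewrite E. eapply Rle_trans. apply pw_le. lra. apply Cmod_ge_0. apply Cmod_sub_le.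
  apply pw_add_le; auto; apply Cmod_ge_0. }
assert (EX : pw (Cmod X) q * pw (dd z) (INR n * q) = pw (Cmod (Cderiv_n m f z) * pw (dd z) (INR m)) q * pw (symb n g m z) q).
{ rewrite <- (pw_mult (x := Cmod (Cderiv_n m f z) * pw (dd z) (INR m))) by first [exact (symb_ge0 n g m z)|apply Rmult_le_pos; [apply Cmod_ge_0|apply pw_ge0]].
  rewrite <- pw_pw, <- pw_mult by (try apply Cmod_ge_0; apply pw_ge0). f_equal. unfold X, symb. rewrite Cmod_mult.
  replace (INR n) with (INR m + INR (n - m)) by (rewrite <- plus_INR; f_equal; lia).
  rewrite pw_plus by auto. ring. }
fold s in Y.
apply Rle_trans with (pw 2 q * (nrm q (Lop (S m) g f) z + pw (Cmod X) q) * pw (dd z) (INR n * q)).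
apply Rmult_le_compat_r; auto.
rewrite Rmult_assoc. apply Rmult_le_compat_l; auto. rewrite Rmult_plus_distr_r, EX. lra.
Qed.

Lemma Lop_bounded_all : Lop_bounded n g p q n -> forall m, (m <= n)%nat -> Lop_bounded n g p q m.
Proof.
intros H. assert (A : forall j, (j <= n)%nat -> Lop_bounded n g p q (n - j)).
{ induction j as [|j IH]; intros hj. now rewrite Nat.sub_0_r.
  assert (h := IH ltac:(lia)). replace (n - j)%nat with (S (n - S j)) in h by lia.
  apply Lop_bounded_pred; auto. lia. apply symb_integrable_of_Lop_bounded; auto. lia. }
intros m hm. replace m with (n - (n - m))%nat by lia. apply A. lia.
Qed.

(** The n-th derivative undoes the n integrations, and the derivative bound moves the A^q estimate
    to the weight d^(nq). *)
Lemma Lop_bounded_top : (exists B, forall f, hol f -> IB (nrm p f) 1 -> IB (nrm q (Top n g f)) B) ->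
  Lop_bounded n g p q n.
Proof.
intros [B HB]. destruct (deriv_n_weighted_bound q 0 n hq ltac:(lra)) as [K [K0 HK]].
assert (B0 : 0 <= B).
{ assert (z0 : hol (fun _ => RtoC 0)) by apply hol_const.
  apply (IB_ge0 (nn_nrm q (hol_Top n g _ hg z0))). apply HB; auto.
  apply (IB_weak (B := 4 * 0)). lra. apply (IB_ext (fun _ => 0)).
  intros z hz. unfold nrm. rewrite Cmod_0, pw_zero; lra. apply nn_const; lra. apply IB_const; lra. }
exists (K * B). split. nra. intros f hf hA.
assert (hT := hol_Top n g f hg hf). assert (hL : hol (Lop n g f)) by now apply hol_Lop.
assert (Q : IB (fun z => nrm q (Top n g f) z * pw (dd z) 0) B).
{ generalize (HB f hf hA). apply IB_ext. intros z hz. now rewrite pw_0r, Rmult_1_r. now apply nn_nrm. }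
generalize (HK _ B hT Q). apply IB_ext.
- intros z hz. unfold nrm. rewrite Rplus_0_l. unfold Top. now rewrite Cderiv_n_Iop_n.
- apply nn_mult. apply nn_nrm. now apply hol_Cderiv_n. apply nn_dd.
Qed.

Lemma symb_integrable : (exists B, forall f, hol f -> IB (nrm p f) 1 -> IB (nrm q (Top n g f)) B) ->
  forall m, (m < n)%nat -> exists B, IB (fun z => pw (symb n g m z) s) B.
Proof.
intros H m hm. apply symb_integrable_of_Lop_bounded; auto. apply Lop_bounded_all. now apply Lop_bounded_top. lia.
Qed.
End Conclusion.

Lemma increasing_selection (P : nat -> nat -> Prop) : (forall m N, exists j, (N <= j)%nat /\ P m j) ->
  exists phi : nat -> nat, (forall m, (phi m < phi (S m))%nat) /\ forall m, P m (phi m).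
Proof.
intros H. set (c := fun m N => proj1_sig (constructive_indefinite_description _ (H m N))).
assert (hc : forall m N, (N <= c m N)%nat /\ P m (c m N)).
{ intros m N. exact (proj2_sig (constructive_indefinite_description _ (H m N))). }
exists (fix phi m := match m with O => c 0%nat 0%nat | S m => c (S m) (S (phi m)) end). split.
- intros m. simpl. apply hc.
- intros [|m]; apply hc.
Qed.

(* The weights [1 - |z|^2] and [1 - |z|] are comparable. *)
Lemma symb_integrable_iff n g k s : hol (g k) -> 0 < s ->
  let h := fun z => pw (Cmod (g k z * RtoC ((1 - Cmod z ^ 2) ^ (n - k)))%C) s in
  nn h /\ ((exists B, IB h B) <-> exists B, IB (fun z => pw (symb n g k z) s) B).
Proof.
intros hg hs h.
assert (nY : nn (fun z => pw (symb n g k z) s)) by (apply nn_pw; now apply meas_symb).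
set (h' := fun z => pw (pw (1 + Cmod z) (INR (n - k))) s * pw (symb n g k z) s).
assert (E : forall z, Cmod z < 1 -> h' z = h z).
{ intros z hz. assert (dz := dd_pos z hz). assert (cz := Cmod_ge_0 z). unfold h', h. rewrite <- pw_mult by (try apply symb_ge0; apply pw_ge0).
  f_equal. rewrite Cmod_mult, Cmod_R, Rabs_pos_eq by (apply pow_le; nra).
  unfold symb. rewrite !pw_nat by lra. replace (1 - Cmod z ^ 2) with ((1 + Cmod z) * dd z) by (unfold dd; ring).
  rewrite Rpow_mult_distr. ring. }
assert (nh' : nn h').
{ apply nn_mult; auto. apply nn_pw. apply meas_pw. apply meas_plus. apply meas_const. apply meas_Cmod. }
assert (nh : nn h) by now apply (nn_ext h').
split; auto. split; intros [B hB].
- exists B. revert hB. apply IB_le. exact nY. exact nh. intros z hz. rewrite <- E by auto. unfold h'.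
  assert (P := pw_ge0 (symb n g k z) s).
  assert (1 <= pw (pw (1 + Cmod z) (INR (n - k))) s).
  { apply pw_ge1. lra. apply pw_ge1. apply pos_INR. generalize (Cmod_ge_0 z); lra. }
  nra.
- exists (pw (pw 2 (INR (n - k))) s * B).
  generalize (IB_scal (pw_ge0 (pw 2 (INR (n - k))) s) nY hB). apply IB_le. exact nh. apply nn_scal. apply pw_ge0. exact nY.
  intros z hz. rewrite <- E by auto. unfold h'. apply Rmult_le_compat_r. apply pw_ge0.
  apply pw_le. lra. apply pw_ge0. assert (cz := Cmod_ge_0 z). apply pw_le. apply pos_INR. lra. lra.
Qed.

(** * Bounded and compact operators in terms of the unit ball *)

Section Operator.
Variables (n : nat) (g : nat -> C -> C) (p q : R).
Hypotheses (hg : forall k, (k < n)%nat -> hol (g k)) (hq : 0 < q) (hqp : q < p).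
Let s := p * q / (p - q).

Lemma Top_ball_of_bounded c : (forall f, Bergman p f -> Bergman q (Top n g f)) ->
  (forall f, Bergman p f -> Bnorm q (Top n g f) <= c * Bnorm p f) ->
  exists B, forall f, hol f -> IB (nrm p f) 1 -> IB (nrm q (Top n g f)) B.
Proof.
intros hT hc. set (M := pw (pinv * 1) (/ p)). assert (M0 : 0 <= M) by apply pw_ge0.
(* The constant c is not assumed nonnegative, hence the absolute value. *)
exists (pw (Rabs c * M) q / pinv). intros f hf hA.
assert (bf : Bergman p f) by (apply Bergman_hol; split; auto; now exists 1).
apply (IB_Bnorm hq (hT f bf)). eapply Rle_trans. exact (hc f bf).
assert (N := Bnorm_le (p := p) ltac:(lra) hf hA). fold M in N. assert (N0 := Bnorm_ge0 p f).
apply Rle_trans with (Rabs c * Bnorm p f). apply Rmult_le_compat_r; auto. apply Rle_abs.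
apply Rmult_le_compat_l; auto. apply Rabs_pos.
Qed.

(** If the images of the unit ball were unbounded, a sequence with the j-th image exceeding j would
    have a subsequence staying within 1 of a fixed function, hence bounded. *)
Lemma Top_ball_of_compact : (forall f, Bergman p f -> Bergman q (Top n g f)) ->
  (forall fs : nat -> C -> C, (forall j, Bergman p (fs j)) -> (exists M, forall j, Bnorm p (fs j) <= M) ->
    exists phi h, (forall j, (phi j < phi (S j))%nat) /\ Bergman q h /\
      exists J, forall j, (J <= j)%nat -> Bnorm q (fun z => Top n g (fs (phi j)) z - h z)%C <= 1) ->
  exists B, forall f, hol f -> IB (nrm p f) 1 -> IB (nrm q (Top n g f)) B.
Proof.
intros hT hc. apply NNPP. intros no.
assert (sel : forall j : nat, exists f, hol f /\ IB (nrm p f) 1 /\ ~ IB (nrm q (Top n g f)) (INR j)).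
{ intros j. apply NNPP. intros nj. apply no. exists (INR j). intros f hf hA. apply NNPP. intros h. apply nj. exists f. auto. }
set (fs := fun j => proj1_sig (constructive_indefinite_description _ (sel j))).
assert (hfs : forall j, hol (fs j) /\ IB (nrm p (fs j)) 1 /\ ~ IB (nrm q (Top n g (fs j))) (INR j)).
{ intros j. exact (proj2_sig (constructive_indefinite_description _ (sel j))). }
destruct (hc fs) as [phi [h [hphi [hh [J hJ]]]]].
- intros j. destruct (hfs j) as [h1 [h2 _]]. apply Bergman_hol. split; auto. now exists 1.
- exists (pw (pinv * 1) (/ p)). intros j. destruct (hfs j) as [h1 [h2 _]]. apply Bnorm_le; auto. lra.
- destruct (proj1 (Bergman_hol q h) hh) as [hol_h [Bh hBh]].
  set (B := pw 2 q * (pw 1 q / pinv + Bh)).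
  assert (phi_ge : forall j, (j <= phi j)%nat) by (induction j; [lia|specialize (hphi j); lia]).
  destruct (INR_unbounded B) as [N hN].
  set (j := Nat.max J N). destruct (hfs (phi j)) as [h1 [h2 h3]]. apply h3.
  apply (IB_weak (B := B)).
  { apply Rle_trans with (INR N). lra. apply le_INR. specialize (phi_ge j). unfold j in *. lia. }
  assert (hTj := hol_Top n g _ hg h1).
  assert (hD : hol (fun z => Top n g (fs (phi j)) z - h z)%C) by now apply hol_minus.
  assert (hDB : IB (nrm q (fun z => Top n g (fs (phi j)) z - h z)%C) (pw 1 q / pinv)).
  { refine (IB_Bnorm hq _ (hJ j ltac:(unfold j; lia))).
    apply Bergman_hol. split; auto.
    destruct (proj1 (Bergman_hol q _) (hT _ (proj2 (Bergman_hol p _) (conj h1 (ex_intro _ 1 h2))))) as [_ [B1 hB1]].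
    eexists. apply nrm_minus_bound; auto. exact hB1. exact hBh. }
  (* The image is written as (T f - h) - (0 - h), so that the bound for differences can be
     reused. *)
  assert (hm : hol (fun z => 0 - h z)%C) by (apply hol_minus; auto; apply hol_const).
  assert (hBm : IB (nrm q (fun z => 0 - h z)%C) Bh).
  { revert hBh. apply IB_ext. intros z hz. unfold nrm. replace (0 - h z)%C with (- h z)%C by ring. now rewrite Cmod_opp.
    now apply nn_nrm. }
  generalize (nrm_minus_bound q _ _ _ _ hq hD hm hDB hBm). apply IB_ext.
  + intros z hz. unfold nrm. f_equal. f_equal. ring.
  + apply nn_nrm. now apply hol_minus.
Qed.

Hypothesis hsymb : forall k, (k < n)%nat -> exists B, IB (fun z => pw (symb n g k z) s) B.

(** [Top_norm_bound] requires a positive t, so it is applied slightly above the norm, and an excess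
    over [c * Bnorm p f] is contradicted by a small enough margin. *)
Lemma Top_bounded : (forall f, Bergman p f -> Bergman q (Top n g f)) /\
  exists c, forall f, Bergman p f -> Bnorm q (Top n g f) <= c * Bnorm p f.
Proof.
destruct (Top_norm_bound n g p q hg hq hqp hsymb) as [c [c0 hc]]. split.
- intros f hf. assert (N0 := Bnorm_ge0 p f). apply (hc f (Bnorm p f + 1)); auto; lra.
- exists c. intros f hf. assert (N0 := Bnorm_ge0 p f). apply Rnot_lt_le. intros h.
  set (e := (Bnorm q (Top n g f) - c * Bnorm p f) / (2 * c)).
  assert (e0 : 0 < e) by (apply Rdiv_lt_0_compat; lra).
  destruct (hc f (Bnorm p f + e) hf) as [_ H]; try lra.
  assert (c * e = (Bnorm q (Top n g f) - c * Bnorm p f) / 2) by (unfold e; field; lra).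
  lra.
Qed.

Lemma Top_compact_sequence (f : nat -> C -> C) M : (forall j, Bergman p (f j)) -> (forall j, Bnorm p (f j) <= M) ->
  exists phi h, (forall m, (phi m < phi (S m))%nat) /\ Bergman q h /\
    forall m, Bnorm q (fun z => Top n g (f (phi m)) z - h z)%C <= / (INR m + 1).
Proof.
intros hf hM. destruct (Top_compact n g p q hg hq hqp hsymb f M hf hM) as [F [hF H]].
destruct (increasing_selection (fun m j => Bnorm q (fun z => Top n g (f j) z - Top n g F z)%C <= / (INR m + 1))) as [phi [h1 h2]].
- intros m N. apply H. apply Rinv_0_lt_compat. generalize (pos_INR m); lra.
- exists phi, (Top n g F). exact (conj h1 (conj (proj1 Top_bounded F hF) h2)).
Qed.
End Operator.

End BergmanSpaces.

(* Assembly of the equivalences *)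
From mathcomp Require Import all_boot all_algebra.
From mathcomp Require Import all_classical all_reals all_analysis.
From mathcomp Require Import Rstruct Rstruct_topology.

Lemma Ig_Top n g f : Ig n g f = Top n g f.
Proof. exact: Ig_Lop. Qed.

Theorem theorem1p4 (n : nat) (g : nat -> C -> C) (p q : R) :
  (0 < n)%N ->
  (forall k : nat, (k < n)%N -> holo (g k)) ->
  Rlt 0 q -> Rlt q p ->
  (bounded_op p q (Ig n g) <-> compact_op p q (Ig n g)) /\
  (compact_op p q (Ig n g) <->
     forall k : nat, (k < n)%N ->
       (intdA (fun z : R * R =>
          powR (Cmod (Cmult (g k z)
                       (RtoC (pow (Rminus 1 (pow (Cmod z) 2)) (n - k)))))
               (Rdiv (Rmult p q) (Rminus p q))) < +oo)%E).
Proof.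
move=> _ hg0 q0 qp.
have hg k : lt k n -> hol (g k) by move=> /ssrnat.ltP kn; apply/holo_hol; exact: hg0.
pose s := Rdiv (Rmult p q) (Rminus p q).
have s0 : Rlt 0 s by exact: s_gt0.
set cond := (forall k : nat, (k < n)%N -> _).
have condE : cond <-> forall k, lt k n -> exists B, IB (fun z => pw (symb n g k z) s) B.
  split=> H k kn.
    have [nh E] := symb_integrable_iff n g k s (hg k kn) s0.
    by apply/E; apply/(intdA_IB nh); move/ssrnat.ltP: kn => /H.
  have kn' : lt k n by apply/ssrnat.ltP.
  have [nh E] := symb_integrable_iff n g k s (hg k kn') s0.
  by have /E/(intdA_IB nh) := H k kn'.
have cond_bounded : cond -> bounded_op p q (Ig n g).
  move=> /condE H; have [h1 [c hc]] := Top_bounded n g p q hg q0 qp H.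
  split=> [f hf|]; first by rewrite Ig_Top; exact: h1.
  by exists c => f hf; rewrite Ig_Top; apply/RleP; exact: hc.
have cond_compact : cond -> compact_op p q (Ig n g).
  move=> /[dup] hcond /condE H; split; first by case: (cond_bounded hcond).
  move=> fs hfs [M hM].
  have [phi [h [hphi [hh H1]]]] := Top_compact_sequence n g p q hg q0 qp H fs M hfs (fun j => elimT RleP (hM j)).
  exists phi, h; split; [by move=> j; apply/ssrnat.ltP; exact: hphi|split=> //].
  (* The selected subsequence has norms at most 1/(j + 1), the harmonic sequence. *)
  apply: (@squeeze_cvgr _ _ _ _ (fun=> 0%R) (fun j => @harmonic R j)).
  - apply: nearW => j; apply/andP; split; apply/RleP; first exact: Bnorm_ge0.
    rewrite Ig_Top; apply: Rle_trans (H1 j) _; right.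
    by rewrite /harmonic /= -GRing.natr1 -INRE.
  - exact: cvg_cst.
  - exact: cvg_harmonic.
have ball_cond : (exists B, forall f, hol f -> IB (nrm p f) 1 -> IB (nrm q (Top n g f)) B) -> cond.
  by move=> H; apply/condE => m mn; exact: symb_integrable n g p q hg q0 qp H m mn.
have bounded_cond : bounded_op p q (Ig n g) -> cond.
  move=> [h1 [c hc]]; apply: ball_cond; apply: (Top_ball_of_bounded n g p q q0 qp c).
    by move=> f hf; rewrite -Ig_Top; exact: h1.
  by move=> f hf; rewrite -Ig_Top; apply/RleP; exact: hc.
have compact_cond : compact_op p q (Ig n g) -> cond.
  move=> [h1 hc]; apply: ball_cond; apply: (Top_ball_of_compact n g p q hg q0 qp).
    by move=> f hf; rewrite -Ig_Top; exact: h1.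
  move=> fs hfs [M hM].
  have [|phi [h [hphi [hh hcv]]]] := hc fs hfs; first by exists M => j; apply/RleP.
  exists phi, h; split; [by move=> j; apply/ssrnat.ltP; exact: hphi|split=> //].
  (* Of the convergence only the eventual bound by 1 is used. *)
  have [N _ HN] := cvgr_le _ hcv 1%R Num.Theory.ltr01.
  exists N => j /ssrnat.leP Nj; rewrite -Ig_Top; apply/RleP; exact: HN.
split; split.
- by move=> /bounded_cond/cond_compact.
- by move=> /compact_cond/cond_bounded.
- exact: compact_cond.
- exact: cond_compact.
Qed.
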